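(* Let $h\ge 0$ and, for each $N\in\mathbb N$, let $M^{[N,h]}$ be the Markov-modulated Ornstein-Uhlenbeck process obtained under the scaling $Q\mapsto NQ$, $\boldsymbol\alpha\mapsto N^h\boldsymbol\alpha$, $\boldsymbol\sigma\mapsto N^{h/2}\boldsymbol\sigma$ (with $\boldsymbol\gamma$ unscaled), i.e. the solution of $$\mathrm dM^{[N,h]}(t)=(N^h\boldsymbol\alpha-\boldsymbol\gamma M^{[N,h]}(t))^{\rm T}\boldsymbol Z^{[N]}(t)\,\mathrm dt+N^{h/2}\boldsymbol\sigma^{\rm T}\boldsymbol Z^{[N]}(t)\,\mathrm dB(t),\qquad M^{[N,h]}(0)=m_0,$$ where $m_0\in\mathbb R$ is a constant not depending on $N$. Let $\beta:=\max\{h/2,\,h-1/2\}$, let $$\varrho(t)=e^{-\gamma_\infty t}\,\mathbf 1_{\{h=0\}}\,m_0+\frac{\alpha_\infty}{\gamma_\infty}\left(1-e^{-\gamma_\infty t}\right),$$ and define $\hat M^{[N,h]}(t):=N^{-\beta}\left(M^{[N,h]}(t)-N^h\varrho(t)\right)$. Let $$V(t):=\int_0^t(\boldsymbol\alpha-\boldsymbol\gamma\varrho(s))^{\rm T}\left(\mathrm{diag}\{\boldsymbol\pi\}D+D^{\rm T}\mathrm{diag}\{\boldsymbol\pi\}\right)(\boldsymbol\alpha-\boldsymbol\gamma\varrho(s))\,\mathrm ds .$$ Then, as $N\to\infty$, the process $\hat M^{[N,h]}$ converges weakly (at the process level) to the solution $\hat M$ of the stochastic differential equation $$\mathrm d\hat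 M(t)=-\gamma_\infty\hat M(t)\,\mathrm dt+\sqrt{\sigma_\infty^2\mathbf 1_{\{h\le 1\}}+V'(t)\mathbf 1_{\{h\ge 1\}}}\;\mathrm dB(t),\qquad \hat M(0)=0,$$ where $B$ is a standard Brownian motion.
   Context: $X$ is a continuous-time Markov chain on $\{1,\dots,d\}$ with generator $Q=(q_{ij})$ (with $q_{ij}\ge0$ for $i\neq j$ and zero row sums) having a unique invariant distribution $\boldsymbol\pi$ (column vector, $\boldsymbol\pi^{\rm T}Q=\boldsymbol 0^{\rm T}$, $\mathbf 1^{\rm T}\boldsymbol\pi=1$). $D:=(\mathbf 1\boldsymbol\pi^{\rm T}-Q)^{-1}-\mathbf 1\boldsymbol\pi^{\rm T}$ is the deviation matrix of $Q$; equivalently $D=\int_0^\infty(e^{Qt}-\mathbf 1\boldsymbol\pi^{\rm T})\,\mathrm dt$. The parameter vectors are $\boldsymbol\alpha,\boldsymbol\gamma,\boldsymbol\sigma\in\mathbb R^d$ with $\gamma_i>0$ for all $i$; $\boldsymbol\sigma^2:=(\sigma_1^2,\dots,\sigma_d^2)^{\rm T}$. The time-averaged parameters are $\alpha_\infty:=\boldsymbol\pi^{\rm T}\boldsymbol\alpha$, $\gamma_\infty:=\boldsymbol\pi^{\rm T}\boldsymbol\gamma$, $\sigma_\infty^2:=\boldsymbol\pi^{\rm T}\boldsymbol\sigma^2$. $\boldsymbol Z^{[N]}(t)\in\{0,1\}^d$ is the indicator vector of the sped-up chain $X^{[N]}$ (equivalently $X^{[N]}(t)=X(Nt)$), which has generator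 $NQ$ and initial law not depending on $N$: $Z^{[N]}_i(t)=1$ if $X^{[N]}(t)=i$ and $0$ otherwise. In the equation for $M^{[N,h]}$, $B$ is a standard Brownian motion independent of the chain. Weak convergence at the process level means convergence in distribution in the space of continuous paths on $[0,\infty)$ with the topology of uniform convergence on compacts. *)

(* Defs.v *)
From HB Require Import structures.
From mathcomp Require Import all_boot all_order all_algebra.
From mathcomp Require Import all_classical all_reals all_analysis.

Set Implicit Arguments.
Unset Strict Implicit.
Unset Printing Implicit Defensive.

Import Order.TTheory GRing.Theory Num.Theory.
Import numFieldNormedType.Exports.

Local Open Scope classical_set_scope.
Local Open Scope ring_scope.

(* Processes are functions [Y : R -> T -> E] of time and outcome; time is
   [0, +oo), so the values at negative times are never constrained or used. *)

Section generators.
Context {R : realType} {d : nat}.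

Definition is_generator (Q : 'M[R]_d) :=
  (forall i j, i != j -> 0 <= Q i j) /\ (forall i, \sum_j Q i j = 0).

Definition invariant_distribution (Q : 'M[R]_d) (p : 'cV[R]_d) :=
  [/\ forall i, 0 <= p i 0, p^T *m Q = 0 & \sum_i p i 0 = 1].

Definition ones : 'cV[R]_d := const_mx 1.

Definition deviation_matrix (Q : 'M[R]_d) (p : 'cV[R]_d) : 'M[R]_d :=
  invmx (ones *m p^T - Q) - ones *m p^T.

Definition dotv (u v : 'cV[R]_d) : R := (u^T *m v) 0 0.

Definition expmx (A : 'M[R]_d) : 'M[R]_d :=
  \matrix_(i, j) limn (series (fun k => (A ^+ k) i j / k`!%:R)).

End generators.

Section processes.
Context {R : realType} {disp : measure_display} {T : measurableType disp}.
Variable P : probability T R.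

Definition is_filtration (F : R -> set (set T)) :=
  [/\ forall t, 0 <= t -> sigma_algebra setT (F t),
      forall t, 0 <= t -> F t `<=` measurable
    & forall s t, 0 <= s -> s <= t -> F s `<=` F t].

Definition adapted {E : Type} (mE : set (set E)) (F : R -> set (set T))
    (Y : R -> T -> E) :=
  forall t, 0 <= t -> preimage_set_system setT (Y t) mE `<=` F t.

Definition sigma_of_process {E : Type} (mE : set (set E)) (Y : R -> T -> E) :
    set (set T) :=
  <<s \bigcup_(t in `[0, +oo[%classic) preimage_set_system setT (Y t) mE >>.

Definition independent_classes (G1 G2 : set (set T)) :=
  forall A1 A2, G1 A1 -> G2 A2 -> P (A1 `&` A2) = (P A1 * P A2)%E.

Definition continuous_paths (Y : R -> T -> R) :=
  forall w, {within `[0, +oo[, continuous (fun t => Y t w)}.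

(* Standard Brownian motion relative to the filtration [F]. The second
   argument of [normal_prob] is the standard deviation. *)
Definition is_brownian_motion (F : R -> set (set T)) (B : R -> T -> R) :=
  [/\ adapted measurable F B,
      continuous_paths B,
      {ae P, forall w, B 0 w = 0},
      forall s t, 0 <= s -> s < t -> forall A, measurable A ->
        P [set w | A (B t w - B s w)] = normal_prob 0 (Num.sqrt (t - s)) A
    & forall s t, 0 <= s -> s < t ->
        independent_classes (F s)
          (preimage_set_system setT (fun w => B t w - B s w) measurable)].

(* Right-continuous Markov chain with initial law [mu] and generator [Q],
   specified by its finite-dimensional distributions. *)
Definition is_ctmc {d : nat} (mu : 'I_d -> R) (Q : 'M[R]_d)
    (X : R -> T -> 'I_d) :=
  [/\ forall t i, 0 <= t -> measurable (X t @^-1` [set i]),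
      forall w t, 0 <= t -> \forall s \near t^'+, X s w = X t w
    & forall (n : nat) (t : nat -> R) (i : nat -> 'I_d),
        t 0%N = 0 -> (forall k, t k <= t k.+1) ->
        P (\bigcap_(k < n.+1) (X (t k) @^-1` [set i k])) =
          (mu (i 0%N) *
            \prod_(k < n) expmx ((t k.+1 - t k) *: Q) (i k) (i k.+1))%:E].

(* The simple process sum_(k < n) coef k * 1_(]time k, time k.+1]). *)
Record simple_process := SimpleProcess {
  sp_size : nat;
  sp_time : nat -> R;
  sp_coef : nat -> T -> R }.

Definition simple_adapted (F : R -> set (set T)) (S : simple_process) :=
  [/\ 0 <= sp_time S 0%N,
      forall k, sp_time S k <= sp_time S k.+1,
      forall k, preimage_set_system setT (sp_coef S k) measurable
                  `<=` F (sp_time S k)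
    & forall k, exists c, forall w, `|sp_coef S k w| <= c].

Definition simple_val (S : simple_process) (s : R) (w : T) : R :=
  \sum_(k < sp_size S)
    sp_coef S k w * (sp_time S k < s <= sp_time S k.+1)%R%:R.

Definition simple_integral (S : simple_process) (B : R -> T -> R)
    (t : R) (w : T) : R :=
  \sum_(k < sp_size S) sp_coef S k w *
    (B (Num.min (sp_time S k.+1) t) w - B (Num.min (sp_time S k) t) w).

(* [I t] is the (square-integrable) Ito integral of [H] against [B] over [0, t]:
   the L2 limit of the integrals of simple adapted processes converging to [H]
   in L2 on [0, t] x T. This determines each [I t] up to a null event. *)
Definition is_ito_integral (F : R -> set (set T)) (B H I : R -> T -> R) :=
  [/\ adapted measurable F H,
      measurable_fun ([set s : measurableTypeR R | 0 <= s] `*` [set: T])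
        (fun p => H p.1 p.2),
      adapted measurable F I
    & forall t, 0 <= t -> exists S : nat -> simple_process,
      [/\ forall n, simple_adapted F (S n),
          (fun n => (\int[P]_w \int[lebesgue_measure]_(s in `[0%R, t])
             (((simple_val (S n) s w - H s w) ^+ 2)%R)%:E)%E) @ \oo --> 0%E
        & (fun n => (\int[P]_w
             (((simple_integral (S n) B t w - I t w) ^+ 2)%R)%:E)%E)
             @ \oo --> 0%E]].

(* dY(t) = a(t, Y(t)) dt + b(t) dB(t), Y(0) = y0, where the drift [a] and the
   dispersion [b] may be random and the dispersion does not depend on [Y]. *)
Definition is_sde_solution (F : R -> set (set T)) (B : R -> T -> R)
    (a : R -> T -> R -> R) (b : R -> T -> R) (y0 : R) (Y : R -> T -> R) :=
  [/\ adapted measurable F Y,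
      continuous_paths Y
    & exists2 I, is_ito_integral F B b I &
        forall t, 0 <= t -> {ae P, forall w,
          Y t w = y0 + (\int[lebesgue_measure]_(s in `[0, t]) a s w (Y s w))
                  + I t w}].

Definition indicator_vector {d : nat} (X : R -> T -> 'I_d) (t : R) (w : T) :
    'cV[R]_d :=
  \col_i (X t w == i)%:R.

(* [M] is the Markov-modulated Ornstein-Uhlenbeck process started at [m0],
   driven by [B] and modulated by the independent chain [X]. *)
Definition is_mmou {d : nat} (F : R -> set (set T)) (B : R -> T -> R)
    (X : R -> T -> 'I_d) (mu : 'I_d -> R) (Q : 'M[R]_d)
    (alpha gamma sigma : 'cV[R]_d) (m0 : R) (M : R -> T -> R) :=
  [/\ is_filtration F,
      is_brownian_motion F B,
      is_ctmc mu Q X /\ adapted setT F X,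
      independent_classes (sigma_of_process measurable B)
                          (sigma_of_process setT X)
    & is_sde_solution F B
        (fun s w x => dotv (alpha - x *: gamma) (indicator_vector X s w))
        (fun s w => dotv sigma (indicator_vector X s w)) m0 M].

End processes.

Section weak_convergence.
Context {R : realType}.

(* Real paths with the topology of uniform convergence on the compact subsets
   of the time set [0, +oo). *)
Definition path_space :=
  {family (fun K : set R => compact K /\ K `<=` `[0, +oo[%classic), R -> R}.

Definition cont_paths : set path_space :=
  [set f | {within `[0, +oo[, continuous (f : R -> R)}].

(* Convergence in distribution in the space of continuous paths: convergence of
   the expectations of all bounded continuous functionals. Only meaningful for
   processes with continuous paths. *)
Definition cvg_weakly
    (disp : nat -> measure_display) (T : forall N, measurableType (disp N))
    (P : forall N, probability (T N) R) (Y : forall N, R -> T N -> R)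
    (displ : measure_display) (Tl : measurableType displ)
    (Pl : probability Tl R) (Yl : R -> Tl -> R) :=
  forall Phi : path_space -> R,
    (exists c, forall f, cont_paths f -> `|Phi f| <= c) ->
    {within cont_paths, continuous Phi} ->
    (fun N => 'E_(P N)[fun w => Phi (fun t => Y N t w)])%E @ \oo -->
      'E_Pl[fun w => Phi (fun t => Yl t w)]%E.

End weak_convergence.

Section limit_coefficients.
Context {R : realType} {d : nat}.
Variables (Q : 'M[R]_d) (pi_ alpha gamma sigma : 'cV[R]_d) (h m0 : R).

Definition alpha_inf : R := dotv pi_ alpha.
Definition gamma_inf : R := dotv pi_ gamma.
Definition sigma2_inf : R := dotv pi_ (\col_i (sigma i 0) ^+ 2).

Definition scaling_exponent : R := Num.max (h / 2) (h - 1 / 2).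

Definition rho (t : R) : R :=
  expR (- gamma_inf * t) * (h == 0)%R%:R * m0
  + alpha_inf / gamma_inf * (1 - expR (- gamma_inf * t)).

Definition V_integrand (s : R) : R :=
  let D := deviation_matrix Q pi_ in
  let v := alpha - rho s *: gamma in
  dotv v ((diag_mx pi_^T *m D + D^T *m diag_mx pi_^T) *m v).

(* For t < 0 the integral from 0 to t is minus the integral from t to 0, which
   makes V differentiable at 0 as well. *)
Definition V (t : R) : R :=
  if 0 <= t then \int[lebesgue_measure]_(s in `[0, t]) V_integrand s
  else - \int[lebesgue_measure]_(s in `[t, 0]) V_integrand s.

Definition limit_dispersion (t : R) : R :=
  Num.sqrt (sigma2_inf * (h <= 1)%R%:R + derive1 V t * (1 <= h)%R%:R).

Definition centered_scaled {T : Type} (N : nat) (M : R -> T -> R) :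
    R -> T -> R :=
  fun t w => N%:R `^ (- scaling_exponent) * (M t w - N%:R `^ h * rho t).

End limit_coefficients.

(* Main.v *)
(* With [Y] the centered and scaled process, [W t = Y t + \int_0^t (gamma . Z) Y]
   equals almost surely [y0 + a A + b J], where [y0 -> 0], [A] is the integral of
   the centered drift [(alpha - rho gamma) . (Z - pi)] and [J] the Ito integral of
   [sigma . Z]. The limit solves the same equation with [W] a Gaussian martingale
   and [gamma . Z] replaced by its average.

   Solving the Poisson equation with the deviation matrix gives, for the increments
   of [A] over a time step [t], conditional means O(1/N), conditional second moments
   [V'(s) t / N + O(t^2 / N)] and fourth moments [O(t^2 / N^2)]. Conditionally on
   the whole chain the increments of [J] are centered Gaussian with variance
   [\int sigma^2 . Z], whose fluctuation is again an additive functional of the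
   chain. Hence [W] has, on a dyadic grid, asymptotically the conditional means and
   variances of the limiting martingale, up to errors [t^(3/2)] that are summable.
   The Lindeberg replacement method then shows that Lipschitz functions of the grid
   values of [W] have the same limits in expectation as for a single Rademacher
   walk, to which the limit process is compared in the same way. The fourth moments
   control the oscillation of [W] uniformly (chaining), Gronwall's inequality
   transfers this to [Y], and an Euler scheme expresses [Y] through the grid values
   of [W]; bounded continuous functionals on path space are monotone limits of
   Lipschitz ones.

   Discretizing the chain and the Brownian motion at a level depending on [N] makes
   all moment computations finite sums. *)

From HB Require Import structures.
Require Import Defs.
From mathcomp Require Import all_boot all_order all_algebra.
From mathcomp Require Import all_classical all_reals all_analysis.
From mathcomp Require Import measurable_realfun.
From mathcomp Require Import ring lra.

Set Implicit Arguments.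
Unset Strict Implicit.
Unset Printing Implicit Defensive.

Import Order.TTheory GRing.Theory Num.Theory.
Import numFieldNormedType.Exports.

Local Open Scope classical_set_scope.
Local Open Scope ring_scope.

(** * Expectations *)

(** The law of the limit is never computed. The scaled processes and the solution of the limiting
    equation are two instances of [driven_family], and both are compared with one real number that
    depends only on the variances and on the test function; the limit enters as a constant sequence.

    The equation holds only up to a null event at each fixed time, whereas path functionals see all
    times. Hence [q] and [k] are pathwise integrals, continuous for every outcome, and the almost
    sure identity is used only at dyadic times, in mean.

    The threshold h = 1 comes from two scales: after division by N^beta the centered drift carries
    N^(h - beta), at most sqrt N, and the noise N^(h/2 - beta), at most 1. A centered additive
    functional of the chain has size 1/sqrt N, so the drift survives exactly for h >= 1 and the
    noise exactly for h <= 1.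

    One step dt of the chain is linearized with error (N dt)^2; the condition N^2 dt <= 1 turns this
    into O(dt), which sums to O(t). *)

Section expectation.
Context {R : realType} {disp : measure_display} {T : measurableType disp}.
Variable P : probability T R.
Implicit Types X Y : T -> R.

(** Real-valued for the sake of field arithmetic. An infinite integral is sent to 0, so a bound on
    [Ex] carries information only together with [itg]; the two are usually proved as a pair. *)
Definition Ex X : R := \int[P]_w X w.

Definition itg X := P.-integrable setT (EFin \o X).

(* All absolute moments are finite, which makes the class closed under products. *)
Definition good X :=
  measurable_fun setT X /\ forall p : nat, itg (fun w => `|X w| ^+ p).

Lemma itg_mfun X : itg X -> measurable_fun setT X.
Proof. by move/integrableP => [/measurable_EFinP]. Qed.

Lemma itg_le X Y : measurable_fun setT X -> itg Y ->
  (forall w, `|X w| <= `|Y w|) -> itg X.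
Proof.
move=> mX iY h; apply: le_integrable iY => //; first exact/measurable_EFinP.
by move=> w _ /=; rewrite lee_fin.
Qed.

Lemma itg_cst c : itg (fun=> c).
Proof. exact: finite_measure_integrable_cst. Qed.

Lemma itgD X Y : itg X -> itg Y -> itg (fun w => X w + Y w).
Proof. by move=> iX iY; have := integrableD measurableT iX iY; exact: eq_integrable. Qed.

Lemma itgZ c X : itg X -> itg (fun w => c * X w).
Proof.
by move=> iX; have := integrableZl measurableT c iX; apply: eq_integrable.
Qed.

Lemma itgN X : itg X -> itg (fun w => - X w).
Proof.
move=> /(itgZ (-1)); rewrite /itg; apply: eq_integrable => // w _ /=.
by rewrite mulN1r.
Qed.

Lemma itgB X Y : itg X -> itg Y -> itg (fun w => X w - Y w).
Proof. by move=> iX iY; apply: itgD => //; exact: itgN. Qed.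

Lemma itg_norm X : itg X -> itg (fun w => `|X w|).
Proof. exact: integrable_norm. Qed.

Lemma itg_sum I (s : seq I) (F : I -> T -> R) : (forall i, itg (F i)) ->
  itg (fun w => \sum_(i <- s) F i w).
Proof.
move=> iF; elim: s => [|a s ih].
  by under [fun w => _]eq_fun do rewrite big_nil; exact: itg_cst.
by under [fun w => _]eq_fun do rewrite big_cons; exact: itgD.
Qed.

Lemma eq_Ex X Y : X =1 Y -> Ex X = Ex Y.
Proof. by move=> XY; congr Ex; apply/funext. Qed.

Lemma Ex_cst c : Ex (fun=> c) = c.
Proof. by rewrite /Ex Rintegral_cst//= probability_setT mulr1. Qed.

Lemma ExD X Y : itg X -> itg Y -> Ex (fun w => X w + Y w) = Ex X + Ex Y.
Proof. by move=> iX iY; rewrite /Ex RintegralD. Qed.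

Lemma ExB X Y : itg X -> itg Y -> Ex (fun w => X w - Y w) = Ex X - Ex Y.
Proof. by move=> iX iY; rewrite /Ex RintegralB. Qed.

Lemma ExZ c X : itg X -> Ex (fun w => c * X w) = c * Ex X.
Proof. by move=> iX; rewrite /Ex RintegralZl. Qed.

Lemma ExN X : itg X -> Ex (fun w => - X w) = - Ex X.
Proof.
by move=> iX; rewrite -mulN1r -ExZ//; apply: eq_Ex => w; rewrite mulN1r.
Qed.

Lemma Ex_sum I (s : seq I) (F : I -> T -> R) : (forall i, itg (F i)) ->
  Ex (fun w => \sum_(i <- s) F i w) = \sum_(i <- s) Ex (F i).
Proof.
move=> iF; elim: s => [|a s ih].
  by rewrite big_nil -[RHS](Ex_cst 0); apply: eq_Ex => w; rewrite big_nil.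
rewrite big_cons -ih -ExD//; last exact: itg_sum.
by apply: eq_Ex => w; rewrite big_cons.
Qed.

Lemma Ex_le X Y : itg X -> itg Y -> (forall w, X w <= Y w) -> Ex X <= Ex Y.
Proof. by move=> iX iY h; apply: le_Rintegral. Qed.

Lemma Ex_ge0 X : (forall w, 0 <= X w) -> 0 <= Ex X.
Proof. by move=> h; apply: Rintegral_ge0. Qed.

Lemma Ex_norm X : itg X -> `|Ex X| <= Ex (fun w => `|X w|).
Proof. exact: le_normr_Rintegral. Qed.

Lemma Ex_norm_le X Y : itg X -> itg Y -> (forall w, `|X w| <= Y w) ->
  `|Ex X| <= Ex Y.
Proof.
move=> iX iY h; apply: (le_trans (Ex_norm iX)).
by apply: Ex_le => //; exact: itg_norm.
Qed.

Lemma EFin_Ex X : itg X -> (Ex X)%:E = 'E_P[X]%E.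
Proof.
by move=> iX; rewrite /Ex /Rintegral unlock fineK//; exact: integrable_fin_num.
Qed.

Lemma Ex_ae X Y : {ae P, forall w, X w = Y w} -> measurable_fun setT X ->
  measurable_fun setT Y -> Ex X = Ex Y.
Proof.
move=> XY mX mY; rewrite /Ex /Rintegral; congr fine.
apply: ae_eq_integral => //; [exact/measurable_EFinP|exact/measurable_EFinP|].
by move: XY; apply: filterS => w ->.
Qed.

Lemma itg_bounded X c : measurable_fun setT X -> (forall w, `|X w| <= c) -> itg X.
Proof.
move=> mX h; apply: (itg_le mX (itg_cst c)) => w.
by rewrite (le_trans (h w))// ler_norm.
Qed.

Lemma good_mfun X : good X -> measurable_fun setT X. Proof. by case. Qed.

Lemma good_itg X : good X -> itg X.
Proof.
move=> [mX h]; apply: (itg_le mX (h 1%N)) => w.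
by rewrite expr1 normr_id.
Qed.

Lemma good_bounded X c : measurable_fun setT X -> (forall w, `|X w| <= c) ->
  good X.
Proof.
move=> mX h; split=> // p; apply: (@itg_bounded _ (c ^+ p)).
  by apply: measurable_funX; exact: measurableT_comp.
by move=> w; rewrite normrX normr_id lerXn2r ?nnegrE// (le_trans _ (h w)).
Qed.

Lemma good_le X Y : measurable_fun setT X -> good Y ->
  (forall w, `|X w| <= `|Y w|) -> good X.
Proof.
move=> mX gY h; split=> // p; apply: (itg_le _ (gY.2 p)).
  by apply: measurable_funX; exact: measurableT_comp.
by move=> w; rewrite !normrX !normr_id lerXn2r ?nnegrE.
Qed.

Lemma good_cst c : good (fun=> c).
Proof. by apply: (@good_bounded _ `|c|). Qed.

Lemma goodM X Y : good X -> good Y -> good (fun w => X w * Y w).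
Proof.
move=> gX gY; split=> [|p]; first by apply: measurable_funM; apply: good_mfun.
apply: (itg_le _ (itgD (gX.2 (p + p)%N) (gY.2 (p + p)%N))).
  apply: measurable_funX; apply: measurableT_comp => //.
  by apply: measurable_funM; apply: good_mfun.
move=> w; rewrite normrX normr_id normrM exprMn [leRHS]ger0_norm ?addr_ge0//.
rewrite !exprD; set a := `|X w| ^+ p; set b := `|Y w| ^+ p.
have a0 : 0 <= a by exact: exprn_ge0.
have b0 : 0 <= b by exact: exprn_ge0.
have := sqr_ge0 (a - b); nra.
Qed.

Lemma goodZ c X : good X -> good (fun w => c * X w).
Proof. by apply: goodM; exact: good_cst. Qed.

Lemma good_norm X : good X -> good (fun w => `|X w|).
Proof.
move=> gX; apply: (good_le _ gX) => [|w]; last by rewrite normr_id.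
by apply: measurableT_comp => //; exact: good_mfun.
Qed.

Lemma goodN X : good X -> good (fun w => - X w).
Proof.
move=> gX; apply: (good_le _ gX) => [|w]; last by rewrite normrN.
by apply: measurable_funN; exact: good_mfun.
Qed.

Lemma goodD X Y : good X -> good Y -> good (fun w => X w + Y w).
Proof.
move=> gX gY; split=> [|p]; first by apply: measurable_funD; apply: good_mfun.
apply: (itg_le _ (itgZ (2 ^+ p) (itgD (gX.2 p) (gY.2 p)))).
  apply: measurable_funX; apply: measurableT_comp => //.
  by apply: measurable_funD; apply: good_mfun.
move=> w; rewrite normrX normr_id [leRHS]ger0_norm ?mulr_ge0 ?addr_ge0 ?exprn_ge0//.
wlog xy : X Y gX gY / `|X w| <= `|Y w|.
  move=> h; have [?|?] := leP `|X w| `|Y w|; first exact: h.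
  by rewrite addrC [X in _ <= _ * X]addrC; apply: h => //; exact: ltW.
have : `|X w + Y w| <= 2 * `|Y w|.
  by rewrite (le_trans (ler_normD _ _))// mulr_natl mulr2n lerD2r.
move=> /(lerXn2r p) => /(_ (normr_ge0 _)); rewrite nnegrE mulr_ge0//.
move=> /(_ isT) /le_trans; apply.
by rewrite exprMn ler_wpM2l ?exprn_ge0// lerDr exprn_ge0.
Qed.

Lemma goodB X Y : good X -> good Y -> good (fun w => X w - Y w).
Proof. by move=> gX gY; apply: goodD => //; exact: goodN. Qed.

Lemma goodX X n : good X -> good (fun w => X w ^+ n).
Proof.
move=> gX; elim: n => [|n ih]; first exact: (good_cst 1).
by under [fun w => _]eq_fun do rewrite exprS; exact: goodM.
Qed.

Lemma good_sum I (s : seq I) (p : pred I) (F : I -> T -> R) :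
  (forall i, good (F i)) -> good (fun w => \sum_(i <- s | p i) F i w).
Proof.
move=> gF; elim: s => [|a s ih].
  by under [fun w => _]eq_fun do rewrite big_nil; exact: good_cst.
under [fun w => _]eq_fun do rewrite big_cons.
by case: (p a) => //; exact: goodD.
Qed.

(** Weighted arithmetic-geometric mean in place of Cauchy-Schwarz. With [e] the square root of a
    bound on the second moment, it turns a mean-square bound e^2 into a first-moment bound e. *)
Lemma Ex_sqr_le X : itg X -> itg (fun w => X w ^+ 2) ->
  forall e, 0 < e -> Ex (fun w => `|X w|) <= (e + e^-1 * Ex (fun w => X w ^+ 2)) / 2.
Proof.
move=> iX iX2 e e0; rewrite -ExZ// -[X in (X + _) / 2](Ex_cst e) -ExD; first last.
  exact: itgZ.
  exact: itg_cst.
rewrite [leRHS]mulrC -ExZ; last by apply: itgD; [exact: itg_cst|exact: itgZ].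
apply: Ex_le => [||w].
- exact: itg_norm.
- by apply: itgZ; apply: itgD; [exact: itg_cst|exact: itgZ].
rewrite -(real_normK (num_real (X w))) -subr_ge0; set a := `|X w|.
rewrite [X in 0 <= X](_ : _ = e^-1 * ((e - a) ^+ 2 / 2)); last first.
  by field; rewrite gt_eqF.
by rewrite mulr_ge0 ?invr_ge0 ?divr_ge0 ?sqr_ge0// ltW.
Qed.

End expectation.


#[export] Hint Resolve good_cst goodM goodZ goodD goodN goodB goodX good_norm
  good_sum good_itg good_mfun itg_cst : good.
Ltac gd := auto 20 with good.

(** * Orthogonality and independence in expectation *)

Section orthogonality.
Context {R : realType} {disp : measure_display} {T : measurableType disp}.
Variable P : probability T R.
Implicit Types X Y Z : T -> R.
Local Notation Ex := (Ex P).
Local Notation itg := (itg P).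
Local Notation good := (good P).

Lemma Ex_dct (F : nat -> T -> R) X Y : (forall n, measurable_fun setT (F n)) ->
  (forall w, F ^~ w @ \oo --> X w) -> itg Y -> (forall n w, `|F n w| <= Y w) ->
  itg X /\ (fun n => Ex (F n)) @ \oo --> Ex X.
Proof.
move=> mF cF iY FY.
have mX : measurable_fun setT X by apply: measurable_fun_cvg mF _ => w _; exact: cF.
have [||||iX _ cvg] := @dominated_convergence _ _ _ P setT measurableT
  (fun n => EFin \o F n) (EFin \o X) (EFin \o Y) _ _ _ iY _.
- by move=> n; exact/measurable_EFinP.
- exact/measurable_EFinP.
- by apply: aeW => w _; apply: cvg_EFin; [exact: nearW|exact: cF].
- have h : forall w n, setT w -> (`|(EFin \o F n) w| <= (EFin \o Y) w)%E.
    by move=> w n _; rewrite /= lee_fin.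
  exact: (aeW _ h).
split=> //.
have iF n : itg (F n).
  apply: (itg_le (mF n) iY) => w; rewrite (le_trans (FY n w))// ler_norm //.
apply: (fine_cvg (f := fun n => (\int[P]_w (F n w)%:E)%E)).
rewrite fineK//; exact: integrable_fin_num.
Qed.

Import HBNNSimple.

(** Orthogonality to indicators of events of [Z] extends linearly to simple functions of [Z], then
    to [h] by dominated convergence with dominating function |Z| |X|. The function [h] is kept
    general so as to cover the positive and the negative part of [Z]. *)
Let orth_nonneg Z X (h : R -> R) : good Z -> good X -> measurable_fun setT h ->
    (forall z, 0 <= h z) -> (forall z, h z <= `|z|) ->
    (forall A, measurable A -> Ex (fun w => \1_A (Z w) * X w) = 0) ->
  Ex (fun w => h (Z w) * X w) = 0.
Proof.
move=> gZ gX mh h0 hz o.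
have mEh : measurable_fun setT (EFin \o h) by exact/measurable_EFinP.
pose g := nnsfun_approx measurableT mEh.
have mgZ n : measurable_fun setT (fun w => g n (Z w)).
  by apply: measurableT_comp => //; exact: (good_mfun gZ).
have gle n z : g n z <= h z.
  rewrite -lee_fin /g nnsfun_approxE; apply: (le_approx (f := EFin \o h)) => //.
  by move=> t _; rewrite lee_fin.
have gg n : good (fun w => g n (Z w)).
  apply: (good_le (mgZ n) (good_norm gZ)) => w.
  by rewrite normr_id ger0_norm// (le_trans (gle _ _)).
have [|||_] := @Ex_dct (fun n w => g n (Z w) * X w) (fun w => h (Z w) * X w)
  (fun w => `|Z w| * `|X w|) (fun n => good_mfun (goodM (gg n) gX)) _ _ _.
- move=> w; apply: cvgMr_tmp; apply: (fine_cvg (f := EFin \o g ^~ (Z w))).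
  by apply: (cvg_nnsfun_approx measurableT mEh) => // z _; rewrite lee_fin.
- by apply: good_itg; apply: goodM; exact: good_norm.
- move=> n w; rewrite normrM; apply: ler_wpM2r => //.
  by rewrite ger0_norm; [exact: le_trans (gle _ _) (hz _)|exact: fun_ge0].
rewrite (_ : (fun n => _) = fun=> 0); last first.
  apply/funext => n.
  have gE z : g n z = \sum_(y \in range (g n)) y * \1_(g n @^-1` [set y]) z.
    by rewrite fimfunE.
  under eq_Ex do rewrite gE fsbig_finite//= big_distrl/=.
  rewrite Ex_sum => [|y]; last first.
    apply: good_itg; apply: goodM gX; apply: goodZ.
    apply: (@good_bounded _ _ _ P _ 1) => [|w].
      by apply: measurableT_comp (good_mfun gZ); exact: measurable_indic.
    by rewrite ger0_norm ?indicE//; case: (_ \in _).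
  apply: big1 => y _; under eq_Ex do rewrite -mulrA.
  rewrite ExZ ?o ?mulr0//.
  apply: good_itg; apply: goodM gX; apply: (@good_bounded _ _ _ P _ 1) => [|w].
    by apply: measurableT_comp (good_mfun gZ); exact: measurable_indic.
  by rewrite ger0_norm ?indicE//; case: (_ \in _).
  by move=> c; apply: (cvg_unique _ c (cvg_cst _)).
Qed.

Lemma Ex_orth Z X : good Z -> good X ->
    (forall A, measurable A -> Ex (fun w => \1_A (Z w) * X w) = 0) ->
  Ex (fun w => Z w * X w) = 0.
Proof.
move=> gZ gX o.
have mx : measurable_fun setT (fun z : R => Num.max z 0) by exact: measurable_maxr.
have mx' : measurable_fun setT (fun z : R => Num.max (- z) 0).
  exact: measurable_maxr.
have e z : z = Num.max z 0 - Num.max (- z) 0 :> R.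
  by rewrite /Num.max; case: ltP => h; case: ltP => h'; lra.
have gm : good (fun w => Num.max (Z w) 0).
  apply: (good_le _ gZ) => [|w]; first exact: (measurableT_comp mx (good_mfun gZ)).
  by rewrite /Num.max; case: ltP => h; rewrite ?normr0.
have gm' : good (fun w => Num.max (- Z w) 0).
  apply: (good_le _ gZ) => [|w].
    exact: (measurableT_comp mx' (good_mfun gZ)).
  by rewrite /Num.max; case: ltP => h; rewrite ?normr0 ?normrN.
under eq_Ex do rewrite (e (Z _)) mulrBl.
rewrite ExB; [|gd|gd].
rewrite (orth_nonneg gZ gX mx) ?(orth_nonneg gZ gX mx') ?subr0//.
- by move=> z; rewrite le_max lexx orbT.
- by move=> z; rewrite ge_max normr_ge0 -normrN ler_norm.
- by move=> z; rewrite le_max lexx orbT.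
- by move=> z; rewrite ge_max normr_ge0 ler_norm.
Qed.

Let Ex_cov U V : good U -> good V ->
  Ex (fun w => U w * (V w - Ex V)) = Ex (fun w => U w * V w) - Ex U * Ex V.
Proof.
move=> gU gV; under eq_Ex do rewrite mulrBr.
rewrite ExB; [|gd|gd]; congr (_ - _); rewrite [RHS]mulrC -ExZ; last gd.
by apply: eq_Ex => w; rewrite mulrC.
Qed.

(** The product rule for events is lifted to variables one factor at a time: [Ex_orth] first reduces
    [X] to indicators, the centering is moved from [Z] to the indicator, and a second use of
    [Ex_orth] reduces [Z]. *)
Lemma Ex_indep (G : set (set T)) Z X : good Z -> good X ->
    (forall A, measurable A -> G (Z @^-1` A)) ->
    (forall A B, G A -> measurable B -> P (A `&` X @^-1` B) = (P A * P (X @^-1` B))%E) ->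
  Ex (fun w => Z w * X w) = Ex Z * Ex X.
Proof.
move=> gZ gX GZ ind.
have mpre A (Y : T -> R) : good Y -> measurable A -> measurable (Y @^-1` A).
  by move=> gY mA; rewrite -[X in measurable X]setTI; apply: (good_mfun gY).
have gi A (Y : T -> R) : good Y -> measurable A -> good (fun w => \1_A (Y w)).
  move=> gY mA; apply: (@good_bounded _ _ _ P _ 1) => [|w].
    by apply: measurableT_comp (good_mfun gY); exact: measurable_indic.
  by rewrite ger0_norm ?indicE//; case: (_ \in _).
have Exi (A : set T) : measurable A -> Ex (fun w => \1_A w) = fine (P A).
  by move=> mA; rewrite /Ex /Rintegral integral_indic// setIT.
have Ei Y C : good Y -> measurable C -> Ex (fun w => \1_C (Y w)) = fine (P (Y @^-1` C)).
  by move=> gY mC; rewrite -Exi//; exact: mpre.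
suff : Ex (fun w => X w * (Z w - Ex Z)) = 0.
  rewrite Ex_cov// => /subr0_eq h; rewrite mulrC -h.
  by apply: eq_Ex => w; rewrite mulrC.
apply: Ex_orth => [//||B mB]; first gd.
have gB := gi _ _ gX mB.
transitivity (Ex (fun w => Z w * (\1_B (X w) - Ex (fun w => \1_B (X w))))).
  rewrite !Ex_cov// mulrC; congr (_ - _); by apply: eq_Ex => w; rewrite mulrC.
apply: Ex_orth => [//||A mA]; first gd.
have gA := gi _ _ gZ mA.
rewrite Ex_cov// !Ei//.
transitivity (Ex (fun w => \1_(Z @^-1` A `&` X @^-1` B) w) -
   fine (P (Z @^-1` A)) * fine (P (X @^-1` B))).
  by congr (_ - _); apply: eq_Ex => w; rewrite indicI.
rewrite Exi; last by apply: measurableI; exact: mpre.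
rewrite ind//; last exact: GZ.
rewrite fineM ?subrr//; apply: fin_num_measure; exact: mpre.
Qed.

End orthogonality.

Ltac nneg := repeat match goal with
  | |- is_true (0 <= _ ^+ 2) => apply: sqr_ge0
  | |- is_true (0 <= _ ^+ _) => apply: exprn_ge0
  | |- is_true (0 <= _ * _) => apply: mulr_ge0
  | |- is_true (0 <= _ + _) => apply: addr_ge0
  | |- is_true (0 <= _^-1) => rewrite invr_ge0
  | |- is_true (0 <= `|_|) => apply: normr_ge0
  | |- is_true (0 <= expR _) => apply: expR_ge0
  | |- is_true (0 <= _%:R) => apply: ler0n
  | |- _ => first [done | assumption | apply: ltW; assumption]
  end.

(** * Gaussian moments *)

Section normal_moments.
Context {R : realType}.
Variable s : R.
Hypothesis s0 : 0 < s.
Local Notation mu := (@lebesgue_measure R).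
Local Notation p := (normal_pdf 0 s).

Let sn0 : s != 0. Proof. by rewrite gt_eqF. Qed.

Let pE (x : R) : p x = normal_peak s * expR (- x ^+ 2 / (s ^+ 2 *+ 2)).
Proof. by rewrite normal_pdfE// /normal_fun subr0. Qed.

Let peak2 : normal_peak (2 * s) = normal_peak s / 2.
Proof.
rewrite /normal_peak exprMn -mulrA -mulrnAr sqrtrM ?sqr_ge0// sqrtr_sqr.
by rewrite ger0_norm// invfM mulrC.
Qed.

(** A power times a Gaussian density is dominated by a wider Gaussian density. The exponents at s
    and 2s differ by u = 3 x^2 / (8 s^2), and u^j <= j! e^u absorbs the power; the factor 2 is the
    ratio of the two peaks. *)
Let p_le (j : nat) (x : R) :
  x ^+ (2 * j) * p x <= 2 * (8 / 3 * s ^+ 2) ^+ j * j`!%:R * normal_pdf 0 (2 * s) x.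
Proof.
rewrite pE normal_pdfE ?mulf_neq0// peak2 /normal_fun subr0.
set u := x ^+ 2 * 3 / (8 * s ^+ 2).
have s2n0 : s ^+ 2 != 0 by rewrite expf_neq0.
have u0 : 0 <= u by rewrite /u; nneg.
have -> : x ^+ (2 * j) = (8 / 3 * s ^+ 2) ^+ j * u ^+ j.
  rewrite exprM -exprMn; congr (_ ^+ _); rewrite /u.
  by move: (x ^+ 2) (s ^+ 2) s2n0 => v w w0; field; rewrite ?w0 ?pnatr_eq0.
have -> : - x ^+ 2 / (s ^+ 2 *+ 2) = - u + - x ^+ 2 / ((2 * s) ^+ 2 *+ 2).
  rewrite /u exprMn; move: (x ^+ 2) (s ^+ 2) s2n0 => v w w0.
  rewrite -[w *+ 2](mulr_natl w 2) -[(2 ^+ 2 * w) *+ 2](mulr_natl (2 ^+ 2 * w) 2).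
  by field; rewrite ?w0 ?pnatr_eq0.
rewrite expRD expRN.
have uj : u ^+ j <= j`!%:R * expR u.
  case: j => [|j]; first by rewrite expr0 fact0 mul1r -expR0 ler_expR.
  rewrite -ler_pdivrMl ?ltr0n ?fact_gt0// mulrC.
  by rewrite (le_trans _ (expR_ge1Dxn j u0))// lerDr.
set E2 := expR (_ / (_ *+ 2)).
have E20 : 0 <= E2 by exact: expR_ge0.
have Ku : u ^+ j / expR u <= j`!%:R by rewrite ler_pdivrMr ?expR_gt0.
rewrite [leLHS](_ : _ = (8 / 3 * s ^+ 2) ^+ j * normal_peak s * E2 * (u ^+ j / expR u)); last by ring.
rewrite [leRHS](_ : _ = (8 / 3 * s ^+ 2) ^+ j * normal_peak s * E2 * j`!%:R); last by field.
apply: ler_wpM2l => //.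
by apply: mulr_ge0 => //; apply: mulr_ge0; [nneg|exact: normal_peak_ge0].
Qed.

Let int_even (j : nat) : mu.-integrable setT (EFin \o (fun x => x ^+ (2 * j) * p x)).
Proof.
have h := integrableZl measurableT (2 * (8 / 3 * s ^+ 2) ^+ j * j`!%:R)
  (integrable_normal_pdf 0 (2 * s)).
apply: le_integrable h => //.
  apply/measurable_EFinP; apply: measurable_funM; last exact: measurable_normal_pdf.
  exact: exprn_measurable.
move=> x _ /=; rewrite lee_fin ger0_norm; last first.
  by rewrite mulr_ge0 ?normal_pdf_ge0// exprM exprn_ge0// sqr_ge0.
by rewrite (le_trans (p_le j x))// ler_norm.
Qed.

Let int_pow (k : nat) : mu.-integrable setT (EFin \o (fun x => x ^+ k * p x)).
Proof.
have h := integrableD measurableT (int_even 0) (int_even k).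
apply: le_integrable h => //.
  apply/measurable_EFinP; apply: measurable_funM; last exact: measurable_normal_pdf.
  exact: exprn_measurable.
move=> x _ /=; rewrite lee_fin muln0 expr0 mul1r normrM (ger0_norm (normal_pdf_ge0 _ _ _)).
rewrite [leRHS]ger0_norm; last by rewrite addr_ge0 ?mulr_ge0 ?normal_pdf_ge0// exprM exprn_ge0// sqr_ge0.
rewrite -{2}(mul1r (p x)) -mulrDl ler_wpM2r ?normal_pdf_ge0//.
have -> : x ^+ (2 * k) = `|x ^+ k| ^+ 2 by rewrite real_normK ?num_real// mulnC exprM.
by set a := `|_|; have := sqr_ge0 (a - 1); nra.
Qed.

Let within_cont (f : R -> R) A : continuous f -> {within A, continuous f}.
Proof. by move=> cf; exact: continuous_subspaceT. Qed.

Let cont_pow k : continuous (fun x : R => x ^+ k * p x).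
Proof.
move=> x; apply: cvgM; first exact: exprn_continuous.
exact: (continuous_normal_pdf (m := 0) sn0).
Qed.

Let odd0 k : odd k -> \int[mu]_x (x ^+ k * p x) = 0.
Proof.
move=> ok.
have mf : measurable_fun [set: R] (fun x : R => x ^+ k * p x).
  by apply: continuous_measurable_fun; exact: cont_pow.
have pN x : p (- x) = p x by rewrite !pE sqrrN.
have -> : [set: R] = `]-oo, 0[ `|` `[0, +oo[ :> set R.
  apply/seteqP; split=> x //= _; rewrite !in_itv/= andbT.
  by case: (ltP x 0) => h; [left|right].
rewrite Rintegral_setU//=; last 2 first.
- by apply: integrableS (int_pow k) => //; exact: measurableU.
- apply/disj_setPS => x [] /=; rewrite !in_itv/= => h1 /andP[h2 _].
  by have := lt_le_trans h1 h2; rewrite ltxx.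
have -> : \int[mu]_(x in `[0, +oo[) (x ^+ k * p x) = - \int[mu]_(x in `]-oo, 0[) (x ^+ k * p x).
  rewrite Rintegral_itv_bndo_bndc//; last by apply: integrableS (int_pow k).
  rewrite -mulN1r -RintegralZl//; last by apply: integrableS (int_pow k).
  (* The substitution x -> -x is available for nonnegative integrands; an odd power is nonpositive
     on the negative half-line, hence the factor -1. *)
  congr fine; have := @ge0_integration_by_substitutionNy R (fun x => -1 * (x ^+ k * p x)) 0.
  rewrite oppr0 => -> //.
  - apply: eq_integral => x _ /=.
    by rewrite pN exprNn -signr_odd ok expr1; congr EFin; ring.
  - apply: within_cont => x; apply: cvgM; [exact: cvg_cst|exact: cont_pow].
  - move=> x; rewrite in_itv/= => x0; rewrite mulrA mulr_ge0 ?normal_pdf_ge0//.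
    have -> : -1 * x ^+ k = (- x) ^+ k by rewrite [in RHS]exprNn -signr_odd ok expr1.
    by rewrite exprn_ge0// oppr_ge0 ltW.
by rewrite addrN.
Qed.

(** Antiderivative of (x^2 - s^2) p(x): integration by parts for the variance in closed form. *)
Let F (x : R) : R := - s ^+ 2 * (x * p x).

Let dF (x : R) : is_derive x 1 F ((x ^+ 2 - s ^+ 2) * p x).
Proof.
rewrite /F; under [fun x => _]eq_fun do rewrite pE.
rewrite pE; apply: is_derive_eq.
rewrite /GRing.scale /= -[s ^+ 2 *+ 2](mulr_natl (s ^+ 2) 2); set e := expR _.
by field; rewrite ?sn0 ?pnatr_eq0.
Qed.

Let cp : continuous p.
Proof. exact: (continuous_normal_pdf (m := 0) sn0). Qed.

Let contF : continuous F.
Proof.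
move=> x; apply: cvgM; first exact: cvg_cst.
by apply: cvgM; [exact: cvg_id|exact: cp].
Qed.

Let F0 : F x @[x --> +oo] --> 0.
Proof.
have [K K0 hK] : exists2 K, 0 < K & forall x, x ^+ 2 * p x <= K.
  exists (2 * (8 / 3 * s ^+ 2) ^+ 1 * 1`!%:R * normal_peak (2 * s)) => [|x].
    by rewrite !mulr_gt0 ?exprn_gt0 ?normal_peak_gt0 ?mulr_gt0 ?exprn_gt0// mulf_neq0.
  apply: (le_trans (p_le 1 x)); apply: ler_wpM2l; first by nneg.
  by rewrite normal_pdf_ub// mulf_neq0.
apply/cvgr0Pnorm_lt => e e0; near=> x.
have x0 : 0 < x by near: x; exact: nbhs_pinfty_gt.
rewrite /F !normrM normrN !ger0_norm ?sqr_ge0 ?normal_pdf_ge0 ?(ltW x0)//.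
have : s ^+ 2 * K / e < x.
  by near: x; apply: nbhs_pinfty_gt; rewrite realE ltW// divr_gt0// mulr_gt0 ?exprn_gt0.
rewrite ltr_pdivrMr// => h; rewrite -(ltr_pM2r x0).
have -> : s ^+ 2 * (x * p x) * x = s ^+ 2 * (x ^+ 2 * p x) by ring.
rewrite (mulrC e); apply: le_lt_trans h; apply: ler_wpM2l => //; exact: sqr_ge0.
Unshelve. all: by end_near. Qed.

Let g x := (x ^+ 2 - s ^+ 2) * p x.

Let int_g : mu.-integrable setT (EFin \o g).
Proof.
have h := integrableB measurableT (int_pow 2) (integrableZl measurableT (s ^+ 2) (int_pow 0)).
by apply: eq_integrable h => // x _ /=; rewrite /g expr0 mul1r mulrBl EFinB EFinM.
Qed.

Let cg : continuous g.
Proof.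
move=> x; apply: cvgM; last exact: cp.
by apply: cvgB; [exact: exprn_continuous|exact: cvg_cst].
Qed.

(** The fundamental theorem on a half-line is applied to a nonnegative integrand, while (x^2 - s^2)
    p(x) changes sign at s. The half-line is therefore cut at s; the two contributions are F(s) -
    F(0) and -F(s), and F(0) = 0. *)
Let g_half : \int[mu]_(x in `[0, +oo[) g x = 0.
Proof.
have -> : `[0, +oo[%classic = `[0, s[ `|` `[s, +oo[ :> set R.
  apply/seteqP; split=> x /=; rewrite !in_itv/= !andbT.
    by move=> x0; case: (ltP x s) => h; [left; rewrite x0|right].
  by move=> [/andP[]//|]; apply: le_trans; exact: ltW.
rewrite Rintegral_setU//=; last 2 first.
- by apply: integrableS int_g => //; exact: measurableU.
- apply/disj_setPS => x [] /=; rewrite !in_itv/= => /andP[_ h1] /andP[h2 _].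
  by have := lt_le_trans h1 h2; rewrite ltxx.
rewrite (@Rintegral_ge0_continuous_FTC2y _ g F s 0); first last.
- by move=> x _; rewrite derive1E; have [_ ->] := dF x.
- by apply: cvg_at_right_filter; exact: contF.
- by move=> x _; have [] := dF x.
- exact: F0.
- exact: within_cont.
- move=> x sx; apply: mulr_ge0; last exact: normal_pdf_ge0.
  by rewrite subr_ge0 lerXn2r// nnegrE ltW// (lt_le_trans s0).
rewrite Rintegral_itv_bndo_bndc; last by apply: integrableS int_g.
rewrite /Rintegral (@continuous_FTC2 _ g F)//.
- by rewrite -EFinB /= {2}/F mul0r mulr0 subr0 sub0r addrN.
- exact: within_cont.
- split => //; last 2 first.
  + by apply: cvg_at_right_filter; exact: contF.
  + by apply: cvg_at_left_filter; exact: contF.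
  by move=> x _; have [] := dF x.
- by move=> x _; rewrite derive1E; have [_ ->] := dF x.
Qed.

(** By evenness both integrals are twice those over [0, +oo), where [g_half] identifies the integral
    of x^2 p with s^2 times that of p. *)
Let second : \int[mu]_x (x ^+ 2 * p x) = s ^+ 2.
Proof.
have pN x : p (- x) = p x by rewrite !pE sqrrN.
have setE : [set x : R | 0 <= x] = `[0, +oo[%classic.
  by apply/seteqP; split => x/=; rewrite in_itv/= andbT.
have half (f : R -> R) : (forall x, 0 <= f x) -> continuous f -> f =1 f \o -%R ->
    mu.-integrable setT (EFin \o f) ->
    \int[mu]_x f x = 2 * \int[mu]_(x in `[0, +oo[) f x.
  move=> f0 cf fe fi; rewrite /Rintegral ge0_symfun_integralT// setE fineM//.
  by apply: integrable_fin_num => //; apply: integrableS fi.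
have ip : mu.-integrable setT (EFin \o p) by exact: integrable_normal_pdf.
rewrite half; last 4 first.
- by move=> x; rewrite mulr_ge0 ?sqr_ge0 ?normal_pdf_ge0.
- exact: cont_pow.
- by move=> x /=; rewrite pN sqrrN.
- exact: int_pow.
have /esym : \int[mu]_x p x = 1 by rewrite /Rintegral integral_normal_pdf.
rewrite half; last 4 first.
- by move=> x; exact: normal_pdf_ge0.
- exact: cp.
- by move=> x /=; rewrite pN.
- exact: ip.
move=> p1; have := g_half; rewrite /g.
under eq_Rintegral do rewrite mulrBl.
rewrite RintegralB//; last 2 first.
- by apply: integrableS (int_pow 2).
- have := integrableZl measurableT (s ^+ 2) ip; apply: integrableS => //.
rewrite RintegralZl//; last by apply: integrableS ip.
by move=> /subr0_eq ->; rewrite mulrCA -p1 mulr1.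
Qed.

(** The Radon-Nikodym derivative of [normal_prob] agrees almost everywhere with the density, since
    both have the same integral over every measurable set. *)
Let rn_bounded (f : R -> R) : mu.-integrable setT (EFin \o (fun x => f x * p x)) ->
  (normal_prob 0 s).-integrable setT (EFin \o f) ->
  (\int[normal_prob 0 s]_x (f x)%:E = \int[mu]_x (f x * p x)%:E)%E.
Proof.
move=> ifp fi; have mf := measurable_int _ fi.
rewrite -(Radon_Nikodym_change_of_variables (normal_prob_dominates 0 s))//=.
apply: ae_eq_integral => //.
- apply: emeasurable_funM => //; apply: (measurable_int mu).
  by apply: Radon_Nikodym_integrable; exact: normal_prob_dominates.
- exact: (measurable_int _ ifp).
under [X in ae_eq _ _ _ X]eq_fun do rewrite EFinM.
apply: ae_eqe_mul2l => /=.
rewrite Radon_NikodymE//=; first exact: normal_prob_dominates.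
move=> nmu; case: cid => /= h [h1 h2 h3].
apply: integral_ae_eq => //=.
- by apply/measurable_EFinP; exact: measurable_normal_pdf.
- by move=> E E01 mE; rewrite -h3.
Qed.

(** The change of variables presupposes integrability under [normal_prob], which is the claim
    itself. It is applied to truncations at level n, whose integrals are bounded by the one against
    the density, and monotone convergence concludes. *)
Lemma integrable_normal_pow (k : nat) :
  (normal_prob 0 s).-integrable setT (EFin \o (fun x => x ^+ k)).
Proof.
apply/integrableP; split; first by apply/measurable_EFinP; exact: exprn_measurable.
pose f n (x : R) := Num.min `|x ^+ k| n%:R.
have mfn n : measurable_fun [set: R] (f n).
  by apply: measurable_minr => //; apply: measurableT_comp => //; exact: exprn_measurable.
have f0 n x : 0 <= f n x by rewrite le_min normr_ge0 ler0n.
have -> : (\int[normal_prob 0 s]_x `|(x ^+ k)%:E| =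
   \int[normal_prob 0 s]_x limn (fun n => (f n x)%:E))%E.
  apply: eq_integral => x _ /=; apply/esym/cvg_lim => //.
  apply: cvg_EFin; first exact: nearW.
  apply: cvg_near_cst; near=> n; rewrite /= /f; apply/min_idPl.
  by near: n; exact: nbhs_infty_ger.
rewrite monotone_convergence//; last 3 first.
- by move=> n; apply/measurable_EFinP; exact: mfn.
- by move=> n x _; rewrite lee_fin.
- by move=> x _ m n mn; rewrite lee_fin /f le_min ge_min lexx/= ge_min ler_nat mn orbT.
have intabs : mu.-integrable setT (EFin \o (fun x => `|x ^+ k| * p x)).
  apply: eq_integrable (integrable_abse (int_pow k)) => // x _ /=.
  by rewrite normrM (ger0_norm (normal_pdf_ge0 _ _ _)).
apply: (@le_lt_trans _ _ (\int[mu]_x (`|x ^+ k| * p x)%:E)%E); last first.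
  exact: integrable_lty.
apply: lime_le.
  apply: ereal_nondecreasing_is_cvgn => m n mn; apply: ge0_le_integral => //.
  - by move=> x _; rewrite lee_fin.
  - by apply/measurable_EFinP; exact: mfn.
  - by apply/measurable_EFinP; exact: mfn.
  - by move=> x _; rewrite lee_fin /f le_min ge_min lexx/= ge_min ler_nat mn orbT.
apply: nearW => n.
have ifp : mu.-integrable setT (EFin \o (fun x => f n x * p x)).
  apply: le_integrable intabs => //.
    by apply/measurable_EFinP/measurable_funM; [exact: mfn|exact: measurable_normal_pdf].
  move=> x _ /=; rewrite lee_fin !normrM normr_id (ger0_norm (f0 _ _)).
  by apply: ler_wpM2r; rewrite ?normr_ge0// /f ge_min lexx.
rewrite rn_bounded//; last first.
  apply: measurable_bounded_integrable => //; last first.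
  - exists n%:R; split=> // M nM x _ /=; rewrite ger0_norm// (le_trans _ (ltW nM))//.
    by rewrite ge_min lexx orbT.
  - exact: mfn.
  - by apply: le_lt_trans (ltry 1); exact: probability_le1.
apply: le_integral => // x _; rewrite lee_fin.
by apply: ler_wpM2r; rewrite ?normal_pdf_ge0// /f ge_min lexx.
Unshelve. all: by end_near. Qed.

Lemma integral_normal_pow (k : nat) :
  \int[normal_prob 0 s]_x (x ^+ k) = \int[mu]_x (x ^+ k * p x).
Proof.
by rewrite /Rintegral rn_bounded//; (exact: int_pow || exact: integrable_normal_pow).
Qed.

Lemma normal_odd k : odd k -> \int[normal_prob 0 s]_x (x ^+ k) = 0.
Proof. by move=> ok; rewrite integral_normal_pow odd0. Qed.

Lemma normal_variance : \int[normal_prob 0 s]_x (x ^+ 2) = s ^+ 2.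
Proof. by rewrite integral_normal_pow second. Qed.

(** Only the order s^4 matters, so the domination [p_le] with j = 2 is enough: 2 (8/3)^2 2! = 256/9
    is below 32. *)
Lemma normal_fourth : \int[normal_prob 0 s]_x (x ^+ 4) <= 32 * s ^+ 4.
Proof.
rewrite integral_normal_pow.
apply: (@le_trans _ _ (\int[mu]_x (2 * (8 / 3 * s ^+ 2) ^+ 2 * 2`!%:R * normal_pdf 0 (2 * s) x))).
  apply: le_Rintegral; first by [].
  - exact: int_pow.
  - by have := integrableZl measurableT (2 * (8 / 3 * s ^+ 2) ^+ 2 * 2`!%:R) (integrable_normal_pdf 0 (2 * s)).
  - by move=> x _; exact: (p_le 2).
rewrite RintegralZl//; last exact: integrable_normal_pdf.
rewrite /Rintegral integral_normal_pdf /= mulr1 exprMn -exprM.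
rewrite (_ : 2`!%:R = 2 :> R)// -subr_ge0.
rewrite (_ : _ - _ = (32 - 256 / 9) * s ^+ 4); last by field.
by rewrite mulr_ge0 ?exprn_ge0 ?(ltW s0)//; lra.
Qed.

End normal_moments.

Section normal_rv.
Context {R : realType} {disp : measure_display} {T : measurableType disp}.
Variables (P : probability T R) (X : T -> R) (s : R).
Hypotheses (s0 : 0 < s) (mX : measurable_fun setT X)
  (lawX : forall A, measurable A -> P (X @^-1` A) = normal_prob 0 s A).

Let mX' : @measurable_fun _ _ T (measurableTypeR R) setT X := mX.

Let Xm : {mfun T >-> measurableTypeR R} := HB.pack X (isMeasurableFun.Build _ _ _ _ _ mX').

Let law_int (f : measurableTypeR R -> \bar R) :
  (\int[pushforward P Xm]_x f x = \int[normal_prob 0 s]_x f x)%E.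
Proof. by apply: eq_measure_integral => A mA _; exact: lawX. Qed.

Lemma normal_rv_good : good P X.
Proof.
split=> // p; apply/integrableP; split.
  by apply/measurable_EFinP; apply: measurable_funX; exact: measurableT_comp.
have /integrableP[_] := integrable_normal_pow s0 p.
rewrite -law_int ge0_integral_pushforward//; last first.
  apply: measurableT_comp => //; apply/measurable_EFinP; exact: exprn_measurable.
apply: le_lt_trans; rewrite le_eqVlt; apply/orP; left; apply/eqP.
by apply: eq_integral => w _ /=; rewrite !normrX normr_id.
Qed.

Lemma Ex_normal_pow k : Ex P (fun w => X w ^+ k) = \int[normal_prob 0 s]_x (x ^+ k).
Proof.
rewrite /Ex /Rintegral -law_int (integral_pushforward mX')//.
  by apply/measurable_EFinP; exact: exprn_measurable.
by rewrite preimage_setT; exact: (good_itg (goodX k normal_rv_good)).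
Qed.

End normal_rv.

(** * Smoothing of Lipschitz functions *)

Section primitive.
Context {R : realType}.
Local Notation mu := (@lebesgue_measure R).
Implicit Types f g : R -> R.
Local Notation is_derive1 x f df := (is_derive (x : R) (1 : R) (f : R -> R) (df : R)).

(** Signed for negative [t], so that a two-sided derivative exists at 0. [V] is the instance with
    integrand [V_integrand]. *)
Definition prim f (t : R) : R :=
  if 0 <= t then \int[mu]_(s in `[0, t]) f s else - \int[mu]_(s in `[t, 0]) f s.

Lemma continuous_itv_integrable f (a b : R) : continuous f ->
  mu.-integrable `[a, b] (EFin \o f).
Proof.
move=> cf; apply: continuous_compact_integrable; first exact: segment_compact.
exact: continuous_subspaceT.
Qed.

(** A base point left of both 0 and [t] writes the two cases of [prim] as one difference of
    integrals, to which the fundamental theorem applies. *)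
Lemma primE f a t : continuous f -> a < 0 -> a <= t ->
  prim f t = \int[mu]_(s in `[a, t]) f s - \int[mu]_(s in `[a, 0]) f s.
Proof.
move=> cf a0 at_; rewrite /prim; case: ifPn => [t0|]; last rewrite -ltNge => t0.
  rewrite Rintegral_itvB; last 3 first.
  - exact: continuous_itv_integrable.
  - by rewrite bnd_simp ltW.
  - by rewrite bnd_simp.
  rewrite Rintegral_itv_obnd_cbnd//.
  apply: integrableS (continuous_itv_integrable 0 t cf) => //.
  by apply: subset_itvr; rewrite bnd_simp.
rewrite -[RHS]opprB; congr (- _).
rewrite Rintegral_itvB; last 3 first.
- exact: continuous_itv_integrable.
- by rewrite bnd_simp.
- by rewrite bnd_simp ltW.
rewrite Rintegral_itv_obnd_cbnd//.
apply: integrableS (continuous_itv_integrable t 0 cf) => //.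
by apply: subset_itvr; rewrite bnd_simp.
Qed.

Lemma prim_is_derive f t : continuous f -> is_derive1 t (prim f) (f t).
Proof.
move=> cf; pose a := - (`|t| + 1).
have a0 : a < 0 by rewrite oppr_lt0 ltr_wpDl.
have at_ : a < t by rewrite /a ltrNl (le_lt_trans (ler_norm _))// normrN ltrDl.
pose G (x : R) := (\int[mu]_(s in `[a, x]) f s : R).
have [dG G'] : derivable G t 1 /\ G^`()%classic t = f t.
  by apply: (@continuous_FTC1_closed _ _ _ _ (t + 1)); rewrite ?ltrDl//;
    [exact: continuous_itv_integrable|exact: cf].
have : is_derive1 t (fun x => G x - G 0) (f t).
  have d1 : is_derive1 t G (f t) by split; rewrite -?derive1E.
  by have := is_deriveB d1 (is_derive_cst (G 0) t 1); rewrite subr0.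
apply: near_eq_is_derive; near=> x; rewrite (@primE f a)// ltW//.
by near: x; exact: lt_nbhsr.
Unshelve. all: by end_near. Qed.

Lemma is_derive_continuous f (g : R -> R) : (forall x, is_derive1 x f (g x)) ->
  continuous f.
Proof.
move=> df x; apply: differentiable_continuous; apply/derivable1_diffP.
by have [] := df x.
Qed.

Lemma mvt_le f g a b K : (forall x, is_derive1 x f (g x)) ->
  (forall x, Num.min a b <= x <= Num.max a b -> `|g x| <= K) ->
  `|f b - f a| <= K * `|b - a|.
Proof.
move=> df; have cf := is_derive_continuous df.
wlog ab : a b / a <= b.
  move=> h gK; have [|/ltW] := leP a b; first by move=> ab; exact: h.
  by move=> ba; rewrite distrC (distrC b); apply: h => //; rewrite minC maxC.
rewrite (min_idPl ab) (max_idPr ab) => gK.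
have [|c cab ->] := @MVT_segment R f g a b ab.
  exact: continuous_subspaceT.
by rewrite normrM ler_wpM2r// gK.
Qed.

(** Applied to a primitive, this is the moving average of the integrand over [y, y + e]. *)
Definition steklov (e : R) (G : R -> R) (y : R) : R := (G (y + e) - G y) / e.

Lemma is_derive_shift f g (y x : R) : (forall x, is_derive1 x f (g x)) ->
  is_derive1 x (fun t => f (y + t)) (g (y + x)).
Proof.
move=> df; have -> : g (y + x) = g (y + x) * 1 by rewrite mulr1.
have h : is_derive1 x (fun t : R => y + t) 1.
  by have := is_deriveD (is_derive_cst y x 1) (is_derive_id x (1 : R)); rewrite add0r.
split; last first.
  rewrite -derive1E (@derive1_comp _ (fun t => y + t) f) ?derive1E.
  - by have [_ ->] := df (y + x); have [_ ->] := h.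
  - by have [] := h.
  - by have [] := df (y + x).
apply/derivable1_diffP; apply: (differentiable_comp (f := fun t => y + t) (g := f)).
  by apply/derivable1_diffP; have [] := h.
by apply/derivable1_diffP; have [] := df (y + x).
Qed.

(** The mean value theorem for the difference of the shifted primitives. Comparing with another
    point, with the zero function or with a linear function gives in turn that averaging preserves
    Lipschitz constants, preserves bounds and moves a function little. *)
Lemma steklov_cmp e G1 G2 g1 g2 y1 y2 K : 0 < e ->
    (forall x, is_derive1 x G1 (g1 x)) -> (forall x, is_derive1 x G2 (g2 x)) ->
    (forall t, 0 <= t <= e -> `|g1 (y1 + t) - g2 (y2 + t)| <= K) ->
  `|steklov e G1 y1 - steklov e G2 y2| <= K.
Proof.
move=> e0 d1 d2 h.
pose D t := G1 (y1 + t) - G2 (y2 + t).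
have dD x : is_derive1 x D (g1 (y1 + x) - g2 (y2 + x)).
  by apply: is_deriveB; exact: is_derive_shift.
have := @mvt_le D (fun t => g1 (y1 + t) - g2 (y2 + t)) 0 e K dD.
rewrite (min_idPl (ltW e0)) (max_idPr (ltW e0)) => /(_ h).
rewrite subr0 (gtr0_norm e0) -ler_pdivrMr// => /le_trans-/(_ _ (lexx _)).
apply: le_trans; rewrite le_eqVlt; apply/orP; left; apply/eqP.
rewrite /steklov /D !addr0 -mulrBl normrM normfV (gtr0_norm e0); congr (`|_| / _).
by ring.
Qed.

Lemma is_derive_steklov e G g x : (forall x, is_derive1 x G (g x)) ->
  is_derive1 x (steklov e G) ((g (x + e) - g x) / e).
Proof.
move=> dG.
have d1 : is_derive1 x (fun t => G (t + e)) (g (x + e)).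
  under [fun t => _]eq_fun do rewrite addrC.
  by rewrite addrC; exact: is_derive_shift.
have := @is_deriveB _ _ _ _ _ _ _ _ _ d1 (dG x).
move=> /(@is_deriveZ _ _ _ _ e^-1).
rewrite (_ : _ \*: _ = steklov e G); last first.
  by apply/funext => y; rewrite /steklov /GRing.scale/= mulrC.
by rewrite /GRing.scale /= mulrC.
Qed.

Lemma taylor2 f f1 f2 K y h : (forall x, is_derive1 x f (f1 x)) ->
    (forall x, is_derive1 x f1 (f2 x)) ->
    (forall x, `|f2 x - f2 y| <= K * `|x - y|) -> 0 <= K ->
  `|f (y + h) - f y - f1 y * h - f2 y * h ^+ 2 / 2| <= K * `|h| ^+ 3.
Proof.
move=> d1 d2 h2 K0.
have btw t : Num.min 0 h <= t <= Num.max 0 h -> `|t| <= `|h|.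
  have [h0|/ltW h0] := leP 0 h => /andP[ht th].
    by rewrite !ger0_norm// (le_trans ht).
  by rewrite !ler0_norm ?lerN2// (le_trans th).
pose r t := f (y + t) - f1 y * t - f2 y / 2 * t ^+ 2.
pose r1 t := f1 (y + t) - f1 y - f2 y * t.
have dr t : is_derive1 t r (r1 t).
  have d := is_derive_shift y t d1.
  have e1 : is_derive1 t (fun t : R => f1 y * t) (f1 y).
    by apply: is_derive_eq; rewrite /GRing.scale/=; ring.
  have e2 : is_derive1 t (fun t : R => f2 y / 2 * t ^+ 2) (f2 y * t).
    by apply: is_derive_eq; rewrite /GRing.scale/=; field.
  exact: (is_deriveB (is_deriveB d e1) e2).
have dr1 t : is_derive1 t r1 (f2 (y + t) - f2 y).
  have d := is_derive_shift y t d2.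
  have e2 : is_derive1 t (fun t : R => f2 y * t) (f2 y).
    by apply: is_derive_eq; rewrite /GRing.scale/=; ring.
  have := is_deriveB (is_deriveB d (is_derive_cst (f1 y) t 1)) e2.
  by rewrite subr0.
have r1b t : Num.min 0 h <= t <= Num.max 0 h -> `|r1 t| <= K * `|h| ^+ 2.
  move=> /btw th.
  have := @mvt_le r1 (fun t => f2 (y + t) - f2 y) 0 t (K * `|h|) dr1.
  have r10 : r1 0 = 0 by rewrite /r1 addr0 subrr mulr0 subr0.
  rewrite r10 !subr0 => H.
  apply: (le_trans (H _)) => [x xt|].
    rewrite (le_trans (h2 _))// addrAC subrr add0r ler_wpM2l// (le_trans _ th)//.
    have [t0|/ltW t0] := leP 0 t; move: xt.
      rewrite (min_idPl t0) (max_idPr t0) => /andP[x0 xt].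
      by rewrite !ger0_norm.
    rewrite (min_idPr t0) (max_idPl t0) => /andP[tx x0].
    by rewrite !ler0_norm// lerN2.
  by rewrite expr2 mulrA ler_wpM2l// mulr_ge0.
have := @mvt_le r r1 0 h (K * `|h| ^+ 2) dr r1b.
rewrite (_ : K * `|h| ^+ 2 * `|h - 0| = K * `|h| ^+ 3); last by rewrite subr0 -mulrA -exprSr.
apply: le_trans; rewrite le_eqVlt; apply/orP; left; apply/eqP; congr `|_|.
by rewrite /r addr0 mulr0 expr0n/= mulr0 !subr0; field.
Qed.

End primitive.

(** * Measurability by rounding *)

Section discretization.
Context {R : realType} {disp : measure_display} {T : measurableType disp}.

Lemma measurable_countable (C : countType) (V : T -> C) (f : C -> R) :
  (forall c, measurable (V @^-1` [set c])) -> measurable_fun setT (f \o V).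
Proof.
move=> mV _ A mA; rewrite setTI.
rewrite (_ : _ @^-1` A = \bigcup_n (if unpickle n is Some c then
   (if `[< A (f c) >] then V @^-1` [set c] else set0) else set0)); last first.
  apply/seteqP; split=> w /=.
    move=> Aw; exists (pickle (V w)) => //; rewrite pickleK.
    by case: asboolP.
  by move=> [n _]; case: unpickle => // c; case: asboolP => // Ac; rewrite /= => ->.
apply: bigcupT_measurable => n; case: unpickle => [c|//].
by case: asboolP => _; [exact: mV|exact: measurable0].
Qed.

Definition rnd (n : nat) (x : R) : R := (Num.floor (n.+1%:R * x))%:~R / n.+1%:R.

Lemma rnd_dist n x : `|rnd n x - x| <= n.+1%:R^-1.
Proof.
have n0 : 0 < n.+1%:R :> R by rewrite ltr0n.
rewrite -(ler_pM2r n0) mulVf ?gt_eqF// -[X in _ * X <= _](gtr0_norm n0) -normrM mulrBl.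
rewrite /rnd divfK ?gt_eqF// distrC (mulrC x) ger0_norm ?subr_ge0 ?floor_le//.
by rewrite lerBlDr addrC; have := ltW (floorD1_gt (n.+1%:R * x)); rewrite intrD.
Qed.

(** Finitely many rounded values form a vector with countable range, and on a countable set every
    [G] is measurable. *)
Lemma measurable_rnd (U : nat -> T -> R) (G : (nat -> R) -> R) k n :
  (forall i, measurable_fun setT (U i)) ->
  measurable_fun setT (fun w => G (fun i => if (i < k)%N then rnd n (U i w) else 0)).
Proof.
move=> mU.
pose V s w := [seq Num.floor (n.+1%:R * U i w) | i <- s].
have mV s c : measurable (V s @^-1` [set c]).
  elim: s c => [|a s ih] [|b c].
  - by rewrite (_ : _ @^-1` _ = setT) //; apply/seteqP; split.
  - by rewrite (_ : _ @^-1` _ = set0) //; apply/seteqP; split.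
  - by rewrite (_ : _ @^-1` _ = set0) //; apply/seteqP; split.
  rewrite (_ : _ @^-1` _ = (fun w => n.+1%:R * U a w) @^-1` `[b%:~R, (b + 1)%:~R[ `&`
     (V s @^-1` [set c])); last first.
    apply/seteqP; split=> w /=.
      move=> [<- <-]; split=> //; rewrite in_itv/= floor_le/=.
      exact: floorD1_gt.
    move=> [h <-]; congr (_ :: _); apply/eqP.
    by rewrite floor_eq; move: h; rewrite in_itv.
  apply: measurableI; last exact: ih.
  rewrite -[X in measurable X]setTI; apply: measurable_funM => //; exact: mU.
pose f (s : seq int) : R := G (fun i => if (i < k)%N then (nth 0 s i)%:~R / n.+1%:R else 0).
rewrite (_ : (fun w => _) = f \o V (iota 0 k)); first exact: measurable_countable.
apply/funext => w; rewrite /f/=; congr G; apply/funext => i.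
case: ifPn => // ik; rewrite /rnd (nth_map 0%N) ?size_iota// nth_iota//.
Qed.

(** The bound also forces [F] to depend on the first [k] coordinates only, so a function of finitely
    many grid values can be written on whole sequences. *)
Definition lip (k : nat) (L : R) (F : (nat -> R) -> R) :=
  forall u v, `|F u - F v| <= L * \sum_(i < k) `|u i - v i|.

Lemma lip_measurable (U : nat -> T -> R) k L F : 0 <= L -> lip k L F ->
  (forall i, measurable_fun setT (U i)) ->
  measurable_fun setT (fun w => F (U ^~ w)).
Proof.
move=> L0 lF mU.
apply: (@measurable_fun_cvg _ _ _ setT
  (fun n w => F (fun i => if (i < k)%N then rnd n (U i w) else 0))).
  by move=> n; exact: measurable_rnd.
move=> w _; apply/cvgrPdist_le => e e0; near=> n.
rewrite (le_trans (lF _ _))//.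
apply: (@le_trans _ _ (L * \sum_(i < k) n.+1%:R^-1)).
  apply: ler_wpM2l => //; apply: ler_sum => i _.
  by rewrite ltn_ord distrC rnd_dist.
rewrite sumr_const card_ord -[X in L * X]mulr_natl mulrA.
rewrite ler_pdivrMr ?ltr0n// -ler_pdivrMl// mulrC.
have : L * k%:R / e <= n%:R by near: n; exact: nbhs_infty_ger.
by move=> /le_trans; apply; rewrite ler_nat.
Unshelve. all: by end_near. Qed.

End discretization.

(** * Smoothing in the present value with the past as a parameter *)

Section smoothing.
Context {R : realType}.
Implicit Types (f : (nat -> R) -> R -> R) (u v : nat -> R).

Definition lip2 (J : nat) (L : R) f := forall u v x y,
  `|f u x - f v y| <= L * (\sum_(j < J) `|u j - v j| + `|x - y|).

Let lip2_shift J L f u v x y t : lip2 J L f ->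
  `|f u (x + t) - f v (y + t)| <= L * (\sum_(j < J) `|u j - v j| + `|x - y|).
Proof.
by move=> lf; have -> : x - y = (x + t) - (y + t) by ring.
Qed.

Lemma lip2_continuous J L f u : 0 <= L -> lip2 J L f -> continuous (f u).
Proof.
move=> L0 lf x; apply/cvgrPdist_le => e e0; near=> y.
rewrite (le_trans (lf _ _ _ _))// big1 ?add0r => [|j _]; last by rewrite subrr normr0.
rewrite (@le_trans _ _ ((L + 1) * `|x - y|))//.
  by rewrite ler_wpM2r// lerDl.
rewrite mulrC -ler_pdivlMr ?ltr_wpDl//.
by near: y; apply: cvgr_dist_le => //; rewrite divr_gt0// ltr_wpDl.
Unshelve. all: by end_near. Qed.

Definition avg (e : R) f u := steklov e (prim (f u)).

Lemma avg_lip J L f e : 0 < e -> 0 <= L -> lip2 J L f -> lip2 J L (avg e f).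
Proof.
move=> e0 L0 lf u v x y.
apply: (steklov_cmp e0 (g1 := f u) (g2 := f v)) => [z|z|t _].
- by apply: prim_is_derive; exact: lip2_continuous lf.
- by apply: prim_is_derive; exact: lip2_continuous lf.
exact: lip2_shift.
Qed.

Lemma avg_bounded J L f e c : 0 < e -> 0 <= L -> lip2 J L f ->
  (forall u x, `|f u x| <= c) -> forall u x, `|avg e f u x| <= c.
Proof.
move=> e0 L0 lf fc u x.
have := @steklov_cmp R e (prim (f u)) (fun=> 0) (f u) (fun=> 0) x 0 c e0.
rewrite {2}/steklov subrr mul0r subr0; apply => [z|t _].
- by apply: prim_is_derive; exact: lip2_continuous lf.
- by rewrite subr0.
Qed.

Lemma avg_close J L f e : 0 < e -> 0 <= L -> lip2 J L f ->
  forall u x, `|avg e f u x - f u x| <= L * e.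
Proof.
move=> e0 L0 lf u x.
have := @steklov_cmp R e (prim (f u)) (fun t => f u x * t) (f u) (fun=> f u x) x 0 (L * e) e0.
rewrite {2}/steklov mulr0 subr0 add0r mulfK ?gt_eqF//; apply => [z|z|t /andP[t0 te]].
- by apply: prim_is_derive; exact: lip2_continuous lf.
- have := @is_deriveZ _ _ _ _ (f u x) _ _ _ (is_derive_id z (1 : R)).
  by rewrite /GRing.scale/= mulr1.
rewrite (le_trans (lf _ _ _ _))// big1 ?add0r => [|j _]; last by rewrite subrr normr0.
by rewrite addrAC subrr add0r ger0_norm// ler_wpM2l.
Qed.

(** The regularity consumed by one replacement step: bounded Lipschitz first and second derivatives
    in the present value, Lipschitz also in the past values so that they are admissible test
    functions themselves, and a cubic remainder. *)
Definition smooth3 (J : nat) (C : R) f f1 f2 :=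
  [/\ lip2 J C f, lip2 J C f1, lip2 J C f2,
      forall u x, `|f1 u x| <= C /\ `|f2 u x| <= C
    & forall u x h,
        `|f u (x + h) - f u x - f1 u x * h - f2 u x * h ^+ 2 / 2| <= C * `|h| ^+ 3].

Let diffq (e : R) f u x := (f u (x + e) - f u x) / e.

Let diffq_lip J L f e : 0 < e -> lip2 J L f -> lip2 J (2 * L / e) (diffq e f).
Proof.
move=> e0 lf u v x y; rewrite /diffq -mulrBl normrM normfV (gtr0_norm e0).
rewrite mulrAC; apply: ler_wpM2r; first by rewrite invr_ge0 ltW.
rewrite [X in `|X|](_ : _ = (f u (x + e) - f v (y + e)) - (f u x - f v y)); last by ring.
rewrite (le_trans (ler_normB _ _))// -mulrA mulr_natl mulr2n lerD//.
exact: lip2_shift.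
Qed.

Let diffq_bounded f e c : 0 < e -> (forall u x, `|f u x| <= c) ->
  forall u x, `|diffq e f u x| <= 2 * c / e.
Proof.
move=> e0 fc u x; rewrite /diffq normrM normfV (gtr0_norm e0).
apply: ler_wpM2r; first by rewrite invr_ge0 ltW.
rewrite (le_trans (ler_normB _ _))//.
by rewrite mulr_natl mulr2n lerD.
Qed.

(** Averaging twice yields two derivatives, which are difference quotients with Lipschitz constants
    of order 1/e and 1/e^2. That [C] is fixed before [J] and [f] is essential: the mesh of the walk
    is later chosen from [C], before the function to be smoothed is known. *)
Lemma smoothing L c e : 0 <= L -> 0 <= c -> 0 < e ->
  exists2 C, 0 <= C & forall J f, lip2 J L f -> (forall u x, `|f u x| <= c) ->
    exists g g1 g2, [/\ smooth3 J C g g1 g2, lip2 J L g, forall u x, `|g u x| <= c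
      & forall u x, `|g u x - f u x| <= 2 * L * e].
Proof.
move=> L0 c0 e0.
exists (L + 2 * L / e + 2 * (2 * L / e) / e + 2 * c / e + 2 * (2 * c / e) / e).
  by nneg.
move=> J f lf fc; set C := (X in smooth3 _ X).
have e0' := ltW e0.
pose H := avg e f; pose g := avg e H; pose g1 := diffq e H; pose g2 := diffq e (diffq e f).
have lH : lip2 J L H by exact: avg_lip.
have lg : lip2 J L g by exact: avg_lip.
have Hc : forall u x, `|H u x| <= c by exact: avg_bounded lf fc.
have gc : forall u x, `|g u x| <= c by exact: avg_bounded lH Hc.
have lipW K f' : lip2 J K f' -> K <= C -> lip2 J C f'.
  move=> lf' KC u v x y; rewrite (le_trans (lf' _ _ _ _))// ler_wpM2r//.
  by rewrite addr_ge0// sumr_ge0.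
have q1 : 0 <= 2 * L / e by nneg.
have q2 : 0 <= 2 * (2 * L / e) / e by nneg.
have q3 : 0 <= 2 * c / e by nneg.
have q4 : 0 <= 2 * (2 * c / e) / e by nneg.
exists g, g1, g2; split => //; last first.
  move=> u x; rewrite (_ : g u x - f u x = (g u x - H u x) + (H u x - f u x)); last by ring.
  rewrite (le_trans (ler_normD _ _))// -mulrA mulr_natl mulr2n lerD//.
    exact: avg_close lH _ _.
  exact: avg_close lf _ _.
have lg2 : lip2 J (2 * (2 * L / e) / e) g2 by apply: diffq_lip => //; exact: diffq_lip.
have dH u x : is_derive x (1 : R) (H u) (diffq e f u x).
  by apply: is_derive_steklov => z; apply: prim_is_derive; exact: lip2_continuous lf.
have dg u x : is_derive x (1 : R) (g u) (g1 u x).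
  by apply: is_derive_steklov => z; apply: prim_is_derive; exact: lip2_continuous lH.
have dg1 u x : is_derive x (1 : R) (g1 u) (g2 u x).
  exact: is_derive_steklov (dH u).
split.
- by apply: lipW lg _; rewrite /C; lra.
- by apply: lipW (diffq_lip e0 lH) _; rewrite /C; lra.
- by apply: lipW lg2 _; rewrite /C; lra.
- move=> u x; split.
    by rewrite (le_trans (diffq_bounded e0 Hc u x))// /C; lra.
  by rewrite (le_trans (diffq_bounded e0 (diffq_bounded e0 fc) u x))// /C; lra.
move=> u x h; apply: (le_trans (y := 2 * (2 * L / e) / e * `|h| ^+ 3)).
  apply: (taylor2 _ (dg u) (dg1 u)) => // y.
  rewrite (le_trans (lg2 _ _ _ _))// big1 ?add0r// => j _.
  by rewrite subrr normr0.
by rewrite ler_wpM2r ?exprn_ge0// /C; lra.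
Qed.

(** Expectation over one symmetric step of size sqrt v. Its mean is 0 and its second moment v, which
    is all that a second-order expansion sees. *)
Definition rad (v : R) f u x := (f u (x + Num.sqrt v) + f u (x - Num.sqrt v)) / 2.

Lemma rad_lip J L (v : R) f : lip2 J L f -> lip2 J L (rad v f).
Proof.
move=> lf u w x y; rewrite /rad -mulrBl normrM [X in _ * X]ger0_norm//.
rewrite ler_pdivrMr// [X in `|X|](_ : _ = (f u (x + Num.sqrt v) - f w (y + Num.sqrt v)) +
  (f u (x - Num.sqrt v) - f w (y - Num.sqrt v))); last by ring.
rewrite (le_trans (ler_normD _ _))// [leRHS]mulrC mulr_natl mulr2n lerD//.
  exact: lip2_shift.
exact: lip2_shift.
Qed.

Let half_le (a b c : R) : `|a| <= c -> `|b| <= c -> `|(a + b) / 2| <= c.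
Proof.
move=> ac bc; rewrite normrM [X in _ * X]ger0_norm// ler_pdivrMr//.
by rewrite (le_trans (ler_normD _ _))// mulrC mulr_natl mulr2n lerD.
Qed.

Lemma rad_bounded (v : R) f c : (forall u x, `|f u x| <= c) ->
  forall u x, `|rad v f u x| <= c.
Proof. by move=> fc u x; exact: half_le. Qed.

Lemma rad_smooth J C (v : R) f f1 f2 : smooth3 J C f f1 f2 ->
  smooth3 J C (rad v f) (rad v f1) (rad v f2).
Proof.
move=> [lf lf1 lf2 b t]; split; [exact: rad_lip|exact: rad_lip|exact: rad_lip| |].
  by move=> u x; split; apply: half_le; case: (b u (x + Num.sqrt v)); case: (b u (x - Num.sqrt v)).
move=> u x h; rewrite /rad.
have h1 := t u (x + Num.sqrt v) h; have h2 := t u (x - Num.sqrt v) h.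
have := half_le h1 h2; apply: le_trans; rewrite le_eqVlt; apply/orP; left; apply/eqP.
rewrite -!(addrAC x h); congr `|_|; by field.
Qed.

Lemma rad_taylor J C (v : R) f f1 f2 u x : 0 <= v -> smooth3 J C f f1 f2 ->
  `|rad v f u x - f u x - f2 u x * v / 2| <= C * Num.sqrt v ^+ 3.
Proof.
move=> v0 [_ _ _ _ t].
have h1 := t u x (Num.sqrt v); have h2 := t u x (- Num.sqrt v).
rewrite normrN in h2; have := half_le h1 h2.
rewrite (ger0_norm (sqrtr_ge0 v)); apply: le_trans.
rewrite le_eqVlt; apply/orP; left; apply/eqP; congr `|_|.
by rewrite /rad sqrrN sqr_sqrtr//; field.
Qed.

End smoothing.

(** * The Lindeberg method *)

Section lindeberg_step.
Context {R : realType} {disp : measure_display} {T : measurableType disp}.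
Variable P : probability T R.

Lemma lip2_lip J L (f : (nat -> R) -> R -> R) (a : nat -> nat) i :
  (forall j, (j < J)%N -> (a j <= i)%N) -> 0 <= L -> lip2 J L f ->
  lip i.+1 (J.+1%:R * L) (fun u => f (fun j => u (a j)) (u i)).
Proof.
move=> ai L0 lf u v; rewrite (le_trans (lf _ _ _ _))//.
rewrite mulrC -[leRHS]mulrA mulrCA [leRHS]mulrC; apply: ler_wpM2r => //.
have le1 k : (k <= i)%N -> `|u k - v k| <= \sum_(j < i.+1) `|u j - v j|.
  move=> ki; rewrite -ltnS in ki; rewrite (bigD1 (Ordinal ki))//= lerDl.
  exact: sumr_ge0.
rewrite -natr1 mulrDl mul1r lerD ?le1//.
apply: (@le_trans _ _ (\sum_(j < J) \sum_(j < i.+1) `|u j - v j|)).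
  by apply: ler_sum => j _; exact: le1 (ai j (ltn_ord j)).
by rewrite sumr_const card_ord mulr_natl.
Qed.

Lemma lip2_measurable J L (f : (nat -> R) -> R -> R) (u : nat -> T -> R) (Y : T -> R) :
  0 <= L -> lip2 J L f -> (forall j, measurable_fun setT (u j)) ->
  measurable_fun setT Y -> measurable_fun setT (fun w => f (u ^~ w) (Y w)).
Proof.
move=> L0 lf mu_ mY.
pose U i := if (i < J)%N then u i else Y.
have ai j : (j < J)%N -> (j <= J)%N by exact: ltnW.
have f_eq w : f (u ^~ w) (Y w) = f (fun j => U j w) (U J w).
  apply/eqP; rewrite -subr_eq0 -normr_le0 (le_trans (lf _ _ _ _))//.
  rewrite /U ltnn subrr normr0 addr0 big1 ?mulr0// => j _.
  by rewrite ltn_ord subrr normr0.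
under [fun w => _]eq_fun do rewrite f_eq.
apply: (@lip_measurable _ _ _ U J.+1 _ (fun g => f g (g J)) _ (lip2_lip ai L0 lf)) => //.
  by nneg.
by move=> i; rewrite /U; case: ifP.
Qed.

(** Both [f] at [Y'] and [rad v f] at [Y] are expanded around [Y]. The zeroth order cancels, the
    first and second orders leave the conditional mean and variance defects e1 and e2, and the cubic
    remainders give the last two terms. *)
Lemma lindeberg_step J C c (f f1 f2 : (nat -> R) -> R -> R) (u : nat -> T -> R)
    (Y Y' : T -> R) v e1 e2 e3 : smooth3 J C f f1 f2 -> 0 <= C ->
    (forall g x, `|f g x| <= c) -> 0 <= v ->
    (forall j, measurable_fun setT (u j)) -> measurable_fun setT Y ->
    measurable_fun setT Y' ->
    itg P (fun w => Y' w - Y w) -> itg P (fun w => (Y' w - Y w) ^+ 2) ->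
    itg P (fun w => `|Y' w - Y w| ^+ 3) ->
    `|Ex P (fun w => f1 (u ^~ w) (Y w) * (Y' w - Y w))| <= e1 ->
    `|Ex P (fun w => f2 (u ^~ w) (Y w) * ((Y' w - Y w) ^+ 2 - v))| <= e2 ->
    Ex P (fun w => `|Y' w - Y w| ^+ 3) <= e3 ->
  `|Ex P (fun w => f (u ^~ w) (Y' w)) - Ex P (fun w => rad v f (u ^~ w) (Y w))| <=
    e1 + e2 + C * e3 + C * Num.sqrt v ^+ 3.
Proof.
move=> sm C0 fc v0 mu_ mY mY' iD iD2 iD3 h1 h2 h3.
have [lf lf1 lf2 b t] := sm.
have mf1 : measurable_fun setT (fun w => f1 (u ^~ w) (Y w)) by exact: lip2_measurable lf1 _ _.
have mf2 : measurable_fun setT (fun w => f2 (u ^~ w) (Y w)) by exact: lip2_measurable lf2 _ _.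
have if' : itg P (fun w => f (u ^~ w) (Y' w)).
  by apply: itg_bounded (fun w => fc _ _); exact: lip2_measurable lf _ _.
have ir : itg P (fun w => rad v f (u ^~ w) (Y w)).
  apply: itg_bounded (fun w => rad_bounded v fc _ _).
  exact: lip2_measurable (rad_lip v lf) _ _.
have iv : itg P (fun w => (Y' w - Y w) ^+ 2 - v) by apply: itgB => //; exact: itg_cst.
have dom (F D : T -> R) : measurable_fun setT F -> itg P D ->
    (forall w, `|F w| <= C) -> itg P (fun w => F w * D w).
  move=> mF iD' FC; apply: (itg_le _ (itgZ C iD')) => [|w].
    by apply: measurable_funM => //; exact: itg_mfun iD'.
  by rewrite !normrM (ger0_norm C0) ler_wpM2r.
have i1 := dom _ _ mf1 iD (fun w => (b _ _).1).
have i2 := dom _ _ mf2 iv (fun w => (b _ _).2).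
pose rem w := f (u ^~ w) (Y' w) - rad v f (u ^~ w) (Y w) -
  (f1 (u ^~ w) (Y w) * (Y' w - Y w) +
   2^-1 * (f2 (u ^~ w) (Y w) * ((Y' w - Y w) ^+ 2 - v))).
have i12 : itg P (fun w => f1 (u ^~ w) (Y w) * (Y' w - Y w) +
   2^-1 * (f2 (u ^~ w) (Y w) * ((Y' w - Y w) ^+ 2 - v))).
  by apply: itgD => //; exact: itgZ.
have irem : itg P rem by apply: itgB => //; exact: itgB.
have remle w : `|rem w| <= C * `|Y' w - Y w| ^+ 3 + C * Num.sqrt v ^+ 3.
  have a1 := t (u ^~ w) (Y w) (Y' w - Y w).
  have a2 := rad_taylor (u ^~ w) (Y w) v0 sm.
  have := lerD a1 a2; apply: le_trans; rewrite -[X in _ <= _ + X]normrN.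
  apply: le_trans (ler_normD _ _); rewrite le_eqVlt; apply/orP; left; apply/eqP.
  rewrite /rem [Y w + (Y' w - Y w)]addrC subrK.
  congr `|_|; by field.
have := Ex_norm_le irem (itgD (itgZ C iD3) (itg_cst P (C * Num.sqrt v ^+ 3))) remle.
rewrite ExD; [|exact: itgZ|exact: itg_cst]; rewrite ExZ// Ex_cst => hrem.
have -> : Ex P (fun w => f (u ^~ w) (Y' w)) - Ex P (fun w => rad v f (u ^~ w) (Y w)) =
    Ex P (fun w => f1 (u ^~ w) (Y w) * (Y' w - Y w)) +
    2^-1 * Ex P (fun w => f2 (u ^~ w) (Y w) * ((Y' w - Y w) ^+ 2 - v)) + Ex P rem.
  rewrite -ExZ// -ExD//; last exact: itgZ.
  by rewrite -ExB// -ExD//; apply: eq_Ex => w; rewrite /rem; ring.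
rewrite (le_trans (ler_normD _ _))// -addrA lerD//.
  rewrite (le_trans (ler_normD _ _))// lerD// normrM ger0_norm//.
  rewrite (le_trans _ h2)// ler_piMl// invf_le1//; lra.
by rewrite (le_trans hrem)// lerD2r ler_wpM2l.
Qed.

End lindeberg_step.

(** * From asymptotic walks to a single Rademacher walk *)

Section random_walk_limit.
Context {R : realType}.

(* [m] increments of mesh [s ^ 2], with asymptotic conditional mean [0] and
   asymptotic conditional variances [v i], up to errors of order [s ^ 3]. *)
Definition asymp_walk (disp : nat -> measure_display)
    (T : forall N, measurableType (disp N)) (P : forall N, probability (T N) R)
    (U : forall N, nat -> T N -> R) (m : nat) (s K : R) (v : nat -> R) :=
  [/\ \forall N \near \oo, forall i, measurable_fun setT (U N i),
      \forall N \near \oo, forall i, (i < m)%N ->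
        itg (P N) (fun w => (U N i.+1 w - U N i w) ^+ 4) /\
        Ex (P N) (fun w => (U N i.+1 w - U N i w) ^+ 4) <= K * s ^+ 4,
      forall i F L, (i < m)%N -> 0 <= L -> lip i.+1 L F -> (forall u, `|F u| <= 1) ->
        forall e, 0 < e -> \forall N \near \oo,
        `|Ex (P N) (fun w => F (U N ^~ w) * (U N i.+1 w - U N i w))| <= K * s ^+ 3 + e
    & forall i F L, (i < m)%N -> 0 <= L -> lip i.+1 L F -> (forall u, `|F u| <= 1) ->
        forall e, 0 < e -> \forall N \near \oo,
        `|Ex (P N) (fun w => F (U N ^~ w) * ((U N i.+1 w - U N i w) ^+ 2 - v i))| <=
          K * s ^+ 3 + e].

(** Backward recursion: the expectation of [f] after [l] further independent symmetric steps with
    variances v i, v (i + 1), and so on. *)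
Fixpoint rads (v : nat -> R) (i l : nat) (f : (nat -> R) -> R -> R) :=
  if l is l'.+1 then rad (v i) (rads v i.+1 l' f) else f.

Lemma rads_smooth v i l J C f f1 f2 : smooth3 J C f f1 f2 ->
  exists g1 g2, smooth3 J C (rads v i l f) g1 g2.
Proof.
move=> sm; elim: l i => [|l ih] i; first by exists f1, f2.
by have [g1 [g2 h]] := ih i.+1; exists (rad (v i) g1), (rad (v i) g2); exact: rad_smooth.
Qed.

Lemma rads_lip v i l J L f : lip2 J L f -> lip2 J L (rads v i l f).
Proof. by move=> lf; elim: l i => [|l ih] i //=; exact: rad_lip. Qed.

Lemma rads_bounded v i l f c : (forall u x, `|f u x| <= c) ->
  forall u x, `|rads v i l f u x| <= c.
Proof. by move=> fc; elim: l i => [|l ih] i //=; exact: rad_bounded. Qed.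

Section family.
Variables (disp : nat -> measure_display)
  (T : forall N, measurableType (disp N)) (P : forall N, probability (T N) R)
  (U : forall N, nat -> T N -> R) (m : nat) (s K : R) (v : nat -> R).
Arguments U : clear implicits.
Hypotheses (s0 : 0 < s) (K0 : 0 <= K) (v0 : forall i, 0 <= v i <= K * s ^+ 2)
  (UW : asymp_walk P U m s K v).

Let moments N i : (forall i, measurable_fun setT (U N i)) ->
    itg (P N) (fun w => (U N i.+1 w - U N i w) ^+ 4) /\
    Ex (P N) (fun w => (U N i.+1 w - U N i w) ^+ 4) <= K * s ^+ 4 ->
  [/\ itg (P N) (fun w => U N i.+1 w - U N i w),
      itg (P N) (fun w => (U N i.+1 w - U N i w) ^+ 2),
      itg (P N) (fun w => `|U N i.+1 w - U N i w| ^+ 3)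
    & Ex (P N) (fun w => `|U N i.+1 w - U N i w| ^+ 3) <= (1 + K) * s ^+ 3].
Proof.
move=> mU [i4 h4].
set D := fun w => U N i.+1 w - U N i w.
have mD : measurable_fun setT D by exact: measurable_funB.
have a0 (x : R) : 0 <= `|x| by [].
have sq4 (x : R) : x ^+ 4 = `|x| ^+ 4 by rewrite -[4%N]/(2 * 2)%N !exprM real_normK ?num_real.
have i14 : itg (P N) (fun w => 1 + D w ^+ 4) by apply: itgD => //; exact: itg_cst.
have bnd (x : R) : 0 <= x -> [/\ x <= 1 + x ^+ 4, x ^+ 2 <= 1 + x ^+ 4 & x ^+ 3 <= 1 + x ^+ 4].
  move=> x0; have [x1|/ltW x1] := leP x 1.
    have p n : x ^+ n <= 1 by exact: exprn_ile1.
    by split; rewrite (le_trans _ (_ : 1 <= _)) ?lerDl ?exprn_ge0 ?p.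
  have p n : (n <= 4)%N -> x ^+ n <= x ^+ 4 by move=> n4; exact: ler_weXn2l.
  by split; rewrite (le_trans _ (_ : x ^+ 4 <= _)) ?lerDr ?(p 1%N) ?p.
have pos w : `|1 + D w ^+ 4| = 1 + `|D w| ^+ 4.
  by rewrite sq4 ger0_norm// addr_ge0// exprn_ge0.
have i1 : itg (P N) D.
  by apply: (itg_le mD i14) => w; rewrite pos; case: (bnd _ (a0 (D w))).
have i2 : itg (P N) (fun w => D w ^+ 2).
  apply: (itg_le _ i14) => [|w]; first exact: measurable_funX.
  by rewrite pos normrX; case: (bnd _ (a0 (D w))).
have i3 : itg (P N) (fun w => `|D w| ^+ 3).
  apply: (itg_le _ i14) => [|w].
    by apply: measurable_funX; exact: measurableT_comp.
  by rewrite pos normrX normr_id; case: (bnd _ (a0 (D w))).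
split=> //.
(* A third absolute moment is bounded through x^3 <= s^3 + x^4 / s, split according to x <= s; a
   fourth moment K s^4 thus costs (1 + K) s^3. *)
apply: (@le_trans _ _ (Ex (P N) (fun w => s ^+ 3 + s^-1 * D w ^+ 4))).
  apply: Ex_le => // [|w]; first by apply: itgD; [exact: itg_cst|exact: itgZ].
  rewrite sq4; move: `|D w| (a0 (D w)) => x x0.
  have [xs|/ltW xs] := leP x s.
    rewrite (le_trans (_ : _ <= s ^+ 3))//; first by rewrite lerXn2r// nnegrE ltW.
    by rewrite lerDl mulr_ge0 ?invr_ge0 ?exprn_ge0// ltW.
  rewrite (le_trans (_ : _ <= s^-1 * x ^+ 4))//; last by rewrite lerDr exprn_ge0// ltW.
  by rewrite ler_pdivlMl// [leRHS]exprSr mulrC ler_wpM2l// exprn_ge0.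
rewrite ExD; [|exact: itg_cst|exact: itgZ].
rewrite Ex_cst ExZ// mulrDl mul1r lerD2l ler_pdivrMl//.
by rewrite (le_trans h4)// [leRHS]mulrCA -exprS.
Qed.

(** Lindeberg telescoping over a block of [l] steps, peeling off the first step each time. Grid
    values from before the block enter as frozen parameters, and every step costs O(s^3) with a
    constant depending on [C] and [K]. *)
Lemma walk_block J C c f f1 f2 (a : nat -> nat) i0 l : smooth3 J C f f1 f2 -> 0 <= C ->
    0 <= c -> (forall u x, `|f u x| <= c) ->
    (forall j, (j < J)%N -> (a j <= i0)%N) -> (i0 + l <= m)%N ->
  forall e, 0 < e -> \forall N \near \oo,
    `|Ex (P N) (fun w => f (fun j => U N (a j) w) (U N (i0 + l)%N w)) -
      Ex (P N) (fun w => rads v i0 l f (fun j => U N (a j) w) (U N i0 w))| <=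
    l%:R * ((C + 1) * (2 + 4 * K) * s ^+ 3 + C * Num.sqrt K ^+ 3 * s ^+ 3) + e.
Proof.
move=> sm C0 c0 fc; elim: l i0 => [|l ih] i0 ai i0m e e0.
  by near=> N; rewrite addn0 subrr normr0 mul0r add0r ltW.
have [UW1 UW2 UW3 UW4] := UW.
have im : (i0 < m)%N by rewrite (leq_trans _ i0m)// addnS ltnS leq_addr.
have ai' j : (j < J)%N -> (a j <= i0.+1)%N by move=> /ai /leqW.
have i0m' : (i0.+1 + l <= m)%N by rewrite addSnnS.
have [g1 [g2 smg]] := rads_smooth v i0.+1 l sm.
set g := rads v i0.+1 l f in smg.
have [lg lg1 lg2 b _] := smg.
have gc : forall u x, `|g u x| <= c by exact: rads_bounded.
pose C1 := C + 1.
have C1p : 0 < C1 by rewrite ltr_wpDl.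
have C1n : 0 <= C1 by exact: ltW.
(* [asymp_walk] tests against functions bounded by 1, so the derivatives are divided by C + 1, which
   is positive even when C = 0. *)
pose F1 u := C1^-1 * g1 (fun j => u (a j)) (u i0).
pose F2 u := C1^-1 * g2 (fun j => u (a j)) (u i0).
have lipZ k L F : lip k L F -> lip k (C1^-1 * L) (fun u => C1^-1 * F u).
  move=> lF u u'; rewrite -mulrBr normrM ger0_norm ?invr_ge0// -mulrA.
  by rewrite ler_wpM2l// invr_ge0.
have lF1 : lip i0.+1 (C1^-1 * (J.+1%:R * C)) F1 by apply: lipZ; exact: (lip2_lip ai C0 lg1).
have lF2 : lip i0.+1 (C1^-1 * (J.+1%:R * C)) F2 by apply: lipZ; exact: (lip2_lip ai C0 lg2).
have L0 : 0 <= C1^-1 * (J.+1%:R * C) by nneg.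
have F11 u : `|F1 u| <= 1.
  rewrite /F1 normrM ger0_norm ?invr_ge0// ler_pdivrMl// mulr1.
  by rewrite (le_trans (b _ _).1)// lerDl.
have F21 u : `|F2 u| <= 1.
  rewrite /F2 normrM ger0_norm ?invr_ge0// ler_pdivrMl// mulr1.
  by rewrite (le_trans (b _ _).2)// lerDl.
have e'0 : 0 < e / 4 / C1 by rewrite !divr_gt0.
near=> N.
have mU : forall i, measurable_fun setT (U N i) by near: N.
have [|iD iD2 iD3 D3] := moments (i := i0) mU.
  by near: N; apply: filterS UW2 => N h; exact: h.
have hb1 : `|Ex (P N) (fun w => F1 (U N ^~ w) * (U N i0.+1 w - U N i0 w))| <=
   K * s ^+ 3 + e / 4 / C1 by near: N; exact: UW3 im L0 lF1 F11 _ e'0.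
have hb2 : `|Ex (P N) (fun w => F2 (U N ^~ w) * ((U N i0.+1 w - U N i0 w) ^+ 2 - v i0))| <=
   K * s ^+ 3 + e / 4 / C1 by near: N; exact: UW4 im L0 lF2 F21 _ e'0.
have hih : `|Ex (P N) (fun w => f (fun j => U N (a j) w) (U N (i0.+1 + l)%N w)) -
      Ex (P N) (fun w => g (fun j => U N (a j) w) (U N i0.+1 w))| <=
    l%:R * ((C + 1) * (2 + 4 * K) * s ^+ 3 + C * Num.sqrt K ^+ 3 * s ^+ 3) + e / 2.
  by near: N; apply: ih => //; rewrite divr_gt0.
have unz (G : (nat -> R) -> R -> R) (D : T N -> R) (x : R) :
    itg (P N) (fun w => C1^-1 * G (fun j => U N (a j) w) (U N i0 w) * D w) ->
    `|Ex (P N) (fun w => C1^-1 * G (fun j => U N (a j) w) (U N i0 w) * D w)| <= x ->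
    `|Ex (P N) (fun w => G (fun j => U N (a j) w) (U N i0 w) * D w)| <= C1 * x.
  move=> iG h; rewrite -ler_pdivrMl//.
  rewrite -(ger0_norm (_ : 0 <= C1^-1)) ?invr_ge0// -normrM -ExZ.
    apply: le_trans h; rewrite le_eqVlt; apply/orP; left; apply/eqP.
    by congr `|_|; apply: eq_Ex => w; rewrite mulrA.
  have := itgZ C1 iG; congr (itg _ _); apply/funext => w.
  by rewrite !mulrA mulfV ?gt_eqF// mul1r.
have dom (G : (nat -> R) -> R) L (D : T N -> R) : 0 <= L -> lip i0.+1 L G ->
    (forall u, `|G u| <= 1) -> itg (P N) D -> itg (P N) (fun w => G (U N ^~ w) * D w).
  move=> L'0 lG G1 iDD; apply: (itg_le _ iDD) => [|w].
    by apply: measurable_funM; [exact: lip_measurable lG _|exact: itg_mfun iDD].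
  by rewrite normrM ler_piMl.
have := @lindeberg_step _ _ _ (P N) J C c g g1 g2 (fun j => U N (a j)) (U N i0)
  (U N i0.+1) (v i0) (C1 * (K * s ^+ 3 + e / 4 / C1)) (C1 * (K * s ^+ 3 + e / 4 / C1))
  ((1 + K) * s ^+ 3) smg C0 gc (proj1 (andP (v0 i0))) (fun j => mU (a j)) (mU i0) (mU i0.+1)
  iD iD2 iD3 (unz _ _ _ (dom _ _ _ L0 lF1 F11 iD) hb1)
  (unz _ _ _ (dom _ _ _ L0 lF2 F21 (itgB iD2 (itg_cst _ _))) hb2) D3.
have sv : Num.sqrt (v i0) ^+ 3 <= Num.sqrt K ^+ 3 * s ^+ 3.
  rewrite -exprMn lerXn2r ?nnegrE ?mulr_ge0 ?sqrtr_ge0 ?(ltW s0)//.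
  have -> : Num.sqrt K * s = Num.sqrt (K * s ^+ 2).
    by rewrite sqrtrM// sqrtr_sqr ger0_norm// ltW.
  apply: ler_wsqrtr.
  by case/andP: (v0 i0).
set A := Ex _ _ in hih *; set B := Ex _ _ in hih *; set D' := Ex _ _ => hstep.
rewrite addnS -addSn -/A.
have -> : A - D' = (A - B) + (B - D') by ring.
rewrite (le_trans (ler_normD _ _))//.
have e4 : C1 * (K * s ^+ 3 + e / 4 / C1) = C1 * K * s ^+ 3 + e / 4.
  by field; rewrite gt_eqF.
rewrite e4 in hstep.
have Csv : C * Num.sqrt (v i0) ^+ 3 <= C * (Num.sqrt K ^+ 3 * s ^+ 3) by exact: ler_wpM2l.
have s30 : 0 <= s ^+ 3 by rewrite exprn_ge0// ltW.
have Ks : 0 <= K * s ^+ 3 by nneg.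
have CKs : 0 <= C * (K * s ^+ 3) by nneg.
have Cs : 0 <= C * s ^+ 3 by nneg.
have := lerD hih hstep; move=> /le_trans; apply.
rewrite -[l.+1%:R]natr1 /C1.
move: (Num.sqrt K ^+ 3) (Num.sqrt (v i0) ^+ 3) (s ^+ 3) (l%:R) Csv s30 Ks CKs Cs => x y t z.
lra.
Unshelve. all: by end_near. Qed.

End family.

(** The order of the quantifiers is the point: [s1] precedes the function, and [r] precedes the
    probability spaces, so two unrelated families share the same target. The induction runs over
    coarse blocks of [q] fine steps: the last block is replaced by Rademacher steps, which leaves a
    function of one coarse value fewer. Since q s^2 <= 1, errors O(s^3) per step add up to O(s) per
    block. *)
Lemma walk_target K L c k eta : 0 <= K -> 0 <= L -> 0 <= c -> 0 < eta ->
  exists2 s1, 0 < s1 & forall s q v m, 0 < s <= s1 -> q%:R * s ^+ 2 <= 1 ->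
    (forall i, 0 <= v i <= K * s ^+ 2) -> (k * q <= m)%N ->
    forall F, lip k.+1 L F -> (forall u, `|F u| <= c) ->
    exists r, forall (disp : nat -> measure_display)
      (T : forall N, measurableType (disp N)) (P : forall N, probability (T N) R)
      (U : forall N, nat -> T N -> R), asymp_walk P U m s K v ->
      (\forall N \near \oo, itg (P N) (U N 0%N)) ->
      (forall e, 0 < e -> \forall N \near \oo, Ex (P N) (fun w => `|U N 0%N w|) <= e) ->
      \forall N \near \oo,
        `|Ex (P N) (fun w => F (fun j => U N (j * q)%N w)) - r| <= eta.
Proof.
move=> K0; elim: k L c eta => [|k ih] L c eta L0 c0 eta0.
  (* With no increments left, only the starting value remains, and it tends to 0 in mean; the target
     is the value of [F] at zero. *)
  exists 1 => // s q v m _ _ _ _ F lF Fc; exists (F (fun=> 0)).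
  move=> disp T P U [UW1 _ _ _] iU0 U0.
  have e0 : 0 < eta / (L + 1) by rewrite divr_gt0// ltr_wpDl.
  near=> N.
  have mU : forall i, measurable_fun setT (U N i) by near: N.
  have iU : itg (P N) (U N 0%N) by near: N.
  have mF : measurable_fun setT (fun w => F (fun j => U N (j * q)%N w)).
    exact: (@lip_measurable _ _ _ (fun j => U N (j * q)%N) _ _ _ L0 lF).
  have iF := itg_bounded (P N) mF (fun w => Fc _).
  rewrite -(Ex_cst (P N) (F _)) -ExB//; last exact: itg_cst.
  apply: (@le_trans _ _ (Ex (P N) (fun w => L * `|U N 0%N w|))).
    apply: Ex_norm_le => [||w].
    - by apply: itgB => //; exact: itg_cst.
    - by apply: itgZ; exact: itg_norm.
    - by rewrite (le_trans (lF _ _))// big_ord1 subr0 mul0n.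
  rewrite ExZ; last exact: itg_norm.
  apply: (@le_trans _ _ (L * (eta / (L + 1)))).
    by apply: ler_wpM2l => //; near: N; exact: U0.
  by rewrite mulrCA ler_piMr ?(ltW eta0)// ler_pdivrMr ?ltr_wpDl// mul1r lerDl.
have eps0 : 0 < eta / 8 / (L + 1) by rewrite !divr_gt0// ltr_wpDl.
have [C C0 sm] := smoothing L0 c0 eps0.
have eta4 : 0 < eta / 4 by rewrite divr_gt0.
have L20 : 0 <= 2 * L by nneg.
have [s2 s20 {}ih] := ih (2 * L) c (eta / 4) L20 c0 eta4.
pose A := (C + 1) * (2 + 4 * K) + C * Num.sqrt K ^+ 3 + 1.
have A0 : 0 < A by rewrite ltr_wpDl// addr_ge0 ?mulr_ge0 ?exprn_ge0 ?sqrtr_ge0 ?addr_ge0// mulr_ge0.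
exists (Num.min s2 (eta / 4 / A)) => [|s q v m].
  by rewrite lt_min s20 divr_gt0.
rewrite le_min => /and3P[s0 ss2 sA] qs vb kqm F lF Fc.
(* The last coarse value is separated from the earlier ones, to be smoothed in that variable
   alone. *)
pose f (u : nat -> R) y := F (fun j => if (j < k.+1)%N then u j else y).
have lf : lip2 k.+1 L f.
  move=> u u' x y; rewrite (le_trans (lF _ _))// big_ord_recr/= ltnn.
  rewrite ler_wpM2l// lerD2r; apply: ler_sum => j _.
  by rewrite ltn_ord.
have [g [g1 [g2 [smg lg gc gf]]]] := sm _ f lf (fun u x => Fc _).
have kqm' : (k * q <= m)%N by rewrite (leq_trans _ kqm)// leq_mul2r leqnSn orbT.
(* The coordinate [u k] occurs both as a past value and as the starting point of the block, whence
   the Lipschitz constant 2 L. *)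
pose F' (u : nat -> R) := rads v (k * q) q g u (u k).
have lF' : lip k.+1 (2 * L) F'.
  move=> u u'; rewrite (le_trans (rads_lip _ _ _ lg _ _ _ _))//.
  rewrite -mulrA mulrCA ler_wpM2l// mulr_natl mulr2n lerD2l.
  by rewrite big_ord_recr/= lerDr sumr_ge0.
have ss : 0 < s <= s2 by rewrite s0.
have [r hr] := ih s q v m ss qs vb kqm' F' lF' (fun u => rads_bounded _ _ _ gc _ _).
exists r => disp T P U UW iU0 U0.
have {}hr := hr disp T P U UW iU0 U0.
have ai j : (j < k.+1)%N -> (j * q <= k * q)%N by rewrite ltnS => h; rewrite leq_mul2r h orbT.
have kqm2 : (k * q + q <= m)%N by rewrite addnC -mulSn.
have blk := walk_block s0 K0 vb UW smg C0 c0 gc ai kqm2 eta4.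
have [UW1 _ _ _] := UW.
near=> N.
have mU : forall i, measurable_fun setT (U N i) by near: N.
have h1 : `|Ex (P N) (fun w => F' (fun j => U N (j * q)%N w)) - r| <= eta / 4 by near: N.
have := near blk N; move=> /(_ _)/wrap[] //; rewrite /F' in h1.
rewrite addnC -mulSn => h2.
have mq j : measurable_fun setT (U N (j * q)%N) by exact: mU.
have mF : measurable_fun setT (fun w => F (fun j => U N (j * q)%N w)).
  exact: (@lip_measurable _ _ _ (fun j => U N (j * q)%N) _ _ _ L0 lF).
have iF := itg_bounded (P N) mF (fun w => Fc _).
have mg : measurable_fun setT (fun w => g (fun j => U N (j * q)%N w) (U N (k.+1 * q)%N w)).
  exact: (lip2_measurable L0 lg mq (mq _)).
have ig := itg_bounded (P N) mg (fun w => gc _ _).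
have h3 : `|Ex (P N) (fun w => F (fun j => U N (j * q)%N w)) -
   Ex (P N) (fun w => g (fun j => U N (j * q)%N w) (U N (k.+1 * q)%N w))| <= eta / 4.
  rewrite -ExB// -[leRHS](Ex_cst (P N)).
  apply: Ex_norm_le => [||w]; [exact: itgB|exact: itg_cst|].
  have -> : F (fun j => U N (j * q)%N w) = f (fun j => U N (j * q)%N w) (U N (k.+1 * q)%N w).
    apply/eqP; rewrite -subr_eq0 -normr_le0 (le_trans (lF _ _))// big_ord_recr/= ltnn.
    rewrite subrr normr0 addr0 big1 ?mulr0// => j _.
    by rewrite ltn_ord subrr normr0.
  rewrite distrC (le_trans (gf _ _))//.
  have -> : 2 * L * (eta / 8 / (L + 1)) = eta / 4 * (L / (L + 1)).
    by field; rewrite gt_eqF// ltr_wpDl.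
  by rewrite ler_piMr ?(ltW eta4)// ler_pdivrMr ?ltr_wpDl// mul1r lerDl.
have qs3 : q%:R * ((C + 1) * (2 + 4 * K) * s ^+ 3 + C * Num.sqrt K ^+ 3 * s ^+ 3) <= eta / 4.
  rewrite -mulrDl exprSr; apply: (@le_trans _ _ (A * s)); last first.
    by rewrite mulrC -ler_pdivlMr.
  rewrite [leLHS](_ : _ = ((C + 1) * (2 + 4 * K) + C * Num.sqrt K ^+ 3) * s * (q%:R * s ^+ 2)); last by ring.
  rewrite -[leRHS]mulr1; apply: ler_pM => //.
  - by rewrite mulr_ge0 ?(ltW s0)// addr_ge0 ?mulr_ge0 ?exprn_ge0 ?sqrtr_ge0 ?addr_ge0// mulr_ge0.
  - by rewrite mulr_ge0// sqr_ge0.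
  - by rewrite ler_wpM2r ?(ltW s0)// /A lerDl.
move: h1 h2 h3; set a := Ex _ _; set b := Ex _ _; set d := Ex _ _ => h1 h2 h3.
have -> : d - r = (d - b) + (b - a) + (a - r) by ring.
rewrite (le_trans (ler_normD _ _))//.
have := ler_normD (d - b) (b - a); lra.
Unshelve. all: by end_near. Qed.

End random_walk_limit.

(** * Path functionals *)

Section paths.
Context {R : realType}.
Implicit Types (f g y : R -> R).

Definition close (T : nat) f g (e : R) :=
  forall t, 0 <= t <= T%:R -> `|f t - g t| <= e.

Definition cpath y := {within `[0, +oo[, continuous y}.

Lemma cpath_unif y (K e : R) : cpath y -> 0 < e -> \forall n \near \oo,
  forall s t, 0 <= s <= K -> 0 <= t -> `|t - s| <= n.+1%:R^-1 -> `|y t - y s| <= e.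
Proof.
move=> cy e0.
have nc := (compact_near_coveringP _).1 (@segment_compact R 0 K).
have : \forall n \near \oo, [set` `[0, K]] `<=` (fun s => 0 <= s -> forall t, 0 <= t ->
    `|t - s| <= n.+1%:R^-1 -> `|y t - y s| <= e).
  apply: (nc nat \oo (fun n s => 0 <= s -> forall t, 0 <= t -> `|t - s| <= n.+1%:R^-1 ->
    `|y t - y s| <= e)) => x.
  rewrite /= in_itv/= => /andP[x0 xK].
  have x0' : `[0, +oo[%classic x by rewrite /= in_itv/= x0.
  have := (@subspace_continuousP R `[0, +oo[%classic R y).1 cy x x0'.
  have e2 : 0 < e / 2 by rewrite divr_gt0.
  move=> /cvgrPdist_le/(_ _ e2); rewrite near_withinE => /nbhs_ballP[d /= d0 hd].
  have d2 : 0 < d / 2 by rewrite divr_gt0.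
  have hn : \forall n \near \oo, n.+1%:R^-1 <= d / 2.
    near=> n; rewrite -[leRHS]invrK lef_pV2 ?posrE ?invr_gt0 ?ltr0n//.
    rewrite (@le_trans _ _ n%:R)//; last by rewrite ler_nat.
    by near: n; exact: nbhs_infty_ger.
  exists (ball x (d / 2), [set n | n.+1%:R^-1 <= d / 2]).
    by split=> //; exact: nbhsx_ballx.
  move=> [s n] /= [bs nd] s0 t t0 ts.
  have near_x z : 0 <= z -> ball x d z -> `|y x - y z| <= e / 2.
    by move=> z0 bz; apply: hd => //; rewrite /= in_itv/= z0.
  have h1 := near_x s s0 (le_ball _ bs); have h2 := near_x t t0.
  rewrite (_ : y t - y s = (y x - y s) - (y x - y t)); last by ring.
  rewrite (le_trans (ler_normB _ _))// (splitr e) lerD//.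
    by apply: h1; rewrite ler_pdivrMr// ler_peMr ?(ltW d0)//; lra.
  apply: h2; move: bs; rewrite /ball /= => bs.
  rewrite (_ : x - t = (x - s) - (t - s)); last by ring.
  by rewrite (le_lt_trans (ler_normB _ _))// (splitr d) ltr_leD// (le_trans ts).
apply: filterS => n h s t /andP[s0 sK] t0 ts.
by apply: h => //=; rewrite in_itv/= s0 sK.
Unshelve. all: by end_near. Qed.

(** A compact set of nonnegative times is bounded, so uniform convergence on the intervals [0, T]
    with integer T suffices. *)
Lemma path_space_cvg (f : path_space) (g : nat -> path_space) :
  (forall (T : nat) e, 0 < e -> \forall n \near \oo, close T (g n) f e) ->
  g @ \oo --> f.
Proof.
move=> gf; apply/fam_cvgP => K [cK K0].
have [M [_ /= hM]] := compact_bounded cK.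
pose T := (Num.truncn (`|M| + 1)).+1.
have KT t : K t -> 0 <= t <= T%:R.
  move=> Kt; have := K0 _ Kt; rewrite /= in_itv/= => /andP[-> _] /=.
  rewrite (le_trans (ler_norm _))//.
  apply: (le_trans (hM (`|M| + 1) _ _ Kt)); last by rewrite ltW// truncnS_gt.
  by rewrite (le_lt_trans (ler_norm _))// ltrDl.
move=> A /uniform_nbhs[E [entE EA]].
move: entE; rewrite -entourage_ballE => -[d /= d0 dE].
have d2 : 0 < d / 2 by rewrite divr_gt0.
have := gf T _ d2; apply: filterS => n hn; apply: EA => t Kt.
apply: dE; rewrite /= /ball /= distrC (le_lt_trans (hn t (KT t Kt)))//.
by rewrite ltr_pdivrMr// ltr_pMr// ltr1n.
Qed.

Section functional.
Variable Phi : @path_space R -> R.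
Hypothesis cPhi : {within cont_paths, continuous Phi}.

Lemma functional_cvg (f : R -> R) (g : nat -> R -> R) : cpath f ->
  (forall n, cpath (g n)) ->
  (forall (T : nat) e, 0 < e -> \forall n \near \oo, close T (g n) f e) ->
  (fun n => Phi (g n)) @ \oo --> Phi f.
Proof.
move=> cf cg gf.
have /(_ f cf) h := (@subspace_continuousP path_space cont_paths R Phi).1 cPhi.
apply: cvg_trans h => A /=; rewrite /nbhs/= => hA.
have : \forall n \near \oo, cont_paths (g n) -> (Phi @^-1` A) (g n).
  exact: (@path_space_cvg f g gf _ hA).
by apply: filterS => n; apply; exact: cg.
Qed.

(** By contradiction through sequences. One index serves as time horizon and as tolerance, so a
    sequence of counterexamples would converge to [f] in path space. *)
Lemma functional_eps f e : cpath f -> 0 < e -> exists n : nat, forall g, cpath g ->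
  close n f g n.+1%:R^-1 -> `|Phi g - Phi f| <= e.
Proof.
move=> cf e0; apply: contrapT => /forallNP h.
have {}h (n : nat) : exists g, [/\ cpath g, close n f g n.+1%:R^-1 & e < `|Phi g - Phi f|].
  have := h n => /existsNP[g /not_implyP[cg /not_implyP[hg /negP]]].
  by rewrite -ltNge => he; exists g.
pose g n := sval (cid (h n)).
have hg n : [/\ cpath (g n), close n f (g n) n.+1%:R^-1 & e < `|Phi (g n) - Phi f|].
  exact: svalP (cid (h n)).
have : (fun n => Phi (g n)) @ \oo --> Phi f.
  apply: functional_cvg => [//|n|T d d0]; first by case: (hg n).
  near=> n => t /andP[t0 tT]; have [_ hn _] := hg n; rewrite distrC.
  apply: (le_trans (hn t _)).
    rewrite t0 (le_trans tT)// ler_nat.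
    by near: n; exact: nbhs_infty_ge.
  rewrite -[leRHS]invrK lef_pV2 ?posrE ?invr_gt0 ?ltr0n//.
  rewrite (@le_trans _ _ n%:R)//; last by rewrite ler_nat.
  by near: n; exact: nbhs_infty_ger.
move=> /cvgrPdist_lt/(_ _ e0)[N _ hN]; have := hN N (leqnn N).
by rewrite /= distrC; have [_ _ /lt_trans h1 /h1] := hg N; rewrite ltxx.
Unshelve. all: by end_near. Qed.

End functional.

Definition hat (x : R) : R := Num.max 0 (1 - `|x|).

Lemma hat_ge0 x : 0 <= hat x. Proof. by rewrite le_max lexx. Qed.

Lemma hat_out x : 1 <= `|x| -> hat x = 0.
Proof. by move=> x1; apply/max_idPl; rewrite subr_le0. Qed.

Lemma hat_cont : continuous hat.
Proof.
move=> x; apply: (@continuous_max _ _ (fun=> 0) (fun x : R => 1 - `|x|)).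
  exact: cvg_cst.
apply: cvgB; first exact: cvg_cst.
exact: norm_continuous.
Qed.

Lemma hat_sum n x : 0 <= x <= n%:R -> \sum_(i < n.+1) hat (x - i%:R) = 1.
Proof.
elim: n => [|n ih] /andP[x0 xn].
  have -> : x = 0 by apply/eqP; rewrite eq_le xn x0.
  by rewrite big_ord1 subrr /hat normr0 subr0; apply/max_idPr.
rewrite big_ord_recr/=; have [xn1|nx] := leP x n%:R.
  rewrite ih ?x0// hat_out ?addr0// -normrN opprB ger0_norm ?subr_ge0//.
  by rewrite -natr1; lra.
rewrite big_ord_recr/= big1 ?add0r => [|i _]; last first.
  rewrite hat_out// ger0_norm; last first.
    by rewrite subr_ge0 (le_trans _ (ltW nx))// ler_nat ltnW.
  rewrite lerBrDr (le_trans _ (ltW nx))// addrC natr1 ler_nat.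
  exact: ltn_ord.
rewrite -natr1 in xn *.
rewrite /hat ger0_norm ?subr_ge0 ?(ltW nx)// ler0_norm; last by rewrite subr_le0.
by rewrite !(max_idPr _); [ring|lra|lra].
Qed.

Definition dy (m i : nat) : R := i%:R / 2 ^+ m.

(** Linear interpolation of the values [u i] at the dyadic times of level [m], written with the hat
    partition of unity. This makes it linear in [u] and, at each time of the range, a convex
    combination of the values at neighbouring grid points. *)
Definition poly (m n : nat) (u : nat -> R) (t : R) : R :=
  \sum_(i < n.+1) u i * hat (2 ^+ m * t - i%:R).

Lemma poly_cont m n u : continuous (poly m n u).
Proof.
rewrite /poly; elim: n.+1 => [|k ih].
  by under [fun t => _]eq_fun do rewrite big_ord0; move=> t; exact: cvg_cst.
under [fun t => _]eq_fun do rewrite big_ord_recr/=.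
move=> t; apply: cvgD; first exact: ih.
apply: cvgM; first exact: cvg_cst.
apply: (@continuous_comp _ _ _ (fun t : R => 2 ^+ m * t - k%:R) hat); last exact: hat_cont.
by apply: cvgB; [apply: cvgM; [exact: cvg_cst|exact: cvg_id]|exact: cvg_cst].
Qed.

Lemma poly_cpath m n u : cpath (poly m n u).
Proof. apply: continuous_subspaceT; exact: poly_cont. Qed.

Lemma poly_approx m n u (y t e : R) : 0 <= t <= dy m n ->
  (forall i, (i <= n)%N -> `|t - dy m i| <= (2 ^+ m)^-1 -> `|u i - y| <= e) ->
  `|poly m n u t - y| <= e.
Proof.
move=> /andP[t0 tn] uy.
have p0 : 0 < 2 ^+ m :> R by rewrite exprn_gt0.
have s1 : \sum_(i < n.+1) hat (2 ^+ m * t - i%:R) = 1.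
  by apply: hat_sum; rewrite mulr_ge0 ?(ltW p0)//= mulrC -ler_pdivlMr.
rewrite -[X in `|_ - X|]mulr1 -[X in _ - y * X]s1 mulr_sumr -sumrB (le_trans (ler_norm_sum _ _ _))//.
rewrite -[leRHS]mulr1 -[X in _ <= e * X]s1 mulr_sumr; apply: ler_sum => i _.
rewrite -mulrBl normrM (ger0_norm (hat_ge0 _)).
have [h|h] := leP 1 `|2 ^+ m * t - i%:R|; first by rewrite hat_out// !mulr0.
apply: ler_wpM2r; first exact: hat_ge0.
apply: uy; first by rewrite -ltnS.
rewrite -(ler_pM2l p0) mulfV ?gt_eqF// -{1}(gtr0_norm p0) -normrM mulrBr ltW//.
by rewrite /dy mulrCA mulfV ?gt_eqF// mulr1.
Qed.

End paths.

Section path_functional_measurable.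
Context {R : realType} {disp : measure_display} {T : measurableType disp}.
Variables (Y : R -> T -> R) (Phi : @path_space R -> R).
Hypotheses (mY : forall t, 0 <= t -> measurable_fun setT (Y t))
  (cY : continuous_paths Y)
  (cPhi : forall (f : R -> R) (g : nat -> R -> R), cpath f -> (forall n, cpath (g n)) ->
    (forall (T : nat) e, 0 < e -> \forall n \near \oo, close T (g n) f e) ->
    (fun n => Phi (g n)) @ \oo --> Phi f).

(** The path is the limit of interpolations of rounded grid values. These take countably many
    values, so [Phi] of them is measurable, and sequential continuity of [Phi] passes this to the
    limit. *)
Lemma functional_measurable : measurable_fun setT (fun w => Phi (Y ^~ w)).
Proof.
pose N n := (n * 2 ^ n)%N.
pose g n w : R -> R := poly n (N n)
  (fun i => if (i < (N n).+1)%N then rnd n (Y (dy n i) w) else 0).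
apply: (@measurable_fun_cvg _ _ _ setT (fun n w => Phi (g n w))).
  move=> n; apply: (@measurable_rnd _ _ _ (fun i => Y (dy n i))
    (fun u => Phi (poly n (N n) u)) (N n).+1 n) => i.
  by apply: mY; rewrite /dy divr_ge0// exprn_ge0.
move=> w _; apply: cPhi => [|n|K e e0]; [exact: cY|exact: poly_cpath|].
have e2 : 0 < e / 2 by rewrite divr_gt0.
have cYw : cpath (Y ^~ w) by exact: cY.
have cu := @cpath_unif R (Y ^~ w) K%:R (e / 2) cYw e2.
near=> n => t /andP[t0 tK].
have p0 : 0 < 2 ^+ n :> R by rewrite exprn_gt0.
apply: poly_approx.
  rewrite t0 (le_trans tK)// /dy /N natrM natrX mulfK ?gt_eqF// ler_nat.
  by near: n; exact: nbhs_infty_ge.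
move=> i iN ti; rewrite ltnS iN.
rewrite (_ : _ - _ = (rnd n (Y (dy n i) w) - Y (dy n i) w) + (Y (dy n i) w - Y t w)); last by ring.
rewrite (le_trans (ler_normD _ _))// (splitr e) lerD//.
  apply: (le_trans (rnd_dist _ _)).
  rewrite -[leRHS]invrK lef_pV2 ?posrE ?invr_gt0 ?ltr0n//.
  rewrite (@le_trans _ _ n%:R)//; last by rewrite ler_nat.
  by near: n; exact: nbhs_infty_ger.
have h : forall s t : R, 0 <= s <= K%:R -> 0 <= t ->
  `|t - s| <= n.+1%:R^-1 -> `|Y t w - Y s w| <= e / 2 by near: n.
apply: h; rewrite ?t0//.
  by rewrite /dy divr_ge0// exprn_ge0.
rewrite distrC (le_trans ti)// lef_pV2 ?posrE ?ltr0n//.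
by rewrite -natrX ler_nat ltn_expl.
Unshelve. all: by end_near. Qed.

End path_functional_measurable.

(** * Reduction of weak convergence to Lipschitz functionals *)

Section weak_convergence_lipschitz.
Context {R : realType}.

Definition lip_path (T : nat) (L : R) (Phi : @path_space R -> R) :=
  forall f g : R -> R, cpath f -> cpath g -> forall e, close T f g e ->
    `|Phi f - Phi g| <= L * e.

Lemma lip_path_cvg T L Phi (f : R -> R) (g : nat -> R -> R) : 0 <= L ->
  lip_path T L Phi -> cpath f -> (forall n, cpath (g n)) ->
  (forall (T : nat) e, 0 < e -> \forall n \near \oo, close T (g n) f e) ->
  (fun n => Phi (g n)) @ \oo --> Phi f.
Proof.
move=> L0 lP cf cg gf; apply/cvgrPdist_le => e e0.
have e'0 : 0 < e / (L + 1) by rewrite divr_gt0// ltr_wpDl.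
have := gf T _ e'0; apply: filterS => n h; rewrite distrC.
rewrite (le_trans (lP _ _ (cg n) cf _ h))// mulrCA ler_piMr ?(ltW e0)//.
by rewrite ler_pdivrMr ?ltr_wpDl// mul1r lerDl.
Qed.

(* A continuous bounded [Phi] is the increasing limit of these Lipschitz functionals. *)
Definition infconv (Phi : @path_space R -> R) (n : nat) (f : R -> R) : R :=
  inf [set x | exists g e, [/\ cpath g, 0 <= e, close n f g e & x = Phi g + n%:R * e]].

Section infconv.
Variables (Phi : @path_space R -> R) (c : R).
Hypothesis Phic : forall f, cpath f -> `|Phi f| <= c.

Let S n f := [set x | exists g e, [/\ cpath g, 0 <= e, close n f g e & x = Phi g + n%:R * e]].

Let lbS n f : lbound (S n f) (- c).
Proof.
move=> x [g [e [cg e0 _ ->]]]; have := Phic cg; rewrite ler_norml => /andP[h _].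
by rewrite (le_trans h)// lerDl mulr_ge0.
Qed.

Let close_refl n (f : R -> R) : close n f f 0.
Proof. by move=> t _; rewrite subrr normr0. Qed.

Let SPhi n f : cpath f -> S n f (Phi f).
Proof. by move=> cf; exists f, 0; split; rewrite ?mulr0 ?addr0//; exact: close_refl. Qed.

Lemma infconv_le n f : cpath f -> infconv Phi n f <= Phi f.
Proof. by move=> cf; apply: ge_inf; [exists (- c); exact: lbS|exact: SPhi]. Qed.

Lemma infconv_bounded n f : cpath f -> `|infconv Phi n f| <= c.
Proof.
move=> cf; rewrite ler_norml; apply/andP; split.
  by apply: lb_le_inf; [exists (Phi f); exact: SPhi|exact: lbS].
by rewrite (le_trans (infconv_le n cf))// (le_trans (ler_norm _))// Phic.
Qed.

Lemma infconv_lip n : lip_path n n%:R (infconv Phi n).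
Proof.
have half (f g : R -> R) e : cpath f -> cpath g -> 0 <= e -> close n f g e ->
    infconv Phi n f <= infconv Phi n g + n%:R * e.
  move=> cf cg e0 fg; rewrite -lerBlDr.
  apply: lb_le_inf; first by exists (Phi g); exact: SPhi.
  move=> x [k [d [ck d0 gk ->]]]; rewrite lerBlDr -addrA -mulrDr.
  apply: ge_inf; first by exists (- c); exact: lbS.
  exists k, (d + e); split => //; first exact: addr_ge0.
  move=> t tn; rewrite (_ : f t - k t = (g t - k t) + (f t - g t)); last by ring.
  by rewrite (le_trans (ler_normD _ _))// lerD ?gk ?fg.
move=> f g cf cg e fg.
have e0 : 0 <= e by rewrite (le_trans _ (fg 0 _))// lexx ler0n.
rewrite ler_norml; apply/andP; split.
  by rewrite lerBrDr addrC -lerBrDr opprK; apply: half => // t tn; rewrite distrC fg.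
by rewrite lerBlDl; exact: half.
Qed.

Lemma infconv_cvg f : cpath f -> {within cont_paths, continuous Phi} ->
  infconv Phi ^~ f @ \oo --> Phi f.
Proof.
move=> cf cPhi; apply/cvgrPdist_le => e e0.
have [m hm] := functional_eps cPhi cf e0.
near=> n.
have mn : (m <= n)%N by near: n; exact: nbhs_infty_ge.
have cn : 2 * c * m.+1%:R <= n%:R by near: n; exact: nbhs_infty_ger.
rewrite ger0_norm ?subr_ge0 ?infconv_le// lerBlDr -lerBlDl.
apply: lb_le_inf; first by exists (Phi f); exact: SPhi.
move=> x [g [d [cg d0 fg ->]]].
(* A competitor at small distance is controlled by continuity of [Phi] at [f]; one at larger
   distance pays a penalty n d of at least 2 c, more than the total oscillation of [Phi]. *)
have [dm|md] := leP d m.+1%:R^-1.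
  have : `|Phi g - Phi f| <= e.
    apply: hm => // t /andP[t0 tm]; apply: le_trans dm; apply: fg.
    by rewrite t0 (le_trans tm)// ler_nat.
  rewrite ler_norml => /andP[h _].
  have : 0 <= n%:R * d by exact: mulr_ge0.
  lra.
have h1 : 2 * c <= n%:R * d.
  apply: (@le_trans _ _ (n%:R * m.+1%:R^-1)); last by rewrite ler_wpM2l// ltW.
  by rewrite ler_pdivlMr ?ltr0n.
have := Phic cf; have := Phic cg; rewrite !ler_norml => /andP[a1 a2] /andP[b1 b2].
lra.
Unshelve. all: by end_near. Qed.

End infconv.

Lemma cvg_weakly_lipschitz
    (disp : nat -> measure_display) (T : forall N, measurableType (disp N))
    (P : forall N, probability (T N) R) (Y : forall N, R -> T N -> R)
    (displ : measure_display) (Tl : measurableType displ)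
    (Pl : probability Tl R) (Yl : R -> Tl -> R) :
  (\forall N \near \oo, (forall t, 0 <= t -> measurable_fun setT (Y N t)) /\
     continuous_paths (Y N)) ->
  (forall t, 0 <= t -> measurable_fun setT (Yl t)) -> continuous_paths Yl ->
  (forall (K : nat) L c (Phi : @path_space R -> R), 0 <= L -> lip_path K L Phi ->
     (forall f, cpath f -> `|Phi f| <= c) ->
     (fun N => Ex (P N) (fun w => Phi (Y N ^~ w))) @ \oo -->
       Ex Pl (fun w => Phi (Yl ^~ w))) ->
  cvg_weakly P Y Pl Yl.
Proof.
move=> hY mYl cYl hlip Phi [c Phic] cPhi.
have cYl' w : cpath (Yl ^~ w) by exact: cYl.
(* Minorants suffice: a Lipschitz minorant with nearly the same limiting expectation gives a lower
   bound for the liminf, and the same for [- Phi] gives the upper bound. *)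
have lower (Psi : @path_space R -> R) : (forall f, cpath f -> `|Psi f| <= c) ->
    {within cont_paths, continuous Psi} -> forall e, 0 < e -> \forall N \near \oo,
    Ex Pl (fun w => Psi (Yl ^~ w)) - e <= Ex (P N) (fun w => Psi (Y N ^~ w)).
  move=> Psic cPsi e e0.
  have mPsi n : measurable_fun setT (fun w => infconv Psi n (Yl ^~ w)).
    exact: (functional_measurable mYl cYl (fun f g => lip_path_cvg (g := g) (ler0n R n) (@infconv_lip Psi c Psic n))).
  have [|||_ hn] := @Ex_dct _ _ _ Pl (fun n w => infconv Psi n (Yl ^~ w))
    (fun w => Psi (Yl ^~ w)) (fun=> c) mPsi _ _ _.
  - move=> w; exact: (infconv_cvg Psic (cYl' w) cPsi).
  - exact: itg_cst.
  - move=> n w; exact: (infconv_bounded Psic n (cYl' w)).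
  have e2 : 0 < e / 2 by rewrite divr_gt0.
  have /cvgrPdist_le/(_ _ e2)[n _ /(_ n (leqnn n)) {}hn] := hn.
  have /cvgrPdist_le/(_ _ e2) hN := hlip n n%:R c (infconv Psi n) (ler0n _ _)
    (@infconv_lip Psi c Psic n) (fun f cf => infconv_bounded Psic n cf).
  near=> N.
  have h1 : `|Ex Pl (fun w => infconv Psi n (Yl ^~ w)) -
              Ex (P N) (fun w => infconv Psi n (Y N ^~ w))| <= e / 2 by near: N.
  have [mY cY] : (forall t, 0 <= t -> measurable_fun setT (Y N t)) /\
     continuous_paths (Y N) by near: N.
  have cY' w : cpath (Y N ^~ w) by exact: cY.
  have h2 : Ex (P N) (fun w => infconv Psi n (Y N ^~ w)) <= Ex (P N) (fun w => Psi (Y N ^~ w)).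
    apply: Ex_le => [||w]; last by exact: (infconv_le Psic n (cY' w)).
    - apply: (@itg_bounded _ _ _ _ _ c) => [|w]; last by exact: (infconv_bounded Psic n (cY' w)).
      exact: (functional_measurable mY cY (fun f g => lip_path_cvg (g := g) (ler0n R n) (@infconv_lip Psi c Psic n))).
    - apply: (@itg_bounded _ _ _ _ _ c) => [|w]; last exact: (Psic _ (cY' w)).
      by apply: functional_measurable => // f g; exact: functional_cvg.
  move: h1 hn; rewrite !ler_norml => /andP[a1 a2] /andP[b1 b2]; lra.
have PhiN : {within cont_paths, continuous (fun f => - Phi f)}.
  by move=> f; apply: cvgN; exact: cPhi.
have il : itg Pl (fun w => Phi (Yl ^~ w)).
  apply: (@itg_bounded _ _ _ _ _ c) => [|w]; last exact: (Phic _ (cYl' w)).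
  by apply: functional_measurable => // f g; exact: functional_cvg.
have iN : \forall N \near \oo, itg (P N) (fun w => Phi (Y N ^~ w)).
  apply: filterS hY => N [mY cY]; have cY' w : cpath (Y N ^~ w) by exact: cY.
  apply: (@itg_bounded _ _ _ _ _ c) => [|w]; last exact: (Phic _ (cY' w)).
  by apply: functional_measurable => // f g; exact: functional_cvg.
rewrite -(EFin_Ex il).
apply: cvg_trans (_ : (fun N => (Ex (P N) (fun w => Phi (Y N ^~ w)))%:E) @ \oo --> _).
  by apply: near_eq_cvg; apply: filterS iN => N h; rewrite EFin_Ex.
apply: cvg_EFin; first exact: nearW.
apply/cvgrPdist_le => e e0.
have h1 := lower Phi Phic cPhi e e0.
have h2 := lower (fun f => - Phi f) _ PhiN e e0.
near=> N.
have iPhi : itg (P N) (fun w => Phi (Y N ^~ w)) by near: N.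
have g1 : Ex Pl (fun w => Phi (Yl ^~ w)) - e <= Ex (P N) (fun w => Phi (Y N ^~ w)) by near: N.
have : Ex Pl (fun w => - Phi (Yl ^~ w)) - e <= Ex (P N) (fun w => - Phi (Y N ^~ w)).
  by near: N; apply: h2 => f cf; rewrite normrN Phic.
rewrite !ExN// /= ler_norml => g2; apply/andP; split; lra.
Unshelve. all: by end_near. Qed.

End weak_convergence_lipschitz.

(** * Integral equations driven by a continuous path *)

Section dyadic_paths.
Context {R : realType}.
Implicit Types (y W q k : R -> R) (u : nat -> R).

Lemma dy_ge0 m i : 0 <= dy m i :> R.
Proof. by rewrite /dy divr_ge0// exprn_ge0. Qed.

Lemma dyS m i : dy m.+1 i.*2 = dy m i :> R.
Proof. by rewrite /dy -muln2 natrM exprS invfM mulrA mulfK ?pnatr_eq0. Qed.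

Lemma dy_succ m i : dy m i.+1 = dy m i + (2 ^+ m)^-1 :> R.
Proof. by rewrite /dy -natr1 mulrDl mul1r. Qed.

(** Index of the dyadic point of level [m] just below [t]. Passing to level m + 1 doubles it or adds
    one more, so a refinement moves the approximating point by at most one cell. *)
Definition dfl (m : nat) (t : R) : nat := Num.truncn (2 ^+ m * t).

Lemma dfl_itv m t : 0 <= t -> dy m (dfl m t) <= t < dy m (dfl m t).+1.
Proof.
move=> t0; have p0 : 0 < 2 ^+ m :> R by rewrite exprn_gt0.
have pt0 : 0 <= 2 ^+ m * t by rewrite mulr_ge0// ltW.
have /andP[h1 h2] := truncn_itv pt0.
by rewrite /dy ler_pdivrMr// ltr_pdivlMr// (mulrC t) h1 h2.
Qed.

Lemma dfl_S m t : 0 <= t -> dfl m.+1 t = (dfl m t).*2 \/ dfl m.+1 t = (dfl m t).*2.+1.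
Proof.
move=> t0; have p0 : 0 < 2 ^+ m.+1 :> R by rewrite exprn_gt0.
have /andP[h1 h2] := dfl_itv m t0; have /andP[h3 h4] := dfl_itv m.+1 t0.
rewrite -dyS in h1; rewrite -dyS in h2.
have a : ((dfl m t).*2 < (dfl m.+1 t).+1)%N.
  by have := le_lt_trans h1 h4; rewrite /dy ltr_pM2r ?invr_gt0// ltr_nat.
have b : (dfl m.+1 t < (dfl m t).+1.*2)%N.
  by have := le_lt_trans h3 h2; rewrite /dy ltr_pM2r ?invr_gt0// ltr_nat.
rewrite doubleS !ltnS in a b; rewrite leq_eqVlt in b.
move: b; rewrite ltnS => /orP[/eqP->|b]; [by right|left].
by apply/eqP; rewrite eqn_leq b a.
Qed.

Lemma dfl_le m t (K : nat) : 0 <= t <= K%:R -> (dfl m t <= K * 2 ^ m)%N.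
Proof.
move=> /andP[t0 tK]; have p0 : 0 < 2 ^+ m :> R by rewrite exprn_gt0.
have /andP[h _] := dfl_itv m t0.
have := le_trans h tK; rewrite /dy ler_pdivrMr// -natrX -natrM ler_nat.
by [].
Qed.

(** Chaining: [t] is reached through its dyadic floors at levels m, m + 1, ..., each refinement
    costing at most one increment of that level, and continuity closes the gap to [t]. The bound is
    on partial sums of [D], so a limit of these sums can be plugged in. *)
Lemma dyadic_chain W D (K m : nat) (o : R) : cpath W ->
    (forall j i, (i < K * 2 ^ j)%N -> `|W (dy j i.+1) - W (dy j i)| <= D j) ->
    (forall j, 0 <= D j) -> (forall n, \sum_(m <= j < n) D j <= o) ->
  forall t i, 0 <= t <= K%:R -> (i <= K * 2 ^ m)%N -> `|t - dy m i| <= (2 ^+ m)^-1 ->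
  `|W t - W (dy m i)| <= o.
Proof.
move=> cW WD D0 Do t i tK iK ti; have /andP[t0 _] := tK.
have p0 : 0 < 2 ^+ m :> R by rewrite exprn_gt0.
have step n : (m <= n)%N ->
    `|W (dy n (dfl n t)) - W (dy m (dfl m t))| <= \sum_(m.+1 <= j < n.+1) D j.
  elim: n => [|n ih]; first by rewrite leqn0 => /eqP->; rewrite subrr normr0 big_geq.
  rewrite leq_eqVlt => /predU1P[->|mn]; first by rewrite subrr normr0 big_geq.
  rewrite ltnS in mn; rewrite big_nat_recr ?ltnS//=.
  rewrite (_ : _ - _ = (W (dy n.+1 (dfl n.+1 t)) - W (dy n (dfl n t))) +
    (W (dy n (dfl n t)) - W (dy m (dfl m t)))); last by ring.
  rewrite (le_trans (ler_normD _ _))// addrC lerD ?ih// -[dy n (dfl n t)]dyS.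
  have := dfl_le n.+1 tK.
  case: (dfl_S n t0) => -> h; first by rewrite subrr normr0.
  exact: WD.
(* A time within 2^-m of [dy m i] has its floor at i - 1, i or i + 1, hence at most one increment of
   level [m] away. *)
have near_i : `|W (dy m (dfl m t)) - W (dy m i)| <= D m.
  have /andP[h1 h2] := dfl_itv m t0; have hK := dfl_le m tK.
  move: ti; rewrite ler_norml => /andP[a b].
  have c1 : ((dfl m t) <= i.+1)%N.
    have : dy m (dfl m t) <= dy m i.+1 :> R by rewrite (dy_succ m i); lra.
    by rewrite /dy ler_pM2r ?invr_gt0// ler_nat.
  have c2 : (i < (dfl m t).+2)%N.
    have : dy m i < dy m (dfl m t).+2 :> R by rewrite (dy_succ m (dfl m t).+1); lra.
    by rewrite /dy ltr_pM2r ?invr_gt0// ltr_nat.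
  rewrite !ltnS in c2; rewrite leq_eqVlt in c1; rewrite leq_eqVlt in c2.
  move: c1 => /orP[/eqP e|]; first by rewrite e WD// -e.
  rewrite ltnS => c1; move: c2 => /orP[/eqP e|].
    by rewrite e distrC WD// -e.
  rewrite ltnS => c2; have -> : dfl m t = i by apply/eqP; rewrite eqn_leq c1 c2.
  by rewrite subrr normr0.
apply/ler_addgt0Pr => e e0.
have e20 : 0 < e by [].
have cu := cpath_unif K%:R cW e0.
have [n mn hn] : exists2 n, (m <= n)%N & `|W t - W (dy n (dfl n t))| <= e.
  have [N _ hN] := cu; exists (maxn m N); first exact: leq_maxl.
  set n := maxn m N.
  have /andP[h1 h2] := dfl_itv n t0.
  apply: (hN n _ (dy n (dfl n t)) t) => //=; first exact: leq_maxr.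
    by rewrite dy_ge0 (le_trans h1)//; case/andP: tK.
  rewrite ger0_norm ?subr_ge0// dy_succ in h2 *.
  rewrite lerBlDl ltW// (lt_le_trans h2)// lerD2l lef_pV2 ?posrE ?exprn_gt0//.
  by rewrite -natrX ler_nat ltn_expl.
rewrite (_ : _ - _ = (W t - W (dy n (dfl n t))) + ((W (dy n (dfl n t)) - W (dy m (dfl m t))) +
  (W (dy m (dfl m t)) - W (dy m i)))); last by ring.
rewrite (le_trans (ler_normD _ _))// addrC lerD// (le_trans (ler_normD _ _))//.
apply: le_trans (lerD (step n mn) near_i) _.
by rewrite addrC -big_ltn ?ltnS// Do.
Qed.

Lemma dyadic_sup W D (K : nat) (o : R) : cpath W ->
    (forall j i, (i < K * 2 ^ j)%N -> `|W (dy j i.+1) - W (dy j i)| <= D j) ->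
    (forall j, 0 <= D j) -> (forall n, \sum_(0 <= j < n) D j <= o) ->
  forall t, 0 <= t <= K%:R -> `|W t| <= `|W 0| + K.+1%:R * o.
Proof.
move=> cW WD D0 Do t tK; have /andP[t0 _] := tK.
have D0o : D 0%N <= o by have := Do 1%N; rewrite big_nat1.
have dy0 i : dy 0 i = i%:R :> R by rewrite /dy expr0 divr1.
have grid i : (i <= K)%N -> `|W i%:R| <= `|W 0| + i%:R * o.
  elim: i => [|i ih] iK; first by rewrite mul0r addr0.
  rewrite (_ : W i.+1%:R = W i%:R + (W (dy 0 i.+1) - W (dy 0 i))); last by rewrite !dy0; ring.
  rewrite (le_trans (ler_normD _ _))// -natr1 mulrDl mul1r addrA lerD//.
    by rewrite ih// ltnW.
  by rewrite (le_trans (WD _ _ _))// expn0 muln1.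
have hK := dfl_le 0 tK; rewrite expn0 muln1 in hK.
have /andP[h1 h2] := dfl_itv 0 t0.
have : `|W t - W (dy 0 (dfl 0 t))| <= o.
  apply: (dyadic_chain cW WD D0 Do tK); first by rewrite expn0 muln1.
  rewrite ger0_norm ?subr_ge0// lerBlDl ltW// (lt_le_trans h2)//.
  by rewrite dy_succ.
rewrite dy0 -natr1 mulrDl mul1r addrA => h.
rewrite (_ : W t = W (dfl 0 t)%:R + (W t - W (dfl 0 t)%:R)); last by ring.
rewrite (le_trans (ler_normD _ _))// lerD// (le_trans (grid _ hK))//.
by rewrite lerD2l ler_wpM2r ?ler_nat// (le_trans (D0 0%N)).
Qed.

(* [q t] and [k t] stand for the integrals over [[0, t]] of [c * y] and of [c],
   where [c] is bounded by [C]. *)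
Definition drift (C : R) y q k := [/\ q 0 = 0, k 0 = 0 &
  forall s t a e, 0 <= s -> s <= t -> (forall v, s <= v <= t -> `|y v - a| <= e) ->
    `|q t - q s - a * (k t - k s)| <= C * e * (t - s)].

(** The horizon is cut into pieces of length 1/p with C/p <= 1/2. On each piece the maximum of |y|
    bounds the change of [q] by half of itself, and this half is absorbed. *)
Lemma gronwall C (K : nat) : 0 <= C -> exists2 A, 0 <= A &
  forall y q k M, cpath y -> drift C y q k ->
    (forall t, 0 <= t <= K%:R -> `|y t + q t| <= M) ->
    forall t, 0 <= t <= K%:R -> `|y t| <= A * M.
Proof.
move=> C0; pose p := (Num.truncn (2 * C)).+1.
(* The recursion solves x <= M + (M + a_j M) + x/2 for the maximum x on the next piece. *)
pose a := fix a j : R := if j is j'.+1 then 4 + 2 * a j' else 1.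
have a0 j : 0 <= a j by elim: j => [|j ih] //=; nneg.
have aS j : a j <= a j.+1 by rewrite /=; have := a0 j; lra.
exists (a (K * p)%N) => // y q k M cy [q0 k0 dq] yM.
have p0 : 0 < p%:R :> R by rewrite ltr0n.
have Cp : C / p%:R <= 2^-1.
  rewrite ler_pdivrMr// mulrC ler_pdivlMr// mulrC ltW//.
  by rewrite /p truncnS_gt.
have M0 : 0 <= M by rewrite (le_trans _ (yM 0 _))// lexx/=.
have main j : forall t, 0 <= t <= K%:R -> t <= j%:R / p%:R -> `|y t| <= a j * M.
  elim: j => [|j ih] t /andP[t0 tK] tj.
    have -> : t = 0 by apply/eqP; rewrite eq_le t0 andbT (le_trans tj)// mul0r.
    have := yM 0; rewrite q0 addr0 mul1r; apply; rewrite lexx/=; exact: ler0n.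
  have [tj'|jt] := leP t (j%:R / p%:R).
    by rewrite (le_trans (ih t _ tj'))// ?t0// ler_wpM2r.
  pose s : R := j%:R / p%:R; have s0 : 0 <= s by rewrite divr_ge0.
  have st : s <= t by exact: ltW.
  have cys : {within `[s, t], continuous (fun x => `|y x|)}.
    have sub : `[s, t] `<=` `[0, +oo[.
      by move=> z /=; rewrite !in_itv/= => /andP[sz _]; rewrite (le_trans s0).
    have cyst := continuous_subspaceW sub cy.
    move=> z; exact: (continuous_comp (cyst z) (@norm_continuous _ R _)).
  have [x xst xmax] := EVT_max st cys.
  move: xst; rewrite in_itv/= => /andP[sx xt].
  have ys : `|y s| <= a j * M by apply: ih; rewrite ?lexx// s0 (le_trans st).
  have qs : `|q s| <= M + a j * M.
    rewrite (_ : q s = (y s + q s) - y s); last by ring.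
    by rewrite (le_trans (ler_normB _ _))// lerD// yM// s0 (le_trans st).
  have qx : `|q x - q s| <= 2^-1 * `|y x|.
    have := dq s x 0 `|y x| s0 sx; rewrite mul0r subr0 => H.
    apply: (le_trans (H _)) => [v /andP[sv vx]|].
      by rewrite subr0; apply: xmax; rewrite in_itv/= sv (le_trans vx).
    rewrite mulrAC ler_wpM2r// (le_trans _ Cp)// ler_wpM2l//.
    rewrite lerBlDl (le_trans xt)// (le_trans tj)// /s -natr1 mulrDl mul1r//.
  have yx : `|y x| <= M + (M + a j * M) + 2^-1 * `|y x|.
    rewrite {1}(_ : y x = (y x + q x) - q s - (q x - q s)); last by ring.
    rewrite (le_trans (ler_normB _ _))// lerD// (le_trans (ler_normB _ _))// lerD//.
    by rewrite yM// (le_trans s0 sx) (le_trans xt).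
  have yt : `|y t| <= `|y x| by apply: xmax; rewrite in_itv/= st lexx.
  by rewrite (le_trans yt)//= mulrDl; lra.
move=> t tK; apply: main => //; rewrite natrM mulfK ?gt_eqF//.
by case/andP: tK.
Qed.

(** The random rate is already replaced by its average [g]: only the driving path [u] remains
    random, which makes the scheme a Lipschitz function of the grid values of W. *)
Fixpoint euler (g d : R) u (i : nat) : R :=
  if i is i'.+1 then euler g d u i' * (1 - g * d) + (u i - u i') else u 0%N.

Lemma euler_lip g d u v i : 0 <= g * d <= 1 ->
  `|euler g d u i - euler g d v i| <= 2 * \sum_(j < i.+1) `|u j - v j|.
Proof.
move=> /andP[gd0 gd1].
(* Each coordinate enters through two consecutive increments, except the last one, which enters
   once; this sharper form is what the induction preserves. *)
suff : `|euler g d u i - euler g d v i| <= 2 * \sum_(j < i) `|u j - v j| + `|u i - v i|.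
  move=> h; rewrite (le_trans h)// big_ord_recr/= mulrDr lerD2l.
  by rewrite mulr_natl mulr2n lerDl.
elim: i => [|i ih] /=; first by rewrite big_ord0 mulr0 add0r.
rewrite (_ : _ - _ = (euler g d u i - euler g d v i) * (1 - g * d) +
  ((u i.+1 - v i.+1) - (u i - v i))); last by ring.
rewrite big_ord_recr/=.
have e1 : `|(euler g d u i - euler g d v i) * (1 - g * d)| <= `|euler g d u i - euler g d v i|.
  by rewrite normrM ler_piMr// ger0_norm ?subr_ge0// lerBlDr lerDl.
rewrite (le_trans (ler_normD _ _))//.
have := ler_normB (u i.+1 - v i.+1) (u i - v i); lra.
Qed.

(* The Euler scheme driven by the grid values of [W = y + q] follows [y]; the
   local errors come from [k] not being linear and from the oscillation of [y]. *)
Lemma euler_error C g (m N : nat) y q k (S o : R) : 0 <= C ->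
    0 <= g / 2 ^+ m <= 1 -> drift C y q k -> 0 <= o ->
    (forall i, (i < N)%N -> `|y (dy m i)| <= S) ->
    (forall i, (i < N)%N -> forall v, dy m i <= v <= dy m i.+1 -> `|y v - y (dy m i)| <= o) ->
  forall i, (i <= N)%N ->
  `|y (dy m i) - euler g (2 ^+ m)^-1 (fun j => y (dy m j) + q (dy m j)) i| <=
  S * \sum_(j < i) `|k (dy m j.+1) - k (dy m j) - g / 2 ^+ m| + i%:R * (C * o / 2 ^+ m).
Proof.
move=> C0 /andP[gd0 gd1] [q0 k0 dq] o0 yS yo; elim=> [|i ih] iN.
  by rewrite big_ord0 mulr0 mul0r addr0 /= /dy mul0r q0 addr0 subrr normr0.
have p0 : 0 < (2 ^+ m)^-1 :> R by rewrite invr_gt0 exprn_gt0.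
set d := (2 ^+ m)^-1 in gd0 gd1 ih p0 *.
have dd : dy m i.+1 - dy m i = d by rewrite dy_succ addrAC subrr add0r.
have hd := dq (dy m i) (dy m i.+1) (y (dy m i)) o (dy_ge0 m i) _ (yo i iN).
rewrite dd in hd; have {}hd := hd (ltW _); rewrite -subr_gt0 dd in hd.
have {}hd := hd p0.
rewrite big_ord_recr /= mulrDr -natr1 (mulrDl i%:R) mul1r.
set e := euler g d _ i in ih *.
set r := q _ - q _ - _ in hd.
set kap := k _ - k _ - _.
rewrite (_ : _ - _ = (y (dy m i) - e) * (1 - g * d) - (y (dy m i) * kap + r)); last first.
  by rewrite /r /kap; ring.
rewrite (le_trans (ler_normB _ _))//.
have e1 : `|(y (dy m i) - e) * (1 - g * d)| <= `|y (dy m i) - e|.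
  by rewrite normrM ler_piMr// ger0_norm ?subr_ge0// lerBlDr lerDl.
have e2 : `|y (dy m i) * kap + r| <= S * `|kap| + C * o * d.
  by rewrite (le_trans (ler_normD _ _))// lerD// normrM ler_wpM2r// yS.
have := ih (ltnW iN); lra.
Qed.

(** [S] bounds |y| by chaining and Gronwall. The oscillation of [y] within a cell is that of W plus
    C S / 2^m from [q]; it enters once through interpolation and once through the accumulated Euler
    error, at most K C times. *)
Lemma path_approximation C g (K m : nat) A y q k D (om o0 : R) : 0 <= C -> 0 <= A ->
    cpath y -> cpath (fun t => y t + q t) -> drift C y q k ->
    0 <= g / 2 ^+ m <= 1 ->
    (forall M, (forall t, 0 <= t <= K%:R -> `|y t + q t| <= M) ->
      forall t, 0 <= t <= K%:R -> `|y t| <= A * M) ->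
    (forall j i, (i < K * 2 ^ j)%N ->
      `|(y (dy j i.+1) + q (dy j i.+1)) - (y (dy j i) + q (dy j i))| <= D j) ->
    (forall j, 0 <= D j) -> (forall n, \sum_(m <= j < n) D j <= om) ->
    (forall n, \sum_(0 <= j < n) D j <= o0) ->
  let S := A * (`|y 0| + K.+1%:R * o0) in
  close K y (poly m (K * 2 ^ m) (euler g (2 ^+ m)^-1 (fun j => y (dy m j) + q (dy m j))))
    ((1 + K%:R * C) * (om + C * S / 2 ^+ m) +
     S * \sum_(j < K * 2 ^ m) `|k (dy m j.+1) - k (dy m j) - g / 2 ^+ m|).
Proof.
move=> C0 A0 cy cW dr gd hA WD D0 Dm Do S.
have [q0 k0 dq] := dr.
pose W t := y t + q t.
have o00 : 0 <= o0 by have := Do 0%N; rewrite big_geq.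
have om0 : 0 <= om by have := Dm m; rewrite big_geq.
have S0 : 0 <= S by rewrite /S; nneg.
have p0 : 0 < 2 ^+ m :> R by rewrite exprn_gt0.
have yS t : 0 <= t <= K%:R -> `|y t| <= S.
  apply: hA => {}t tK; have := dyadic_sup cW WD D0 Do tK.
  by rewrite q0 addr0.
have gridK i : (i <= K * 2 ^ m)%N -> 0 <= (dy m i : R) <= K%:R.
  move=> iK; rewrite dy_ge0/= /dy ler_pdivrMr// -natrX -natrM ler_nat//.
have osc t i : 0 <= t <= K%:R -> (i <= K * 2 ^ m)%N -> `|t - dy m i| <= (2 ^+ m)^-1 ->
    `|y t - y (dy m i)| <= om + C * S / 2 ^+ m.
  move=> tK iK ti; have h1 := dyadic_chain cW WD D0 Dm tK iK ti.
  have qd s t' : 0 <= s -> s <= t' -> t' <= K%:R -> `|q t' - q s| <= C * S * (t' - s).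
    move=> s0 st tK'; have := dq s t' 0 S s0 st; rewrite mul0r subr0; apply => v /andP[sv vt].
    by rewrite subr0 yS// (le_trans s0 sv) (le_trans vt).
  have h2 : `|q t - q (dy m i)| <= C * S / 2 ^+ m.
    have CS : 0 <= C * S by nneg.
    have /andP[t0 t1] := tK; have /andP[d0 d1] := gridK i iK.
    have [h|/ltW h] := leP (dy m i) t.
      rewrite (le_trans (qd _ _ d0 h t1))// ler_wpM2l// (le_trans _ ti)//.
      exact: ler_norm.
    rewrite distrC (le_trans (qd _ _ t0 h d1))// ler_wpM2l// (le_trans _ ti)//.
    by rewrite distrC ler_norm.
  rewrite (_ : y t - y (dy m i) = (y t + q t - (y (dy m i) + q (dy m i))) - (q t - q (dy m i))); last by ring.
  by rewrite (le_trans (ler_normB _ _))// lerD.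
set om' := om + C * S / 2 ^+ m in osc *.
have om'0 : 0 <= om' by rewrite /om'; nneg.
have err := @euler_error C g m (K * 2 ^ m) y q k S om' C0 gd dr om'0.
move=> t tK; rewrite distrC; apply: poly_approx.
  by rewrite /dy natrM natrX mulfK ?gt_eqF.
move=> i iK ti; set e := euler _ _ _ _.
rewrite (_ : e - y t = (y (dy m i) - y t) - (y (dy m i) - e)); last by ring.
rewrite (le_trans (ler_normB _ _))// mulrDl mul1r -addrA lerD//.
  by rewrite distrC osc.
rewrite addrC; apply: (le_trans (err _ _ i iK)) => [j jK|j jK v /andP[v1 v2]|].
- by apply: yS; apply: gridK; exact: ltnW.
- have /andP[_ jK1] := gridK j.+1 jK.
  apply: osc; [|exact: ltnW|].
    by rewrite (le_trans (dy_ge0 m j) v1) (le_trans v2).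
  by rewrite ger0_norm ?subr_ge0// lerBlDl -dy_succ.
apply: lerD.
  rewrite ler_wpM2l// -(big_mkord xpredT (fun j => `|k (dy m j.+1) - k (dy m j) - g / 2 ^+ m|)).
  rewrite -(big_mkord xpredT (fun j => `|k (dy m j.+1) - k (dy m j) - g / 2 ^+ m|)).
  by rewrite (big_cat_nat (n := i) (p := K * 2 ^ m)%N)//= lerDl sumr_ge0.
rewrite (_ : i%:R * _ = (i%:R / 2 ^+ m) * C * om'); last by ring.
by apply: ler_wpM2r => //; apply: ler_wpM2r => //; have /andP[] := gridK i iK.
Qed.

End dyadic_paths.

(** * Reduction to asymptotic random walks *)

Section monotone_bound.
Context {R : realType} {disp : measure_display} {T : measurableType disp}.
Variable P : probability T R.

(* A form of monotone convergence in which the limit need not be finite. *)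
Lemma Ex_mono_bound (X : T -> R) (H : nat -> T -> R) (B M : R) :
  measurable_fun setT X -> (forall w, 0 <= X w <= M) -> (forall n, itg P (H n)) ->
  (forall n w, 0 <= H n w) -> (forall w, nondecreasing_seq (H ^~ w)) ->
  (forall n, Ex P (H n) <= B) ->
  (forall w h, (forall n, H n w <= h) -> X w <= h) -> Ex P X <= B.
Proof.
move=> mX XM iH H0 ndH HB XH.
pose G n w := Num.min (H n w) M.
have mG n : measurable_fun setT (G n).
  by apply: measurable_minr => //; exact: itg_mfun (iH n).
have ndG w : nondecreasing_seq (G ^~ w).
  by move=> m n mn; rewrite /G le_min ge_min ndH//= ge_min lexx orbT.
have cG w : cvgn (G ^~ w).
  apply: nondecreasing_is_cvgn => //; exists M => _ [n _ <-].
  by rewrite /G ge_min lexx orbT.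
have M0 (w : T) : 0 <= M by case/andP: (XM w) => a b; exact: le_trans b.
have [||| iG cE] := @Ex_dct _ _ _ P G (fun w => limn (G ^~ w)) (fun=> M) mG _ _ _.
- by move=> w; exact: cG.
- exact: itg_cst.
- move=> n w; rewrite ger0_norm; first by rewrite /G ge_min lexx orbT.
  by rewrite /G le_min H0 (M0 w).
have XG w : X w <= limn (G ^~ w).
  have Gl n : G n w <= limn (G ^~ w) by exact: nondecreasing_cvgn_le.
  (* Either all [H n w] stay below [M], so truncation changes nothing and the limit dominates every
     [H n w], or the truncation reaches [M], which dominates [X]. *)
  have [h|/existsNP[n /negP]] := pselect (forall n, H n w <= M).
    apply: XH => n; rewrite (le_trans _ (Gl n))// /G le_min lexx/=; exact: h.
  rewrite -ltNge => Hn; rewrite (le_trans _ (Gl n))// /G.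
  by rewrite (min_idPr (ltW Hn)); case/andP: (XM w).
have iX : itg P X by apply: (@itg_bounded _ _ _ _ _ M) => // w; have /andP[a b] := XM w; rewrite ger0_norm.
apply: (@le_trans _ _ (Ex P (fun w => limn (G ^~ w)))); first exact: Ex_le.
have iGn n : itg P (G n).
  apply: (itg_le (mG n) (iH n)) => w.
  by rewrite !ger0_norm// /G ?ge_min ?lexx// le_min H0 (M0 w).
apply: (@ler_cvg_to _ _ _ _ _ _ _ _ cE (cvg_cst B)); apply: nearW => n.
by apply: le_trans (HB n); apply: Ex_le => // w; rewrite /G ge_min lexx.
Qed.

End monotone_bound.

(** * The Euler approximation in mean *)

Section euler_approximation.
Context {R : realType} {disp : measure_display} {T : measurableType disp}.
Variable P : probability T R.
Variables (Y q k : R -> T -> R) (C g C4 A : R) (K : nat).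
Let W t w := Y t w + q t w.
Hypotheses (C0 : 0 <= C) (C40 : 0 <= C4) (A0 : 0 < A).
Hypothesis mY : forall t, 0 <= t -> measurable_fun setT (Y t).
Hypothesis mq : forall t, 0 <= t -> measurable_fun setT (q t).
Hypothesis cY : continuous_paths Y.
Hypothesis cW : continuous_paths W.
Hypothesis dr : forall w, drift C (Y ^~ w) (q ^~ w) (k ^~ w).
Hypothesis iY0 : itg P (Y 0).
Hypothesis EY0 : Ex P (fun w => `|Y 0 w|) <= C4.
Hypothesis W4 : forall j i, (i < K * 2 ^ j)%N ->
  itg P (fun w => (W (dy j i.+1) w - W (dy j i) w) ^+ 4) /\
  Ex P (fun w => (W (dy j i.+1) w - W (dy j i) w) ^+ 4) <= C4 / 2 ^+ j / 2 ^+ j.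
Hypothesis hA : forall w M, (forall t, 0 <= t <= K%:R -> `|W t w| <= M) ->
  forall t, 0 <= t <= K%:R -> `|Y t w| <= A * M.

(** Any ratio below 1 with 2 lam^4 >= 1 works: the second condition keeps the expected fourth-moment
    part of [D] below a multiple of lam^j, and the geometric sum is 1 / (1 - lam) = 10. *)
Let lam : R := 9 / 10.

(** Bounds all increments of level [j] at once through |x| <= lam^j + x^4 / lam^(3j), the maximum
    over the level being replaced by a sum. The mean is of order lam^j, hence summable over
    levels. *)
Let D j w := lam ^+ j + lam ^- j ^+ 3 *
  \sum_(i < K * 2 ^ j) (W (dy j i.+1) w - W (dy j i) w) ^+ 4.

Let lam0 : 0 < lam. Proof. by rewrite /lam; lra. Qed.

Let pow4_ge0 (x : R) : 0 <= x ^+ 4.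
Proof. by rewrite -[4%N]/(2 * 2)%N exprM sqr_ge0. Qed.

Let D_ge0 j w : 0 <= D j w.
Proof.
rewrite addr_ge0 ?exprn_ge0 ?(ltW lam0)// mulr_ge0//.
  by rewrite exprn_ge0// invr_ge0 exprn_ge0// ltW.
exact: sumr_ge0.
Qed.

Let D_incr w j i : (i < K * 2 ^ j)%N -> `|W (dy j i.+1) w - W (dy j i) w| <= D j w.
Proof.
move=> ij; set x := (X in `|X|).
have l0 : 0 < lam ^+ j by exact: exprn_gt0.
apply: (@le_trans _ _ (lam ^+ j + lam ^- j ^+ 3 * x ^+ 4)); last first.
  rewrite lerD2l ler_wpM2l//; first by rewrite exprn_ge0// invr_ge0 ltW.
  by rewrite (bigD1 (Ordinal ij))//= lerDl sumr_ge0.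
have [xl|/ltW lx] := leP `|x| (lam ^+ j).
  by rewrite (le_trans xl)// lerDl mulr_ge0// exprn_ge0// invr_ge0 ltW.
rewrite (le_trans (_ : _ <= lam ^- j ^+ 3 * x ^+ 4)) ?lerDr ?(ltW l0)//.
have x4 : x ^+ 4 = `|x| ^+ 4 by rewrite -[4%N]/(2 * 2)%N !exprM real_normK ?num_real.
rewrite exprVn ler_pdivlMl ?exprn_gt0// x4 [leRHS]exprSr ler_wpM2r//.
by rewrite lerXn2r// nnegrE ltW.
Qed.

Let mW t : 0 <= t -> measurable_fun setT (W t).
Proof. by move=> t0; apply: measurable_funD; [exact: mY|exact: mq]. Qed.

Let iD j : itg P (D j).
Proof.
apply: itgD; first exact: itg_cst.
apply: itgZ.
by apply: (@itg_sum _ _ _ _ _ _ (fun (i : 'I_(K * 2 ^ j)) w =>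
  (W (dy j i.+1) w - W (dy j i) w) ^+ 4)) => i; exact: (W4 (ltn_ord i)).1.
Qed.

Let ED j : Ex P (D j) <= (1 + K%:R * C4) * lam ^+ j.
Proof.
have iF (i : 'I_(K * 2 ^ j)) : itg P (fun w => (W (dy j i.+1) w - W (dy j i) w) ^+ 4).
  exact: (W4 (ltn_ord i)).1.
have l0 : 0 < lam ^+ j by exact: exprn_gt0.
rewrite ExD; [|exact: itg_cst|by apply: itgZ; exact: itg_sum].
rewrite Ex_cst ExZ; last exact: itg_sum.
rewrite Ex_sum// mulrDl mul1r lerD2l.
apply: (@le_trans _ _ (lam ^- j ^+ 3 * ((K * 2 ^ j)%:R * (C4 / 2 ^+ j / 2 ^+ j)))).
  apply: ler_wpM2l; first by rewrite exprn_ge0// invr_ge0 ltW.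
  rewrite -[X in _ <= X%:R * _](card_ord (K * 2 ^ j)) mulr_natl -sumr_const.
  by apply: ler_sum => i _; exact: (W4 (ltn_ord i)).2.
have p0 : 0 < 2 ^+ j :> R by rewrite exprn_gt0.
rewrite natrM natrX (_ : K%:R * 2 ^+ j * _ = K%:R * C4 / 2 ^+ j); last first.
  by field; rewrite (gt_eqF p0).
rewrite mulrCA.
apply: ler_wpM2l; first by rewrite mulr_ge0.
rewrite exprVn -invfM -exprM mulnC exprM -exprMn -exprVn.
apply: lerXn2r; rewrite ?nnegrE ?invr_ge0 ?mulr_ge0 ?exprn_ge0 ?(ltW lam0)//.
rewrite invf_ple ?posrE ?mulr_gt0 ?exprn_gt0//; rewrite /lam; lra.
Qed.

Let geo m n : \sum_(m <= j < n) lam ^+ j <= 10 * lam ^+ m.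
Proof.
have [mn|nm] := leqP m n; last first.
  by rewrite big_geq ?(ltnW nm)// mulr_ge0// exprn_ge0// ltW.
suff : \sum_(m <= j < n) lam ^+ j = 10 * (lam ^+ m - lam ^+ n).
  by move=> ->; rewrite ler_pM2l// gerBl exprn_ge0// ltW.
elim: n mn => [|n ih]; first by rewrite leqn0 => /eqP->; rewrite big_geq// subrr mulr0.
rewrite leq_eqVlt => /predU1P[->|]; first by rewrite big_geq// subrr mulr0.
rewrite ltnS => mn; rewrite big_nat_recr//= ih// exprS /lam; lra.
Qed.

Let O m n w := \sum_(m <= j < n) D j w.

Let iO m n : itg P (O m n).
Proof. by apply: (@itg_sum _ _ _ _ _ _ D). Qed.

Let EO m n : Ex P (O m n) <= 10 * (1 + K%:R * C4) * lam ^+ m.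
Proof.
rewrite /O (Ex_sum _ iD); apply: le_trans (ler_sum _ (fun j _ => ED j)) _.
rewrite -mulr_sumr [leRHS](_ : _ = (1 + K%:R * C4) * (10 * lam ^+ m)); last by ring.
by apply: ler_wpM2l => //; rewrite addr_ge0// mulr_ge0.
Qed.

Let S n w := A * (`|Y 0 w| + K.+1%:R * O 0 n w).

Let iS n : itg P (S n).
Proof. by apply: itgZ; apply: itgD; [exact: itg_norm|apply: itgZ; exact: iO]. Qed.

Let ES n : Ex P (S n) <= A * (C4 + K.+1%:R * (10 * (1 + K%:R * C4))).
Proof.
have iO0 := iO 0 n.
rewrite ExZ; last by apply: itgD; [exact: itg_norm|exact: itgZ].
rewrite ler_pM2l// ExD; [|exact: itg_norm|exact: itgZ].
rewrite lerD// ExZ// ler_pM2l ?ltr0n//.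
by apply: le_trans (EO 0 n) _; rewrite expr0 mulr1.
Qed.

Variables (m : nat) (L c eta ek : R) (Phi : @path_space R -> R).
Hypotheses (L0 : 0 < L) (c0 : 0 <= c) (eta0 : 0 < eta).
Hypothesis lPhi : lip_path K L Phi.
Hypothesis Phic : forall f, cpath f -> `|Phi f| <= c.
Hypothesis gm : 0 <= g / 2 ^+ m <= 1.
Let kap i w := k (dy m i.+1) w - k (dy m i) w - g / 2 ^+ m.
Hypothesis ikap : forall i, (i < K * 2 ^ m)%N -> itg P (kap i) /\
  Ex P (fun w => `|kap i w|) <= ek.

Let Z w : R -> R := poly m (K * 2 ^ m) (euler g (2 ^+ m)^-1 (fun j => W (dy m j) w)).

Let cZ w : cpath (Z w). Proof. exact: poly_cpath. Qed.

Let mZ t : measurable_fun setT (fun w => Z w t).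
Proof.
have me i : measurable_fun setT (fun w => euler g (2 ^+ m)^-1 (fun j => W (dy m j) w) i).
  elim: i => [|i ih] /=; first by apply: mW; exact: dy_ge0.
  apply: measurable_funD; first by apply: measurable_funM => //; exact: measurable_cst.
  by apply: measurable_funB; apply: mW; exact: dy_ge0.
rewrite /Z /poly; elim: (K * 2 ^ m).+1 => [|n ih].
  by under eq_fun do rewrite big_ord0; exact: measurable_cst.
under eq_fun do rewrite big_ord_recr/=.
by apply: measurable_funD => //; apply: measurable_funM => //; exact: measurable_cst.
Qed.

Let cvgPhi (f : R -> R) (h : nat -> R -> R) := lip_path_cvg (g := h) (ltW L0) lPhi (f := f).

Let mPhiY : measurable_fun setT (fun w => Phi (Y ^~ w)).
Proof. exact: (functional_measurable mY cY cvgPhi). Qed.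

Let mPhiZ : measurable_fun setT (fun w => Phi (Z w)).
Proof.
by apply: (@functional_measurable _ _ _ (fun t w => Z w t) Phi) => [t _|w|]; [exact: mZ|exact: cZ|exact: cvgPhi].
Qed.

(** If the rate errors [kap] add up to at most [eta], the pathwise estimate applies with [eta] in
    their place; otherwise the trivial bound 2 c is paid by the last term. The index n truncates the
    sums over levels, which may diverge at some outcomes. *)
Let H n w := L * ((1 + K%:R * C) * (O m n w + C * S n w / 2 ^+ m) + eta * S n w) +
  2 * c / eta * \sum_(i < K * 2 ^ m) `|kap i w|.

Let ndO p w : nondecreasing_seq (fun n => O p n w).
Proof.
apply/nondecreasing_seqP => n; rewrite /O.
have [pn|np] := leqP p n; last by rewrite !big_geq// ltnW.
by rewrite big_nat_recr//= lerDl.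
Qed.

Let O_ge0 p n w : 0 <= O p n w. Proof. by apply: sumr_ge0. Qed.

Let S_ge0 n w : 0 <= S n w.
Proof. by rewrite /S mulr_ge0 ?(ltW A0)// addr_ge0// mulr_ge0. Qed.

Let p0 : 0 < 2 ^+ m :> R. Proof. by rewrite exprn_gt0. Qed.

(** A uniform bound on [H n w] forces the level sums to converge at this outcome, which is what
    makes the pathwise approximation applicable with their limits. *)
Let H_bound w x : (forall n, H n w <= x) -> `|Phi (Y ^~ w) - Phi (Z w)| <= x.
Proof.
move=> Hx.
have cYw : cpath (Y ^~ w) by exact: cY.
have X2 : `|Phi (Y ^~ w) - Phi (Z w)| <= 2 * c.
  by rewrite (le_trans (ler_normB _ _))// mulr_natl mulr2n lerD ?Phic.
set k1 := \sum_(i < K * 2 ^ m) `|kap i w| in Hx *.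
have k10 : 0 <= k1 by apply: sumr_ge0.
have rest n : 0 <= (1 + K%:R * C) * (O m n w + C * S n w / 2 ^+ m).
  have := S_ge0 n w; have := O_ge0 m n w; have := ltW p0 => *; nneg.
have [ek1|/ltW ek1] := leP eta k1.
  apply: (le_trans X2); apply: le_trans (Hx 0%N); rewrite /H.
  apply: (@le_trans _ _ (2 * c / eta * k1)); last first.
    by rewrite lerDr mulr_ge0 ?(ltW L0)// addr_ge0// mulr_ge0// ltW.
  by rewrite mulrAC ler_pdivlMr// ler_wpM2l// mulr_ge0.
have Hx' n : L * ((1 + K%:R * C) * (O m n w + C * S n w / 2 ^+ m) + eta * S n w) <= x.
  by apply: le_trans (Hx n); rewrite /H lerDl mulr_ge0// divr_ge0 ?mulr_ge0// ltW.
have bO n : O 0 n w <= x / (L * eta * A).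
  rewrite ler_pdivlMr ?mulr_gt0//; apply: le_trans (Hx' n).
  rewrite [leLHS](_ : _ = L * (eta * (A * O 0 n w))); last by ring.
  rewrite ler_pM2l// (le_trans (_ : _ <= eta * S n w)) ?lerDr//.
  rewrite ler_pM2l// /S ler_pM2l// (le_trans (_ : _ <= K.+1%:R * O 0 n w)) ?lerDr//.
  by rewrite ler_peMl// ler1n.
have cvO p : (p <= m)%N -> cvgn (fun n => O p n w).
  move=> _; apply: nondecreasing_is_cvgn; first exact: ndO.
  exists (x / (L * eta * A)) => _ [n _ <-]; apply: le_trans (bO n).
  rewrite /O; have [pn|np] := leqP p n; last by rewrite big_geq ?(ltnW np)//; exact: O_ge0.
  by rewrite (big_cat_nat (n := p) (m := 0))//= lerDr; exact: O_ge0.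
set om := limn (fun n => O m n w); set o0 := limn (fun n => O 0 n w).
have c1 : (fun n => O m n w) @ \oo --> om by exact: cvO.
have c2 : (fun n => O 0 n w) @ \oo --> o0 by exact: cvO.
pose Sl := A * (`|Y 0 w| + K.+1%:R * o0).
have c3 : (fun n => S n w) @ \oo --> Sl.
  by apply: cvgM; [exact: cvg_cst|apply: cvgD; [exact: cvg_cst|apply: cvgM => //; exact: cvg_cst]].
have Ol p n : (p <= m)%N -> O p n w <= limn (fun n => O p n w).
  by move=> pm; apply: (nondecreasing_cvgn_le (ndO p w)); exact: cvO.
have lim_le : L * ((1 + K%:R * C) * (om + C * Sl / 2 ^+ m) + eta * Sl) <= x.
  have cH : (fun n => L * ((1 + K%:R * C) * (O m n w + C * S n w / 2 ^+ m) + eta * S n w)) @ \oo -->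
      L * ((1 + K%:R * C) * (om + C * Sl / 2 ^+ m) + eta * Sl).
    apply: cvgM; first exact: cvg_cst.
    apply: cvgD; last by apply: cvgM => //; exact: cvg_cst.
    apply: cvgM; first exact: cvg_cst.
    apply: cvgD => //; apply: cvgM; last exact: cvg_cst.
    by apply: cvgM => //; exact: cvg_cst.
  by apply: (ler_cvg_to cH (cvg_cst x)); apply: nearW => n; exact: Hx'.
have Sl0 : 0 <= Sl.
  by rewrite /Sl mulr_ge0 ?(ltW A0)// addr_ge0// mulr_ge0// (le_trans (O_ge0 0 0 w))// Ol.
have cWw : cpath (fun t => Y t w + q t w) by exact: cW.
have := @path_approximation R C g K m A (Y ^~ w) (q ^~ w) (k ^~ w) (D ^~ w) om o0 C0 (ltW A0) cYw cWw
  (dr w) gm (@hA w) (fun j i => @D_incr w j i) (D_ge0 ^~ w) (fun n => Ol m n (leqnn m)) (fun n => Ol 0%N n (leq0n m)).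
move=> /= cl; apply: le_trans lim_le.
have cZw : cpath (Z w) by exact: cZ.
have h := @lPhi _ _ cYw cZw _ cl.
apply: (le_trans h).
rewrite ler_pM2l// lerD2l mulrC ler_wpM2r//.
Qed.

Lemma euler_approximation :
  `|Ex P (fun w => Phi (Y ^~ w)) - Ex P (fun w => Phi (Z w))| <=
  L * ((1 + K%:R * C) * (10 * (1 + K%:R * C4) * lam ^+ m +
      C * (A * (C4 + K.+1%:R * (10 * (1 + K%:R * C4)))) / 2 ^+ m) +
    eta * (A * (C4 + K.+1%:R * (10 * (1 + K%:R * C4))))) + 2 * c / eta * ((K * 2 ^ m)%:R * ek).
Proof.
set S1 := A * _.
have cYw w : cpath (Y ^~ w) by exact: cY.
have iY : itg P (fun w => Phi (Y ^~ w)) by apply: (@itg_bounded _ _ _ _ _ c) => // w; exact: Phic.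
have iZ : itg P (fun w => Phi (Z w)) by apply: (@itg_bounded _ _ _ _ _ c) => // w; exact: Phic.
rewrite -ExB// (le_trans (Ex_norm (itgB iY iZ)))//.
have iK (i : 'I_(K * 2 ^ m)) : itg P (fun w => `|kap i w|).
  by apply: itg_norm; exact: (ikap (ltn_ord i)).1.
have iH1 n : itg P (fun w => (1 + K%:R * C) * (O m n w + C * S n w / 2 ^+ m)).
  apply: itgZ; apply: itgD => //; under eq_fun do rewrite mulrAC; exact: itgZ.
have iH2 n : itg P (fun w => (1 + K%:R * C) * (O m n w + C * S n w / 2 ^+ m) + eta * S n w).
  by apply: itgD => //; exact: itgZ.
have iH3 : itg P (fun w => \sum_(i < K * 2 ^ m) `|kap i w|).
  exact: (@itg_sum _ _ _ _ _ _ (fun (i : 'I_(K * 2 ^ m)) w => `|kap i w|)).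
have iH n : itg P (H n) by apply: itgD; exact: itgZ.
apply: (@Ex_mono_bound _ _ _ _ _ H _ (2 * c)) => //.
- by apply: measurableT_comp => //; exact: measurable_funB.
- move=> w; rewrite normr_ge0/= (le_trans (ler_normB _ _))// mulr_natl mulr2n lerD ?Phic//.
- move=> n w; have := S_ge0 n w; have := O_ge0 m n w; have := ltW p0; have := ltW L0; have := ltW eta0.
  have : 0 <= \sum_(i < K * 2 ^ m) `|kap i w| by apply: sumr_ge0.
  by rewrite /H => *; nneg.
- move=> w n n' nn'; rewrite /H lerD2r ler_pM2l//.
  have hS : S n w <= S n' w.
    by rewrite /S ler_pM2l// lerD2l ler_wpM2l//; exact: ndO.
  apply: lerD; last by rewrite ler_pM2l.
  rewrite ler_wpM2l ?addr_ge0 ?mulr_ge0// lerD//; first exact: ndO.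
  by rewrite ler_wpM2r ?invr_ge0 ?(ltW p0)// ler_wpM2l.
- move=> n; rewrite /H ExD; [|exact: itgZ|exact: itgZ].
  rewrite ExZ// ExZ// Ex_sum//; apply: lerD; last first.
    apply: ler_wpM2l; first by rewrite divr_ge0 ?mulr_ge0// ltW.
    rewrite -[X in _ <= X%:R * _](card_ord (K * 2 ^ m)) mulr_natl -sumr_const.
    by apply: ler_sum => i _; exact: (ikap (ltn_ord i)).2.
  rewrite ler_pM2l// ExD//; last exact: itgZ.
  rewrite ExZ; last by (apply: itgD => //; under eq_fun do rewrite mulrAC; exact: itgZ).
  rewrite ExZ// lerD//; last by rewrite ler_pM2l// ES.
  rewrite ler_wpM2l ?addr_ge0 ?mulr_ge0// ExD//; last by (under eq_fun do rewrite mulrAC; exact: itgZ).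
  rewrite lerD ?EO//; under eq_Ex do rewrite mulrAC.
  rewrite ExZ// [leRHS]mulrAC ler_wpM2l ?ES//.
  by rewrite divr_ge0// ltW.
Qed.

End euler_approximation.

(** * Comparison of two driven families *)

Section reduction.
Context {R : realType}.

(* The pathwise integral equation [Y t + q t = W t], where [q] and [k] are the
   integrals of [c Y] and of [c]; [k t] is asymptotically [g * t] and [W] is
   asymptotically a centered walk with variances [v t dt]. *)
Definition driven_family (disp : nat -> measure_display)
    (T : forall N, measurableType (disp N)) (P : forall N, probability (T N) R)
    (Y q k : forall N, R -> T N -> R) (C g : R) (v : R -> R) :=
  [/\ \forall N \near \oo,
        [/\ forall t, 0 <= t -> measurable_fun setT (Y N t),
            forall t, 0 <= t -> measurable_fun setT (q N t),
            continuous_paths (Y N) /\ continuous_paths (fun t w => Y N t w + q N t w)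
          & forall w, drift C (Y N ^~ w) (q N ^~ w) (k N ^~ w)],
      (\forall N \near \oo, itg (P N) (Y N 0)) /\
        (forall e, 0 < e -> \forall N \near \oo, Ex (P N) (fun w => `|Y N 0 w|) <= e),
      forall K : nat, exists2 C4, 0 <= C4 & \forall N \near \oo, forall j i,
        (i < K * 2 ^ j)%N ->
        let D w := Y N (dy j i.+1) w + q N (dy j i.+1) w -
                   (Y N (dy j i) w + q N (dy j i) w) in
        itg (P N) (fun w => D w ^+ 4) /\
        Ex (P N) (fun w => D w ^+ 4) <= C4 / 2 ^+ j / 2 ^+ j,
      forall m i e, 0 < e -> \forall N \near \oo,
        let kap w := k N (dy m i.+1) w - k N (dy m i) w - g / 2 ^+ m in
        itg (P N) kap /\ Ex (P N) (fun w => `|kap w|) <= e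
    & forall K : nat, exists2 C4, 0 <= C4 & forall n,
        exists U : forall N, nat -> T N -> R,
        [/\ asymp_walk P U (K * 2 ^ n) (Num.sqrt (2 ^- n)) C4 (fun i => v (dy n i) / 2 ^+ n),
            \forall N \near \oo, forall i, itg (P N) (U N i)
          & forall i e, (i <= K * 2 ^ n)%N -> 0 < e -> \forall N \near \oo,
            let D w := Y N (dy n i) w + q N (dy n i) w - U N i w in
            itg (P N) D /\ Ex (P N) (fun w => `|D w|) <= e]].

Definition euler_functional (g : R) (Phi : @path_space R -> R) (K m : nat)
    (u : nat -> R) : R :=
  Phi (poly m (K * 2 ^ m) (euler g (2 ^+ m)^-1 u)).

Lemma euler_functional_lip g Phi K m L : 0 <= L -> lip_path K L Phi ->
  0 <= g / 2 ^+ m <= 1 ->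
  lip (K * 2 ^ m).+1 (L * 2) (euler_functional g Phi K m).
Proof.
move=> L0 lPhi gm u v; rewrite /euler_functional -mulrA.
apply: lPhi; try exact: poly_cpath.
have p0 : 0 < 2 ^+ m :> R by rewrite exprn_gt0.
move=> t /andP[t0 tK].
rewrite /poly -sumrB; set B := _ * \sum_(_ < _) _.
have B0 : 0 <= B by rewrite mulr_ge0// sumr_ge0.
have s1 : \sum_(i < (K * 2 ^ m).+1) hat (2 ^+ m * t - i%:R) = 1.
  by apply: hat_sum; rewrite mulr_ge0 ?(ltW p0)//= natrM natrX mulrC ler_wpM2r// ltW.
rewrite (le_trans (ler_norm_sum _ _ _))// -[leRHS]mulr1 -[X in B * X]s1 mulr_sumr.
apply: ler_sum => i _; rewrite -mulrBl normrM (ger0_norm (hat_ge0 _)) ler_wpM2r ?hat_ge0//.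
rewrite (le_trans (@euler_lip R g (2 ^+ m)^-1 u v i gm))// /B ler_pM2l//.
rewrite -(big_mkord xpredT (fun j => `|u j - v j|)) -(big_mkord xpredT (fun j => `|u j - v j|)).
by rewrite (big_cat_nat (n := i.+1) (p := (K * 2 ^ m).+1))//= lerDl sumr_ge0.
Qed.

(** Order of choices: [eta] from [e], then the grid level [m], then the tolerance [ek] for the rate,
    which may depend on the number of grid cells, and finally [N]. *)
Lemma driven_euler (disp : nat -> measure_display)
    (T : forall N, measurableType (disp N)) (P : forall N, probability (T N) R)
    (Y q k : forall N, R -> T N -> R) (C g : R) (v : R -> R) K L c Phi e :
  0 <= C -> 0 <= g -> driven_family P Y q k C g v -> 0 < L -> 0 <= c -> 0 < e ->
  lip_path K L Phi -> (forall f, cpath f -> `|Phi f| <= c) ->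
  \forall m \near \oo, \forall N \near \oo,
    `|Ex (P N) (fun w => Phi (Y N ^~ w)) - Ex (P N) (fun w =>
       euler_functional g Phi K m (fun j => Y N (dy m j) w + q N (dy m j) w))| <= e.
Proof.
move=> C0 g0 [reg [iY0 EY0] W4 kap _] L0 c0 e0 lPhi Phic.
have [C4 C40 {}W4] := W4 K.
have [A A0 hA] := gronwall K C0.
(* Enlarged by 1 so that [A'] is positive and [C5] also bounds the initial mean. *)
pose C5 := C4 + 1; pose A' := A + 1.
pose c1 := L * (1 + K%:R * C) * (10 * (1 + K%:R * C5)).
pose S1 := A' * (C5 + K.+1%:R * (10 * (1 + K%:R * C5))).
pose c2 := L * (1 + K%:R * C) * (C * S1).
have A'0 : 0 < A' by rewrite /A' ltr_wpDl.
have C50 : 0 <= C5 by rewrite /C5 addr_ge0.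
have S10 : 0 <= S1 by rewrite /S1 mulr_ge0 ?(ltW A'0)// addr_ge0// !mulr_ge0// addr_ge0// mulr_ge0.
have e4 : 0 < e / 4 by rewrite divr_gt0.
pose eta := e / 4 / (L * S1 + 1).
have LS : 0 < L * S1 + 1 by rewrite ltr_wpDl// mulr_ge0// ltW.
have eta0 : 0 < eta by rewrite divr_gt0.
have lim1 : (fun m => c1 * (9 / 10 : R) ^+ m) @ \oo --> (0 : R).
  rewrite -[X in _ --> X](mulr0 c1); apply: cvgM; first exact: cvg_cst.
  by apply: cvg_expr; rewrite ger0_norm; lra.
have lim2 (x : R) : (fun m => x * (2^-1 : R) ^+ m) @ \oo --> (0 : R).
  rewrite -[X in _ --> X](mulr0 x); apply: cvgM; first exact: cvg_cst.
  by apply: cvg_expr; rewrite ger0_norm; lra.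
near=> m.
have m1 : `|c1 * (9 / 10 : R) ^+ m| <= e / 4.
  by near: m; have /cvgr0Pnorm_le/(_ _ e4) := lim1.
have m2 : `|c2 * (2^-1 : R) ^+ m| <= e / 4.
  by near: m; have /cvgr0Pnorm_le/(_ _ e4) := lim2 c2.
have m3 : `|g * (2^-1 : R) ^+ m| <= 1.
  by near: m; have /cvgr0Pnorm_le/(_ _ ltr01) := lim2 g.
have gm : 0 <= g / 2 ^+ m <= 1.
  have p0 : 0 < 2 ^+ m :> R by rewrite exprn_gt0.
  rewrite divr_ge0 ?(ltW p0)//=; move: m3; rewrite exprVn ger0_norm// mulr_ge0// invr_ge0 ltW//.
pose n := (K * 2 ^ m)%N.
pose ek := e / 4 / (2 * c / eta * n%:R + 1).
have X0 : 0 <= 2 * c / eta * n%:R.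
  apply: mulr_ge0; last exact: ler0n.
  by apply: divr_ge0; [exact: mulr_ge0|exact: ltW].
have ek0 : 0 < ek by rewrite divr_gt0// ltr_wpDl.
have kapN : \forall N \near \oo, forall i : 'I_n,
    let kap w := k N (dy m i.+1) w - k N (dy m i) w - g / 2 ^+ m in
    itg (P N) kap /\ Ex (P N) (fun w => `|kap w|) <= ek.
  by apply: filter_forall => i; exact: kap.
near=> N.
have [mY mq [cY cW] dr] : [/\ forall t, 0 <= t -> measurable_fun setT (Y N t),
            forall t, 0 <= t -> measurable_fun setT (q N t),
            continuous_paths (Y N) /\ continuous_paths (fun t w => Y N t w + q N t w)
          & forall w, drift C (Y N ^~ w) (q N ^~ w) (k N ^~ w)] by near: N.
have iY : itg (P N) (Y N 0) by near: N.
have EY : Ex (P N) (fun w => `|Y N 0 w|) <= C5.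
  apply: (@le_trans _ _ 1); last by rewrite /C5 lerDr.
  by near: N; exact: EY0.
have kN : forall i : 'I_n, let kap w := k N (dy m i.+1) w - k N (dy m i) w - g / 2 ^+ m in
    itg (P N) kap /\ Ex (P N) (fun w => `|kap w|) <= ek by near: N.
have W4N : forall j i, (i < K * 2 ^ j)%N ->
        let D w := Y N (dy j i.+1) w + q N (dy j i.+1) w -
                   (Y N (dy j i) w + q N (dy j i) w) in
        itg (P N) (fun w => D w ^+ 4) /\
        Ex (P N) (fun w => D w ^+ 4) <= C4 / 2 ^+ j / 2 ^+ j by near: N.
have h1 : forall j i, (i < K * 2 ^ j)%N ->
  itg (P N) (fun w => (Y N (dy j i.+1) w + q N (dy j i.+1) w - (Y N (dy j i) w + q N (dy j i) w)) ^+ 4) /\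
  Ex (P N) (fun w => (Y N (dy j i.+1) w + q N (dy j i.+1) w - (Y N (dy j i) w + q N (dy j i) w)) ^+ 4)
    <= C5 / 2 ^+ j / 2 ^+ j.
  move=> j i ij; have [a b] := W4N j i ij; split=> //; apply: (le_trans b).
  by rewrite !ler_pM2r ?invr_gt0 ?exprn_gt0// /C5 lerDl.
have h2 w M : (forall t, 0 <= t <= K%:R -> `|Y N t w + q N t w| <= M) ->
    forall t, 0 <= t <= K%:R -> `|Y N t w| <= A' * M.
  have cYw : cpath (Y N ^~ w) by exact: cY.
  move=> HM t tK; rewrite (le_trans (hA _ _ _ M cYw (dr w) HM t tK))// ler_wpM2r ?lerDl//.
  by rewrite (le_trans _ (HM 0 _))// lexx/=.
have E := (@euler_approximation R _ _ (P N) (Y N) (q N) (k N) C g C5 A' K C0 C50 A'0 mY mq cY cW dr iY EY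
  h1 h2 m L c eta ek Phi L0 c0 eta0 lPhi Phic gm (fun i ik => kN (Ordinal ik))).
apply: (le_trans E); rewrite -/S1 -/n.
have e3 : L * (eta * S1) <= e / 4.
  rewrite /eta [leLHS](_ : _ = (e / 4) * (L * S1 / (L * S1 + 1))); last by ring.
  by rewrite ler_piMr ?(ltW e4)// ler_pdivrMr// mul1r lerDl.
have e5 : 2 * c / eta * (n%:R * ek) <= e / 4.
  rewrite mulrA /ek mulrCA ler_piMr ?(ltW e4)// ler_pdivrMr ?ltr_wpDl// mul1r lerDl//.
rewrite [X in X + _ <= _](_ : _ = c1 * (9 / 10) ^+ m + c2 * 2^-1 ^+ m + L * (eta * S1)); last first.
  by rewrite /c1 /c2 exprVn; ring.
have := ler_norm (c1 * (9 / 10) ^+ m); have := ler_norm (c2 * 2^-1 ^+ m); lra.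
Unshelve. all: by end_near. Qed.

Lemma asymp_walk_le (disp : nat -> measure_display)
    (T : forall N, measurableType (disp N)) (P : forall N, probability (T N) R)
    (U : forall N, nat -> T N -> R) m s K K' v : 0 <= s -> K <= K' ->
  asymp_walk P U m s K v -> asymp_walk P U m s K' v.
Proof.
move=> s0 KK' [h1 h2 h3 h4]; split => //.
- apply: filterS h2 => N h i im; have [a b] := h i im; split=> //; apply: (le_trans b).
  by rewrite ler_wpM2r// exprn_ge0.
- move=> i F L im L0 lF F1 e e0; have := h3 i F L im L0 lF F1 e e0.
  by apply: filterS => N h; rewrite (le_trans h)// lerD2r ler_wpM2r// exprn_ge0.
- move=> i F L im L0 lF F1 e e0; have := h4 i F L im L0 lF F1 e e0.
  by apply: filterS => N h; rewrite (le_trans h)// lerD2r ler_wpM2r// exprn_ge0.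
Qed.

(** Each side is carried to the Euler functional at level [m], then to the walk on a finer grid of
    level [n], then to the number [r] common to both. Two Euler errors e/6 and two walk errors e/3
    add up to e. *)
Lemma driven_invariance
    (disp1 : nat -> measure_display) (T1 : forall N, measurableType (disp1 N))
    (P1 : forall N, probability (T1 N) R) (Y1 q1 k1 : forall N, R -> T1 N -> R)
    (disp2 : nat -> measure_display) (T2 : forall N, measurableType (disp2 N))
    (P2 : forall N, probability (T2 N) R) (Y2 q2 k2 : forall N, R -> T2 N -> R)
    (C g Cv : R) (v : R -> R) K L c Phi e :
  0 <= C -> 0 <= g -> (forall t, 0 <= t -> 0 <= v t <= Cv) ->
  driven_family P1 Y1 q1 k1 C g v -> driven_family P2 Y2 q2 k2 C g v ->
  0 < L -> 0 <= c -> 0 < e ->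
  lip_path K L Phi -> (forall f, cpath f -> `|Phi f| <= c) ->
  \forall N \near \oo,
    `|Ex (P1 N) (fun w => Phi (Y1 N ^~ w)) - Ex (P2 N) (fun w => Phi (Y2 N ^~ w))| <= e.
Proof.
move=> C0 g0 vC f1 f2 L0 c0 e0 lPhi Phic.
have e4 : 0 < e / 6 by rewrite divr_gt0.
have near1 := driven_euler C0 g0 f1 L0 c0 e4 lPhi Phic.
have near2 := driven_euler C0 g0 f2 L0 c0 e4 lPhi Phic.
have near3 : \forall m \near \oo, 0 <= g / 2 ^+ m <= 1.
  near=> m; have p0 : 0 < 2 ^+ m :> R by rewrite exprn_gt0.
  rewrite divr_ge0 ?(ltW p0)//= ler_pdivrMr// mul1r (@le_trans _ _ m%:R)//.
    by near: m; exact: nbhs_infty_ger.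
  by rewrite -natrX ler_nat ltnW// ltn_expl.
have [m [hm1 hm2 gm]] : exists m, [/\
    \forall N \near \oo, `|Ex (P1 N) (fun w => Phi (Y1 N ^~ w)) - Ex (P1 N) (fun w =>
       euler_functional g Phi K m (fun j => Y1 N (dy m j) w + q1 N (dy m j) w))| <= e / 6,
    \forall N \near \oo, `|Ex (P2 N) (fun w => Phi (Y2 N ^~ w)) - Ex (P2 N) (fun w =>
       euler_functional g Phi K m (fun j => Y2 N (dy m j) w + q2 N (dy m j) w))| <= e / 6
    & 0 <= g / 2 ^+ m <= 1].
  near \oo => m; exists m; split; near: m; [exact: near1|exact: near2|exact: near3].
have [_ [iY1 EY1] _ _ /(_ K)[K1 K10 w1]] := f1.
have [_ [iY2 EY2] _ _ /(_ K)[K2 K20 w2]] := f2.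
pose K3 := K1 + K2 + Cv.
have Cv0 : 0 <= Cv by have /andP[a b] := vC 0 (lexx 0); exact: le_trans b.
have K30 : 0 <= K3 by rewrite !addr_ge0.
have L2 : 0 <= L * 2 by rewrite mulr_ge0// ltW.
have [s1 s10 ws] := @walk_target R K3 (L * 2) c (K * 2 ^ m) (e / 6) K30 L2 c0 e4.
have : (fun n => (2^-1 : R) ^+ n) @ \oo --> (0 : R) by apply: cvg_expr; rewrite ger0_norm; lra.
move=> /cvgr0Pnorm_le/(_ (s1 ^+ 2)); rewrite exprn_gt0// => /(_ isT) near4.
have [n [mn sn]] : exists n, (m <= n)%N /\ (2^-1 : R) ^+ n <= s1 ^+ 2.
  near \oo => n; exists n; split; near: n; first exact: nbhs_infty_ge.
  by apply: filterS near4 => n; apply: le_trans; exact: ler_norm.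
(* Mesh s^2 = 2^-n; each cell of level [m] contains q = 2^(n - m) fine steps, so q s^2 = 2^-m <=
   1. *)
pose s : R := Num.sqrt (2 ^- n).
have p0 (i : nat) : 0 < 2 ^+ i :> R by rewrite exprn_gt0.
have s2 : s ^+ 2 = 2 ^- n by rewrite sqr_sqrtr// invr_ge0 ltW.
have s0 : 0 < s by rewrite sqrtr_gt0 invr_gt0.
have ss1 : 0 < s <= s1.
  by rewrite s0/= -(@ler_pXn2r _ 2%N) ?nnegrE ?(ltW s0) ?(ltW s10)// s2 -exprVn.
pose q := (2 ^ (n - m))%N.
have qs : q%:R * s ^+ 2 <= 1.
  rewrite s2 ler_pdivrMr// mul1r /q natrX -natrX -natrX ler_nat leq_exp2l//.
  by rewrite leq_subr.
have vK i : 0 <= v (dy n i) / 2 ^+ n <= K3 * s ^+ 2.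
  have /andP[a b] := vC _ (dy_ge0 n i : 0 <= (dy n i : R)).
  rewrite divr_ge0 ?(ltW (p0 n))//= s2 ler_pM2r ?invr_gt0//.
  by rewrite (le_trans b)// /K3 lerDr addr_ge0.
have qm : (K * 2 ^ m * q <= K * 2 ^ n)%N by rewrite /q -mulnA -expnD subnKC.
have [|r hr] := ws s q (fun i => v (dy n i) / 2 ^+ n) (K * 2 ^ n)%N ss1 qs vK qm
  (euler_functional g Phi K m) (euler_functional_lip (ltW L0) lPhi gm).
  by move=> u; apply: Phic; exact: poly_cpath.
have dyq j : dy n (j * q) = dy m j :> R.
  rewrite /dy /q natrM natrX -{2}(subnKC mn) exprD invfM mulrACA mulfV ?mulr1//.
(* [U] only approximates the grid values of Y + q in mean, and the Euler functional is Lipschitz in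
   these values. *)
have side (disp : nat -> measure_display) (T : forall N, measurableType (disp N))
    (P : forall N, probability (T N) R) (Y q' k : forall N, R -> T N -> R) Kc
    (U : forall N, nat -> T N -> R) :
    Kc <= K3 -> driven_family P Y q' k C g v ->
    [/\ asymp_walk P U (K * 2 ^ n) s Kc (fun i => v (dy n i) / 2 ^+ n),
        \forall N \near \oo, forall i, itg (P N) (U N i)
      & forall i e, (i <= K * 2 ^ n)%N -> 0 < e -> \forall N \near \oo,
        let D w := Y N (dy n i) w + q' N (dy n i) w - U N i w in
        itg (P N) D /\ Ex (P N) (fun w => `|D w|) <= e] ->
    \forall N \near \oo, `|Ex (P N) (fun w =>
       euler_functional g Phi K m (fun j => Y N (dy m j) w + q' N (dy m j) w)) - r| <= e / 6 + e / 6.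
  move=> Kc3 [reg [iY EY] _ _ _] [w0 iU WU].
  have z0 : dy n 0 = 0 :> R by rewrite /dy mul0r.
  have W0 : \forall N \near \oo, forall w, Y N (dy n 0) w + q' N (dy n 0) w = Y N 0 w.
    by apply: filterS reg => N [_ _ _ dr] w; have [h _ _] := dr w; rewrite z0 h addr0.
  have iU0 : \forall N \near \oo, itg (P N) (U N 0%N) by apply: filterS iU => N; exact.
  have EU0 e' : 0 < e' -> \forall N \near \oo, Ex (P N) (fun w => `|U N 0%N w|) <= e'.
    move=> e'0; have e2 : 0 < e' / 2 by rewrite divr_gt0.
    near=> N.
    have h1 : Ex (P N) (fun w => `|Y N 0 w|) <= e' / 2 by near: N; exact: EY.
    have h2 : forall w, Y N (dy n 0) w + q' N (dy n 0) w = Y N 0 w by near: N.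
    have h3 : itg (P N) (Y N 0) by near: N.
    have [h4 h5] : itg (P N) (fun w => Y N (dy n 0) w + q' N (dy n 0) w - U N 0%N w) /\
        Ex (P N) (fun w => `|Y N (dy n 0) w + q' N (dy n 0) w - U N 0%N w|) <= e' / 2.
      by near: N; exact: WU.
    have h6 : itg (P N) (U N 0%N) by near: N.
    apply: (@le_trans _ _ (Ex (P N) (fun w => `|Y N 0 w| + `|Y N (dy n 0) w + q' N (dy n 0) w - U N 0%N w|))).
      apply: Ex_le; [exact: itg_norm|by apply: itgD; exact: itg_norm|move=> w].
      rewrite h2; have := ler_normB (Y N 0 w) (Y N 0 w - U N 0%N w).
      by rewrite (_ : Y N 0 w - (Y N 0 w - U N 0%N w) = U N 0%N w); last by ring.
    rewrite ExD; [|exact: itg_norm|exact: itg_norm]; lra.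
  have hU := hr _ _ _ _ (asymp_walk_le (ltW s0) Kc3 w0) iU0 EU0.
  pose k' := (K * 2 ^ m).+1.
  pose e' := e / 6 / (L * 2 * k'%:R + 1).
  have Lk : 0 < L * 2 * k'%:R + 1 by rewrite ltr_wpDl// mulr_ge0.
  have e'0 : 0 < e' by rewrite divr_gt0.
  have WUs : \forall N \near \oo, forall j : 'I_k',
      let D w := Y N (dy n (j * q)) w + q' N (dy n (j * q)) w - U N (j * q)%N w in
      itg (P N) D /\ Ex (P N) (fun w => `|D w|) <= e'.
    apply: filter_forall => j; apply: WU => //; apply: leq_trans qm; rewrite leq_mul2r.
    by rewrite -ltnS ltn_ord orbT.
  near=> N.
  have h1 : `|Ex (P N) (fun w => euler_functional g Phi K m (fun j => U N (j * q)%N w)) - r| <= e / 6.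
    by near: N.
  have h2 : forall j : 'I_k',
      let D w := Y N (dy n (j * q)) w + q' N (dy n (j * q)) w - U N (j * q)%N w in
      itg (P N) D /\ Ex (P N) (fun w => `|D w|) <= e' by near: N.
  have [mY mq _ _] : [/\ forall t, 0 <= t -> measurable_fun setT (Y N t),
            forall t, 0 <= t -> measurable_fun setT (q' N t),
            continuous_paths (Y N) /\ continuous_paths (fun t w => Y N t w + q' N t w)
          & forall w, drift C (Y N ^~ w) (q' N ^~ w) (k N ^~ w)] by near: N.
  have h3 : forall i, itg (P N) (U N i) by near: N.
  have lF := euler_functional_lip (ltW L0) lPhi gm.
  have Fc u : `|euler_functional g Phi K m u| <= c by apply: Phic; exact: poly_cpath.
  have i1 : itg (P N) (fun w => euler_functional g Phi K m (fun j => Y N (dy m j) w + q' N (dy m j) w)).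
    apply: (@itg_bounded _ _ _ _ _ c) => //.
    apply: (lip_measurable (U := fun j w => Y N (dy m j) w + q' N (dy m j) w) L2 lF) => i.
    by apply: measurable_funD; [exact: mY (dy_ge0 _ _)|exact: mq (dy_ge0 _ _)].
  have i2 : itg (P N) (fun w => euler_functional g Phi K m (fun j => U N (j * q)%N w)).
    apply: (@itg_bounded _ _ _ _ _ c) => //.
    by apply: (lip_measurable (U := fun j w => U N (j * q)%N w) L2 lF) => i; exact: itg_mfun.
  have iD (j : 'I_k') : itg (P N) (fun w => `|Y N (dy n (j * q)) w + q' N (dy n (j * q)) w - U N (j * q)%N w|).
    by apply: itg_norm; exact: (h2 j).1.
  have h4 : `|Ex (P N) (fun w => euler_functional g Phi K m (fun j => Y N (dy m j) w + q' N (dy m j) w)) -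
      Ex (P N) (fun w => euler_functional g Phi K m (fun j => U N (j * q)%N w))| <= e / 6.
    rewrite -ExB//; apply: (@le_trans _ _ (Ex (P N) (fun w => L * 2 * \sum_(j < k')
        `|Y N (dy n (j * q)) w + q' N (dy n (j * q)) w - U N (j * q)%N w|))).
      apply: Ex_norm_le; [exact: itgB|by apply: itgZ; exact: itg_sum|move=> w].
      apply: le_trans (lF _ _) _; rewrite ler_wpM2l//; apply: ler_sum => j _.
      by rewrite dyq.
    rewrite ExZ; last exact: itg_sum.
    rewrite Ex_sum//; apply: (@le_trans _ _ (L * 2 * (k'%:R * e'))).
      rewrite ler_wpM2l// mulr_natl -[X in _ *+ X](card_ord k') -sumr_const.
      by apply: ler_sum => j _; exact: (h2 j).2.
    rewrite mulrA /e' mulrCA ler_piMr ?(ltW e4)// ler_pdivrMr// mul1r lerDl//.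
  move: h1 h4; rewrite !ler_norml; lra.
have k1K : K1 <= K3 by rewrite /K3; lra.
have k2K : K2 <= K3 by rewrite /K3; lra.
have [U1 hU1] := w1 n; have [U2 hU2] := w2 n.
have n1 := side _ _ _ _ _ _ K1 U1 k1K f1 hU1.
have n2 := side _ _ _ _ _ _ K2 U2 k2K f2 hU2.
near=> N.
have a1 : `|Ex (P1 N) (fun w => Phi (Y1 N ^~ w)) - Ex (P1 N) (fun w =>
       euler_functional g Phi K m (fun j => Y1 N (dy m j) w + q1 N (dy m j) w))| <= e / 6 by near: N.
have a2 : `|Ex (P2 N) (fun w => Phi (Y2 N ^~ w)) - Ex (P2 N) (fun w =>
       euler_functional g Phi K m (fun j => Y2 N (dy m j) w + q2 N (dy m j) w))| <= e / 6 by near: N.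
have a3 : `|Ex (P1 N) (fun w =>
       euler_functional g Phi K m (fun j => Y1 N (dy m j) w + q1 N (dy m j) w)) - r| <= e / 6 + e / 6.
  by near: N; exact: n1.
have a4 : `|Ex (P2 N) (fun w =>
       euler_functional g Phi K m (fun j => Y2 N (dy m j) w + q2 N (dy m j) w)) - r| <= e / 6 + e / 6.
  by near: N; exact: n2.
move: a1 a2 a3 a4; rewrite !ler_norml; lra.
Unshelve. all: by end_near. Qed.

Lemma driven_cvg_weakly
    (disp : nat -> measure_display) (T : forall N, measurableType (disp N))
    (P : forall N, probability (T N) R) (Y q k : forall N, R -> T N -> R)
    (displ : measure_display) (Tl : measurableType displ)
    (Pl : probability Tl R) (Yl ql kl : R -> Tl -> R) (C g Cv : R) (v : R -> R) :
  0 <= C -> 0 <= g -> (forall t, 0 <= t -> 0 <= v t <= Cv) ->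
  driven_family P Y q k C g v ->
  driven_family (fun _ : nat => Pl) (fun=> Yl) (fun=> ql) (fun=> kl) C g v ->
  cvg_weakly P Y Pl Yl.
Proof.
move=> C0 g0 vC f1 f2; have [reg1 _ _ _ _] := f1; have [reg2 _ _ _ _] := f2.
have [_ [N _ /(_ N (leqnn N))[mYl _ [cYl _] _]]] := (reg2, reg2).
apply: cvg_weakly_lipschitz => //.
  by apply: filterS reg1 => N' [mY _ [cY _] _].
move=> K L c Phi L0 lPhi Phic; apply/cvgrPdist_le => e e0.
have c0 : 0 <= c by rewrite (le_trans _ (Phic (cst 0) _))//; apply: continuous_subspaceT; exact: cst_continuous.
have L1 : 0 < L + 1 by rewrite ltr_wpDl.
have lPhi' : lip_path K (L + 1) Phi.
  move=> f h cf ch d fd; rewrite (le_trans (lPhi _ _ cf ch _ fd))// ler_wpM2r ?lerDl//.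
  by rewrite (le_trans _ (fd 0 _))// lexx/=.
have := driven_invariance C0 g0 vC f1 f2 L1 c0 e0 lPhi' Phic.
by apply: filterS => n; rewrite distrC.
Qed.

End reduction.

(** * The deviation matrix and the limit coefficients *)

Section generator_algebra.
Context {R : realType} {d : nat}.
Variables (Q : 'M[R]_d) (p : 'cV[R]_d).
Hypotheses (genQ : is_generator Q) (inv_p : invariant_distribution Q p)
  (uniq_p : forall p', invariant_distribution Q p' -> p' = p).

Definition pavg (f : 'I_d -> R) : R := \sum_i p i 0 * f i.

Lemma pavg_cst c : pavg (fun=> c) = c.
Proof. by rewrite /pavg -mulr_suml; have [_ _ ->] := inv_p; rewrite mul1r. Qed.

Lemma pavg_le f g : (forall i, f i <= g i) -> pavg f <= pavg g.
Proof. by move=> fg; apply: ler_sum => i _; rewrite ler_wpM2l//; have [] := inv_p. Qed.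

Lemma pavg_norm f c : (forall i, `|f i| <= c) -> `|pavg f| <= c.
Proof.
move=> fc; rewrite ler_norml -{1}[c]pavg_cst -[X in _ && (_ <= X)]pavg_cst.
rewrite /pavg -sumrN; apply/andP; split; last by apply: pavg_le => i; rewrite (le_trans (ler_norm _)).
apply: ler_sum => i _; rewrite -mulrN ler_wpM2l//; first by have [] := inv_p.
by have := fc i; rewrite ler_norml => /andP[].
Qed.

Lemma dotv_pavg v : dotv p v = pavg (fun i => v i 0).
Proof. by rewrite /dotv mxE; apply: eq_bigr => i _; rewrite mxE. Qed.

Lemma pavg_Q f : pavg (fun i => \sum_j Q i j * f j) = 0.
Proof.
rewrite /pavg; under eq_bigr do rewrite mulr_sumr.
rewrite exchange_big/= big1// => j _; under eq_bigr do rewrite mulrA.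
rewrite -mulr_suml; have [_ /matrixP/(_ 0 j) + _] := inv_p.
rewrite mxE [RHS]mxE => h; rewrite [X in X * _](_ : _ = 0) ?mul0r//.
by rewrite -[RHS]h; apply: eq_bigr => i _; rewrite mxE.
Qed.

(* If [v^T Q = 0] then [|v|^T Q >= 0] off the zero row sums, so [|v|] and the
   positive part of [v] are invariant too. *)
Lemma left_kernel_generator (v : 'rV[R]_d) : v *m Q = 0 -> exists c, v = c *: p^T.
Proof.
have [Q0 Q1] := genQ.
have nonneg_case (u : 'rV[R]_d) : (forall i, 0 <= u 0 i) -> u *m Q = 0 -> exists c, u = c *: p^T.
  move=> u0 uQ; pose c := \sum_i u 0 i.
  have [c0|cn0] := eqVneq c 0.
    exists 0; apply/rowP => i; rewrite !mxE mul0r.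
    by have /(_ i isT) := psumr_eq0P (fun i _ => u0 i) c0.
  exists c; have cp : 0 < c by rewrite lt0r cn0 sumr_ge0.
  rewrite -(uniq_p (p' := c^-1 *: u^T)).
    by rewrite linearZ/= trmxK scalerA mulfV// scale1r.
  split.
  - by move=> i; rewrite !mxE mulr_ge0// invr_ge0 ltW.
  - by rewrite linearZ/= trmxK -scalemxAl uQ scaler0.
  - by under eq_bigr do rewrite !mxE; rewrite -mulr_sumr mulVf.
move=> vQ; pose u : 'rV[R]_d := \row_i `|v 0 i|.
have uQ0 j : 0 <= (u *m Q) 0 j.
  have : (v *m Q) 0 j = 0 by rewrite vQ mxE.
  rewrite !mxE (bigD1 j)//= => /eqP; rewrite addr_eq0 => /eqP vj.
  rewrite (bigD1 j)//= !mxE.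
  have Qjj : Q j j <= 0.
    have := Q1 j; rewrite (bigD1 j)//= => /eqP; rewrite addr_eq0 => /eqP->.
    by rewrite oppr_le0 sumr_ge0// => i ij; apply: Q0; rewrite eq_sym.
  have -> : `|v 0 j| * Q j j = - `|v 0 j * Q j j| by rewrite normrM (ler0_norm Qjj) mulrN opprK.
  rewrite vj normrN addrC subr_ge0 (le_trans (ler_norm_sum _ _ _))//.
  apply: ler_sum => i ij; rewrite mxE normrM [X in _ * X]ger0_norm//; exact: Q0.
have uQ : u *m Q = 0.
  apply/rowP => j; rewrite [RHS]mxE.
  have s0 : \sum_j (u *m Q) 0 j = 0.
    under eq_bigr do rewrite mxE.
    by rewrite exchange_big/= big1// => i _; rewrite -mulr_sumr Q1 mulr0.
  by have /(_ j isT) := psumr_eq0P (fun i _ => uQ0 i) s0.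
have [c uc] : exists c, u = c *: p^T by apply: nonneg_case => // i; rewrite mxE.
have [c' vc] : exists c, u + v = c *: p^T.
  apply: nonneg_case; last by rewrite mulmxDl uQ vQ addr0.
  by move=> i; rewrite !mxE -lerBlDr sub0r -normrN ler_norm.
exists (c' - c); rewrite scalerBl -vc -uc addrAC subrr add0r//.
Qed.

Let A : 'M[R]_d := ones *m p^T - Q.

Let pT1 : p^T *m ones = 1.
Proof.
apply/matrixP => i j; rewrite !ord1 !mxE.
by have [_ _ <-] := inv_p; apply: eq_bigr => k _; rewrite !mxE mulr1.
Qed.

Let Q1 : Q *m ones = 0 :> 'cV[R]_d.
Proof.
apply/colP => i; rewrite !mxE -[RHS](genQ.2 i).
by apply: eq_bigr => k _; rewrite !mxE mulr1.
Qed.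

Let pQ : p^T *m Q = 0. Proof. by have [] := inv_p. Qed.

Let A1 : A *m ones = ones.
Proof. by rewrite /A mulmxBl -mulmxA pT1 mulmx1 Q1 subr0. Qed.

Let pA : p^T *m A = p^T.
Proof. by rewrite /A mulmxBr mulmxA pT1 mul1mx pQ subr0. Qed.

(** If v A = 0, then v 1 = v A 1 = 0, so v Q = 0, so v is a multiple of the invariant law, and v 1 =
    0 makes the multiple zero. *)
Let uA : A \in unitmx.
Proof.
rewrite -row_free_unit; apply/inj_row_free => v vA.
have v1 : v *m ones = 0 by rewrite -A1 mulmxA vA mul0mx.
have vQ : v *m Q = 0.
  by move: vA; rewrite /A mulmxBr mulmxA v1 mul0mx sub0r => /eqP; rewrite oppr_eq0 => /eqP.
have [c vc] := left_kernel_generator vQ.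
move: v1; rewrite vc -scalemxAl pT1 => /matrixP/(_ 0 0); rewrite !mxE mulr1 => ->.
by rewrite scale0r.
Qed.

Let D := deviation_matrix Q p.

Let D1 : D *m ones = 0 :> 'cV[R]_d.
Proof.
rewrite /D /deviation_matrix mulmxBl -mulmxA pT1 mulmx1 -/A.
by rewrite -{1}A1 mulKmx// subrr.
Qed.

Let pD : p^T *m D = 0.
Proof.
rewrite /D /deviation_matrix mulmxBr mulmxA pT1 mul1mx -/A.
by rewrite -{1}pA mulmxK// subrr.
Qed.

Let QD : Q *m D = ones *m p^T - 1%:M.
Proof.
have : A *m invmx A = 1%:M by rewrite mulmxV.
rewrite {1}/A mulmxBl -(mulmxA _ p^T) (_ : p^T *m invmx A = p^T); last by rewrite -{1}pA mulmxK.
move=> h; rewrite /D /deviation_matrix -/A mulmxBr mulmxA Q1 mul0mx subr0 -h opprB.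
by rewrite addrC subrK.
Qed.

(** The vector D g: the solution of Q u = pi g - g with pi u = 0. *)
Definition poisson (g : 'I_d -> R) (i : 'I_d) : R := \sum_j D i j * g j.

Let DgE g i : (D *m \col_j g j) i 0 = poisson g i.
Proof. by rewrite mxE; apply: eq_bigr => j _; rewrite mxE. Qed.

Lemma poissonE g i : \sum_j Q i j * poisson g j = pavg g - g i.
Proof.
have /colP/(_ i) : Q *m D *m (\col_j g j) = (ones *m p^T - 1%:M) *m (\col_j g j) by rewrite QD.
rewrite mulmxBl mul1mx -!mulmxA [RHS]mxE [X in _ = _ + X]mxE mxE => h.
transitivity (\sum_j Q i j * (D *m \col_j0 g j0) j 0).
  by apply: eq_bigr => j _; rewrite DgE.
rewrite h [X in _ - X]mxE; congr (_ - _); rewrite mxE big_ord1 !mxE mul1r.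
by apply: eq_bigr => k _; rewrite !mxE.
Qed.

Lemma pavg_poisson g : pavg (poisson g) = 0.
Proof.
have /matrixP/(_ 0 0) : p^T *m D *m (\col_j g j) = 0 by rewrite pD mul0mx.
rewrite -mulmxA mxE [RHS]mxE => h; rewrite -[RHS]h; apply: eq_bigr => i _.
by rewrite DgE mxE.
Qed.

Lemma poisson_shift g c i : poisson (fun j => g j - c) i = poisson g i.
Proof.
rewrite /poisson; under eq_bigr do rewrite mulrBr.
rewrite sumrB -mulr_suml (_ : \sum_j D i j = 0) ?mul0r ?subr0//.
have /colP/(_ i) := D1; rewrite !mxE => h; rewrite -[RHS]h.
by apply: eq_bigr => j _; rewrite !mxE mulr1.
Qed.

Lemma poissonB g h i : poisson (fun j => g j - h j) i = poisson g i - poisson h i.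
Proof. by rewrite /poisson -sumrB; apply: eq_bigr => j _; rewrite mulrBr. Qed.

Lemma poisson_bound : exists2 C, 0 <= C &
  forall g c i, (forall j, `|g j| <= c) -> `|poisson g i| <= C * c.
Proof.
exists (\sum_i \sum_j `|D i j|) => [|g c i gc]; first by rewrite !sumr_ge0// => i _; exact: sumr_ge0.
have c0 : 0 <= c by rewrite (le_trans _ (gc i)).
rewrite (le_trans (ler_norm_sum _ _ _))//.
apply: (@le_trans _ _ ((\sum_j `|D i j|) * c)).
  by rewrite mulr_suml; apply: ler_sum => j _; rewrite normrM ler_wpM2l.
rewrite ler_wpM2r// [leRHS](bigD1 i)//= lerDl sumr_ge0// => k _; exact: sumr_ge0.
Qed.

(** The two summands are transposes of each other and give the same scalar. Centering is free
    because D annihilates constants on the right and the invariant law on the left. *)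
Lemma deviation_quadratic (v : 'cV[R]_d) :
  dotv v ((diag_mx p^T *m D + D^T *m diag_mx p^T) *m v) =
  2 * pavg (fun i => (v i 0 - dotv p v) * poisson (fun j => v j 0 - dotv p v) i).
Proof.
have e1 : dotv v ((diag_mx p^T *m D) *m v) = pavg (fun i => v i 0 * poisson (fun j => v j 0) i).
  rewrite /dotv -mulmxA mul_diag_mx mxE; apply: eq_bigr => i _; rewrite !mxE.
  by rewrite mulrCA; congr (_ * (_ * _)).
have e2 : dotv v ((D^T *m diag_mx p^T) *m v) = dotv v ((diag_mx p^T *m D) *m v).
  rewrite /dotv -[in LHS](trmxK (v^T *m _)) mxE !trmx_mul !trmxK tr_diag_mx.
  by rewrite -!mulmxA.
rewrite mulmxDl /dotv mulmxDr mxE -/(dotv _ _) -/(dotv _ _) -/(dotv _ _) e2 e1.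
rewrite [LHS](_ : _ = 2 * pavg (fun i => v i 0 * poisson (fun j => v j 0) i)); last by ring.
congr (_ * _).
rewrite /pavg; under [in RHS]eq_bigr do rewrite mulrBl mulrBr poisson_shift.
rewrite sumrB [X in _ - X](_ : _ = 0) ?subr0//.
under eq_bigr do rewrite mulrCA.
by rewrite -mulr_sumr [X in _ * X]pavg_poisson mulr0.
Qed.

(** With g = - Q u the form is half the Dirichlet sum of p_i Q_ij (u_i - u_j)^2: after expanding,
    the u_i^2 terms vanish by zero row sums and the u_j^2 terms by invariance. *)
Lemma dirichlet_ge0 g : pavg g = 0 -> 0 <= pavg (fun i => g i * poisson g i).
Proof.
move=> g0; pose u := poisson g.
have Qu i : \sum_j Q i j * u j = - g i by rewrite poissonE g0 sub0r.
rewrite -/u; clearbody u.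
have -> : pavg (fun i => g i * u i) = 2^-1 * \sum_i \sum_j p i 0 * Q i j * (u i - u j) ^+ 2.
  have e i : \sum_j p i 0 * Q i j * (u i - u j) ^+ 2 =
      p i 0 * (\sum_j Q i j * u j ^+ 2) + 2 * (p i 0 * (g i * u i)).
    transitivity (p i 0 * (\sum_j Q i j) * u i ^+ 2 - 2 * p i 0 * u i * (\sum_j Q i j * u j) +
        p i 0 * (\sum_j Q i j * u j ^+ 2)).
      rewrite !mulr_sumr mulr_suml -sumrB -big_split/=; apply: eq_bigr => j _; ring.
    by rewrite Qu genQ.2; ring.
  under [in RHS]eq_bigr do rewrite e.
  rewrite big_split/= [X in X + _](_ : _ = 0); last exact: (pavg_Q (fun j => u j ^+ 2)).
  by rewrite add0r -mulr_sumr mulrA mulVf ?mul1r// pnatr_eq0.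
rewrite mulr_ge0// sumr_ge0// => i _; rewrite sumr_ge0// => j _.
have [->|ij] := eqVneq i j; first by rewrite subrr expr0n mulr0.
have [p0 _ _] := inv_p.
by rewrite mulr_ge0 ?sqr_ge0// mulr_ge0//; exact: genQ.1.
Qed.

End generator_algebra.

Section matrix_exponential.
Context {R : realType} {d : nat}.
Implicit Types A Q : 'M[R]_d.

Lemma expr_entry_bound A (a : R) k i j : 0 <= a -> (forall i j, `|A i j| <= a) ->
  `|(A ^+ k) i j| <= (d%:R * a) ^+ k.
Proof.
move=> a0 Aa; elim: k i j => [|k ih] i j.
  by rewrite expr0 expr0 mxE; case: (i == j); rewrite ?normr1 ?normr0.
rewrite exprS mxE (le_trans (ler_norm_sum _ _ _))//.
apply: (@le_trans _ _ (\sum_(l : 'I_d) a * (d%:R * a) ^+ k)).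
  by apply: ler_sum => l _; rewrite normrM ler_pM.
by rewrite sumr_const card_ord [leRHS]exprS -mulrA [leRHS]mulr_natl lexx.
Qed.

(** Entries of A^k are at most (d a)^k, so for tau <= 1 the series beyond its first two terms is at
    most tau^2 times the exponential series at d a. *)
Lemma expmx_bound Q : exists2 C : R, 0 <= C & forall tau i j, 0 <= tau <= 1 ->
  `|expmx (tau *: Q) i j - (i == j)%:R - tau * Q i j| <= C * tau ^+ 2.
Proof.
pose a : R := \sum_i \sum_j `|Q i j|.
have a0 : 0 <= a by rewrite !sumr_ge0// => i _; exact: sumr_ge0.
have Qa i j : `|Q i j| <= a.
  rewrite /a (bigD1 i)//= (bigD1 j)//= -addrA lerDl addr_ge0// sumr_ge0// => k _.
  exact: sumr_ge0.
pose b := d%:R * a; have b0 : 0 <= b by rewrite /b mulr_ge0.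
exists (expR b) => [|tau i j /andP[t0 t1]]; first exact: expR_ge0.
pose u k := ((tau *: Q) ^+ k) i j / k`!%:R.
have ub k : `|u k| <= tau ^+ k * exp_coeff b k.
  rewrite /u normrM /exp_coeff mulrA normfV [X in _ / X]ger0_norm// ler_wpM2r ?invr_ge0//.
  rewrite -exprMn (le_trans (@expr_entry_bound _ (tau * a) _ _ _ _ _))//.
  - by rewrite mulr_ge0.
  - by move=> i' j'; rewrite mxE normrM ger0_norm// ler_wpM2l.
  - by rewrite /b mulrCA.
have ub1 k : `|u k| <= exp_coeff b k.
  rewrite (le_trans (ub k))// ler_piMl ?exprn_ile1// /exp_coeff.
  by rewrite divr_ge0// exprn_ge0.
have cu : cvgn (series u).
  apply: normed_cvg; apply: (series_le_cvg _ _ ub1 (is_cvg_series_exp_coeff b)) => k //=.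
  by rewrite /exp_coeff divr_ge0// exprn_ge0.
rewrite /expmx mxE -/u.
have u0 : u 0%N = (i == j)%:R by rewrite /u expr0 mxE fact0 divr1.
have u1 : u 1%N = tau * Q i j by rewrite /u expr1 mxE (_ : 1`! = 1%N)// divr1.
have part n : (2 <= n)%N -> `|series u n - (i == j)%:R - tau * Q i j| <= expR b * tau ^+ 2.
  move=> n2; rewrite /series/= -u0 -u1 (big_cat_nat (n := 2) (p := n))//=.
  rewrite big_nat_recl// big_nat1 (_ : _ - _ - _ = \sum_(2 <= k < n) u k); last by ring.
  rewrite (le_trans (ler_norm_sum _ _ _))//.
  apply: (@le_trans _ _ (tau ^+ 2 * series (exp_coeff b) n)).
    rewrite /series/= [X in _ * X](big_cat_nat (n := 2) (p := n))//= mulrDr ler_wpDl//.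
      by rewrite mulr_ge0 ?sqr_ge0// sumr_ge0// => k _; rewrite /exp_coeff divr_ge0// exprn_ge0.
    rewrite mulr_sumr !big_seq; apply: ler_sum => k; rewrite mem_index_iota => /andP[k2 _].
    rewrite (le_trans (ub k))// ler_wpM2r//; first by rewrite /exp_coeff divr_ge0// exprn_ge0.
    by rewrite -(subnKC k2) exprD ler_piMr ?sqr_ge0// exprn_ile1.
  rewrite mulrC ler_wpM2r ?sqr_ge0//; apply: nondecreasing_cvgn_le; last exact: is_cvg_series_exp_coeff.
  apply/nondecreasing_seqP => k; rewrite /series/= big_nat_recr//= lerDl.
  by rewrite /exp_coeff divr_ge0// exprn_ge0.
have cl : (fun n => `|series u n - (i == j)%:R - tau * Q i j|) @ \oo -->
    `|limn (series u) - (i == j)%:R - tau * Q i j|.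
  apply: cvg_norm; apply: cvgB; last exact: cvg_cst.
  by apply: cvgB; [exact: cu|exact: cvg_cst].
apply: (ler_cvg_to cl (cvg_cst _)); near=> n; apply: part.
by near: n; exact: nbhs_infty_ge.
Unshelve. all: by end_near. Qed.

End matrix_exponential.

(** * Regularity of the limit coefficients *)

Section limit_coefficients_theory.
Context {R : realType} {d : nat}.
Variables (Q : 'M[R]_d) (p alpha gamma sigma : 'cV[R]_d) (h m0 : R).
Hypotheses (genQ : is_generator Q) (inv_p : invariant_distribution Q p)
  (uniq_p : forall p', invariant_distribution Q p' -> p' = p)
  (gamma_gt0 : forall i, 0 < gamma i 0).

Local Notation ginf := (gamma_inf p gamma).
Local Notation ainf := (alpha_inf p alpha).
Local Notation rho := (rho p alpha gamma h m0).
Local Notation Vint := (V_integrand Q p alpha gamma h m0).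

Lemma gamma_inf_gt0 : 0 < ginf.
Proof.
have [p0 _ p1] := inv_p; rewrite /gamma_inf dotv_pavg /pavg.
rewrite lt0r sumr_ge0 ?andbT => [|i _]; last by rewrite mulr_ge0// ltW.
apply/negP => /eqP s0.
have : forall i, p i 0 = 0.
  move=> i; have /(_ i isT)/eqP := psumr_eq0P (fun i _ => mulr_ge0 (p0 i) (ltW (gamma_gt0 i))) s0.
  by rewrite mulf_eq0 (gt_eqF (gamma_gt0 i)) orbF => /eqP.
by move=> pi0; move: p1; rewrite big1// => /eqP; rewrite eq_sym oner_eq0.
Qed.

Lemma is_derive_rho t : is_derive t (1 : R) rho (ainf - ginf * rho t).
Proof.
have g0 : ginf != 0 by rewrite gt_eqF// gamma_inf_gt0.
pose A : R := (h == 0)%:R * m0 - ainf / ginf.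
have rhoE : rho = (fun x => A * expR (- ginf * x) + ainf / ginf).
  by apply/funext => x; rewrite /Defs.rho /A; ring.
rewrite rhoE.
have d1 : is_derive t (1 : R) (fun x => - ginf * x) (- ginf).
  by apply: is_derive_eq; rewrite /GRing.scale/= mulr1.
have d2 : is_derive t (1 : R) (fun x => expR (- ginf * x)) (- ginf * expR (- ginf * t)).
  rewrite mulrC; exact: (@is_derive1_comp _ expR (fun x => - ginf * x)).
have d3 : is_derive t (1 : R) (fun x => A * expR (- ginf * x)) (A * (- ginf * expR (- ginf * t))).
  exact: (is_deriveZ A).
have := is_deriveD d3 (is_derive_cst (ainf / ginf) t (1 : R)).
rewrite addr0 (_ : ainf - _ = A * (- ginf * expR (- ginf * t)))//.
by rewrite mulrDr [X in _ - (_ + X)]mulrCA mulfV// mulr1; ring.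
Qed.

Lemma rho_continuous : continuous rho.
Proof. by apply: is_derive_continuous => x; exact: is_derive_rho. Qed.

Lemma rho_bounded : exists2 C, 0 <= C & forall t, 0 <= t -> `|rho t| <= C.
Proof.
exists (`|m0| + 2 * `|ainf / ginf|) => [|t t0]; first by rewrite addr_ge0// mulr_ge0.
have e0 := expR_ge0 (- ginf * t).
have e1 : expR (- ginf * t) <= 1.
  by rewrite expR_le1 mulNr oppr_le0 mulr_ge0// ltW// gamma_inf_gt0.
rewrite /Defs.rho (le_trans (ler_normD _ _))// lerD// normrM.
  rewrite ler_piMl// normrM (ger0_norm e0) mulr_ile1//.
  by case: (h == 0); rewrite ?normr1 ?normr0.
by rewrite mulrC ler_wpM2r// (le_trans (ler_normB _ _))// normr1 ger0_norm//; lra.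
Qed.

Lemma rho_lipschitz : exists2 C, 0 <= C &
  forall s t, 0 <= s -> 0 <= t -> `|rho t - rho s| <= C * `|t - s|.
Proof.
have [C C0 rC] := rho_bounded; have g0 := ltW gamma_inf_gt0.
exists (`|ainf| + ginf * C) => [|s t s0 t0]; first by rewrite addr_ge0// mulr_ge0.
apply: (mvt_le (g := fun x => ainf - ginf * rho x)) => [x|x /andP[x0 _]].
  exact: is_derive_rho.
rewrite (le_trans (ler_normB _ _))// lerD// normrM (ger0_norm g0) ler_wpM2l// rC//.
by rewrite (le_trans _ x0)// le_min s0.
Qed.

(** The drift along the deterministic limit [rho] minus its average under the invariant law; that
    average is the derivative of [rho]. *)
Definition field (t : R) (i : 'I_d) : R :=
  alpha i 0 - rho t * gamma i 0 - (ainf - rho t * ginf).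

Lemma pavg_field t : pavg p (field t) = 0.
Proof.
rewrite /pavg /field; under eq_bigr do rewrite !mulrBr mulrCA.
rewrite !sumrB -mulr_sumr -!mulr_suml; have [_ _ ->] := inv_p.
by rewrite /alpha_inf /gamma_inf !dotv_pavg /pavg; ring.
Qed.

Lemma field_bounded : exists2 C, 0 <= C & forall t i, 0 <= t -> `|field t i| <= C.
Proof.
have [C C0 rC] := rho_bounded.
pose S : R := \sum_i (`|alpha i 0| + C * `|gamma i 0|).
exists (S + (`|ainf| + C * `|ginf|)) => [|t i t0].
  by rewrite !addr_ge0 ?mulr_ge0// sumr_ge0// => i _; rewrite addr_ge0 ?mulr_ge0.
rewrite (le_trans (ler_normB _ _))// lerD// (le_trans (ler_normB _ _))//; last first.
  by rewrite lerD// normrM ler_wpM2r// rC.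
apply: (@le_trans _ _ (`|alpha i 0| + C * `|gamma i 0|)).
  by rewrite lerD// normrM ler_wpM2r// rC.
rewrite /S (bigD1 i)//= lerDl sumr_ge0// => j _; rewrite addr_ge0 ?mulr_ge0//.
Qed.

Lemma field_lipschitz : exists2 C, 0 <= C &
  forall s t i, 0 <= s -> 0 <= t -> `|field t i - field s i| <= C * `|t - s|.
Proof.
have [C C0 rC] := rho_lipschitz.
pose S : R := \sum_i `|gamma i 0|.
have S0 : 0 <= S by exact: sumr_ge0.
exists (C * (S + `|ginf|)) => [|s t i s0 t0]; first by rewrite mulr_ge0// addr_ge0.
rewrite (_ : field t i - field s i = (rho t - rho s) * (ginf - gamma i 0)); last first.
  by rewrite /field; ring.
rewrite normrM [leRHS]mulrAC ler_pM// ?rC// (le_trans (ler_normB _ _))// addrC lerD//.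
by rewrite /S (bigD1 i)//= lerDl sumr_ge0.
Qed.

(** Twice the average of f D f for the centered field f: the form in which the second moment of an
    additive functional produces the variance. *)
Lemma V_integrandE t :
  Vint t = 2 * pavg p (fun i => field t i * poisson Q p (field t) i).
Proof.
rewrite /V_integrand/= deviation_quadratic//; congr (_ * _); apply: eq_bigr => i _.
have e j : (alpha - rho t *: gamma) j 0 - dotv p (alpha - rho t *: gamma) = field t j.
  rewrite !mxE /field; congr (_ - _).
  rewrite /alpha_inf /gamma_inf !dotv_pavg /pavg.
  by under eq_bigr do rewrite !mxE mulrBr mulrCA; rewrite sumrB -mulr_sumr.
by rewrite e; congr (_ * (_ * _)); rewrite /poisson; apply: eq_bigr => j _; rewrite e.
Qed.

Lemma V_integrand_ge0 t : 0 <= Vint t.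
Proof. by rewrite V_integrandE mulr_ge0// dirichlet_ge0// pavg_field. Qed.

Lemma V_integrand_bounded : exists2 C, 0 <= C & forall t, 0 <= t -> Vint t <= C.
Proof.
have [G G0 gG] := field_bounded; have [D D0 pD] := poisson_bound Q p.
exists (2 * (G * (D * G))) => [|t t0]; first by rewrite !mulr_ge0.
rewrite V_integrandE ler_pM2l// (le_trans (ler_norm _))//.
apply: (pavg_norm inv_p) => i; rewrite normrM ler_pM ?gG//.
by apply: pD => j; exact: gG.
Qed.

Lemma V_integrand_lipschitz : exists2 C, 0 <= C &
  forall s t, 0 <= s -> 0 <= t -> `|Vint t - Vint s| <= C * `|t - s|.
Proof.
have [G G0 gG] := field_bounded; have [D D0 pD] := poisson_bound Q p.
have [L L0 gL] := field_lipschitz.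
exists (2 * (L * (D * G) + G * (D * L))) => [|s t s0 t0]; first by rewrite mulr_ge0// addr_ge0// !mulr_ge0.
rewrite !V_integrandE -mulrBr normrM ger0_norm// -mulrA ler_pM2l//.
rewrite /pavg -sumrB; under eq_bigr do rewrite -mulrBr.
apply: (pavg_norm inv_p) => i.
rewrite (_ : field t i * _ - _ = (field t i - field s i) * poisson Q p (field t) i +
   field s i * poisson Q p (fun j => field t j - field s j) i); last by rewrite (poissonB Q p (field t) (field s)); ring.
rewrite (le_trans (ler_normD _ _))// [leRHS]mulrDl lerD// normrM.
  by rewrite [leRHS]mulrAC ler_pM ?gL// pD// => j; exact: gG.
by rewrite -[leRHS]mulrA ler_pM ?gG// -mulrA pD// => j; exact: gL.
Qed.

Let continuous_sum (F : 'I_d -> R -> R) : (forall i, continuous (F i)) ->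
  continuous (fun t => \sum_i F i t).
Proof.
move=> cF; elim: (index_enum _) => [|i s ih].
  by under [fun t => _]eq_fun do rewrite big_nil; move=> t; exact: cvg_cst.
under [fun t => _]eq_fun do rewrite big_cons.
by move=> t; apply: cvgD; [exact: cF|exact: ih].
Qed.

Lemma V_integrand_continuous : continuous Vint.
Proof.
have cf i : continuous (fun t => field t i).
  move=> t; apply: cvgB.
    by apply: cvgB; [exact: cvg_cst|apply: cvgM; [exact: rho_continuous|exact: cvg_cst]].
  by apply: cvgB; [exact: cvg_cst|apply: cvgM; [exact: rho_continuous|exact: cvg_cst]].
rewrite (_ : Vint = fun t => 2 * pavg p (fun i => field t i * poisson Q p (field t) i)); last first.
  by apply/funext => t; rewrite V_integrandE.
move=> t; apply: cvgM; first exact: cvg_cst.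
apply: (@continuous_sum (fun i t => p i 0 * (field t i * poisson Q p (field t) i))) => i {}t.
apply: cvgM; first exact: cvg_cst.
apply: cvgM; first exact: cf.
apply: (@continuous_sum (fun j t => deviation_matrix Q p i j * field t j)) => j {}t.
by apply: cvgM; [exact: cvg_cst|exact: cf].
Qed.

Lemma derive_V t : derive1 (V Q p alpha gamma h m0) t = Vint t.
Proof.
have := @prim_is_derive R Vint t V_integrand_continuous.
by move=> hd; rewrite derive1E; exact: (derive_val (f := prim Vint)).
Qed.

Definition limit_variance (t : R) : R :=
  sigma2_inf p sigma * (h <= 1)%R%:R + Vint t * (1 <= h)%R%:R.

Lemma limit_dispersionE t :
  limit_dispersion Q p alpha gamma sigma h m0 t = Num.sqrt (limit_variance t).
Proof. by rewrite /limit_dispersion derive_V. Qed.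

Lemma sigma2_inf_ge0 : 0 <= sigma2_inf p sigma.
Proof.
rewrite /sigma2_inf dotv_pavg sumr_ge0// => i _; rewrite mxE mulr_ge0 ?sqr_ge0//.
by have [] := inv_p.
Qed.

Lemma limit_variance_ge0 t : 0 <= limit_variance t.
Proof. by rewrite addr_ge0// mulr_ge0// ?sigma2_inf_ge0// V_integrand_ge0. Qed.

Lemma limit_variance_bounded : exists2 C, 0 <= C & forall t, 0 <= t -> limit_variance t <= C.
Proof.
have [C C0 VC] := V_integrand_bounded; have s0 := sigma2_inf_ge0.
exists (sigma2_inf p sigma + C) => [|t t0]; first by rewrite addr_ge0.
rewrite /limit_variance lerD//; first by case: (h <= 1); rewrite ?mulr1 ?mulr0.
by case: (1 <= h); rewrite ?mulr1 ?mulr0// VC.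
Qed.

Lemma limit_variance_lipschitz : exists2 C, 0 <= C &
  forall s t, 0 <= s -> 0 <= t -> `|limit_variance t - limit_variance s| <= C * `|t - s|.
Proof.
have [C C0 VC] := V_integrand_lipschitz; exists C => // s t s0 t0.
rewrite /limit_variance (_ : _ - _ = (Vint t - Vint s) * (1 <= h)%R%:R); last by ring.
rewrite normrM (le_trans _ (VC s t s0 t0))// ler_piMr//.
by case: (1 <= h); rewrite ?normr1 ?normr0.
Qed.

End limit_coefficients_theory.

(** * Additive functionals of a fast Markov chain *)

Section finite_paths.
Context {R : realType} {disp : measure_display} {T : measurableType disp} {d : nat}.
Variables (P : probability T R) (x : nat -> T -> 'I_d) (i0 : 'I_d).
Hypothesis mx : forall l i, measurable (x l @^-1` [set i]).

(** Plays the role of measurability with respect to the first [k] states. With finitely many states,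
    expectations become finite sums over words. *)
Definition prefix (k : nat) (U : Type) (H : (nat -> 'I_d) -> U) :=
  forall c c', (forall j, (j < k)%N -> c j = c' j) -> H c = H c'.

Definition extend k (c : {ffun 'I_k -> 'I_d}) (j : nat) : 'I_d :=
  if insub j is Some j' then c j' else i0.

Definition path_event k (c : {ffun 'I_k -> 'I_d}) : set T :=
  \big[setI/setT]_(j < k) (x j @^-1` [set c j]).

Lemma extendE k (c : {ffun 'I_k -> 'I_d}) (j : 'I_k) : extend c j = c j.
Proof. by rewrite /extend valK. Qed.

Lemma in_path_event k (c : {ffun 'I_k -> 'I_d}) w :
  path_event c w <-> (forall j : 'I_k, x j w = c j).
Proof.
rewrite /path_event -bigcap_seq; split; last by move=> h j _; exact: h.
by move=> h j; apply: h; rewrite /= mem_index_enum.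
Qed.

Lemma measurable_path_event k (c : {ffun 'I_k -> 'I_d}) : measurable (path_event c).
Proof. by apply: bigsetI_measurable => j _; exact: mx. Qed.

(** Exactly one word has its event occurring, so the random path may be replaced by a deterministic
    one inside each summand. *)
Lemma path_decomposition k (G : (nat -> 'I_d) -> T -> R) w : prefix k G ->
  G (x ^~ w) w = \sum_(c : {ffun 'I_k -> 'I_d}) \1_(path_event c) w * G (extend c) w.
Proof.
move=> pG; pose c0 : {ffun 'I_k -> 'I_d} := [ffun j : 'I_k => x j w].
rewrite (bigD1 c0)//= big1 ?addr0 => [|c cc0].
  rewrite indicE mem_set ?mul1r; last by apply/in_path_event => j; rewrite ffunE.
  congr (_ w); apply: pG => j jk; rewrite -[j]/(val (Ordinal jk)) extendE ffunE//.
rewrite indicE memNset ?mul0r// => /in_path_event h.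
by move/eqP: cc0; apply; apply/ffunP => j; rewrite ffunE h.
Qed.

Lemma good_indic A : measurable A -> good P (\1_A : T -> R).
Proof.
move=> mA; apply: (@good_bounded _ _ _ _ _ 1); first exact: measurable_indic.
by move=> w; rewrite indicE; case: (w \in A); rewrite ?normr1 ?normr0.
Qed.

Lemma good_path k (G : (nat -> 'I_d) -> T -> R) : prefix k G ->
  (forall c, good P (G c)) -> good P (fun w => G (x ^~ w) w).
Proof.
move=> pG gG; rewrite (_ : (fun w => _) = (fun w =>
    \sum_(c : {ffun 'I_k -> 'I_d}) \1_(path_event c) w * G (extend c) w)); last first.
  by apply/funext => w; exact: path_decomposition.
apply: good_sum => c; apply: goodM; last exact: gG.
by apply: good_indic; exact: measurable_path_event.
Qed.

Lemma good_prefix k (H : (nat -> 'I_d) -> R) : prefix k H -> good P (fun w => H (x ^~ w)).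
Proof.
move=> pH; apply: (@good_path k (fun c _ => H c)) => [c c' cc'|c].
  by apply/funext => _; exact: pH.
exact: good_cst.
Qed.

(* Integrating out a source of randomness that is independent of the path. *)
Lemma Ex_path (G : set (set T)) k (F : (nat -> 'I_d) -> T -> R) : prefix k F ->
  (forall c, good P (F c)) -> G `<=` measurable -> (forall c A, measurable A -> G (F c @^-1` A)) ->
  (forall A (c : {ffun 'I_k -> 'I_d}), G A -> P (A `&` path_event c) = (P A * P (path_event c))%E) ->
  Ex P (fun w => F (x ^~ w) w) = Ex P (fun w => Ex P (F (x ^~ w))).
Proof.
move=> pF gF mG GF ind.
have gI (c : {ffun 'I_k -> 'I_d}) : good P (\1_(path_event c) : T -> R).
  by apply: good_indic; exact: measurable_path_event.
rewrite (@eq_Ex _ _ _ P _ _ (fun w => path_decomposition w pF)).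
have pE : prefix k (fun c (_ : T) => Ex P (F c)).
  by move=> c c' cc'; rewrite (pF c c' cc').
rewrite (@eq_Ex _ _ _ P _ _ (fun w => path_decomposition w pE)).
rewrite !Ex_sum => [|c|c]; [|by apply: good_itg; apply: goodM => //; exact: good_cst|by apply: good_itg; exact: goodM].
apply: eq_bigr => c _.
under eq_Ex do rewrite mulrC.
rewrite (@Ex_indep _ _ _ P G) ?(gF, gI)//.
- under [RHS]eq_Ex do rewrite mulrC.
  by rewrite ExZ//; exact: good_itg.
- by move=> A mA; exact: GF.
move=> A B GA mB.
have ind' := ind A c GA; have mA := mG _ GA.
have mE := measurable_path_event c.
(* The preimage of a set under an indicator is everything, the event, its complement or empty,
   according to which of 1 and 0 the set contains. *)
rewrite preimage_indic; case: ifPn => [_|_]; case: ifPn => [_|_] //.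
- by rewrite setIT probability_setT mule1.
- rewrite -setDE; have -> : P (A `\` path_event c) = (P A - P (A `&` path_event c))%E.
    by apply: measureD => //; rewrite ltey_eq fin_num_measure.
  rewrite ind' probability_setC//.
  by rewrite muleBr ?mule1 ?fin_num_measure// fin_num_adde_defl// fin_numN fin_num_measure.
- by rewrite setI0 measure0 mule0.
Qed.

End finite_paths.

Section chain_moments.
Context {R : realType} {disp : measure_display} {T : measurableType disp} {d : nat}.
Variables (P : probability T R) (x : nat -> T -> 'I_d) (i0 : 'I_d).
Variables (Q Pm : 'M[R]_d) (p : 'cV[R]_d) (N Dt CP D : R).
Local Notation E := (Ex P).
Hypothesis mx : forall l i, measurable (x l @^-1` [set i]).
Hypothesis markov : forall l (H : (nat -> 'I_d) -> R) (phi : 'I_d -> R), prefix l.+1 H ->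
  E (fun w => H (x ^~ w) * phi (x l.+1 w)) =
  E (fun w => H (x ^~ w) * \sum_j Pm (x l w) j * phi j).
Hypotheses (genQ : is_generator Q) (inv_p : invariant_distribution Q p)
  (uniq_p : forall p', invariant_distribution Q p' -> p' = p).
Hypotheses (CP0 : 0 <= CP) (D0 : 0 <= D) (N1 : 1 <= N) (Dt0 : 0 < Dt) (NDt : N ^+ 2 * Dt <= 1).
Hypothesis PmQ : forall i j,
  `|Pm i j - (i == j)%:R - N * Dt * Q i j| <= CP * (N * Dt) ^+ 2.
Hypothesis poissonD : forall g c i, (forall j, `|g j| <= c) -> `|poisson Q p g i| <= D * c.

Let Dt_le : N * Dt <= N^-1.
Proof. by rewrite -[N^-1]mul1r ler_pdivlMr ?(lt_le_trans ltr01)// mulrC mulrA -expr2. Qed.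

(** In this regime the quadratic error of one transition is O(Dt), so n steps accumulate only O(n
    Dt). *)
Let eps2 : (N * Dt) ^+ 2 <= Dt.
Proof. by rewrite exprMn [Dt ^+ 2]expr2 mulrA ler_piMl// ltW. Qed.

Let gP (H : (nat -> 'I_d) -> R) k : prefix k H -> good P (fun w => H (x ^~ w)).
Proof. by move=> pH; exact: (good_prefix P i0 mx pH). Qed.

(** One step of the chain lowers the mean of the Poisson solution by N Dt g, up to O(Dt): an
    approximate martingale decomposition of the additive functional. *)
Lemma transition_poisson (g : 'I_d -> R) c i : pavg p g = 0 -> (forall j, `|g j| <= c) ->
  `|\sum_j Pm i j * poisson Q p g j - poisson Q p g i + N * Dt * g i| <=
    CP * Dt * (d%:R * (D * c)).
Proof.
move=> g0 gc; set u := poisson Q p g.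
have Qu : \sum_j Q i j * u j = - g i by rewrite (poissonE genQ inv_p uniq_p) g0 sub0r.
have ui : u i = \sum_j (i == j)%:R * u j.
  rewrite (bigD1 i)//= eqxx mul1r big1 ?addr0// => j ji.
  by rewrite eq_sym (negbTE ji) mul0r.
rewrite -[g i]opprK -Qu mulrN ui mulr_sumr -!sumrB (le_trans (ler_norm_sum _ _ _))//.
apply: (@le_trans _ _ (\sum_(j : 'I_d) CP * Dt * (D * c))).
  apply: ler_sum => j _.
  rewrite (_ : _ - _ - _ = (Pm i j - (i == j)%:R - N * Dt * Q i j) * u j); last by ring.
  rewrite normrM ler_pM//; last exact: poissonD.
  by rewrite (le_trans (PmQ i j))// ler_wpM2l.
by rewrite sumr_const card_ord -[leLHS]mulr_natl mulrCA lexx.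
Qed.

Section field.
Variables (g : nat -> 'I_d -> R) (G L : R).
Hypotheses (gG : forall l i, `|g l i| <= G)
  (gL : forall l i, `|g l.+1 i - g l i| <= L * Dt) (g0 : forall l, pavg p (g l) = 0).

Let u l := poisson Q p (g l).
Let A k n (c : nat -> 'I_d) := \sum_(l < n) Dt * g (k + l)%N (c (k + l)%N).

Let G0 : 0 <= G. Proof. exact: le_trans (gG 0 i0). Qed.
Let L0 : 0 <= L.
Proof. by rewrite -(pmulr_lge0 _ Dt0) (le_trans _ (gL 0 i0)). Qed.

Let uG l i : `|u l i| <= D * G. Proof. exact: poissonD. Qed.

Let uL l i : `|u l.+1 i - u l i| <= D * (L * Dt).
Proof. by rewrite /u -poissonB; apply: poissonD => j; exact: gL. Qed.

Let pA k n : prefix (k + n) (A k n).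
Proof. by move=> c c' cc'; apply: eq_bigr => l _; rewrite cc'// ltn_add2l. Qed.

Let pc (f : 'I_d -> R) l : prefix l.+1 (fun c => f (c l)).
Proof. by move=> c c' ->. Qed.

Let A0 k c : A k 0 c = 0. Proof. by rewrite /A big_ord0. Qed.

Let AS k n c : A k n.+1 c = A k n c + Dt * g (k + n)%N (c (k + n)%N).
Proof. by rewrite /A big_ord_recr. Qed.

Let AF k n c : A k n.+1 c = Dt * g k (c k) + A k.+1 n c.
Proof.
rewrite /A big_ord_recl/= addn0; congr (_ + _); apply: eq_bigr => l _.
by rewrite /bump leq0n add1n addnS addSn.
Qed.

Let prefixW k k' (U : Type) (H : (nat -> 'I_d) -> U) : (k <= k')%N -> prefix k H -> prefix k' H.
Proof. by move=> kk' pH c c' cc'; apply: pH => j jk; apply: cc'; exact: leq_trans kk'. Qed.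

Let prefixM k (H H' : (nat -> 'I_d) -> R) : prefix k H -> prefix k H' ->
  prefix k (fun c => H c * H' c).
Proof. by move=> h h' c c' cc'; rewrite (h c c' cc') (h' c c' cc'). Qed.

Let C1 := D * L + CP * (d%:R * (D * G)).

Let C10 : 0 <= C1. Proof. by rewrite /C1; nneg. Qed.

Let gA k n : good P (fun w => A k n (x ^~ w)). Proof. exact: gP (@pA k n). Qed.
Let gc (f : 'I_d -> R) l : good P (fun w => f (x l w)). Proof. exact: gP (@pc f l). Qed.

Let step H m : prefix m.+1 H ->
  `|N * E (fun w => H (x ^~ w) * (Dt * g m (x m w))) -
    (E (fun w => H (x ^~ w) * u m (x m w)) - E (fun w => H (x ^~ w) * u m.+1 (x m.+1 w)))|
    <= C1 * Dt * E (fun w => `|H (x ^~ w)|).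
Proof.
move=> pH; have gH := gP pH.
have gS (f : 'I_d -> R) : good P (fun w => H (x ^~ w) * f (x m w)) by gd.
have gS' (f : 'I_d -> R) : good P (fun w => H (x ^~ w) * f (x m.+1 w)) by gd.
have e1 : E (fun w => H (x ^~ w) * u m.+1 (x m.+1 w)) =
    E (fun w => H (x ^~ w) * (u m.+1 (x m.+1 w) - u m (x m.+1 w))) +
    E (fun w => H (x ^~ w) * u m (x m.+1 w)).
  rewrite -ExD; [|exact: good_itg (gS' (fun i => u m.+1 i - u m i))|exact: good_itg].
  by apply: eq_Ex => w; ring.
rewrite e1 (markov (u m) pH).
rewrite (_ : _ - _ = E (fun w => H (x ^~ w) * (u m.+1 (x m.+1 w) - u m (x m.+1 w))) +
   E (fun w => H (x ^~ w) * (\sum_j Pm (x m w) j * u m j - u m (x m w) + N * Dt * g m (x m w)))); last first.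
  rewrite -ExZ; last exact: good_itg (gS (fun i => Dt * g m i)).
  rewrite [X in _ = _ + X](_ : _ = E (fun w => H (x ^~ w) * (\sum_j Pm (x m w) j * u m j)) -
      E (fun w => H (x ^~ w) * u m (x m w)) +
      E (fun w => N * (H (x ^~ w) * (Dt * g m (x m w))))); first by ring.
  rewrite -ExB; [|exact: good_itg (gS (fun i => \sum_j Pm i j * u m j))|exact: good_itg].
  rewrite -ExD; [by apply: eq_Ex => w; ring| |].
    exact: good_itg (goodB (gS (fun i => \sum_j Pm i j * u m j)) (gS (u m))).
  exact: good_itg (goodZ N (gS (fun i => Dt * g m i))).
have gn := good_norm gH.
rewrite (le_trans (ler_normD _ _))// /C1 !mulrDl lerD//.
  rewrite -ExZ; last exact: good_itg.
  apply: Ex_norm_le; [exact: good_itg (gS' (fun i => u m.+1 i - u m i))|exact: good_itg (goodZ _ gn)|].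
  by move=> w; rewrite normrM mulrC ler_wpM2r// -mulrA.
rewrite -ExZ; last exact: good_itg.
apply: Ex_norm_le; [exact: good_itg (gS (fun i => \sum_j Pm i j * u m j - u m i + N * Dt * g m i))
  |exact: good_itg (goodZ _ gn)|].
move=> w; rewrite normrM mulrC; apply: ler_wpM2r => //; rewrite [leRHS]mulrAC.
exact: transition_poisson.
Qed.

(** Summing the one-step identity telescopes the Poisson solution. What remains are two boundary
    terms and an O(1) error per unit time, so dividing by N gives conditional means O(1/N). *)
Lemma additive_expansion H k n : prefix k.+1 H ->
  `|N * E (fun w => H (x ^~ w) * A k n (x ^~ w)) -
    (E (fun w => H (x ^~ w) * u k (x k w)) - E (fun w => H (x ^~ w) * u (k + n)%N (x (k + n)%N w)))|
    <= C1 * (n%:R * Dt) * E (fun w => `|H (x ^~ w)|).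
Proof.
move=> pH; have gH := gP pH; elim: n => [|n ih].
  rewrite addn0 subrr subr0 (@eq_Ex _ _ _ _ _ (fun=> 0)) => [|w]; last by rewrite A0 mulr0.
  by rewrite Ex_cst mulr0 normr0 mul0r mulr0 mul0r.
have pH' : prefix (k + n).+1 H by apply: prefixW pH; rewrite ltnS leq_addr.
have st := step pH'.
rewrite (_ : E (fun w => _ * A k n.+1 _) = E (fun w => H (x ^~ w) * A k n (x ^~ w)) +
   E (fun w => H (x ^~ w) * (Dt * g (k + n)%N (x (k + n)%N w)))); last first.
  rewrite -ExD; [|exact: good_itg (goodM gH (gA k n))|].
    by apply: eq_Ex => w; rewrite AS mulrDr.
  exact: good_itg (goodM gH (gc (fun i => Dt * g (k + n)%N i) (k + n))).
rewrite addnS -natr1 (mulrDl n%:R) mul1r mulrDr mulrDl.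
apply: le_trans (lerD ih st); apply: le_trans (ler_normD _ _).
by rewrite le_eqVlt; apply/orP; left; apply/eqP; congr (`|_|); ring.
Qed.

Let t n := n%:R * Dt.

Let C2 K := 2 * (D * G) + C1 * K.

Lemma additive_first H k n K : prefix k.+1 H -> n%:R * Dt <= K ->
  `|E (fun w => H (x ^~ w) * A k n (x ^~ w))| <= C2 K / N * E (fun w => `|H (x ^~ w)|).
Proof.
move=> pH nK; have N0 : 0 < N by exact: lt_le_trans N1.
have gH := gP pH; have gn := good_norm gH.
have EH : 0 <= E (fun w => `|H (x ^~ w)|) by apply: Ex_ge0.
rewrite mulrAC ler_pdivlMr// mulrC -(gtr0_norm N0) -normrM.
have b l : `|E (fun w => H (x ^~ w) * u l (x l w))| <= D * G * E (fun w => `|H (x ^~ w)|).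
  rewrite -ExZ; last exact: good_itg.
  apply: Ex_norm_le; [exact: good_itg (goodM gH (gc (u l) l))|exact: good_itg (goodZ _ gn)|].
  by move=> w; rewrite normrM mulrC ler_wpM2r.
have h := additive_expansion n pH; have b1 := b k; have b2 := b (k + n)%N.
have h' : C1 * (n%:R * Dt) * E (fun w => `|H (x ^~ w)|) <= C1 * K * E (fun w => `|H (x ^~ w)|).
  by rewrite ler_wpM2r// ler_wpM2l.
rewrite /C2 mulrDl -[2 * _ * _]mulrA; move: h b1 b2 h'; rewrite !ler_norml; lra.
Qed.

Let C3 K := 2 * G * C2 K + G ^+ 2.

Let N0 : 0 < N. Proof. exact: lt_le_trans N1. Qed.

Let Dt_N : Dt <= N^-1.
Proof. by apply: le_trans Dt_le; rewrite ler_peMl// ltW. Qed.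

Let pe k : prefix k.+1 (fun c => Dt * g k (c k)).
Proof. by move=> c c' ->. Qed.

Let e_le k i : `|Dt * g k i| <= Dt * G.
Proof. by rewrite normrM (gtr0_norm Dt0) ler_pM2l. Qed.

Let C2_ge0 K : 0 <= K -> 0 <= C2 K.
Proof. by move=> K0; rewrite /C2; nneg. Qed.

(** The first summand is peeled off. In the cross term it serves as the test function of
    [additive_first], which gains 1/N; its own square is O(Dt^2), and Dt <= 1/N. *)
Lemma additive_second_bound k n K : n%:R * Dt <= K ->
  E (fun w => A k n (x ^~ w) ^+ 2) <= C3 K * (n%:R * Dt) / N.
Proof.
elim: n k => [|n ih] k nK.
  rewrite (@eq_Ex _ _ _ _ _ (fun=> 0)) => [|w]; last by rewrite A0 expr0n.
  by rewrite Ex_cst !mul0r mulr0 mul0r.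
have K0 : 0 <= K by rewrite (le_trans _ nK)// mulr_ge0// ltW.
have nK' : n%:R * Dt <= K by rewrite (le_trans _ nK)// ler_wpM2r ?(ltW Dt0)// ler_nat.
have g1 : good P (fun w => Dt * g k (x k w)) by exact: (gc (fun i => Dt * g k i)).
have g2 := gA k.+1 n.
rewrite (@eq_Ex _ _ _ _ _ (fun w => A k.+1 n (x ^~ w) ^+ 2 +
  (2 * ((Dt * g k (x k w)) * A k.+1 n (x ^~ w)) + (Dt * g k (x k w)) ^+ 2))); last first.
  by move=> w; rewrite AF; ring.
rewrite ExD; [|by gd|by gd]; rewrite ExD; [|by gd|by gd]; rewrite ExZ; last by gd.
have h1 := ih k.+1 nK'.
have h2 := additive_first (prefixW (leqnSn _) (@pe k)) nK'.
have h3 : E (fun w => `|Dt * g k (x k w)|) <= Dt * G.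
  rewrite -[leRHS](Ex_cst P); apply: Ex_le; [exact: good_itg (good_norm g1)|exact: itg_cst|].
  by move=> w.
have h4 : E (fun w => (Dt * g k (x k w)) ^+ 2) <= Dt * (G ^+ 2 / N).
  rewrite -[leRHS](Ex_cst P); apply: Ex_le; [by gd|exact: itg_cst|move=> w].
  rewrite -(real_normK (num_real _)) (le_trans (_ : _ <= (Dt * G) ^+ 2))//.
    by rewrite lerXn2r// nnegrE// mulr_ge0// ltW.
  rewrite exprMn [Dt ^+ 2]expr2 -mulrA ler_wpM2l ?(ltW Dt0)// mulrC ler_wpM2l// sqr_ge0//.
have h5 : C2 K / N * E (fun w => `|Dt * g k (x k w)|) <= C2 K / N * (Dt * G).
  by rewrite ler_wpM2l// divr_ge0 ?C2_ge0// ltW.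
have h6 := le_trans (ler_norm _) (le_trans h2 h5).
rewrite -natr1 /C3 (_ : _ / N = (2 * G * C2 K + G ^+ 2) * (n%:R * Dt) / N +
  (2 * (C2 K / N * (Dt * G)) + Dt * (G ^+ 2 / N))); last by ring.
rewrite lerD// lerD// ler_pM2l//.
Qed.

Let M3 k n K : n%:R * Dt <= K -> E (fun w => A k n (x ^~ w) ^+ 2) <= C3 K * (n%:R * Dt) / N.
Proof. exact: additive_second_bound. Qed.

(** Summation by parts brings the sum over the future next to a quantity of the past, so that
    [additive_first] can supply its factor 1/N; the cube increment is moreover of order Dt times a
    square. *)
Lemma additive_abel k n c :
  \sum_(j < n) A k j c ^+ 3 * (Dt * g (k + j)%N (c (k + j)%N)) =
  \sum_(j < n) (A k j.+1 c ^+ 3 - A k j c ^+ 3) * A (k + j.+1)%N (n - j.+1)%N c.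
Proof.
have split j : (j <= n)%N -> A k n c = A k j c + A (k + j)%N (n - j)%N c.
  elim: j => [|j ih] jn; first by rewrite A0 add0r addn0 subn0.
  rewrite ih ?(ltnW jn)// AS -addrA; congr (_ + _).
  by rewrite -{1}(subnSK jn) AF addnS.
rewrite [RHS](eq_bigr (fun j : 'I_n => (A k j.+1 c ^+ 3 - A k j c ^+ 3) * (A k n c - A k j.+1 c))); last first.
  by move=> j _; congr (_ * _); rewrite (split _ (ltn_ord j)) addrAC subrr add0r.
elim: (n) => [|m ih]; first by rewrite !big_ord0.
rewrite !big_ord_recr/= ih subrr mulr0 addr0 AS.
have -> : A k m c ^+ 3 = \sum_(j < m) (A k j.+1 c ^+ 3 - A k j c ^+ 3).
  elim: (m) => [|l ihl]; first by rewrite big_ord0 A0 expr0n.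
  by rewrite big_ord_recr/= -ihl addrC subrK.
rewrite mulr_suml -big_split/=; apply: eq_bigr => j _; ring.
Qed.

Let C5 K := 12 * C2 K * G * C3 K + 8 * G ^+ 2 * C3 K + 3 * G ^+ 4.

Lemma additive_fourth k n K : n%:R * Dt <= K ->
  E (fun w => A k n (x ^~ w) ^+ 4) <= C5 K * (n%:R * Dt) ^+ 2 / N ^+ 2.
Proof.
move=> nK; pose a w j := A k j (x ^~ w); pose e w j := Dt * g (k + j)%N (x (k + j)%N w).
have [->|n0] := posnP n.
  rewrite (@eq_Ex _ _ _ _ _ (fun=> 0)) => [|w]; last by rewrite A0 expr0n.
  by rewrite Ex_cst mul0r expr0n/= mulr0 mul0r.
have t0 : 0 <= n%:R * Dt by rewrite mulr_ge0// ltW.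
have K0 : 0 <= K by exact: le_trans nK.
have C20 := C2_ge0 K0.
have C30 : 0 <= C3 K by rewrite /C3; nneg; rewrite sqr_ge0.
have ga j : good P (a ^~ j) by exact: gA.
have ge j : good P (e ^~ j) by exact: (gc (fun i => Dt * g (k + j)%N i)).
have expand w : a w n ^+ 4 = 4 * (\sum_(j < n) (a w j.+1 ^+ 3 - a w j ^+ 3) * A (k + j.+1)%N (n - j.+1)%N (x ^~ w)) +
    \sum_(j < n) (6 * a w j ^+ 2 * e w j ^+ 2 + 4 * a w j * e w j ^+ 3 + e w j ^+ 4).
  rewrite -additive_abel.
  elim: (n) => [|m ih]; first by rewrite !big_ord0 /a A0 expr0n mulr0 addr0.
  rewrite !big_ord_recr/= /a AS mulrDr -/(a w m) -/(e w m) addrACA -ih; ring.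
rewrite (eq_Ex _ expand).
have gs1 (j : 'I_n) : good P (fun w => (a w j.+1 ^+ 3 - a w j ^+ 3) * A (k + j.+1)%N (n - j.+1)%N (x ^~ w)).
  by have := gA (k + j.+1)%N (n - j.+1)%N; gd.
have gs2 (j : 'I_n) : good P (fun w => 6 * a w j ^+ 2 * e w j ^+ 2 + 4 * a w j * e w j ^+ 3 + e w j ^+ 4).
  by apply: goodD; [apply: goodD|]; gd.
rewrite ExD; [|apply: good_itg; apply: goodZ; exact: good_sum|apply: good_itg; exact: good_sum].
rewrite ExZ; last by apply: good_itg; exact: good_sum.
rewrite !Ex_sum; [|by move=> j; apply: good_itg|by move=> j; apply: good_itg].
have e2 w j : e w j ^+ 2 <= (Dt * G) ^+ 2.
  rewrite -(real_normK (num_real _)); apply: lerXn2r; rewrite ?nnegrE//.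
    by rewrite mulr_ge0// ltW.
  exact: e_le.
have mono j : (j <= n)%N -> E (fun w => a w j ^+ 2) <= C3 K * (n%:R * Dt) / N.
  move=> jn; have jn' : j%:R * Dt <= n%:R * Dt by rewrite ler_wpM2r ?(ltW Dt0)// ler_nat.
  rewrite (le_trans (M3 _ (le_trans jn' nK)))// ler_wpM2r ?invr_ge0 ?(ltW N0)// ler_wpM2l//.
have Q0 := mono 0%N (leq0n _).
(* Uses |x^3 - y^3| <= (3/2) |x - y| (x^2 + y^2) with |x - y| <= Dt G, and then the second-moment
   bound. *)
have B1 (j : 'I_n) : E (fun w => (a w j.+1 ^+ 3 - a w j ^+ 3) * A (k + j.+1)%N (n - j.+1)%N (x ^~ w)) <=
    3 * C2 K * G * C3 K * (n%:R * Dt) / N ^+ 2 * Dt.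
  have pH : prefix (k + j.+1).+1 (fun c => A k j.+1 c ^+ 3 - A k j c ^+ 3).
    move=> c c' cc'; rewrite (@pA k j.+1 c c') ?(@pA k j c c')// => i ik; apply: cc'.
      by rewrite (leq_trans ik)// addnS ltnW// ltnS ltnW.
    by rewrite (leq_trans ik)// ltnW.
  have nj : (n - j.+1)%:R * Dt <= K.
    by rewrite (le_trans _ nK)// ler_wpM2r ?(ltW Dt0)// ler_nat leq_subr.
  apply: le_trans (ler_norm _) _; apply: le_trans (additive_first pH nj) _.
  have h : E (fun w => `|A k j.+1 (x ^~ w) ^+ 3 - A k j (x ^~ w) ^+ 3|) <=
      3 / 2 * (Dt * G) * (2 * (C3 K * (n%:R * Dt) / N)).
    apply: (@le_trans _ _ (E (fun w => 3 / 2 * (Dt * G) * (a w j.+1 ^+ 2 + a w j ^+ 2)))).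
      apply: Ex_le; [apply: good_itg; apply: good_norm; have := ga j; have := ga j.+1; gd|by gd|].
      move=> w; rewrite -/(a w j.+1) -/(a w j).
      rewrite (_ : _ - _ = (a w j.+1 - a w j) * (a w j.+1 ^+ 2 + a w j.+1 * a w j + a w j ^+ 2)); last by ring.
      rewrite normrM {1}/a AS -/(a w j) [X in `|X| * _](_ : _ = e w j); last by rewrite /e; ring.
      rewrite [leRHS](_ : _ = (Dt * G) * (3 / 2 * (a w j.+1 ^+ 2 + a w j ^+ 2))); last by ring.
      apply: ler_pM; [by []|by []|exact: e_le|].
      rewrite ger0_norm; first by have := sqr_ge0 (a w j.+1 - a w j); rewrite sqrrB; lra.
      by have := sqr_ge0 (a w j.+1 + a w j); have := sqr_ge0 (a w j.+1); have := sqr_ge0 (a w j); rewrite sqrrD; lra.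
    rewrite ExZ; last by gd.
    rewrite ler_wpM2l//; first by rewrite mulr_ge0// mulr_ge0// ltW.
    rewrite ExD; [|by gd|by gd].
    by have := mono j (ltnW (ltn_ord j)); have := mono j.+1 (ltn_ord j); lra.
  apply: le_trans (ler_wpM2l _ h) _; first by rewrite divr_ge0// ltW.
  by rewrite le_eqVlt; apply/orP; left; apply/eqP; field; rewrite gt_eqF.
(* The mixed term obeys 4 a e^3 <= 2 a^2 e^2 + 2 e^4, which turns 6, 4, 1 into 8 and 3. *)
have B2 (j : 'I_n) : E (fun w => 6 * a w j ^+ 2 * e w j ^+ 2 + 4 * a w j * e w j ^+ 3 + e w j ^+ 4) <=
    (8 * G ^+ 2 * C3 K + 3 * G ^+ 4) * (n%:R * Dt) / N ^+ 2 * Dt.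
  apply: (@le_trans _ _ (E (fun w => 8 * (Dt * G) ^+ 2 * a w j ^+ 2 + 3 * (Dt * G) ^+ 4))).
    apply: Ex_le; [exact: good_itg (gs2 j)|by gd|move=> w].
    have q1 : a w j ^+ 2 * e w j ^+ 2 <= a w j ^+ 2 * (Dt * G) ^+ 2 by rewrite ler_wpM2l ?sqr_ge0.
    have q2 : e w j ^+ 4 <= (Dt * G) ^+ 4.
      by rewrite -[4%N]/(2 * 2)%N !exprM lerXn2r// nnegrE sqr_ge0.
    have := sqr_ge0 (a w j * e w j - e w j ^+ 2).
    rewrite (_ : (_ - _) ^+ 2 = a w j ^+ 2 * e w j ^+ 2 - 2 * (a w j * e w j ^+ 3) + e w j ^+ 4); last by ring.
    move: q1 q2; lra.
  rewrite ExD; [|by gd|by gd]; rewrite Ex_cst ExZ; last by gd.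
  have h := mono j (ltnW (ltn_ord j)).
  have Dt2 : Dt ^+ 2 <= N^-1 * Dt by rewrite expr2 ler_wpM2r// ltW.
  have Dt4 : Dt ^+ 4 <= (n%:R * Dt) / N ^+ 2 * Dt.
    rewrite (_ : Dt ^+ 4 = Dt * Dt ^+ 2 * Dt); last by ring.
    rewrite ler_pM2r// ler_pM ?(ltW Dt0) ?sqr_ge0//.
      by rewrite ler_peMl ?(ltW Dt0)// ler1n.
    by rewrite -exprVn lerXn2r// nnegrE ?invr_ge0 ltW.
  rewrite (_ : (8 * G ^+ 2 * C3 K + 3 * G ^+ 4) * (n%:R * Dt) / N ^+ 2 * Dt =
    8 * G ^+ 2 * C3 K * (n%:R * Dt) / N ^+ 2 * Dt + 3 * G ^+ 4 * (n%:R * Dt) / N ^+ 2 * Dt); last by ring.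
  apply: lerD.
    rewrite (_ : (8 * G ^+ 2 * C3 K) * (n%:R * Dt) / N ^+ 2 * Dt =
      8 * G ^+ 2 * ((N^-1 * Dt) * (C3 K * (n%:R * Dt) / N))); last by field; rewrite gt_eqF.
    rewrite exprMn [8 * (_ * _)](_ : _ = 8 * G ^+ 2 * Dt ^+ 2); last by ring.
    rewrite -mulrA ler_wpM2l ?mulr_ge0 ?sqr_ge0//.
    by apply: ler_pM => //; [exact: sqr_ge0|apply: Ex_ge0 => w; exact: sqr_ge0].
  rewrite exprMn (_ : 3 * G ^+ 4 * (n%:R * Dt) / N ^+ 2 * Dt = 3 * G ^+ 4 * ((n%:R * Dt) / N ^+ 2 * Dt)); last by ring.
  by rewrite [leLHS](_ : _ = 3 * G ^+ 4 * Dt ^+ 4); [apply: ler_wpM2l => //; rewrite mulr_ge0// exprn_ge0|ring].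
have S1 : \sum_(j < n) E (fun w => (a w j.+1 ^+ 3 - a w j ^+ 3) * A (k + j.+1)%N (n - j.+1)%N (x ^~ w)) <=
    n%:R * (3 * C2 K * G * C3 K * (n%:R * Dt) / N ^+ 2 * Dt).
  rewrite -[X in _ <= X%:R * _](card_ord n) mulr_natl -sumr_const.
  by apply: ler_sum => j _; exact: B1.
have S2 : \sum_(j < n) E (fun w => 6 * a w j ^+ 2 * e w j ^+ 2 + 4 * a w j * e w j ^+ 3 + e w j ^+ 4) <=
    n%:R * ((8 * G ^+ 2 * C3 K + 3 * G ^+ 4) * (n%:R * Dt) / N ^+ 2 * Dt).
  rewrite -[X in _ <= X%:R * _](card_ord n) mulr_natl -sumr_const.
  by apply: ler_sum => j _; exact: B2.
rewrite (_ : C5 K * _ / _ = 4 * (n%:R * (3 * C2 K * G * C3 K * (n%:R * Dt) / N ^+ 2 * Dt)) +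
  n%:R * ((8 * G ^+ 2 * C3 K + 3 * G ^+ 4) * (n%:R * Dt) / N ^+ 2 * Dt)); last by rewrite /C5; ring.
by rewrite lerD// ler_pM2l.
Qed.

Let r M := 2 * (C1 * (M * Dt) * G) + 2 * (N * Dt * G + C1 * Dt) * G + N * Dt * G ^+ 2.

(** Again the first summand is peeled off. The cross term is expanded with the Poisson solution,
    whose initial value sits at time k + 1 and is brought back to time k by [step]; the products g u
    at time k collect into the leading sum. The bound [M] keeps the error rate fixed while [n]
    varies in the induction. *)
Lemma additive_second_expansion H k n M : prefix k.+1 H -> (forall c, `|H c| <= 1) -> (n <= M)%N ->
  `|N * E (fun w => H (x ^~ w) * A k n (x ^~ w) ^+ 2) -
    2 * \sum_(l < n) E (fun w => H (x ^~ w) * (Dt * g (k + l)%N (x (k + l)%N w) * u (k + l)%N (x (k + l)%N w))) +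
    2 * E (fun w => H (x ^~ w) * A k n (x ^~ w) * u (k + n)%N (x (k + n)%N w))| <=
    n%:R * Dt * r M%:R.
Proof.
move=> pH H1; elim: n k pH => [|n ih] k pH nM.
  rewrite big_ord0 mulr0 subr0 !(@eq_Ex _ _ _ _ _ (fun=> 0)) => [||w]; first by rewrite Ex_cst !mulr0 addr0 normr0 !mul0r.
    by move=> w; rewrite A0 mulr0 mul0r.
  by rewrite A0 expr0n mulr0.
have gH := gP pH.
have pH' := prefixM pH (@pe k); have gH' := gP pH'.
have g1 : good P (fun w => Dt * g k (x k w)) by exact: (gc (fun i => Dt * g k i)).
have g2 := gA k.+1 n.
have gu l : good P (fun w => u l (x l w)) by exact: gc.
have EH' : E (fun w => `|H (x ^~ w) * (Dt * g k (x k w))|) <= Dt * G.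
  rewrite -[leRHS](Ex_cst P); apply: Ex_le; [exact: good_itg (good_norm gH')|exact: itg_cst|].
  by move=> w; rewrite normrM -[leRHS]mul1r ler_pM.
have EH0 : 0 <= E (fun w => `|H (x ^~ w) * (Dt * g k (x k w))|) by apply: Ex_ge0.
have := ih k.+1 (prefixW (leqnSn _) pH) (ltnW nM).
set a1 := E (fun w => H (x ^~ w) * A k.+1 n (x ^~ w) ^+ 2).
set s1 := \sum_(l < n) _; set b1 := E (fun w => H (x ^~ w) * A k.+1 n (x ^~ w) * _).
have := additive_expansion n (prefixW (leqnSn _) pH').
set a2 := E (fun w => H (x ^~ w) * (Dt * g k (x k w)) * A k.+1 n (x ^~ w)).
set u1 := E (fun w => H (x ^~ w) * (Dt * g k (x k w)) * u k.+1 (x k.+1 w)).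
set u2 := E (fun w => H (x ^~ w) * (Dt * g k (x k w)) * u (k.+1 + n)%N _).
have := step pH'.
set a3 := E (fun w => H (x ^~ w) * (Dt * g k (x k w)) * (Dt * g k (x k w))).
set u0 := E (fun w => H (x ^~ w) * (Dt * g k (x k w)) * u k (x k w)).
move=> h3 h2 h1; rewrite -/u1 in h3.
rewrite (_ : E (fun w => H _ * A k n.+1 _ ^+ 2) = a1 + 2 * a2 + a3); last first.
  rewrite /a1 /a2 /a3 -ExZ; last by gd.
  rewrite -ExD; [|by gd|by gd]; rewrite -ExD; [|by gd|by gd].
  by apply: eq_Ex => w; rewrite AF; ring.
rewrite (_ : E (fun w => H _ * A k n.+1 _ * _) = u2 + b1); last first.
  rewrite /u2 /b1 -ExD; [|by have := gu (k.+1 + n)%N; gd|by have := gu (k.+1 + n)%N; gd].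
  by apply: eq_Ex => w; rewrite AF addSnnS; ring.
rewrite big_ord_recl/= addn0.
rewrite (_ : E (fun w => H _ * (Dt * g k (x k w) * u k (x k w))) = u0); last first.
  by apply: eq_Ex => w; rewrite mulrA.
rewrite (_ : \sum_(i < n) _ = s1); last first.
  by apply: eq_bigr => i _; rewrite /bump leq0n add1n addnS addSn.
have a3b : `|a3| <= Dt * (Dt * G ^+ 2).
  rewrite -[leRHS](Ex_cst P); apply: Ex_norm_le; [by gd|exact: itg_cst|move=> w].
  rewrite (_ : Dt * (Dt * G ^+ 2) = 1 * (Dt * G) * (Dt * G)); last by ring.
  by rewrite normrM; apply: ler_pM => //; rewrite normrM; exact: ler_pM.
have N0' := ltW N0; have Dt0' := ltW Dt0.
have b2 : C1 * (n%:R * Dt) * E (fun w => `|H (x ^~ w) * (Dt * g k (x k w))|) <=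
    C1 * (M%:R * Dt) * (Dt * G).
  rewrite ler_pM// ?mulr_ge0// ler_wpM2l// ler_wpM2r// ler_nat ltnW//.
have b3 : C1 * Dt * E (fun w => `|H (x ^~ w) * (Dt * g k (x k w))|) <= C1 * Dt * (Dt * G).
  by rewrite ler_wpM2l// mulr_ge0.
have b4 : `|N * a3| <= N * (Dt * (Dt * G ^+ 2)) by rewrite normrM gtr0_norm// ler_pM2l.
rewrite (_ : n.+1%:R * Dt * r M%:R = n%:R * Dt * r M%:R + Dt * r M%:R); last first.
  by rewrite -(natr1 n); ring.
rewrite {2}/r.
move: h1 (le_trans h2 b2) (le_trans h3 b3) b4; rewrite !ler_norml.
set q1 := n%:R * Dt * r _; set q2 := C1 * (M%:R * Dt) * (Dt * G); set q3 := C1 * Dt * (Dt * G).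
set q4 := N * (Dt * (Dt * G ^+ 2)).
rewrite (_ : Dt * _ = 2 * q2 + 2 * (q4 + q3) + q4); last by rewrite /q2 /q3 /q4; ring.
set z1 := N * a1; set z2 := N * a2; set z3 := N * a3.
have q40 : 0 <= q4 by rewrite /q4 !mulr_ge0// sqr_ge0.
rewrite (_ : N * (a1 + 2 * a2 + a3) = z1 + 2 * z2 + z3); last by rewrite /z1 /z2 /z3; ring.
clearbody z1 z2 z3 q1 q2 q3 q4; lra.
Qed.

End field.

Section second_moment.
Variables (g : nat -> 'I_d -> R) (G L : R).
Hypotheses (gG : forall l i, `|g l i| <= G)
  (gL : forall l i, `|g l.+1 i - g l i| <= L * Dt) (g0 : forall l, pavg p (g l) = 0).
Let A k n (c : nat -> 'I_d) := \sum_(l < n) Dt * g (k + l)%N (c (k + l)%N).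
Let u l := poisson Q p (g l).
Let v l := 2 * pavg p (fun i => g l i * u l i).
Let G0 : 0 <= G. Proof. exact: le_trans (gG 0 i0). Qed.
Let N0 : 0 < N. Proof. exact: lt_le_trans N1. Qed.
Let L0 : 0 <= L.
Proof. by rewrite -(pmulr_lge0 _ Dt0) (le_trans _ (gL 0 i0)). Qed.

(** The fluctuation of g u around its average is itself a centered, slowly varying field, so
    [additive_first] applies to it and replaces g u by its average at cost O(1/N). *)
Let g' l i := g l i * u l i - pavg p (fun i => g l i * u l i).
Let G' := 2 * (G * (D * G)).
Let L' := 2 * (L * (D * G) + G * (D * L)).

Let guG l i : `|g l i * u l i| <= G * (D * G).
Proof. by rewrite normrM ler_pM//; exact: poissonD. Qed.

Let guL l i : `|g l.+1 i * u l.+1 i - g l i * u l i| <= (L * (D * G) + G * (D * L)) * Dt.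
Proof.
rewrite (_ : _ - _ = (g l.+1 i - g l i) * u l.+1 i +
   g l i * poisson Q p (fun j => g l.+1 j - g l j) i); last by rewrite (poissonB Q p (g l.+1) (g l)) /u; ring.
rewrite (le_trans (ler_normD _ _))// [leRHS]mulrDl lerD// normrM.
  by rewrite [leRHS]mulrAC ler_pM//; exact: poissonD.
by rewrite -[leRHS]mulrA ler_pM// -mulrA; apply: poissonD => j.
Qed.

Let g'G l i : `|g' l i| <= G'.
Proof.
rewrite (le_trans (ler_normB _ _))// /G' mulr_natl mulr2n lerD//.
exact: (pavg_norm inv_p).
Qed.

Let g'L l i : `|g' l.+1 i - g' l i| <= L' * Dt.
Proof.
rewrite (_ : _ - _ = (g l.+1 i * u l.+1 i - g l i * u l i) -
  pavg p (fun i => g l.+1 i * u l.+1 i - g l i * u l i)); last first.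
  rewrite /pavg; under [in RHS]eq_bigr do rewrite mulrBr.
  by rewrite sumrB /g' /pavg; ring.
rewrite (le_trans (ler_normB _ _))// /L' -mulrA mulr_natl mulr2n lerD//.
by apply: (pavg_norm inv_p) => j.
Qed.

Let g'0 l : pavg p (g' l) = 0.
Proof.
rewrite /pavg /g'; under eq_bigr do rewrite mulrBr.
by rewrite sumrB -mulr_suml; have [_ _ ->] := inv_p; rewrite mul1r subrr.
Qed.

Let C1 := D * L + CP * (d%:R * (D * G)).
Let C2 K := 2 * (D * G) + C1 * K.
Let C3 K := 2 * G * C2 K + G ^+ 2.
Let C2' K := 2 * (D * G') + (D * L' + CP * (d%:R * (D * G'))) * K.
Let s := Num.sqrt N.

Let s0 : 0 < s. Proof. by rewrite sqrtr_gt0. Qed.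
Let sN : s ^+ 2 = N. Proof. by rewrite sqr_sqrtr// ltW. Qed.
Let s1 : 1 <= s. Proof. by rewrite -sqrtr1 ler_wsqrtr. Qed.
Let Ns : N^-1 <= s^-1.
Proof. by rewrite lef_pV2 ?posrE// -sN expr2 ler_peMr// ltW. Qed.

(** The boundary term is controlled by the mean of |A|, of order 1/sqrt N, which fixes the rate. The
    part 2 C1 G t^2 does not vanish with N; it is the error from conditioning only at the start of
    the interval. *)
Lemma additive_second H k n K : prefix k.+1 H -> (forall c, `|H c| <= 1) -> n%:R * Dt <= K ->
  `|N * E (fun w => H (x ^~ w) * A k n (x ^~ w) ^+ 2) -
    (\sum_(l < n) Dt * v (k + l)%N) * E (fun w => H (x ^~ w))| <=
    2 * C1 * G * (n%:R * Dt) ^+ 2 +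
    (D * G * (1 + C3 K * K) + 2 * C2' K + K * (3 * G ^+ 2 + 2 * C1 * G)) / s.
Proof.
move=> pH H1 nK; have gH := gP pH.
have t0 : 0 <= n%:R * Dt by rewrite mulr_ge0// ltW.
have K0 : 0 <= K by exact: le_trans nK.
have gA : good P (fun w => A k n (x ^~ w)).
  have pA : prefix (k + n) (A k n).
    by move=> c c' cc'; apply: eq_bigr => l _; rewrite cc'// ltn_add2l.
  exact: gP pA.
have gf (f : 'I_d -> R) l : good P (fun w => f (x l w)).
  have pc : prefix l.+1 (fun c => f (c l)) by move=> c c' ->.
  exact: gP pc.
have gu := gf (u (k + n)%N) (k + n)%N.
have C30 : 0 <= C3 K by rewrite /C3 /C2 /C1; nneg; rewrite sqr_ge0.
pose E1 := E (fun w => H (x ^~ w) * A k n (x ^~ w) ^+ 2).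
pose E3 := E (fun w => H (x ^~ w) * A k n (x ^~ w) * u (k + n)%N (x (k + n)%N w)).
have h1 : `|N * E1 - 2 * \sum_(l < n) E (fun w => H (x ^~ w) *
      (Dt * g (k + l)%N (x (k + l)%N w) * u (k + l)%N (x (k + l)%N w))) + 2 * E3| <=
    n%:R * Dt * (2 * (C1 * (n%:R * Dt) * G) + 2 * (N * Dt * G + C1 * Dt) * G + N * Dt * G ^+ 2).
  have h := additive_second_expansion gG gL g0 pH H1 (leqnn n).
  exact h.
have h2 := additive_first g'G g'L g'0 pH nK.
have h3 := additive_second_bound gG gL g0 k nK.
rewrite -/A -/u -/C1 -/(C2 K) -/(C3 K) in h2 h3.
have EH : E (fun w => `|H (x ^~ w)|) <= 1.
  rewrite -[leRHS](Ex_cst P); apply: Ex_le => //; [exact: good_itg (good_norm gH)|exact: itg_cst].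
have EH0 : 0 <= E (fun w => `|H (x ^~ w)|) by exact: Ex_ge0.
have {}h2 : `|E (fun w => H (x ^~ w) * \sum_(l < n) Dt * g' (k + l)%N (x (k + l)%N w))| <= C2' K / s.
  apply: (le_trans h2); rewrite -[leRHS]mulr1 ler_pM//.
    by rewrite divr_ge0 ?(ltW N0)// /C2' /L' /G'; nneg.
  by rewrite ler_wpM2l// /C2' /L' /G'; nneg.
have hA : E (fun w => `|A k n (x ^~ w)|) <= (1 + C3 K * K) / s / 2.
  have s'0 : 0 < s^-1 by rewrite invr_gt0.
  apply: le_trans (Ex_sqr_le (good_itg gA) (good_itg (goodX 2 gA)) s'0) _.
  rewrite ler_pM2r ?invr_gt0// invrK mulrDl mul1r lerD2l.
  apply: (@le_trans _ _ (s * (C3 K * K / N))).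
    rewrite ler_pM2l// (le_trans h3)// ler_wpM2r ?invr_ge0 ?(ltW N0)// ler_wpM2l//.
  by rewrite -sN le_eqVlt; apply/orP; left; apply/eqP; field; rewrite gt_eqF.
have hb : `|E (fun w => H (x ^~ w) * A k n (x ^~ w) * u (k + n)%N (x (k + n)%N w))| <=
    D * G * ((1 + C3 K * K) / s / 2).
  apply: (@le_trans _ _ (E (fun w => D * G * `|A k n (x ^~ w)|))).
    apply: Ex_norm_le; [by gd|by gd|move=> w].
    rewrite !normrM mulrC; apply: ler_pM => //; first exact: poissonD.
    by rewrite ler_piMl.
  rewrite ExZ; last by gd.
  by rewrite ler_wpM2l// mulr_ge0.
have hs : 2 * \sum_(l < n) E (fun w => H (x ^~ w) * (Dt * g (k + l)%N (x (k + l)%N w) * u (k + l)%N (x (k + l)%N w))) =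
   2 * E (fun w => H (x ^~ w) * \sum_(l < n) Dt * g' (k + l)%N (x (k + l)%N w)) +
   (\sum_(l < n) Dt * v (k + l)%N) * E (fun w => H (x ^~ w)).
  have gl (l : 'I_n) : good P (fun w => H (x ^~ w) * (Dt * g (k + l)%N (x (k + l)%N w) * u (k + l)%N (x (k + l)%N w))).
    exact: (goodM gH (gf (fun i => Dt * g (k + l)%N i * u (k + l)%N i) (k + l)%N)).
  rewrite -Ex_sum => [|l]; last exact: good_itg (gl l).
  have gl' : good P (fun w => H (x ^~ w) * \sum_(l < n) Dt * g' (k + l)%N (x (k + l)%N w)).
    apply: goodM => //; apply: good_sum => l; exact: (gf (fun i => Dt * g' (k + l)%N i)).
  rewrite -!ExZ; [|by gd|by gd|apply: good_itg; exact: good_sum].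
  rewrite -ExD; [|by gd|by gd]; apply: eq_Ex => w.
  have e (l : 'I_n) : 2 * (H (x ^~ w) * (Dt * g (k + l)%N (x (k + l)%N w) * u (k + l)%N (x (k + l)%N w))) =
      2 * (H (x ^~ w) * (Dt * g' (k + l)%N (x (k + l)%N w))) + (Dt * v (k + l)%N) * H (x ^~ w).
    by rewrite /g' /v; ring.
  by rewrite [LHS]mulr_sumr (eq_bigr _ (fun l _ => e l)) big_split/= -[in LHS]mulr_sumr -[in LHS]mulr_sumr -mulr_suml.
have hr : n%:R * Dt * (2 * (C1 * (n%:R * Dt) * G) + 2 * (N * Dt * G + C1 * Dt) * G + N * Dt * G ^+ 2) <=
    2 * C1 * G * (n%:R * Dt) ^+ 2 + K * (3 * G ^+ 2 + 2 * C1 * G) / s.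
  have C10 : 0 <= C1 by rewrite /C1; nneg.
  have q1 : N * Dt <= s^-1 by exact: le_trans Dt_le Ns.
  have q2 : Dt <= s^-1 by apply: le_trans q1; rewrite ler_peMl// ltW.
  rewrite (_ : n%:R * Dt * _ = 2 * C1 * G * (n%:R * Dt) ^+ 2 +
     n%:R * Dt * (3 * G ^+ 2 * (N * Dt) + 2 * C1 * G * Dt)); last by ring.
  rewrite lerD2l -[leRHS]mulrA; apply: ler_pM => //.
    by rewrite addr_ge0// mulr_ge0// ?mulr_ge0 ?sqr_ge0 ?(ltW N0)// ltW.
  by rewrite [leRHS]mulrDl lerD// ler_wpM2l// !mulr_ge0// sqr_ge0.
move: (le_trans h1 hr) h2 hb; rewrite hs -/E1 -/E3 !ler_norml.
rewrite (_ : (D * G * (1 + C3 K * K) + 2 * C2' K + K * (3 * G ^+ 2 + 2 * C1 * G)) / s =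
  2 * (D * G * ((1 + C3 K * K) / s / 2)) + 2 * (C2' K / s) + K * (3 * G ^+ 2 + 2 * C1 * G) / s); last first.
  by field; rewrite gt_eqF.
set z1 := D * G * _; set z2 := C2' K / s; set z3 := K * _ / s; set z4 := 2 * C1 * G * _.
set z5 := _ * E (fun w => H _); set z6 := N * E1; set z7 := E (fun w => H _ * _).
clearbody z1 z2 z3 z4 z5 z6 z7 E3; lra.
Qed.

End second_moment.

End chain_moments.

Lemma chain_moments (R : realType) (d : nat) (Q : 'M[R]_d) (p : 'cV[R]_d) (CP G L K : R) :
  is_generator Q -> invariant_distribution Q p ->
  (forall p', invariant_distribution Q p' -> p' = p) ->
  0 <= CP -> 0 <= G -> 0 <= L -> 0 <= K ->
  exists2 C, 0 <= C & forall (disp : measure_display) (T : measurableType disp)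
    (P : probability T R) (x : nat -> T -> 'I_d) (Pm : 'M[R]_d) (N Dt : R),
  'I_d ->
  (forall l i, measurable (x l @^-1` [set i])) ->
  (forall l (H : (nat -> 'I_d) -> R) (phi : 'I_d -> R), prefix l.+1 H ->
    Ex P (fun w => H (x ^~ w) * phi (x l.+1 w)) =
    Ex P (fun w => H (x ^~ w) * \sum_j Pm (x l w) j * phi j)) ->
  1 <= N -> 0 < Dt -> N ^+ 2 * Dt <= 1 ->
  (forall i j, `|Pm i j - (i == j)%:R - N * Dt * Q i j| <= CP * (N * Dt) ^+ 2) ->
  forall g : nat -> 'I_d -> R, (forall l i, `|g l i| <= G) ->
    (forall l i, `|g l.+1 i - g l i| <= L * Dt) -> (forall l, pavg p (g l) = 0) ->
  forall k n, n%:R * Dt <= K ->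
  let A w := \sum_(l < n) Dt * g (k + l)%N (x (k + l)%N w) in
  [/\ Ex P (fun w => A w ^+ 2) <= C * (n%:R * Dt) / N,
      Ex P (fun w => A w ^+ 4) <= C * (n%:R * Dt) ^+ 2 / N ^+ 2
    & forall H, prefix k.+1 H -> (forall c, `|H c| <= 1) ->
      `|Ex P (fun w => H (x ^~ w) * A w)| <= C / N /\
      `|N * Ex P (fun w => H (x ^~ w) * A w ^+ 2) -
        (\sum_(l < n) Dt * (2 * pavg p (fun i => g (k + l)%N i * poisson Q p (g (k + l)%N) i))) *
        Ex P (fun w => H (x ^~ w))| <= C * (n%:R * Dt) ^+ 2 + C / Num.sqrt N].
Proof.
move=> genQ inv_p uniq_p CP0 G0 L0 K0.
have [D D0 pD] := poisson_bound Q p.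
pose G' := 2 * (G * (D * G)).
pose L' := 2 * (L * (D * G) + G * (D * L)).
pose C1 := D * L + CP * (d%:R * (D * G)).
pose C2 := 2 * (D * G) + C1 * K.
pose C3 := 2 * G * C2 + G ^+ 2.
pose C2' := 2 * (D * G') + (D * L' + CP * (d%:R * (D * G'))) * K.
pose C5 := 12 * C2 * G * C3 + 8 * G ^+ 2 * C3 + 3 * G ^+ 4.
pose C6 := D * G * (1 + C3 * K) + 2 * C2' + K * (3 * G ^+ 2 + 2 * C1 * G).
have C10 : 0 <= C1 by rewrite /C1; nneg.
have C20 : 0 <= C2 by rewrite /C2; nneg.
have C30 : 0 <= C3 by rewrite /C3; nneg; rewrite sqr_ge0.
have C20' : 0 <= C2' by rewrite /C2' /G' /L'; nneg.
have C50 : 0 <= C5.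
  by rewrite /C5; nneg; rewrite ?sqr_ge0// -[4%N]/(2 * 2)%N exprM sqr_ge0.
have C60 : 0 <= C6 by rewrite /C6; nneg; rewrite sqr_ge0.
pose C := C3 + C5 + C2 + 2 * C1 * G + C6.
have C0 : 0 <= 2 * C1 * G by nneg.
have cC3 : C3 <= C by rewrite /C; lra.
have cC5 : C5 <= C by rewrite /C; lra.
have cC2 : C2 <= C by rewrite /C; lra.
have cC1 : 2 * C1 * G <= C by rewrite /C; lra.
have cC6 : C6 <= C by rewrite /C; lra.
exists C => [|disp T P x Pm N Dt i0 mx mk N1 Dt0 NDt PmQ g gG gL g0 k n nK A].
  by rewrite (le_trans C30).
have N0 : 0 < N by exact: lt_le_trans N1.
have t0 : 0 <= n%:R * Dt by rewrite mulr_ge0// ltW.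
split.
- have h := (additive_second_bound i0 mx mk genQ inv_p uniq_p CP0 D0 N1 Dt0 NDt PmQ pD gG gL g0 k nK).
  apply: (le_trans h).
  by rewrite ler_wpM2r ?invr_ge0 ?(ltW N0)// ler_wpM2r.
- apply: le_trans (additive_fourth i0 mx mk genQ inv_p uniq_p CP0 D0 N1 Dt0 NDt PmQ pD gG gL g0 k nK) _.
  by rewrite ler_wpM2r ?invr_ge0 ?exprn_ge0 ?(ltW N0)// ler_wpM2r// sqr_ge0.
move=> H pH H1; split.
  apply: le_trans (additive_first i0 mx mk genQ inv_p uniq_p CP0 D0 N1 Dt0 NDt PmQ pD gG gL g0 pH nK) _.
  have gH := good_prefix P i0 mx pH.
  have EH : Ex P (fun w => `|H (x ^~ w)|) <= 1.
    by rewrite -[leRHS](Ex_cst P); apply: Ex_le => //; [exact: good_itg (good_norm gH)|exact: itg_cst].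
  rewrite -[leRHS]mulr1 ler_pM// ?Ex_ge0// ?divr_ge0 ?(ltW N0)//.
  by rewrite ler_wpM2r ?invr_ge0 ?(ltW N0).
apply: le_trans (additive_second i0 mx mk genQ inv_p uniq_p CP0 D0 N1 Dt0 NDt PmQ pD gG gL g0 pH H1 nK) _.
rewrite lerD//; first by rewrite ler_wpM2r// sqr_ge0.
by rewrite ler_wpM2r// invr_ge0 sqrtr_ge0.
Qed.

(** * Ito integrals and Gaussian sums *)

Section measurable_wrt.
Context {R : realType} {disp : measure_display} {T : measurableType disp}.
Implicit Types (G : set (set T)) (X Y Z : T -> R).

Definition fmeas G Z := forall A, measurable A -> G (Z @^-1` A).

Section closure.
Variable G : set (set T).
Hypothesis sG : sigma_algebra setT G.

Let TG : measurableType _ := g_sigma_algebraType G.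

(** Regarding [G] as the sigma-algebra of a measurable type makes all closure properties of
    measurable functions available for [fmeas]. *)
Lemma fmeasP Z : fmeas G Z <-> @measurable_fun _ _ TG R setT Z.
Proof.
have mE : @measurable _ TG = G by exact: measurable_g_measurableTypeE.
split=> h; first by move=> _ A mA; rewrite setTI mE; exact: h.
by move=> A mA; rewrite -mE -[X in measurable X]setTI; apply: h.
Qed.

Lemma fmeas_cst c : fmeas G (fun=> c).
Proof. by apply/fmeasP; exact: measurable_cst. Qed.

Lemma fmeasD X Y : fmeas G X -> fmeas G Y -> fmeas G (fun w => X w + Y w).
Proof. by move=> /fmeasP hX /fmeasP hY; apply/fmeasP; exact: measurable_funD. Qed.

Lemma fmeasB X Y : fmeas G X -> fmeas G Y -> fmeas G (fun w => X w - Y w).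
Proof. by move=> /fmeasP hX /fmeasP hY; apply/fmeasP; exact: measurable_funB. Qed.

Lemma fmeasM X Y : fmeas G X -> fmeas G Y -> fmeas G (fun w => X w * Y w).
Proof. by move=> /fmeasP hX /fmeasP hY; apply/fmeasP; exact: measurable_funM. Qed.

Lemma fmeasX X n : fmeas G X -> fmeas G (fun w => X w ^+ n).
Proof. by move=> /fmeasP hX; apply/fmeasP; exact: measurable_funX. Qed.

Lemma fmeas_sum I (s : seq I) (X : I -> T -> R) : (forall i, fmeas G (X i)) ->
  fmeas G (fun w => \sum_(i <- s) X i w).
Proof.
move=> fX; elim: s => [|i s ih].
  by under [fun w => _]eq_fun do rewrite big_nil; exact: fmeas_cst.
by under [fun w => _]eq_fun do rewrite big_cons; exact: fmeasD.
Qed.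

Lemma fmeas_lip (U : nat -> T -> R) k L F : 0 <= L -> lip k L F ->
  (forall i, (i < k)%N -> fmeas G (U i)) -> fmeas G (fun w => F (U ^~ w)).
Proof.
move=> L0 lF fU.
pose U' i w := if (i < k)%N then U i w else 0.
have -> : (fun w => F (U ^~ w)) = (fun w => F (U' ^~ w)).
  apply/funext => w; apply/eqP; rewrite -subr_eq0 -normr_le0 (le_trans (lF _ _))//.
  by rewrite big1 ?mulr0// => i _; rewrite /U' ltn_ord subrr normr0.
apply/fmeasP; apply: (lip_measurable L0 lF) => i; rewrite /U'.
case ik : (i < k)%N; last exact: measurable_cst.
by apply/fmeasP; exact: fU.
Qed.

End closure.

Lemma fmeas_sub G G' Z : G `<=` G' -> fmeas G Z -> fmeas G' Z.
Proof. by move=> GG' fZ A mA; apply: GG'; exact: fZ. Qed.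

Lemma fmeas_measurable G Z : G `<=` measurable -> fmeas G Z -> measurable_fun setT Z.
Proof. by move=> mG fZ _ A mA; rewrite setTI; apply: mG; exact: fZ. Qed.

End measurable_wrt.

(** * Moments and orthogonality of Brownian increments *)

Section brownian_increments.
Context {R : realType} {disp : measure_display} {T : measurableType disp}.
Variables (P : probability T R) (F : R -> set (set T)) (B : R -> T -> R).
Hypotheses (fF : is_filtration F) (bm : is_brownian_motion P F B).
Local Notation E := (Ex P).
Implicit Types (s t u : R) (Z : T -> R).

Lemma filtration_sigma t : 0 <= t -> sigma_algebra setT (F t).
Proof. by have [] := fF => h _ _; exact: h. Qed.

Lemma filtration_measurable t : 0 <= t -> F t `<=` measurable.
Proof. by have [] := fF => _ h _; exact: h. Qed.

Lemma fmeas_filtration s t Z : 0 <= s -> s <= t -> fmeas (F s) Z -> fmeas (F t) Z.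
Proof. by move=> s0 st; apply: fmeas_sub; have [_ _] := fF; apply. Qed.

Lemma adapted_fmeas (Y : R -> T -> R) t : adapted measurable F Y -> 0 <= t -> fmeas (F t) (Y t).
Proof.
by move=> aY t0 A mA; apply: aY => //; exists A => //; rewrite setTI.
Qed.

Lemma brownian_fmeas t : 0 <= t -> fmeas (F t) (B t).
Proof. by have [aB _ _ _ _] := bm; exact: adapted_fmeas. Qed.

Let incr s t w := B t w - B s w.

Lemma incr_fmeas s t : 0 <= s -> s <= t -> fmeas (F t) (incr s t).
Proof.
move=> s0 st; have t0 := le_trans s0 st; apply: fmeasB; first exact: filtration_sigma.
  exact: brownian_fmeas.
by apply: fmeas_filtration (brownian_fmeas s0).
Qed.

Lemma incr_measurable s t : 0 <= s -> s <= t -> measurable_fun setT (incr s t).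
Proof.
move=> s0 st; apply: fmeas_measurable (incr_fmeas s0 st).
exact: filtration_measurable (le_trans s0 st).
Qed.

Let law s t : 0 <= s -> s < t -> forall A, measurable A ->
  P (incr s t @^-1` A) = normal_prob 0 (Num.sqrt (t - s)) A.
Proof. by move=> s0 st A mA; have [_ _ _ l _] := bm; exact: l. Qed.

Lemma incr_good s t : 0 <= s -> s <= t -> good P (incr s t).
Proof.
move=> s0; rewrite le_eqVlt => /predU1P[<-|st].
  rewrite (_ : incr s s = fun=> 0); first exact: good_cst.
  by apply/funext => w; rewrite /incr subrr.
apply: (@normal_rv_good _ _ _ _ _ (Num.sqrt (t - s))); first by rewrite sqrtr_gt0 subr_gt0.
  exact: incr_measurable (ltW st).
exact: law.
Qed.

Let incr_pow s t k : 0 <= s -> s < t ->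
  E (fun w => incr s t w ^+ k) = \int[normal_prob 0 (Num.sqrt (t - s))]_x (x ^+ k).
Proof.
move=> s0 st; apply: Ex_normal_pow; first by rewrite sqrtr_gt0 subr_gt0.
  exact: incr_measurable (ltW st).
exact: law.
Qed.

Let Ex_incr0 s k : (0 < k)%N -> E (fun w => incr s s w ^+ k) = 0.
Proof.
move=> k0; rewrite -[RHS](Ex_cst P); apply: eq_Ex => w.
by rewrite /incr subrr expr0n eqn0Ngt k0.
Qed.

Lemma incr_odd s t k : 0 <= s -> s <= t -> odd k -> E (fun w => incr s t w ^+ k) = 0.
Proof.
move=> s0; rewrite le_eqVlt => /predU1P[<- ok|st ok]; first by rewrite Ex_incr0//; case: k ok.
by rewrite incr_pow// normal_odd// sqrtr_gt0 subr_gt0.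
Qed.

Lemma incr_second s t : 0 <= s -> s <= t -> E (fun w => incr s t w ^+ 2) = t - s.
Proof.
move=> s0; rewrite le_eqVlt => /predU1P[<-|st]; first by rewrite Ex_incr0// subrr.
by rewrite incr_pow// normal_variance ?sqrtr_gt0 ?subr_gt0// sqr_sqrtr// subr_ge0 ltW.
Qed.

Lemma incr_fourth s t : 0 <= s -> s <= t -> E (fun w => incr s t w ^+ 4) <= 32 * (t - s) ^+ 2.
Proof.
move=> s0; rewrite le_eqVlt => /predU1P[<-|st]; first by rewrite Ex_incr0// subrr expr0n mulr0.
rewrite incr_pow// (le_trans (normal_fourth _))// ?sqrtr_gt0 ?subr_gt0//.
by rewrite -[4%N]/(2 * 2)%N exprM sqr_sqrtr// subr_ge0 ltW.
Qed.

Lemma incr_indep Z s t k : 0 <= s -> s <= t -> good P Z -> fmeas (F s) Z ->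
  E (fun w => Z w * incr s t w ^+ k) = E Z * E (fun w => incr s t w ^+ k).
Proof.
move=> s0 st gZ fZ; have gi := incr_good s0 st.
move: st; rewrite le_eqVlt => /predU1P[<-|st].
  have [->|k0] := posnP k.
    by under eq_Ex do rewrite expr0 mulr1; under [X in _ * X]eq_Ex do rewrite expr0; rewrite Ex_cst mulr1.
  rewrite Ex_incr0// mulr0 -[RHS](Ex_cst P); apply: eq_Ex => w.
  by rewrite /incr subrr expr0n eqn0Ngt k0 mulr0.
apply: (@Ex_indep _ _ _ P (F s)) => [//||//|A A' FA mA']; first exact: goodX.
have [_ _ _ _ ind] := bm; apply: (ind s t s0 st) => //.
exists ((fun x => x ^+ k) @^-1` A'); last by rewrite setTI.
by rewrite -[X in measurable X]setTI; exact: exprn_measurable.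
Qed.

Lemma incr_orth Z s t : 0 <= s -> s <= t -> good P Z -> fmeas (F s) Z ->
  E (fun w => Z w * incr s t w) = 0.
Proof.
move=> s0 st gZ fZ; have := incr_indep 1 s0 st gZ fZ.
by rewrite (incr_odd s0 st (k := 1))// mulr0.
Qed.

Lemma incr_square Z s t : 0 <= s -> s <= t -> good P Z -> fmeas (F s) Z ->
  E (fun w => Z w * incr s t w ^+ 2) = E Z * (t - s).
Proof. by move=> s0 st gZ fZ; rewrite incr_indep// incr_second. Qed.

(** Length of the intersection of the intervals ]a, b] and ]a', b']. *)
Definition overlap (a b a' b' : R) : R := Num.max 0 (Num.min b b' - Num.max a a').

Lemma overlapC a b a' b' : overlap a b a' b' = overlap a' b' a b.
Proof. by rewrite /overlap (minC b) (maxC a). Qed.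

(** With a <= a', disjoint intervals give an increment orthogonal to everything before it. Otherwise
    the part before a' is orthogonal, and from the common start a' the longer increment is the
    shorter one plus a later, orthogonal piece. *)
Lemma overlap_isometry c c' a b a' b' : 0 <= a -> a <= b -> 0 <= a' -> a' <= b' ->
  good P c -> fmeas (F a) c -> good P c' -> fmeas (F a') c' ->
  E (fun w => (c w * incr a b w) * (c' w * incr a' b' w)) =
  E (fun w => c w * c' w) * overlap a b a' b'.
Proof.
wlog aa' : c c' a b a' b' / a <= a'.
  move=> h a0 ab a0' ab' gc fc gc' fc'; have [aa'|/ltW aa'] := leP a a'; first exact: h.
  rewrite overlapC; have := h c' c a' b' a b aa' a0' ab' a0 ab gc' fc' gc fc.
  by under eq_Ex do rewrite mulrC; move=> ->; congr (_ * _); apply: eq_Ex => w; rewrite mulrC.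
move=> a0 ab a0' ab' gc fc gc' fc'.
have sF s := filtration_sigma (t := s).
have gI s t : 0 <= s -> s <= t -> good P (incr s t) by exact: incr_good.
have gab := gI _ _ a0 ab; have gab' := gI _ _ a0' ab'.
have fc'' : fmeas (F a') c by exact: fmeas_filtration fc.
have gcc : good P (fun w => c w * c' w) by exact: goodM.
have fcc : fmeas (F a') (fun w => c w * c' w) by apply: fmeasM => //; exact: sF.
have [ba'|a'b] := leP b a'.
  rewrite (_ : overlap _ _ _ _ = 0) ?mulr0.
    have fi : fmeas (F a') (incr a b).
      by apply: fmeas_filtration (incr_fmeas a0 ab) => //; exact: le_trans ab.
    rewrite -[RHS](@incr_orth (fun w => c w * c' w * incr a b w) a' b')//.
    - by apply: eq_Ex => w; ring.
    - exact: goodM.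
    - by apply: fmeasM => //; exact: sF.
  apply/max_idPl; rewrite subr_le0 (max_idPr aa') (le_trans _ ba')//.
  by rewrite ge_min lexx.
have key b1 b2 (e1 e2 : T -> R) : a' <= b1 -> b1 <= b2 ->
    E (fun w => c w * c' w * (incr a' b1 w * incr a' b2 w)) = E (fun w => c w * c' w) * (b1 - a').
  move=> ab1 b12; have b10 := le_trans a0' ab1.
  rewrite (@eq_Ex _ _ _ _ _ (fun w => c w * c' w * incr a' b1 w ^+ 2 +
    c w * c' w * incr a' b1 w * incr b1 b2 w)); last by move=> w; rewrite /incr; ring.
  have g1 := gI _ _ a0' ab1; have g2 := gI _ _ b10 b12.
  rewrite ExD; [|by gd|by gd]; rewrite incr_square// incr_orth ?addr0//; first by gd.
  apply: fmeasM; [exact: sF|by exact: fmeas_filtration fcc|exact: incr_fmeas].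
have gaa := gI _ _ a0 aa'; have ga'b := gI _ _ a0' (ltW a'b).
rewrite (@eq_Ex _ _ _ _ _ (fun w => c w * c' w * incr a a' w * incr a' b' w +
    c w * c' w * (incr a' b w * incr a' b' w))); last by move=> w; rewrite /incr; ring.
rewrite ExD; [|by gd|by gd]; rewrite incr_orth// ?add0r; first last.
- by apply: fmeasM; [exact: sF|done|exact: incr_fmeas].
- by gd.
rewrite /overlap (max_idPr aa'); have [bb'|/ltW b'b] := leP b b'.
  rewrite (max_idPr _) ?subr_ge0 ?(ltW a'b)//; exact: key (ltW a'b) bb'.
rewrite (max_idPr _) ?subr_ge0// -(key b' b c c ab' b'b).
by apply: eq_Ex => w; rewrite [incr a' b w * _]mulrC.
Qed.

End brownian_increments.

Lemma integral_EFin (R : realType) (disp : measure_display) (T : measurableType disp)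
    (P : probability T R) (X : T -> R) : itg P X ->
  (\int[P]_w (X w)%:E = (Ex P X)%:E)%E.
Proof. by move=> iX; rewrite EFin_Ex// unlock. Qed.

(** * Mean-square distance on time times outcomes *)

Section square_norm.
Context {R : realType} {disp : measure_display} {T : measurableType disp}.
Variable P : probability T R.
Local Notation mu := (@lebesgue_measure R).
Local Notation RT := (measurableTypeR R * T)%type.
Implicit Types (h : RT -> R).

Definition sqnorm h : \bar R := (\int[P]_w \int[mu]_s ((h (s, w)) ^+ 2)%:E)%E.

Let msq h : measurable_fun setT h -> measurable_fun setT (fun z => ((h z) ^+ 2)%:E).
Proof. by move=> mh; apply/measurable_EFinP; exact: measurable_funX. Qed.

Let sq0 h z : (0 <= ((h z) ^+ 2)%:E)%E. Proof. by rewrite lee_fin sqr_ge0. Qed.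

Lemma sqnorm_product h : measurable_fun setT h ->
  sqnorm h = (\int[mu \x P]_z ((h z) ^+ 2)%:E)%E.
Proof.
by move=> mh; rewrite (@fubini_tonelli2 _ _ _ _ _ mu P (fun z => ((h z) ^+ 2)%:E))//; exact: msq.
Qed.

Lemma sqnorm_swap h : measurable_fun setT h ->
  sqnorm h = (\int[mu]_s \int[P]_w ((h (s, w)) ^+ 2)%:E)%E.
Proof.
move=> mh; rewrite sqnorm_product//.
by rewrite (@fubini_tonelli1 _ _ _ _ _ mu P (fun z => ((h z) ^+ 2)%:E))//; exact: msq.
Qed.

Lemma sqnormB h1 h2 h3 : measurable_fun setT h1 -> measurable_fun setT h2 ->
  measurable_fun setT h3 ->
  (sqnorm (fun z => h1 z - h2 z)%R <=
    2%:E * sqnorm (fun z => h1 z - h3 z)%R + 2%:E * sqnorm (fun z => h2 z - h3 z)%R)%E.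
Proof.
move=> m1 m2 m3.
have m12 := measurable_funB m1 m2; have m13 := measurable_funB m1 m3.
have m23 := measurable_funB m2 m3.
rewrite !sqnorm_product// -!ge0_integralZl_EFin//; try exact: msq.
rewrite -ge0_integralD//; first last.
- by apply: measurable_funeM; exact: (msq m23).
- by move=> z _; rewrite mule_ge0 ?lee_fin ?sqr_ge0.
- by apply: measurable_funeM; exact: (msq m13).
- by move=> z _; rewrite mule_ge0 ?lee_fin ?sqr_ge0.
apply: ge0_le_integral => //.
- by move=> z _; rewrite lee_fin sqr_ge0.
- exact: (msq m12).
- by apply: emeasurable_funD; apply: measurable_funeM; [exact: (msq m13)|exact: (msq m23)].
move=> z _; rewrite -!EFinM -EFinD lee_fin.
have := sqr_ge0 (h1 z - h3 z + (h2 z - h3 z)).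
rewrite -subr_ge0 [X in _ -> 0 <= X](_ : _ = (h1 z - h3 z + (h2 z - h3 z)) ^+ 2)//; ring.
by move=> z _; rewrite lee_fin sqr_ge0.
by move=> z _; rewrite lee_fin sqr_ge0.
Qed.

Lemma sqnorm_le h t r : 0 <= t -> 0 <= r -> measurable_fun setT h ->
  (forall s w, ~ (0 < s <= t) -> h (s, w) = 0) ->
  (forall s, 0 < s <= t -> itg P (fun w => h (s, w) ^+ 2) /\ Ex P (fun w => h (s, w) ^+ 2) <= r) ->
  (sqnorm h <= (r * t)%:E)%E.
Proof.
move=> t0 r0 mh h0 hr; rewrite sqnorm_swap//.
apply: (@le_trans _ _ (\int[mu]_s (r * \1_(`]0, t]%classic) s)%:E)%E); last first.
  under eq_integral do rewrite EFinM.
  rewrite ge0_integralZl_EFin//; last first.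
    by apply/measurable_EFinP; apply: measurable_indic; exact: measurable_itv.
  rewrite integral_indic//= setIT lebesgue_measure_itv/= lte_fin.
  case: ifPn => _; first by rewrite -EFinD subr0 -EFinM.
  by rewrite mule0 lee_fin mulr_ge0.
apply: ge0_le_integral => //.
- by move=> s _; apply: integral_ge0 => w _; exact: sq0.
- exact: (@measurable_fun_fubini_tonelli_F _ _ _ _ _ P (fun z => ((h z) ^+ 2)%:E) (msq mh) (sq0 h)).
- apply/measurable_EFinP; apply: measurable_funM; first exact: measurable_cst.
  by apply: measurable_indic; exact: measurable_itv.
move=> s _; have [st|/negP st] := boolP (0 < s <= t).
  have [i1 i2] := hr s st; rewrite integral_EFin//.
  rewrite indicE mem_set ?mulr1 ?lee_fin//= in_itv/=; exact: st.
rewrite integral0_eq ?lee_fin ?mulr_ge0// => w _.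
by rewrite h0// expr0n.
Qed.

(** Time 0 is a null set, so the closed interval becomes the half-open one that fits the cells of
    step processes, and the domain becomes a factor of the integrand. *)
Lemma square_integral_itv t (f : R -> R) : measurable_fun setT f ->
  (\int[mu]_(s in `[0%R, t]) ((f s) ^+ 2)%:E =
   \int[mu]_s ((\1_(`]0%R, t]%classic) s * f s) ^+ 2)%:E)%E.
Proof.
move=> mf; rewrite -(@integral_itv_obnd_cbnd _ 0 (BRight t) (fun s => ((f s) ^+ 2)%:E)); last first.
  by apply: measurable_funTS; apply/measurable_EFinP; exact: measurable_funX.
rewrite integral_mkcond; apply: eq_integral => s _.
rewrite /patch indicE; case: ifPn => _; first by rewrite mul1r.
by rewrite mul0r expr0n.
Qed.

End square_norm.

Lemma overlap_min (R : realType) (t x y x' y' : R) :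
  overlap (Num.min x t) (Num.min y t) (Num.min x' t) (Num.min y' t) =
  Num.max 0 (Num.min (Num.min y y') t - Num.max x x').
Proof.
rewrite /overlap (_ : Num.min (Num.min y t) (Num.min y' t) = Num.min (Num.min y y') t); last first.
  by rewrite minACA minxx.
rewrite -min_maxl.
have [xt|/ltW tx] := leP (Num.max x x') t; first by [].
have h1 : Num.min (Num.min y y') t <= t by rewrite ge_min lexx orbT.
have h2 : Num.min (Num.min y y') t - t <= 0 by rewrite subr_le0.
have h3 : Num.min (Num.min y y') t - Num.max x x' <= 0 by rewrite subr_le0 (le_trans h1).
by rewrite (max_idPl h2) (max_idPl h3).
Qed.

Section ito.
Context {R : realType} {disp : measure_display} {T : measurableType disp}.
Variables (P : probability T R) (F : R -> set (set T)) (B : R -> T -> R).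
Hypotheses (fF : is_filtration F) (bm : is_brownian_motion P F B).
Local Notation E := (Ex P).
Local Notation mu := (@lebesgue_measure R).

Section step_family.
Variables (I : finType) (c : I -> T -> R) (a b : I -> R).
Hypotheses (a0 : forall k, 0 <= a k) (ab : forall k, a k <= b k)
  (gc : forall k, good P (c k)) (fc : forall k, fmeas (F (a k)) (c k)).

(** The index type is arbitrary and the intervals may overlap: the difference of two step processes
    on different partitions is again of this form over the sum type. *)
Definition step_val (s : R) (w : T) : R := \sum_k c k w * (a k < s <= b k)%R%:R.
Definition step_int (t : R) (w : T) : R :=
  \sum_k c k w * (B (Num.min (b k) t) w - B (Num.min (a k) t) w).

Let mean_square t : 0 <= t ->
  E (fun w => step_int t w ^+ 2) = E (fun w => \sum_k \sum_j (c k w * c j w) *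
    overlap (Num.min (a k) t) (Num.min (b k) t) (Num.min (a j) t) (Num.min (b j) t)).
Proof.
move=> t0.
have m0 k : 0 <= Num.min (a k) t by rewrite le_min a0.
have mm k : Num.min (a k) t <= Num.min (b k) t by rewrite le_min2.
have gi k : good P (fun w => B (Num.min (b k) t) w - B (Num.min (a k) t) w).
  by apply: (incr_good fF bm).
have gt k : good P (fun w => c k w * (B (Num.min (b k) t) w - B (Num.min (a k) t) w)).
  by apply: goodM.
rewrite (@eq_Ex _ _ _ _ _ (fun w => \sum_k \sum_j
    (c k w * (B (Num.min (b k) t) w - B (Num.min (a k) t) w)) *
    (c j w * (B (Num.min (b j) t) w - B (Num.min (a j) t) w)))); last first.
  by move=> w; rewrite expr2 /step_int mulr_suml; apply: eq_bigr => k _; rewrite mulr_sumr.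
have i1 k j : itg P (fun w => (c k w * (B (Num.min (b k) t) w - B (Num.min (a k) t) w)) *
    (c j w * (B (Num.min (b j) t) w - B (Num.min (a j) t) w))) by apply: good_itg; exact: goodM.
have i2 k j : itg P (fun w => c k w * c j w *
    overlap (Num.min (a k) t) (Num.min (b k) t) (Num.min (a j) t) (Num.min (b j) t)).
  by apply: good_itg; apply: goodM; [exact: goodM|exact: good_cst].
rewrite !Ex_sum; try by move=> k; exact: itg_sum.
apply: eq_bigr => k _; rewrite !Ex_sum//; apply: eq_bigr => j _.
have small i : t < a i -> (fun w => B (Num.min (b i) t) w - B (Num.min (a i) t) w) = fun=> 0.
  move=> ta; have tb := lt_le_trans ta (ab i).
  by apply/funext => w; rewrite !(min_idPr (ltW _))// subrr.
have overlap0 x y : overlap t t x y = 0.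
  by apply/max_idPl; rewrite subr_le0 le_max ge_min lexx.
(* Intervals starting after [t] are set aside: their clipped increment is zero, and their
   coefficient is adapted only at a time later than the clipped one. *)
have [ak|ka] := leP (a k) t; last first.
  rewrite (min_idPr (ltW (lt_le_trans ka (ab k)))) overlap0.
  by apply: eq_Ex => w; rewrite subrr mulr0 mul0r mulr0.
have [aj|ja] := leP (a j) t; last first.
  rewrite [Num.min (b j) t](min_idPr (ltW (lt_le_trans ja (ab j)))).
  rewrite overlapC overlap0; by apply: eq_Ex => w; rewrite subrr !mulr0.
have mk i : a i <= t -> a i <= Num.min (b i) t by move=> ait; rewrite le_min ab.
rewrite (overlap_isometry fF bm) ?mk//.
under [RHS]eq_Ex do rewrite mulrC.
by rewrite ExZ 1?mulrC//; apply: good_itg; exact: goodM.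
Qed.

Let inner w t : 0 <= t -> (\int[mu]_(s in `[0%R, t]) ((step_val s w) ^+ 2)%:E =
   (\sum_k \sum_j (c k w * c j w) *
    overlap (Num.min (a k) t) (Num.min (b k) t) (Num.min (a j) t) (Num.min (b j) t))%:E)%E.
Proof.
move=> t0.
pose J k j : interval R := `](Num.max (a k) (a j)), (Num.min (b k) (b j))].
under eq_integral => s _.
  rewrite (_ : ((step_val s w) ^+ 2)%:E =
    (\sum_k \sum_j (c k w * c j w)%:E * (\1_([set` J k j]) s)%:E)%E); last first.
    rewrite expr2 /step_val mulr_suml -sumEFin; apply: eq_bigr => k _.
    rewrite mulr_sumr -sumEFin; apply: eq_bigr => j _; rewrite -EFinM mulrACA; congr (_ * _)%:E.
    rewrite -natrM mulnb indicE; congr (_ %:R); congr nat_of_bool.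
    apply/idP/idP => [h|/set_mem/=]; last first.
      by rewrite in_itv/= gt_max le_min => /andP[/andP[-> ->] /andP[-> ->]].
    apply/mem_set; rewrite /= in_itv/= gt_max le_min.
    by case/andP: h => /andP[-> ->] /andP[-> ->].
  over.
have mJ k j : measurable [set` J k j] by exact: measurable_itv.
have fin_t : (mu `[0%R, t] < +oo)%E.
  by rewrite lebesgue_measure_itv/=; case: ifPn => _; rewrite ?ltry// -EFinD ltry.
have iJ1 k j : mu.-integrable `[0, t] (fun s => (\1_([set` J k j]) s)%:E).
  apply/integrableP; split; first by apply/measurable_EFinP; exact: measurable_indic.
  apply: (@le_lt_trans _ _ (\int[mu]_(s in `[0%R, t]) 1)%E); last by rewrite integral_cst// mul1e.
  apply: ge0_le_integral => //; first by apply/measurable_EFinP; apply: measurableT_comp => //; exact: measurable_indic.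
  by move=> s _; rewrite lee_fin indicE; case: (_ \in _); rewrite ?normr1 ?normr0.
have iJ k j : mu.-integrable `[0, t] (fun s => ((c k w * c j w)%:E * (\1_([set` J k j]) s)%:E)%E).
  apply: integrableZl => //; exact: iJ1.
rewrite integral_sum//; last by move=> k; apply: integrable_sum.
rewrite -sumEFin; apply: eq_bigr => k _.
rewrite integral_sum// -sumEFin; apply: eq_bigr => j _.
have e := (@integralZl _ _ _ mu _ (measurable_itv `[0, t]) _ (iJ1 k j) (c k w * c j w)).
rewrite e.
rewrite integral_indic// [RHS]EFinM; congr (_ * _)%E.
rewrite overlap_min (_ : _ `&` _ = [set` `](Num.max (a k) (a j)), (Num.min (Num.min (b k) (b j)) t)]]); last first.
  apply/seteqP; split => s /=; rewrite !in_itv/= !gt_max !le_min.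
    by move=> [/andP[/andP[-> ->] /andP[-> ->]] /andP[_ ->]].
  move=> /andP[/andP[h1 h2] /andP[/andP[-> ->] ->]]; rewrite h1 h2/= andbT; split=> //.
  by rewrite ltW// (le_lt_trans (a0 k)).
have em := lebesgue_measure_itv (`](Num.max (a k) (a j)), (Num.min (Num.min (b k) (b j)) t)] : interval R).
etransitivity; first exact: em.
rewrite /= lte_fin; case: ltP => h.
  have h' := ltW h; rewrite -subr_ge0 in h'.
  by rewrite -EFinD (max_idPr h').
by rewrite -subr_le0 in h; rewrite (max_idPl h).
Qed.

(** The Ito isometry: both sides expand into the same double sum of products of coefficients times
    overlaps. *)
Lemma step_isometry t : 0 <= t ->
  (\int[P]_w \int[mu]_(s in `[0%R, t]) ((step_val s w) ^+ 2)%:E)%E =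
  (E (fun w => step_int t w ^+ 2))%:E.
Proof.
move=> t0; rewrite mean_square//; under eq_integral do rewrite inner//.
have gS : good P (fun w => \sum_k \sum_j (c k w * c j w) *
    overlap (Num.min (a k) t) (Num.min (b k) t) (Num.min (a j) t) (Num.min (b j) t)).
  by apply: good_sum => k; apply: good_sum => j; apply: goodM; [exact: goodM|exact: good_cst].
by rewrite integral_EFin//; exact: good_itg.
Qed.

Lemma step_int_good t : 0 <= t -> good P (step_int t).
Proof.
move=> t0; apply: good_sum => k; apply: goodM => //; apply: (incr_good fF bm).
  by rewrite le_min a0.
by rewrite le_min2.
Qed.

Lemma step_val_measurable :
  measurable_fun setT (fun z : measurableTypeR R * T => step_val z.1 z.2).
Proof.
apply: measurable_sum => k; apply: measurable_funM.
  by apply: measurableT_comp; [exact: good_mfun (gc k)|exact: measurable_snd].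
rewrite (_ : (fun z => _) = (\1_(`]a k, b k]%classic) : R -> R) \o fst).
  apply: measurableT_comp; last exact: measurable_fst.
  by apply: measurable_indic; exact: measurable_itv.
apply/funext => z /=; rewrite indicE; congr (_%:R); congr nat_of_bool.
by apply/idP/idP => [h|/set_mem/=]; [apply/mem_set; rewrite /= in_itv|rewrite in_itv].
Qed.

End step_family.

Variables (H I : R -> T -> R).
Hypothesis ito : is_ito_integral P F B H I.
Hypothesis gH : forall t, 0 <= t -> good P (H t).

Lemma ito_measurable t : 0 <= t -> measurable_fun setT (I t).
Proof.
move=> t0; have [_ _ aI _] := ito.
by apply: fmeas_measurable (adapted_fmeas aI t0); exact: (filtration_measurable fF).
Qed.

Definition left_sum (m i : nat) (w : T) : R :=
  \sum_(l < i) H (dy m l) w * (B (dy m l.+1) w - B (dy m l) w).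

(** Extension by zero to negative times, which makes the integrand jointly measurable on the whole
    product. *)
Let Hz (z : measurableTypeR R * T) : R := if 0 <= z.1 then H z.1 z.2 else 0.

Let mHz : measurable_fun setT Hz.
Proof.
have [_ mH _ _] := ito.
have mD : measurable ([set s : measurableTypeR R | 0 <= s] `*` [set: T]).
  apply: measurableX => //; rewrite (_ : [set _ | _] = `[0, +oo[%classic); first exact: measurable_itv.
  by apply/seteqP; split => s /=; rewrite in_itv/= andbT.
have := (measurable_restrictT _ mD).1 mH; congr measurable_fun.
apply/funext => z; rewrite /patch /Hz; case: ifPn => [/set_mem[/= -> _]//|/negP h].
by case: ifPn => // z0; case: h; apply/mem_set; split.
Qed.

Let gcoef l m : good P (H (dy m l)). Proof. by apply: gH; exact: dy_ge0. Qed.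

Let fcoef l m : fmeas (F (dy m l)) (H (dy m l)).
Proof. by have [aH _ _ _] := ito; apply: adapted_fmeas => //; exact: dy_ge0. Qed.

Let dy_le m l : (dy m l : R) <= dy m l.+1.
Proof. by rewrite dy_succ lerDl invr_ge0 exprn_ge0. Qed.

(** The simple integrals from the definition of [I] serve as intermediaries. The isometry turns left
    sum minus simple integral into a distance of integrands, at most 2 r t plus twice a vanishing
    term; another factor 2 for the passage to [I] gives 4 r t. *)
Lemma ito_approximation (m i : nat) (r : R) : 0 <= r ->
  (forall l s, (l < i)%N -> dy m l < s <= dy m l.+1 ->
    Ex P (fun w => (H (dy m l) w - H s w) ^+ 2) <= r) ->
  itg P (fun w => (left_sum m i w - I (dy m i) w) ^+ 2) /\
  Ex P (fun w => (left_sum m i w - I (dy m i) w) ^+ 2) <= 4 * r * dy m i.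
Proof.
move=> r0 Hr; pose t : R := dy m i.
have t0 : 0 <= t by exact: dy_ge0.
have [_ _ aI /(_ t t0)[S [aS S1 S2]]] := ito.
pose c1 (l : 'I_i) := H (dy m l); pose a1 (l : 'I_i) : R := dy m l; pose b1 (l : 'I_i) : R := dy m l.+1.
pose J n : finType := ('I_i + 'I_(sp_size (S n)))%type.
pose c n (k : J n) := match k with inl l => c1 l | inr k => fun w => - sp_coef (S n) k w end.
pose a n (k : J n) := match k with inl l => a1 l | inr k => sp_time (S n) k end.
pose b n (k : J n) := match k with inl l => b1 l | inr k => sp_time (S n) k.+1 end.
have time0 n k : 0 <= sp_time (S n) k.
  by have [h0 h1 _ _] := aS n; elim: k => // k ih; exact: le_trans (h1 k).
have a0 n k : 0 <= a n k by case: k => [l|k] /=; [exact: dy_ge0|exact: time0].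
have ab n k : a n k <= b n k.
  by case: k => [l|k] /=; [exact: dy_le|have [_ h _ _] := aS n; exact: h].
have coef_f n k : fmeas (F (sp_time (S n) k)) (sp_coef (S n) k).
  have [_ _ h _] := aS n => A mA; apply: (h k); exists A => //; by rewrite setTI.
have gc n k : good P (c n k).
  case: k => [l|k] /=; first exact: gcoef.
  apply: goodN; have [_ _ _ /(_ k)[M hM]] := aS n.
  apply: (@good_bounded _ _ _ _ _ M) => //; apply: fmeas_measurable (coef_f n k).
  exact: (filtration_measurable fF).
have fc n k : fmeas (F (a n k)) (c n k).
  case: k => [l|k] /=; first exact: fcoef.
  have sG := filtration_sigma fF (time0 n k).
  rewrite (_ : (fun w => _) = (fun w => 0 - sp_coef (S n) k w)); last by apply/funext => w; rewrite sub0r.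
  by apply: fmeasB => //; exact: fmeas_cst.
have valE n s w : step_val (c n) (a n) (b n) s w = step_val c1 a1 b1 s w - simple_val (S n) s w.
  rewrite /step_val big_sumType/= -sumrN; congr (_ + _); apply: eq_bigr => k _; by rewrite mulNr.
have le_dy (l l' : nat) : (l <= l')%N -> dy m l <= dy m l' :> R.
  by move=> ll'; rewrite /dy ler_pM2r ?invr_gt0 ?exprn_gt0// ler_nat.
have intE n w : step_int (c n) (a n) (b n) t w = left_sum m i w - simple_integral (S n) B t w.
  rewrite /step_int big_sumType/= -sumrN; congr (_ + _); apply: eq_bigr => k _; last by rewrite mulNr.
  by rewrite /c1 /a1 /b1 !(min_idPl _)//; apply: le_dy; rewrite // ltnW.
have iso n := step_isometry (a0 n) (ab n) (gc n) (fc n) t0.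
pose G1 (z : measurableTypeR R * T) := \1_(`]0, t]%classic) z.1 * step_val c1 a1 b1 z.1 z.2.
pose G2 n (z : measurableTypeR R * T) := \1_(`]0, t]%classic) z.1 * simple_val (S n) z.1 z.2.
pose G3 (z : measurableTypeR R * T) := \1_(`]0, t]%classic) z.1 * Hz z.
have m1_ : measurable_fun setT (fun z : measurableTypeR R * T => (\1_(`]0, t]%classic) z.1 : R)).
  rewrite (_ : (fun z => _) = (\1_(`]0, t]%classic) : R -> R) \o fst)//.
  apply: measurableT_comp; last exact: measurable_fst.
  by apply: measurable_indic; exact: measurable_itv.
have c10 l : 0 <= a1 l by exact: dy_ge0.
have mG1 : measurable_fun setT G1.
  apply: measurable_funM => //; apply: step_val_measurable => l; exact: gcoef.
have mval n : measurable_fun setT (fun z : measurableTypeR R * T => simple_val (S n) z.1 z.2).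
  apply: (@step_val_measurable 'I_(sp_size (S n)) (fun k => sp_coef (S n) k) (fun k => sp_time (S n) k)
    (fun k => sp_time (S n) k.+1)) => k.
  by have := goodN (gc n (inr k)) => /=; under eq_fun do rewrite opprK.
have mG2 n : measurable_fun setT (G2 n) by exact: measurable_funM.
have mG3 : measurable_fun setT G3 by exact: measurable_funM.
have E1 n : sqnorm P (fun z => G1 z - G2 n z) = (E (fun w => (left_sum m i w - simple_integral (S n) B t w) ^+ 2))%:E.
  transitivity ((\int[P]_w \int[mu]_(s in `[0%R, t]) ((step_val (c n) (a n) (b n) s w) ^+ 2)%:E)%E).
    apply: eq_integral => w _; rewrite [RHS]square_integral_itv.
      by apply: eq_integral => s _; rewrite /G1 /G2 /= valE mulrBr.
    exact: (measurableT_comp (step_val_measurable (a n) (b n) (gc n)) (pair2_measurable w)).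
  rewrite iso; congr (_%:E); apply: eq_Ex => w; by rewrite intE.
have E2 n : sqnorm P (fun z => G2 n z - G3 z) =
    (\int[P]_w \int[mu]_(s in `[0%R, t]) (((simple_val (S n) s w - H s w) ^+ 2)%R)%:E)%E.
  apply: eq_integral => w _.
  transitivity ((\int[mu]_(s in `[0%R, t]) ((simple_val (S n) s w - Hz (s, w)) ^+ 2)%:E)%E); last first.
    by apply: eq_integral => s /set_mem/=; rewrite in_itv/= => /andP[s0 _]; rewrite /Hz/= s0.
  rewrite square_integral_itv; first by apply: eq_integral => s _; rewrite /G2 /G3 /= mulrBr.
  apply: measurable_funB; first exact: (measurableT_comp (mval n) (pair2_measurable w)).
  exact: (measurableT_comp mHz (pair2_measurable w)).
have E3 : (sqnorm P (fun z => (G1 z - G3 z)%R) <= (r * t)%:E)%E.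
  apply: sqnorm_le => //; first exact: measurable_funB.
    move=> s w /negP st; rewrite /G1 /G3 /= indicE memNset ?mul0r ?subr0//= in_itv/=.
    exact/negP.
  move=> s st; have /andP[s0 s1] := st.
  have [l li ls] : exists2 l, (l < i)%N & dy m l < s <= dy m l.+1.
    have : s <= dy m i by [].
    elim: (i) => [|j ih] sj; first by move: s0; rewrite ltNge (le_trans sj)// /dy mul0r.
    have [sj'|js] := leP s (dy m j); last by exists j => //; rewrite js.
    by have [l lj ls] := ih sj'; exists l => //; rewrite ltnS ltnW.
  have val w : step_val c1 a1 b1 s w = H (dy m l) w.
    rewrite /step_val (bigD1 (Ordinal li))//= big1 ?addr0 => [|j jl].
      by rewrite /a1 /b1 /c1/= ls mulr1.
    rewrite /a1 /b1 (_ : _ < _ <= _ = false) ?mulr0//; apply/negP => /andP[js sj].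
    have /andP[ls1 ls2] := ls.
    have := lt_le_trans js ls2; have := lt_le_trans ls1 sj.
    rewrite /dy !ltr_pM2r ?invr_gt0 ?exprn_gt0// !ltr_nat !ltnS => h1 h2.
    by case/negP: jl; apply/eqP/val_inj/eqP => /=; rewrite eqn_leq h1 h2.
  have e w : (G1 (s, w) - G3 (s, w)) ^+ 2 = (H (dy m l) w - H s w) ^+ 2.
    rewrite /G1 /G3 /= /Hz /= (ltW s0) indicE mem_set ?mul1r ?val//= in_itv/=; exact: st.
  under eq_Ex do rewrite e; under [fun w => _]eq_fun do rewrite e.
  split; last exact: Hr.
  by apply: good_itg; apply: goodX; apply: goodB; [exact: gcoef|apply: gH; exact: ltW].
have mJ : good P (left_sum m i).
  by apply: good_sum => l; apply: goodM; [exact: gcoef|apply: (incr_good fF bm); [exact: dy_ge0|exact: dy_le]].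
have mI : measurable_fun setT (I t) by exact: ito_measurable.
have gS n : good P (simple_integral (S n) B t).
  have := goodB mJ (step_int_good (a0 n) (ab n) (gc n) t0).
  by congr good; apply/funext => w; rewrite intE; ring.
pose X w := (left_sum m i w - I t w) ^+ 2.
have mX : measurable_fun setT X by apply: measurable_funX; apply: measurable_funB => //; exact: (good_mfun mJ).
have bound n : (\int[P]_w (X w)%:E <= 2%:E * (2%:E * (r * t)%:E + 2%:E * sqnorm P (fun z => G2 n z - G3 z)%R) +
    2%:E * (\int[P]_w (((simple_integral (S n) B t w - I t w) ^+ 2)%R)%:E))%E.
  have mSI : measurable_fun setT (fun w => (simple_integral (S n) B t w - I t w) ^+ 2).
    by apply: measurable_funX; apply: measurable_funB => //; exact: (good_mfun (gS n)).
  have gJS : good P (fun w => (left_sum m i w - simple_integral (S n) B t w) ^+ 2).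
    by apply: goodX; exact: goodB.
  apply: (@le_trans _ _ (2%:E * (\int[P]_w ((left_sum m i w - simple_integral (S n) B t w) ^+ 2)%:E) +
     2%:E * (\int[P]_w (((simple_integral (S n) B t w - I t w) ^+ 2)%R)%:E))%E).
    rewrite -!ge0_integralZl_EFin//; first last.
    - by apply/measurable_EFinP; exact: (good_mfun gJS).
    - by move=> w _; rewrite lee_fin sqr_ge0.
    - by apply/measurable_EFinP.
    - by move=> w _; rewrite lee_fin sqr_ge0.
    rewrite -ge0_integralD//; first last.
    - by apply: measurable_funeM; exact/measurable_EFinP.
    - by move=> w _; rewrite mule_ge0 ?lee_fin ?sqr_ge0.
    - by apply: measurable_funeM; apply/measurable_EFinP; exact: (good_mfun gJS).
    - by move=> w _; rewrite mule_ge0 ?lee_fin ?sqr_ge0.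
    apply: ge0_le_integral => //.
    - by move=> w _; rewrite lee_fin sqr_ge0.
    - exact/measurable_EFinP.
    - apply: emeasurable_funD; apply: measurable_funeM; apply/measurable_EFinP => //.
      exact: (good_mfun gJS).
    move=> w _; rewrite -!EFinM -EFinD lee_fin /X.
    have := sqr_ge0 (left_sum m i w - simple_integral (S n) B t w - (simple_integral (S n) B t w - I t w)).
    set y := left_sum m i w; set z := simple_integral _ _ _ _; set x := I t w; nra.
  rewrite leeD2r// lee_pmul2l ?lte_fin//.
  rewrite (integral_EFin (good_itg gJS)) -E1.
  apply: le_trans (sqnormB P mG1 (mG2 n) mG3) _.
  by rewrite leeD2r// lee_pmul2l ?lte_fin.
have cv2 : (fun n => sqnorm P (fun z => G2 n z - G3 z)%R) @ \oo --> 0%E.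
  have e2 : (fun n => sqnorm P (fun z => G2 n z - G3 z)%R) = (fun n =>
      \int[P]_w \int[mu]_(s in `[0%R, t]) (((simple_val (S n) s w - H s w) ^+ 2)%R)%:E)%E.
    by apply/funext.
  by rewrite e2.
have lim : (\int[P]_w (X w)%:E <= (4 * r * t)%:E)%E.
  have cv : (fun n => 2%:E * (2%:E * (r * t)%:E + 2%:E * sqnorm P (fun z => G2 n z - G3 z)%R) +
    2%:E * (\int[P]_w (((simple_integral (S n) B t w - I t w) ^+ 2)%R)%:E))%E @ \oo --> (4 * r * t)%:E.
    have -> : (4 * r * t)%:E = (2%:E * (2%:E * (r * t)%:E + 2%:E * 0) + 2%:E * 0)%E.
      by rewrite !mule0 !adde0 -!EFinM; congr (_%:E); ring.
    apply: cvgeD => //; last exact: cvgeZl.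
    apply: cvgeZl => //; apply: cvgeD => //; first exact: cvg_cst.
    by apply: cvgeZl; [by []|exact: cv2].
  by apply: (lee_cvg_to (cvg_cst _) cv); apply: nearW => n; exact: bound.
have iX : itg P X.
  apply/integrableP; split; first exact/measurable_EFinP.
  apply: le_lt_trans (ltry (4 * r * t)); apply: le_trans lim.
  by rewrite le_eqVlt; apply/orP; left; apply/eqP; apply: eq_integral => w _; rewrite /= ger0_norm// sqr_ge0.
by split => //; rewrite -lee_fin -integral_EFin.
Qed.

End ito.

(** * Gaussian sums with frozen coefficients *)

Section gaussian_sums.
Context {R : realType} {disp : measure_display} {T : measurableType disp}.
Variables (P : probability T R) (F : R -> set (set T)) (B : R -> T -> R).
Hypotheses (fF : is_filtration F) (bm : is_brownian_motion P F B).
Variables (m : nat) (sg : nat -> R) (S : R).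
Hypothesis sgS : forall l, `|sg l| <= S.
Local Notation E := (Ex P).
Local Notation F' l := (F (dy m l)).

(** The coefficients are deterministic: random ones are inserted only after the path of the chain
    has been frozen. *)
Definition gsum (k n : nat) (w : T) : R :=
  \sum_(l < n) sg (k + l)%N * (B (dy m (k + l)%N.+1) w - B (dy m (k + l)%N) w).

Let d0 l : 0 <= dy m l :> R. Proof. exact: dy_ge0. Qed.

Let d_le l l' : (l <= l')%N -> dy m l <= dy m l' :> R.
Proof. by move=> ll'; rewrite /dy ler_pM2r ?invr_gt0 ?exprn_gt0// ler_nat. Qed.

Let dS l : (dy m l.+1 - dy m l : R) = 2 ^- m.
Proof. by rewrite dy_succ addrAC subrr add0r. Qed.

Let gb l : good P (fun w => B (dy m l.+1) w - B (dy m l) w).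
Proof. by apply: (incr_good fF bm) => //; exact: d_le. Qed.

Lemma gsum_good k n : good P (gsum k n).
Proof. by apply: good_sum => l; exact: goodZ. Qed.

Lemma gsum_fmeas_wrt G k n : sigma_algebra setT G -> (forall t, 0 <= t -> fmeas G (B t)) ->
  fmeas G (gsum k n).
Proof.
move=> sG fB; apply: fmeas_sum => // l; apply: fmeasM => //; first exact: fmeas_cst.
by apply: fmeasB => //; exact: fB.
Qed.

Lemma gsum_fmeas k n : fmeas (F' (k + n)%N) (gsum k n).
Proof.
have sG := filtration_sigma fF (d0 (k + n)).
apply: fmeas_sum => // l; apply: fmeasM => //; first exact: fmeas_cst.
have ln := ltn_ord l.
apply: fmeasB => //.
  apply: (fmeas_filtration fF (d0 (k + l).+1)); last exact: (brownian_fmeas bm).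
  by apply: d_le; rewrite -addnS leq_add2l.
apply: (fmeas_filtration fF (d0 (k + l))); last exact: (brownian_fmeas bm).
by apply: d_le; rewrite leq_add2l ltnW.
Qed.

Let gsumS k n w : gsum k n.+1 w = gsum k n w +
  sg (k + n)%N * (B (dy m (k + n)%N.+1) w - B (dy m (k + n)%N) w).
Proof. by rewrite /gsum big_ord_recr. Qed.

Let gsum0 k w : gsum k 0 w = 0. Proof. by rewrite /gsum big_ord0. Qed.

Lemma gsum_orth k n Psi : good P Psi -> fmeas (F' k) Psi -> E (fun w => Psi w * gsum k n w) = 0.
Proof.
move=> gP fP; elim: n => [|n ih].
  by rewrite -[RHS](Ex_cst P); apply: eq_Ex => w; rewrite gsum0 mulr0.
have g1 := gsum_good k n; have g2 := gb (k + n).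
rewrite (@eq_Ex _ _ _ _ _ (fun w => Psi w * gsum k n w + sg (k + n)%N *
  (Psi w * (B (dy m (k + n)%N.+1) w - B (dy m (k + n)%N) w)))); last by move=> w; rewrite gsumS; ring.
rewrite ExD; [|by gd|by gd]; rewrite ih add0r ExZ; last by gd.
rewrite (incr_orth fF bm) ?mulr0//; first exact: d_le.
by apply: (fmeas_filtration fF (d0 k)) => //; apply: d_le; rewrite leq_addr.
Qed.

Lemma gsum_square k n Psi : good P Psi -> fmeas (F' k) Psi ->
  E (fun w => Psi w * gsum k n w ^+ 2) = (\sum_(l < n) sg (k + l)%N ^+ 2) / 2 ^+ m * E Psi.
Proof.
move=> gP fP; elim: n => [|n ih].
  rewrite big_ord0 mul0r mul0r -[RHS](Ex_cst P); apply: eq_Ex => w.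
  by rewrite gsum0 expr0n mulr0.
have g1 := gsum_good k n; have g2 := gb (k + n).
have dle : dy m (k + n) <= dy m (k + n).+1 :> R by exact: d_le.
have fP' : fmeas (F' (k + n)) Psi.
  by apply: (fmeas_filtration fF (d0 k)) => //; apply: d_le; rewrite leq_addr.
have sG := filtration_sigma fF (d0 (k + n)).
rewrite (@eq_Ex _ _ _ _ _ (fun w => Psi w * gsum k n w ^+ 2 +
  (2 * sg (k + n)%N * (Psi w * gsum k n w * (B (dy m (k + n)%N.+1) w - B (dy m (k + n)%N) w)) +
   sg (k + n)%N ^+ 2 * (Psi w * (B (dy m (k + n)%N.+1) w - B (dy m (k + n)%N) w) ^+ 2)))); last first.
  by move=> w; rewrite gsumS; ring.
rewrite ExD; [|by gd|by gd]; rewrite ExD; [|by gd|by gd].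
rewrite ih ExZ; last by gd.
rewrite ExZ; last by gd.
rewrite (incr_orth fF bm)//; [|by gd|by apply: fmeasM => //; exact: gsum_fmeas].
rewrite (incr_square fF bm)// dS big_ord_recr/=; ring.
Qed.

Let S0 : 0 <= S. Proof. exact: le_trans (sgS 0). Qed.

Let sg2 l : sg l ^+ 2 <= S ^+ 2.
Proof. by rewrite -(real_normK (num_real _)) lerXn2r// nnegrE. Qed.

Lemma gsum_second k n : E (fun w => gsum k n w ^+ 2) <= S ^+ 2 * (n%:R / 2 ^+ m).
Proof.
have sG := filtration_sigma fF (d0 k).
have := @gsum_square k n (fun=> 1) (good_cst P 1) (fmeas_cst sG 1).
rewrite Ex_cst mulr1 (@eq_Ex _ _ _ _ _ (fun w => gsum k n w ^+ 2)) => [->|w]; last by rewrite mul1r.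
rewrite mulrA ler_wpM2r ?invr_ge0 ?exprn_ge0// mulr_natr -[X in _ *+ X](card_ord n) -sumr_const.
by apply: ler_sum.
Qed.

(** Odd powers of the new increment vanish, which leaves an increase of (6 n + 32) S^4 in units of
    the squared mesh; this is at most 35 ((n + 1)^2 - n^2) S^4, with slack 64 n + 3. *)
Lemma gsum_fourth k n : E (fun w => gsum k n w ^+ 4) <= 35 * S ^+ 4 * (n%:R / 2 ^+ m) ^+ 2.
Proof.
elim: n => [|n ih].
  rewrite (@eq_Ex _ _ _ _ _ (fun=> 0)) => [|w]; last by rewrite gsum0 expr0n.
  by rewrite Ex_cst mul0r expr0n mulr0.
have g1 := gsum_good k n; have g2 := gb (k + n).
have dle : dy m (k + n) <= dy m (k + n).+1 :> R by exact: d_le.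
have sG := filtration_sigma fF (d0 (k + n)).
pose b w := B (dy m (k + n)%N.+1) w - B (dy m (k + n)%N) w.
pose c := sg (k + n)%N.
have f1 := gsum_fmeas k n.
rewrite (@eq_Ex _ _ _ _ _ (fun w => gsum k n w ^+ 4 + (4 * c * (gsum k n w ^+ 3 * b w ^+ 1) +
   (6 * c ^+ 2 * (gsum k n w ^+ 2 * b w ^+ 2) + (4 * c ^+ 3 * (gsum k n w * b w ^+ 3) +
    c ^+ 4 * (b w ^+ 4)))))); last first.
  by move=> w; rewrite gsumS -/(b w) -/c; ring.
have gb' : good P b by exact: gb.
rewrite ExD; [|by gd|by gd]; rewrite ExD; [|by gd|by gd].
rewrite ExD; [|by gd|by gd]; rewrite ExD; [|by gd|by gd].
rewrite !ExZ; try by gd.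
rewrite (incr_indep fF bm (Z := fun w => gsum k n w ^+ 3))//; [|by gd|exact: fmeasX].
rewrite (incr_indep fF bm (Z := fun w => gsum k n w ^+ 2))//; [|by gd|exact: fmeasX].
rewrite (incr_indep fF bm (Z := gsum k n))//.
rewrite (incr_odd fF bm (k := 1))// (incr_odd fF bm (k := 3))// (incr_second fF bm)//.
rewrite !mulr0 add0r add0r dS.
have p0 : 0 < 2 ^+ m :> R by rewrite exprn_gt0.
have h4 := incr_fourth fF bm (d0 (k + n)) dle; rewrite dS in h4.
have h2 := gsum_second k n.
have e4 : c ^+ 4 * E (fun w => b w ^+ 4) <= S ^+ 4 * (32 * (2 ^- m) ^+ 2).
  apply: ler_pM => //.
  - by rewrite -[4%N]/(2 * 2)%N exprM sqr_ge0.
  - by apply: Ex_ge0 => w; rewrite -[4%N]/(2 * 2)%N exprM sqr_ge0.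
  - rewrite -[4%N]/(2 * 2)%N !exprM; apply: lerXn2r; rewrite ?nnegrE ?sqr_ge0//; exact: sg2.
have e2 : 6 * c ^+ 2 * (E (fun w => gsum k n w ^+ 2) * 2 ^- m) <= 6 * S ^+ 2 * (S ^+ 2 * (n%:R / 2 ^+ m) * 2 ^- m).
  apply: ler_pM.
  - by rewrite mulr_ge0// sqr_ge0.
  - by rewrite mulr_ge0 ?invr_ge0 ?(ltW p0)//; apply: Ex_ge0 => w; exact: sqr_ge0.
  - by rewrite ler_wpM2l//; exact: sg2.
  - by rewrite ler_wpM2r// invr_ge0 ltW.
apply: le_trans (lerD ih (lerD e2 e4)) _.
have S4 : 0 <= S ^+ 4 by rewrite exprn_ge0.
rewrite -subr_ge0 (_ : _ - _ = S ^+ 4 * (2 ^- m) ^+ 2 * (64 * n%:R + 3)); last first.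
  by rewrite -(natr1 n); ring.
by rewrite !mulr_ge0 ?sqr_ge0// addr_ge0// mulr_ge0.
Qed.

End gaussian_sums.

(** * Riemann sums of right-continuous paths *)

Section right_continuous_functions.
Context {R : realType}.
Implicit Types (f g y : R -> R).
Local Notation mu := (@lebesgue_measure R).

Definition rcont f := forall t, 0 <= t -> f x @[x --> t^'+] --> f t.

Lemma rcontM f g : rcont f -> rcont g -> rcont (fun t => f t * g t).
Proof. by move=> rf rg t t0; apply: cvgM; [exact: rf|exact: rg]. Qed.

Lemma rcontB f g : rcont f -> rcont g -> rcont (fun t => f t - g t).
Proof. by move=> rf rg t t0; apply: cvgB; [exact: rf|exact: rg]. Qed.

Lemma rcontD f g : rcont f -> rcont g -> rcont (fun t => f t + g t).
Proof. by move=> rf rg t t0; apply: cvgD; [exact: rf|exact: rg]. Qed.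

Lemma rcont_cst c : rcont (fun=> c).
Proof. by move=> t _; exact: cvg_cst. Qed.

Lemma continuous_rcont f : continuous f -> rcont f.
Proof. by move=> cf t _; apply: cvg_at_right_filter; exact: cf. Qed.

Lemma cpath_rcont y : cpath y -> rcont y.
Proof.
move=> /continuous_within_itvcyP[cy cy0] t; rewrite le_eqVlt => /predU1P[<-//|t0].
by apply: cvg_at_right_filter; apply: cy; rewrite in_itv/= andbT.
Qed.

Lemma cpath_bounded y (K : R) : cpath y -> exists2 c, 0 <= c & forall t, 0 <= t <= K -> `|y t| <= c.
Proof.
move=> cy; have [K0|K0] := ltP K 0.
  by exists 0 => // t /andP[t0 tK]; move: (le_lt_trans (le_trans t0 tK) K0); rewrite ltxx.
have cyK : {within `[0, K], continuous (fun x => `|y x|)}.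
  have sub : `[0, K] `<=` `[0, +oo[ by move=> z /=; rewrite !in_itv/= => /andP[-> _].
  have cyst := continuous_subspaceW sub cy.
  by move=> z; exact: (continuous_comp (cyst z) (@norm_continuous _ R _)).
have [x xK xmax] := EVT_max K0 cyK.
by exists `|y x| => // t tK; apply: xmax; rewrite in_itv.
Qed.

Section riemann.
Variables (f : R -> R) (c t : R).
Hypotheses (rf : rcont f) (t0 : 0 < t) (fc : forall s, 0 <= s <= t -> `|f s| <= c).

Let node (p l : nat) : R := t * l%:R / p%:R.

Let cell (p l : nat) : interval R := `](node p l), (node p l.+1)].

(** Sampling at the right end of each cell: the sample points approach every time from the right,
    the side on which the function is continuous. *)
Let fstep (p : nat) (s : R) : R := \sum_(l < p) f (node p l.+1) * \1_([set` cell p l]) s.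

Let node_le p l l' : (l <= l')%N -> node p l <= node p l'.
Proof. by move=> ll'; rewrite ler_wpM2r ?invr_ge0// ler_pM2l// ler_nat. Qed.

Let nodeS p l : node p l.+1 - node p l = t / p%:R.
Proof. by rewrite /node -natr1; ring. Qed.

Let in_cell p s : (0 < p)%N -> 0 < s <= t ->
  exists2 l, (l < p)%N & node p l < s <= node p l.+1 /\ fstep p s = f (node p l.+1).
Proof.
move=> p0 /andP[s0 st].
have p0' : 0 < p%:R :> R by rewrite ltr0n.
have [l lp ls] : exists2 l, (l < p)%N & node p l < s <= node p l.+1.
  have : s <= node p p by rewrite /node mulfK ?gt_eqF.
  suff : forall j, s <= node p j -> exists2 l, (l < j)%N & node p l < s <= node p l.+1 by exact.
  elim=> [|j ih] sj; first by move: s0; rewrite ltNge (le_trans sj)// /node mulr0 mul0r.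
  have [sj'|js] := leP s (node p j); last by exists j => //; rewrite js.
  by have [l lj ls] := ih sj'; exists l => //; rewrite ltnS ltnW.
exists l => //; split=> //.
rewrite /fstep (bigD1 (Ordinal lp))//= big1 ?addr0 => [|j jl].
  by rewrite indicE mem_set ?mulr1//= in_itv.
rewrite indicE memNset ?mulr0//= in_itv/= => /andP[js sj]; have /andP[ls1 ls2] := ls.
have := lt_le_trans js ls2; have := lt_le_trans ls1 sj.
rewrite /node !ltr_pM2r ?invr_gt0// !ltr_pM2l// !ltr_nat !ltnS => h1 h2.
by case/negP: jl; apply/eqP/val_inj/eqP => /=; rewrite eqn_leq h1 h2.
Qed.

Variable p : nat -> nat.
Hypotheses (p0 : forall n, (0 < p n)%N) (pn : forall n, (n <= p n)%N).

Let fstep_cvg s : 0 < s <= t -> (fun n => fstep (p n) s) @ \oo --> f s.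
Proof.
move=> st; have /andP[s0 st'] := st.
apply/cvgrPdist_le => e e0.
have := rf (ltW s0) => /cvgrPdist_le/(_ _ e0).
rewrite /at_right near_withinE => /nbhs_ballP[d /= d0 hd].
near=> n.
have [l lp [/andP[ls1 ls2] ->]] := in_cell (p0 n) st.
move: ls2; rewrite le_eqVlt => /predU1P[<-|ls2]; first by rewrite subrr normr0 ltW.
apply: hd => //; rewrite /ball/= distrC ger0_norm ?subr_ge0 ?(ltW ls2)//.
apply: (@le_lt_trans _ _ (t / (p n)%:R)); first by rewrite -(nodeS (p n) l) lerB// ltW.
rewrite ltr_pdivrMr ?ltr0n// mulrC -ltr_pdivrMr//.
apply: (@lt_le_trans _ _ n%:R); last by rewrite ler_nat.
by near: n; exact: nbhs_infty_gtr.
Unshelve. all: by end_near. Qed.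

Let fstep_measurable q : measurable_fun setT (fstep q).
Proof.
apply: measurable_sum => l; apply: measurable_funM; first exact: measurable_cst.
exact: measurable_indic.
Qed.

Let D : set R := `]0, t]%classic.
Let mD : measurable D. Proof. exact: measurable_itv. Qed.

Let finD : (mu D < +oo)%E.
Proof. by rewrite /D lebesgue_measure_itv/= lte_fin t0 -EFinB ltry. Qed.

Let fstep_integral q : (0 < q)%N ->
  (\int[mu]_(s in D) (fstep q s)%:E = (t / q%:R * \sum_(l < q) f (node q l.+1))%:E)%E.
Proof.
move=> q0; have q0' : 0 < q%:R :> R by rewrite ltr0n.
under eq_integral do rewrite /fstep -sumEFin.
have iJ1 l : mu.-integrable D (fun s => (\1_([set` cell q l]) s)%:E).
  apply/integrableP; split; first by apply/measurable_EFinP; exact: measurable_indic.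
  apply: (@le_lt_trans _ _ (\int[mu]_(s in D) 1)%E); last by rewrite integral_cst// mul1e.
  apply: ge0_le_integral => //; first by apply/measurable_EFinP; apply: measurableT_comp => //; exact: measurable_indic.
  by move=> s _; rewrite lee_fin indicE; case: (_ \in _); rewrite ?normr1 ?normr0.
have iJ l : mu.-integrable D (fun s => ((f (node q l.+1) * \1_([set` cell q l]) s)%:E)%E).
  by under eq_fun do rewrite EFinM; exact: integrableZl.
rewrite integral_sum// mulr_sumr -sumEFin; apply: eq_bigr => l _.
under eq_integral do rewrite EFinM.
have e := (@integralZl _ _ _ mu _ (measurable_itv `]0, t]) _ (iJ1 l) (f (node q l.+1))).
etransitivity; first exact: e.
rewrite integral_indic//= mulrC EFinM; congr (_ * _)%E.
rewrite (_ : _ `&` _ = [set` cell q l]); last first.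
  apply/seteqP; split => s /=; rewrite !in_itv/=; first by case.
  move=> /andP[h1 h2]; rewrite h1 h2; split=> //.
  rewrite (le_lt_trans _ h1)//=; last by rewrite /node divr_ge0// mulr_ge0// ltW.
  by rewrite (le_trans h2)// (le_trans (node_le q (ltn_ord l)))// /node mulfK// gt_eqF.
have em := lebesgue_measure_itv (cell q l); etransitivity; first exact: em.
rewrite /= lte_fin; have h : node q l < node q l.+1 by rewrite -subr_gt0 nodeS divr_gt0.
by rewrite h -EFinD nodeS.
Qed.

Let c0 : 0 <= c. Proof. by apply: le_trans (fc (s := 0) _) => //; rewrite lexx ltW. Qed.

Let measurable_obnd : measurable_fun D f.
Proof.
apply: (@measurable_fun_cvg _ _ _ D (fun n => fstep (p n))).
  by move=> n; apply: measurable_funTS.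
by move=> s Ds; apply: fstep_cvg; move: Ds; rewrite /D/= in_itv.
Qed.

Let fstep_bound q s : (0 < q)%N -> 0 < s <= t -> `|fstep q s| <= c.
Proof.
move=> q0 st; have [l lq [_ ->]] := in_cell q0 st.
apply: fc; rewrite divr_ge0 ?mulr_ge0 ?(ltW t0)//=.
by rewrite (le_trans (node_le q lq))// /node mulfK// gt_eqF// ltr0n.
Qed.

Lemma rcont_measurable : measurable_fun (`[0, t]%classic : set R) f.
Proof.
have -> : `[0, t]%classic = [set 0] `|` D.
  apply/seteqP; split => s /=; rewrite !in_itv/=.
    by move=> /andP[]; rewrite le_eqVlt => /predU1P[<-|s0] st; [left|right; rewrite /D/= in_itv/= s0].
  by move=> [->|]; rewrite ?lexx ?(ltW t0)// /D/= in_itv/= => /andP[s0 ->]; rewrite ltW.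
apply/measurable_funU => //; split => //; exact: measurable_fun_set1.
Qed.

Lemma rcont_integrable : mu.-integrable `[0, t] (EFin \o f).
Proof.
apply: measurable_bounded_integrable => //.
- rewrite (_ : (_ `[0%R, t]%classic)%E = t%:E) ?ltry//.
  by etransitivity; [exact: (lebesgue_measure_itv (`[0, t] : interval R))|rewrite /= lte_fin t0 -EFinB subr0].
- exact: rcont_measurable.
exists c; split; first exact: num_real.
by move=> M cM s /=; rewrite in_itv/= => st; rewrite (le_trans (fc st))// ltW.
Qed.

Lemma riemann_rcont : (fun n => t / (p n)%:R * \sum_(l < p n) f (t * l.+1%:R / (p n)%:R)) @ \oo -->
  \int[mu]_(s in `[0, t]) f s.
Proof.
have [|||||_ _] := @dominated_convergence _ _ _ mu D mD (fun n => EFin \o fstep (p n))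
  (EFin \o f) (cst c%:E) _ _ _ _ _.
- move=> n; have h : measurable_fun D (fstep (p n)) by exact: measurable_funTS.
  have h' : @measurable_fun _ _ (measurableTypeR R) R D (fstep (p n)) := h.
  exact/measurable_EFinP.
- have h' : @measurable_fun _ _ (measurableTypeR R) R D f := measurable_obnd.
  exact/measurable_EFinP.
- apply: aeW => s Ds; apply: cvg_EFin; first exact: nearW.
  by apply: fstep_cvg; move: Ds; rewrite /D/= in_itv.
- apply/integrableP; split; first exact: measurable_cst.
  by rewrite /= integral_cst// lte_mul_pinfty// ?lee_fin// abse_ge0.
- apply: aeW => s n Ds; rewrite /= lee_fin; apply: fstep_bound => //.
move=> cv.
have iF : mu.-integrable D (EFin \o f).
  apply: integrableS rcont_integrable => // s; rewrite /D/= !in_itv/= => /andP[/ltW -> ->]//.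
rewrite -(@Rintegral_itv_obnd_cbnd R 0 (BRight t) f iF).
apply: (fine_cvg (f := fun n => (t / (p n)%:R * \sum_(l < p n) f (t * l.+1%:R / (p n)%:R))%:E)).
rewrite /Rintegral fineK; last exact: integrable_fin_num.
by under eq_fun do rewrite -fstep_integral//.
Qed.

End riemann.

Definition integral0 f (t : R) : R := \int[mu]_(s in `[0, t]) f s.

Lemma integral00 f : integral0 f 0 = 0.
Proof. by rewrite /integral0 set_itv1 Rintegral_set1. Qed.

Definition loc_bounded f := forall K : R, exists2 c, 0 <= c & forall t, 0 <= t <= K -> `|f t| <= c.

Lemma rcont_integrable0 f t : rcont f -> loc_bounded f -> 0 <= t ->
  mu.-integrable `[0, t] (EFin \o f).
Proof.
move=> rf bf; rewrite le_eqVlt => /predU1P[<-|t0].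
  rewrite set_itv1; apply/integrableP; split; first exact: measurable_fun_set1.
  by rewrite integral_set1 ltry.
by have [c _ fc] := bf t; exact: (rcont_integrable rf t0 fc (p := succn)).
Qed.

Lemma riemann0 f t (p : nat -> nat) : rcont f -> loc_bounded f -> 0 <= t ->
  (forall n, (0 < p n)%N) -> (forall n, (n <= p n)%N) ->
  (fun n => t / (p n)%:R * \sum_(l < p n) f (t * l.+1%:R / (p n)%:R)) @ \oo --> integral0 f t.
Proof.
move=> rf bf t0 p0 pn; move: t0; rewrite le_eqVlt => /predU1P[<-|t0].
  rewrite integral00; under eq_fun do rewrite mul0r mul0r; exact: cvg_cst.
by have [c _ fc] := bf t; exact: (riemann_rcont rf t0 fc p0 pn).
Qed.

(* On a dyadic interval the left Riemann sums converge as well, the difference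
   with the right ones being the telescoping sum [(f 0 - f t) / 2^n]. *)
Lemma riemann_left f m i : rcont f -> loc_bounded f ->
  (fun n => \sum_(l < i * 2 ^ n) f (dy (m + n) l) / 2 ^+ (m + n)) @ \oo --> integral0 f (dy m i).
Proof.
move=> rf bf; case: i => [|i].
  rewrite /dy mul0r integral00; under eq_fun do rewrite mul0n big_ord0; exact: cvg_cst.
pose p n := (i.+1 * 2 ^ n)%N.
have p0 n : (0 < p n)%N by rewrite /p muln_gt0 expn_gt0.
have pn n : (n <= p n)%N.
  by rewrite (leq_trans (ltnW (ltn_expl n (ltnSn 1))))// /p leq_pmull.
have cv := riemann0 rf bf (dy_ge0 m i.+1) p0 pn.
have q0 n : 0 < 2 ^+ n :> R by rewrite exprn_gt0.
have nodeE n l : dy m i.+1 * l%:R / (p n)%:R = dy (m + n) l :> R.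
  rewrite /dy /p natrM natrX exprD; field.
  by rewrite !gt_eqF// ?(addr_gt0, ltr0n, q0)// ?natr1 ltr0n.
have meshE n : dy m i.+1 / (p n)%:R = 2 ^- (m + n) :> R.
  by have := nodeE n 1%N; rewrite mulr1 => ->; rewrite /dy mul1r.
have e n : \sum_(l < p n) f (dy (m + n) l) / 2 ^+ (m + n) =
    dy m i.+1 / (p n)%:R * \sum_(l < p n) f (dy m i.+1 * l.+1%:R / (p n)%:R) +
    (f 0 - f (dy m i.+1)) * (2^-1 ^+ m * 2^-1 ^+ n).
  rewrite meshE -mulr_suml mulrC -exprD exprVn [X in _ + X]mulrC -mulrDr; congr (_ * _).
  under [in RHS]eq_bigr do rewrite nodeE.
  have -> : dy m i.+1 = dy (m + n) (p n) :> R.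
    by rewrite /dy /p natrM natrX exprD invfM mulrACA mulfV ?mulr1// gt_eqF.
  have -> : f 0 = f (dy (m + n) 0) by rewrite /dy mul0r.
  elim: (p n) => [|k ih]; first by rewrite !big_ord0 subrr addr0.
  by rewrite !big_ord_recr/= ih; ring.
rewrite (_ : (fun n => _) = (fun n => dy m i.+1 / (p n)%:R * \sum_(l < p n) f (dy m i.+1 * l.+1%:R / (p n)%:R) +
    (f 0 - f (dy m i.+1)) * (2^-1 ^+ m * 2^-1 ^+ n))); last by apply/funext => n; exact: e.
rewrite -[X in _ --> X]addr0; apply: cvgD; first exact: cv.
have cz : (fun n => ((f 0 - f (dy m i.+1)) * 2^-1 ^+ m) * (2^-1 : R) ^+ n) @ \oo --> (0 : R).
  rewrite -[X in _ --> X](mulr0 ((f 0 - f (dy m i.+1)) * 2^-1 ^+ m)).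
  by apply: cvgM; [exact: cvg_cst|apply: cvg_expr; rewrite ger0_norm; lra].
by under eq_fun do rewrite mulrA.
Qed.

Lemma integral0D f g t : rcont f -> loc_bounded f -> rcont g -> loc_bounded g -> 0 <= t ->
  integral0 (fun s => f s + g s) t = integral0 f t + integral0 g t.
Proof. by move=> rf bf rg bg t0; apply: RintegralD => //; exact: rcont_integrable0. Qed.

Lemma integral0B f g t : rcont f -> loc_bounded f -> rcont g -> loc_bounded g -> 0 <= t ->
  integral0 (fun s => f s - g s) t = integral0 f t - integral0 g t.
Proof. by move=> rf bf rg bg t0; apply: RintegralB => //; exact: rcont_integrable0. Qed.

Lemma integral0Z f a t : rcont f -> loc_bounded f -> 0 <= t ->
  integral0 (fun s => a * f s) t = a * integral0 f t.
Proof. by move=> rf bf t0; apply: RintegralZl => //; exact: rcont_integrable0. Qed.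

Lemma integral0_cst a t : 0 <= t -> integral0 (fun=> a) t = a * t.
Proof.
move=> t0; rewrite /integral0 Rintegral_cst; last exact: measurable_itv.
congr (_ * _); have em := lebesgue_measure_itv (`[0, t] : interval R).
transitivity (fine (if (0 < t)%R then t%:E else 0%E)); last first.
  by move: t0; rewrite le_eqVlt => /predU1P[<-|->] //; rewrite ltxx.
congr fine; etransitivity; first exact: em.
by rewrite /= lte_fin; case: ifP => // _; rewrite -EFinB subr0.
Qed.

Lemma integral0_diff f s t c : rcont f -> loc_bounded f -> 0 <= s -> s <= t ->
  (forall u, s <= u <= t -> `|f u| <= c) -> `|integral0 f t - integral0 f s| <= c * (t - s).
Proof.
move=> rf bf s0; rewrite le_eqVlt => /predU1P[<- _|st fc].
  by rewrite !subrr normr0 mulr0.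
have t0 := le_trans s0 (ltW st).
have it := rcont_integrable0 rf bf t0.
have -> : integral0 f t - integral0 f s = \int[mu]_(u in `]s, t]) f u.
  by rewrite /integral0 Rintegral_itvB//; rewrite bnd_simp// ltW.
have sub : `]s, t] `<=` `[0, t].
  by move=> u /=; rewrite !in_itv/= => /andP[su ->]; rewrite (le_trans s0)// ltW.
have it' : mu.-integrable `]s, t] (EFin \o f) by apply: integrableS it => //; exact: measurable_itv.
rewrite (le_trans (@le_normr_Rintegral _ _ _ mu _ f (measurable_itv `]s, t]) it'))//.
have fin : (mu `]s, t]) = (t - s)%:E.
  by etransitivity; [exact: (lebesgue_measure_itv (`]s, t] : interval R))|rewrite /= lte_fin st -EFinB].
have -> : c * (t - s) = \int[mu]_(u in `]s, t]) c.
  rewrite Rintegral_cst; last exact: measurable_itv.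
  by congr (_ * _); rewrite (_ : (_ `]s, t]%classic)%E = (t - s)%:E).
apply: le_Rintegral.
- exact: measurable_itv.
- by have := integrable_norm it'.
- apply/integrableP; split; first exact: measurable_cst.
  rewrite /= integral_cst; last exact: measurable_itv.
  by rewrite (_ : (_ `]s, t]%classic)%E = (t - s)%:E)// -EFinM ltry.
by move=> u; rewrite /= in_itv/= => /andP[su ut]; apply: fc; rewrite (ltW su).
Qed.

Lemma loc_boundedM f g : loc_bounded f -> loc_bounded g -> loc_bounded (fun t => f t * g t).
Proof.
move=> bf bg K; have [c c0 fc] := bf K; have [d d0 gd] := bg K.
by exists (c * d) => [|t tK]; [exact: mulr_ge0|rewrite normrM ler_pM ?fc ?gd].
Qed.

Lemma loc_boundedB f g : loc_bounded f -> loc_bounded g -> loc_bounded (fun t => f t - g t).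
Proof.
move=> bf bg K; have [c c0 fc] := bf K; have [d d0 gd] := bg K.
by exists (c + d) => [|t tK]; [exact: addr_ge0|rewrite (le_trans (ler_normB _ _))// lerD ?fc ?gd].
Qed.

Lemma loc_boundedD f g : loc_bounded f -> loc_bounded g -> loc_bounded (fun t => f t + g t).
Proof.
move=> bf bg K; have [c c0 fc] := bf K; have [d d0 gd] := bg K.
by exists (c + d) => [|t tK]; [exact: addr_ge0|rewrite (le_trans (ler_normD _ _))// lerD ?fc ?gd].
Qed.

Lemma loc_bounded_cst a : loc_bounded (fun=> a).
Proof. by move=> K; exists `|a|. Qed.

Lemma loc_bounded_bounded f c : (forall t, 0 <= t -> `|f t| <= c) -> loc_bounded f.
Proof.
by move=> fc K; exists c => [|t /andP[t0 _]]; [rewrite (le_trans _ (fc 0 _))|exact: fc].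
Qed.

Lemma drift_integral C y g : cpath y -> rcont g -> (forall t, 0 <= t -> `|g t| <= C) ->
  drift C y (integral0 (fun s => g s * y s)) (integral0 g).
Proof.
move=> cy rg gC.
have ry := cpath_rcont cy.
have by_ : loc_bounded y by move=> K; exact: cpath_bounded.
have bg := loc_bounded_bounded gC.
split; [exact: integral00|exact: integral00|move=> s t a e s0 st ya].
have t0 := le_trans s0 st.
have rgy := rcontM rg ry; have bgy := loc_boundedM bg by_.
have h u : 0 <= u -> integral0 (fun s => g s * y s - a * g s) u =
    integral0 (fun s => g s * y s) u - a * integral0 g u.
  move=> u0; rewrite integral0B//; last 2 first.
  - by apply: rcontM => //; exact: rcont_cst.
  - by apply: loc_boundedM => //; exact: loc_bounded_cst.
  by rewrite (@integral0Z g a u).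
rewrite (_ : _ - _ = integral0 (fun s => g s * y s - a * g s) t -
   integral0 (fun s => g s * y s - a * g s) s); last by rewrite !h//; ring.
apply: integral0_diff => //.
- by apply: rcontB => //; apply: rcontM => //; exact: rcont_cst.
- by apply: loc_boundedB => //; apply: loc_boundedM => //; exact: loc_bounded_cst.
move=> u su; have /andP[su1 _] := su.
rewrite (_ : _ - _ = g u * (y u - a)); last by ring.
by rewrite normrM ler_pM ?gC ?ya// (le_trans s0).
Qed.

(** The drift inequality with a = 0 makes [q] Lipschitz on bounded intervals. *)
Lemma drift_cpath C y q k : 0 <= C -> cpath y -> drift C y q k -> cpath (fun t => y t + q t).
Proof.
move=> C0 cy [_ _ dq]; apply/subspace_continuousP => t t_ge0.
have t0 : 0 <= t by move: t_ge0; rewrite /= in_itv/= andbT.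
have hy := (@subspace_continuousP R `[0, +oo[%classic R y).1 cy t t_ge0.
suff hq : q x @[x --> within `[0, +oo[ (nbhs t)] --> q t by exact: (cvgD hy hq).
have [c c0 yc] := cpath_bounded (t + 1) cy.
have lip s u : 0 <= s -> s <= u -> u <= t + 1 -> `|q u - q s| <= C * c * (u - s).
  move=> s0 su ut; have := dq s u 0 c s0 su; rewrite mul0r subr0; apply=> v /andP[sv vu].
  by rewrite subr0 yc// (le_trans s0 sv) (le_trans vu).
apply/cvgrPdist_le => e e0; rewrite near_withinE.
have Cc : 0 < C * c + 1 by rewrite ltr_wpDl// mulr_ge0.
near=> u => u_ge0; have u0 : 0 <= u by move: u_ge0; rewrite /= in_itv/= andbT.
have d1 : `|t - u| <= 1 by near: u; apply: cvgr_dist_le => //; exact: cvg_id.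
have d2 : `|t - u| <= e / (C * c + 1).
  by near: u; apply: cvgr_dist_le; [exact: cvg_id|exact: divr_gt0].
have bnd : C * c * `|t - u| <= e.
  rewrite (le_trans (_ : _ <= (C * c + 1) * `|t - u|)) ?ler_wpM2r ?lerDl//.
  by rewrite mulrC -ler_pdivlMr.
have [ut|/ltW tu] := leP u t.
  rewrite (le_trans (lip _ _ u0 ut _))//; first by rewrite lerDl.
  by rewrite -[t - u]ger0_norm ?subr_ge0.
rewrite distrC (le_trans (lip _ _ t0 tu _))//.
  by move: d1; rewrite ler_norml => /andP[+ _]; lra.
by rewrite -[u - t]ger0_norm ?subr_ge0// distrC.
Unshelve. all: by end_near. Qed.

End right_continuous_functions.

Section integral_process.
Context {R : realType} {disp : measure_display} {T : measurableType disp}.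

Lemma integral0_measurable (f : R -> T -> R) t : 0 <= t ->
  (forall s, 0 <= s -> measurable_fun setT (f s)) -> (forall w, rcont (f ^~ w)) ->
  (forall w, loc_bounded (f ^~ w)) -> measurable_fun setT (fun w => integral0 (f ^~ w) t).
Proof.
move=> t0 mf rf bf.
apply: (@measurable_fun_cvg _ _ _ setT (fun n w => t / n.+1%:R * \sum_(l < n.+1) f (t * l.+1%:R / n.+1%:R) w)).
  move=> n; apply: measurable_funM; first exact: measurable_cst.
  by apply: measurable_sum => l; apply: mf; rewrite divr_ge0// mulr_ge0.
move=> w _; exact: (riemann0 (rf w) (bf w) t0 (p := succn)).
Qed.

(* Fatou's lemma for fourth moments, via the truncations at level [n]. *)
Lemma fourth_moment_limit (P : probability T R) (X : T -> R) M :
  measurable_fun setT X ->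
  (forall e, 0 < e -> exists Z, [/\ good P Z, Ex P (fun w => Z w ^+ 4) <= M,
     itg P (fun w => X w - Z w) & Ex P (fun w => `|X w - Z w|) <= e]) ->
  itg P (fun w => X w ^+ 4) /\ Ex P (fun w => X w ^+ 4) <= M.
Proof.
move=> mX hZ.
pose G (n : nat) (w : T) := Num.min `|X w| n%:R ^+ 4.
have m0 (n : nat) (x : R) : 0 <= Num.min `|x| n%:R by rewrite le_min normr_ge0 ler0n.
have mn (n : nat) (x : R) : Num.min `|x| n%:R <= n%:R by rewrite ge_min lexx orbT.
have x4 (x : R) : x ^+ 4 = `|x| ^+ 4 by rewrite -[4%N]/(2 * 2)%N !exprM real_normK ?num_real.
have mG n : measurable_fun setT (G n).
  apply: measurable_funX; apply: measurable_minr; last exact: measurable_cst.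
  exact: measurableT_comp.
have gG n : good P (G n).
  apply: (@good_bounded _ _ _ _ _ (n%:R ^+ 4)) => // w.
  by rewrite ger0_norm ?exprn_ge0// lerXn2r// nnegrE.
have EG n : Ex P (G n) <= M.
  apply/ler_addgt0Pr => e e0.
  (* 4 n^3 is a Lipschitz constant of the fourth power on [0, n]; the added 1 keeps the divisor
     positive at n = 0. *)
  have L0 : 0 < 4 * n%:R ^+ 3 + 1 :> R by rewrite ltr_wpDl// mulr_ge0// exprn_ge0.
  have [Z [gZ Z4 iXZ EXZ]] := hZ (e / (4 * n%:R ^+ 3 + 1)) (divr_gt0 e0 L0).
  have := lerD Z4 (_ : (4 * n%:R ^+ 3 + 1) * Ex P (fun w => `|X w - Z w|) <= e).
  move=> /(_ _); rewrite mulrC -ler_pdivlMr// => /(_ EXZ); apply: le_trans.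
  have gZ4 : itg P (fun w => Z w ^+ 4) by gd.
  rewrite mulrC -ExZ; last exact: itg_norm.
  rewrite -ExD//; last by apply: itgZ; exact: itg_norm.
  apply: Ex_le; [exact: good_itg|by apply: itgD => //; apply: itgZ; exact: itg_norm|move=> w].
  rewrite /G; set a := Num.min `|X w| n%:R; set b := Num.min `|Z w| n%:R.
  have ab : `|a - b| <= `|X w - Z w|.
    rewrite /a /b; have := lerB_dist (X w) (Z w); have := lerB_dist (Z w) (X w).
    rewrite [`|Z w - X w|]distrC.
    case: (leP `|X w| n%:R) => h1; case: (leP `|Z w| n%:R) => h2; rewrite ler_norml; move: h1 h2; lra.
  have bZ : b ^+ 4 <= Z w ^+ 4.
    by rewrite (x4 (Z w)) lerXn2r// ?nnegrE// ?m0// ge_min lexx.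
  have : a ^+ 4 - b ^+ 4 <= 4 * n%:R ^+ 3 * `|a - b|.
    rewrite (_ : _ - _ = (a ^+ 3 + a ^+ 2 * b + a * b ^+ 2 + b ^+ 3) * (a - b)); last by ring.
    have a0 : 0 <= a by exact: m0. have b0 : 0 <= b by exact: m0.
    have an : a <= n%:R by exact: mn. have bn : b <= n%:R by exact: mn.
    have s0 : 0 <= a ^+ 3 + a ^+ 2 * b + a * b ^+ 2 + b ^+ 3.
      by rewrite !addr_ge0 ?mulr_ge0 ?exprn_ge0.
    apply: (@le_trans _ _ ((a ^+ 3 + a ^+ 2 * b + a * b ^+ 2 + b ^+ 3) * `|a - b|)).
      by rewrite ler_wpM2l// ler_norm.
    rewrite ler_wpM2r//.
    have p3 (u v z : R) : 0 <= u -> 0 <= v -> 0 <= z -> u <= n%:R -> v <= n%:R -> z <= n%:R ->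
        u * v * z <= n%:R ^+ 3.
      by move=> u0 v0 z0 un vn zn; rewrite -[n%:R ^+ 3]/(n%:R * (n%:R * n%:R)) mulrA ler_pM// ?mulr_ge0// ler_pM.
    have := p3 a a a a0 a0 a0 an an an; have := p3 a a b a0 a0 b0 an an bn.
    have := p3 a b b a0 b0 b0 an bn bn; have := p3 b b b b0 b0 b0 bn bn bn.
    set N := n%:R ^+ 3.
    rewrite (_ : a ^+ 3 = a * a * a) 1?(_ : b ^+ 3 = b * b * b) 1?(_ : a ^+ 2 * b = a * a * b) 1?(_ : a * b ^+ 2 = a * b * b);
      try by ring.
    lra.
  have : 4 * n%:R ^+ 3 * `|a - b| <= (4 * n%:R ^+ 3 + 1) * `|X w - Z w|.
    rewrite ler_pM// ?mulr_ge0 ?exprn_ge0// lerDl//.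
  by move: bZ; lra.
have lim : (\int[P]_w (X w ^+ 4)%:E <= M%:E)%E.
  have ndG w : nondecreasing_seq (EFin \o G ^~ w).
    move=> n k nk; rewrite /= lee_fin /G lerXn2r ?nnegrE ?m0// le_min ge_min lexx/=.
    by rewrite (le_trans (mn n (X w)))// ler_nat.
  have cG w : (EFin \o G ^~ w) @ \oo --> (X w ^+ 4)%:E.
    apply: cvg_near_cst; near=> n.
    have h : `|X w| <= n%:R by near: n; exact: nbhs_infty_ger.
    by rewrite /comp /G (min_idPl h) -x4.
  have mcv := @cvg_monotone_convergence _ _ _ P setT measurableT (fun n => EFin \o G n) _ _ _.
  have {}mcv : (fun n => \int[P]_w (G n w)%:E)%E @ \oo --> (\int[P]_w (X w ^+ 4)%:E)%E.
    rewrite (_ : (\int[P]_w (X w ^+ 4)%:E)%E = (\int[P]_w limn (fun n => (EFin \o G n) w))%E); last first.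
      by apply: eq_integral => w _; apply/esym/cvg_lim => //; exact: cG.
    apply: mcv => //.
    - by move=> n; exact/measurable_EFinP.
    - by move=> n w _; rewrite /= lee_fin exprn_ge0.
    - by move=> w _; exact: ndG.
  apply: (lee_cvg_to mcv (cvg_cst _)); apply: nearW => n.
  by rewrite (integral_EFin (good_itg (gG n))) lee_fin.
have iX : itg P (fun w => X w ^+ 4).
  apply/integrableP; split; first by apply/measurable_EFinP; exact: measurable_funX.
  apply: le_lt_trans (ltry M); apply: le_trans lim.
  rewrite le_eqVlt; apply/orP; left; apply/eqP; apply: eq_integral => w _.
  by rewrite /= ger0_norm// x4 exprn_ge0.
by split => //; rewrite -lee_fin -integral_EFin.
Unshelve. all: by end_near. Qed.

End integral_process.

(** * The modulating chain *)

Section markov_chain.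
Context {R : realType} {disp : measure_display} {T : measurableType disp} {d : nat}.
Variables (P : probability T R) (mu : 'I_d -> R) (Q : 'M[R]_d) (X : R -> T -> 'I_d).
Hypothesis ctmc : is_ctmc P mu Q X.

Lemma Ex_indic A : measurable A -> Ex P (\1_A : T -> R) = fine (P A).
Proof. by move=> mA; rewrite /Ex /Rintegral integral_indic// setIT. Qed.

Lemma state_decomposition (phi : 'I_d -> R) (y : T -> 'I_d) w :
  phi (y w) = \sum_j \1_(y @^-1` [set j]) w * phi j.
Proof.
rewrite (bigD1 (y w))//= big1 ?addr0 => [|j /eqP jy].
  by rewrite indicE mem_set ?mul1r.
by rewrite indicE memNset ?mul0r// => /= e; apply: jy.
Qed.

Lemma ctmc_measurable (f : 'I_d -> R) t : 0 <= t -> measurable_fun setT (fun w => f (X t w)).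
Proof.
move=> t0; have [mX _ _] := ctmc.
rewrite (_ : (fun w => _) = (fun w => \sum_j \1_(X t @^-1` [set j]) w * f j)); last first.
  by apply/funext => w; exact: state_decomposition.
by apply: measurable_sum => j; apply: measurable_funM => //; apply: measurable_indic; exact: mX.
Qed.

Lemma state_bounded (f : 'I_d -> R) i : `|f i| <= \sum_j `|f j|.
Proof. by rewrite (bigD1 i)//= lerDl sumr_ge0. Qed.

Lemma ctmc_good (f : 'I_d -> R) t : 0 <= t -> good P (fun w => f (X t w)).
Proof.
move=> t0; apply: (@good_bounded _ _ _ _ _ (\sum_j `|f j|)); first exact: ctmc_measurable.
by move=> w; exact: state_bounded.
Qed.

Lemma ctmc_rcont (f : 'I_d -> R) w : rcont (fun t => f (X t w)).
Proof.
move=> t t0; have [_ cX _] := ctmc.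
by apply: cvg_near_cst; near=> s; congr f; near: s; exact: cX.
Unshelve. all: by end_near. Qed.

Lemma ctmc_loc_bounded (f : 'I_d -> R) w : loc_bounded (fun t => f (X t w)).
Proof. by apply: (@loc_bounded_bounded _ _ (\sum_j `|f j|)) => t _; exact: state_bounded. Qed.

Variable t : nat -> R.
Hypotheses (t0 : t 0%N = 0) (tS : forall k, t k <= t k.+1).
Local Notation x l := (X (t l)).

Let t_ge0 l : 0 <= t l.
Proof. by elim: l => [|l ih]; [rewrite t0|exact: le_trans (tS l)]. Qed.

Let mx l i : measurable (x l @^-1` [set i]).
Proof. by have [mX _ _] := ctmc; exact: mX. Qed.

Let path_prob k (c : nat -> 'I_d) : P (\big[setI/setT]_(j < k.+1) (x j @^-1` [set c j])) =
  (mu (c 0%N) * \prod_(j < k) expmx ((t j.+1 - t j) *: Q) (c j) (c j.+1))%:E.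
Proof. by have [_ _ fdd] := ctmc; rewrite -fdd// bigcap_mkord. Qed.

Let path_step l (c : {ffun 'I_l.+1 -> 'I_d}) i0 j :
  fine (P (path_event (fun l => x l) c `&` x l.+1 @^-1` [set j])) =
  fine (P (path_event (fun l => x l) c)) * expmx ((t l.+1 - t l) *: Q) (extend i0 c l) j.
Proof.
pose c' k := if k == l.+1 then j else extend i0 c k.
have -> : path_event (fun l => x l) c = \big[setI/setT]_(k < l.+1) (x k @^-1` [set c' k]).
  rewrite /path_event; apply: eq_bigr => k _; rewrite /c' extendE ltn_eqF//.
have -> : x l.+1 @^-1` [set j] = x l.+1 @^-1` [set c' l.+1] by rewrite /c' eqxx.
have -> : \big[setI/setT]_(k < l.+1) (x k @^-1` [set c' k]) `&` x l.+1 @^-1` [set c' l.+1] =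
    \big[setI/setT]_(k < l.+2) (x k @^-1` [set c' k]) by rewrite [in RHS]big_ord_recr.
rewrite !path_prob.
have e1 : c' l.+1 = j by rewrite /c' eqxx.
have e2 : c' l = extend i0 c l by rewrite /c' ltn_eqF.
by rewrite /= big_ord_recr/= mulrA e1 e2.
Qed.

(** The finite-dimensional distributions give the one-step rule for each word ([path_step]); a
    function of the past is a combination of word indicators. *)
Lemma ctmc_markov (i0 : 'I_d) l (H : (nat -> 'I_d) -> R) (phi : 'I_d -> R) : prefix l.+1 H ->
  Ex P (fun w => H (fun j => x j w) * phi (x l.+1 w)) =
  Ex P (fun w => H (fun j => x j w) * \sum_j expmx ((t l.+1 - t l) *: Q) (x l w) j * phi j).
Proof.
move=> pH; pose xx l := x l.
have p1 : prefix l.+1 (fun c w => H c * phi (x l.+1 w)).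
  by move=> c c' cc'; rewrite (pH c c' cc').
have p2 : prefix l.+1 (fun c (_ : T) => H c * \sum_j expmx ((t l.+1 - t l) *: Q) (c l) j * phi j).
  by move=> c c' cc'; rewrite (pH c c' cc') (cc' l (ltnSn l)).
rewrite (@eq_Ex _ _ _ P _ _ (fun w => path_decomposition xx i0 w p1)).
rewrite (@eq_Ex _ _ _ P _ _ (fun w => path_decomposition xx i0 w p2)).
have gp (c : {ffun 'I_l.+1 -> 'I_d}) : good P (\1_(path_event xx c) : T -> R).
  by apply: good_indic; exact: measurable_path_event.
have gf : good P (fun w => phi (x l.+1 w)) by exact: ctmc_good.
rewrite !Ex_sum => [|c|c]; [|by apply: good_itg; gd|by apply: good_itg; gd].
apply: eq_bigr => c _.
have -> : Ex P (fun w => \1_(path_event xx c) w * (H (extend i0 c) * phi (x l.+1 w))) =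
    \sum_j (H (extend i0 c) * phi j) * fine (P (path_event xx c `&` x l.+1 @^-1` [set j])).
  rewrite (@eq_Ex _ _ _ P _ (fun w => \sum_j (H (extend i0 c) * phi j) *
      \1_(path_event xx c `&` x l.+1 @^-1` [set j]) w)) => [|w].
    have gi j : good P (\1_(path_event xx c `&` x l.+1 @^-1` [set j]) : T -> R).
      by apply: good_indic; apply: measurableI => //; exact: measurable_path_event.
    rewrite Ex_sum => [|j]; last by apply: good_itg; gd.
    apply: eq_bigr => j _; rewrite ExZ ?Ex_indic//; last exact: good_itg.
    by apply: measurableI => //; exact: measurable_path_event.
  rewrite (state_decomposition phi (x l.+1)) !mulr_sumr; apply: eq_bigr => j _.
  by rewrite indicI/= ; ring.
rewrite (@eq_Ex _ _ _ P _ (fun w => (H (extend i0 c) * \sum_j expmx ((t l.+1 - t l) *: Q) (extend i0 c l) j * phi j) *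
  \1_(path_event xx c) w)) => [|w]; last by rewrite mulrC.
rewrite ExZ ?Ex_indic//; [|exact: measurable_path_event|exact: good_itg].
rewrite -mulrA mulr_suml mulr_sumr; apply: eq_bigr => j _.
by rewrite (path_step c i0); ring.
Qed.

End markov_chain.

Lemma dotv_indicator (R : realType) (disp : measure_display)
    (T : measurableType disp) (d : nat) (v : 'cV[R]_d) (X : R -> T -> 'I_d) s w :
  dotv v (indicator_vector X s w) = v (X s w) 0.
Proof.
rewrite /dotv mxE (bigD1 (X s w))//= big1 ?addr0 => [|j /negPf jX].
  by rewrite !mxE eqxx mulr1.
by rewrite !mxE eq_sym jX mulr0.
Qed.

(* The chain leaves its state within time [u - s] with probability O(n (u - s)). *)
Lemma ctmc_oscillation (R : realType) (d : nat) (Q : 'M[R]_d) (f : 'I_d -> R) :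
  exists2 C, 0 <= C & forall (disp : measure_display) (T : measurableType disp)
    (P : probability T R) (mu : 'I_d -> R) (X : R -> T -> 'I_d) (n s u : R),
  is_ctmc P mu (n *: Q) X -> 0 <= n -> 0 <= s -> s <= u -> n * (u - s) <= 1 ->
  Ex P (fun w => (f (X s w) - f (X u w)) ^+ 2) <= C * (n * (u - s)).
Proof.
have [C C0 eC] := expmx_bound Q.
pose S := \sum_j `|f j|; have S0 : 0 <= S by exact: sumr_ge0.
pose q := \sum_i \sum_j `|Q i j|.
have qij i j : `|Q i j| <= q.
  rewrite /q (bigD1 i)//= (bigD1 j)//= -addrA lerDl addr_ge0 ?sumr_ge0// => k _; exact: sumr_ge0.
have q0 : 0 <= q by rewrite sumr_ge0// => i _; exact: sumr_ge0.
exists (d%:R * (d%:R * ((q + C) * (2 * S) ^+ 2))).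
  by rewrite !mulr_ge0 ?addr_ge0 ?exprn_ge0 ?mulr_ge0.
move=> disp T P mu X n s u ctmc n0 s0 su nus.
(* A grid 0, s, u, u, ...: the Markov property at index 1 is the transition from time s to time
   u. *)
pose t k : R := match k with 0%N => 0 | 1%N => s | _ => u end.
have tS k : t k <= t k.+1 by case: k => [|[|k]].
have tau : 0 <= n * (u - s) <= 1 by rewrite nus andbT mulr_ge0// subr_ge0.
have i0 : 'I_d := X 0 (point : T).
have m2 : 0 <= u by exact: le_trans su.
have gs (g : 'I_d -> R) := ctmc_good ctmc g s0.
have gu (g : 'I_d -> R) := ctmc_good ctmc g m2.
have e i : Ex P (fun w => (X s w == i)%:R * (f i - f (X u w)) ^+ 2) <=
    d%:R * ((q + C) * (2 * S) ^+ 2) * (n * (u - s)).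
  have := @ctmc_markov _ _ _ _ _ _ _ _ ctmc t erefl tS i0 1 (fun c => (c 1%N == i)%:R) (fun j => (f i - f j) ^+ 2).
  rewrite /t => ->; last by move=> c c' cc'; rewrite cc'.
  have h : 0 <= d%:R * ((q + C) * (2 * S) ^+ 2) * (n * (u - s)).
    by case/andP: tau => tau0 _; rewrite mulr_ge0// mulr_ge0// mulr_ge0 ?addr_ge0 ?sqr_ge0.
  rewrite -[leRHS](Ex_cst P); apply: Ex_le; [|exact: itg_cst|].
    apply: good_itg; apply: goodM; first exact: (gs (fun k => (k == i)%:R)).
    exact: (gs (fun k => \sum_j expmx ((u - s) *: (n *: Q)) k j * (f i - f j) ^+ 2)).
  move=> w; have [Xi|_] := eqVneq (X s w) i; last by rewrite mul0r.
  rewrite mul1r (le_trans (ler_norm _))// (le_trans (ler_norm_sum _ _ _))//.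
  have -> : d%:R * ((q + C) * (2 * S) ^+ 2) * (n * (u - s)) =
      \sum_(j < d) ((q + C) * (2 * S) ^+ 2) * (n * (u - s)).
    by rewrite sumr_const card_ord -[RHS]mulr_natl -mulrA.
  apply: ler_sum => j _; have [ij|ij] := eqVneq (X s w) j.
    rewrite -ij Xi subrr expr0n/= mulr0 normr0.
    by case/andP: tau => tau0 _; rewrite mulr_ge0// mulr_ge0 ?addr_ge0 ?sqr_ge0.
  have := eC (n * (u - s)) (X s w) j tau; rewrite (negPf ij) subr0 => hC.
  have -> : (u - s) *: (n *: Q) = (n * (u - s)) *: Q by rewrite scalerA mulrC.
  rewrite normrM [leRHS]mulrAC ler_pM//; last first.
    rewrite normrX lerXn2r// ?nnegrE ?mulr_ge0// (le_trans (ler_normB _ _))// mulr_natl mulr2n lerD//; exact: state_bounded.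
  have {}hC : `|expmx (n * (u - s) *: Q) (X s w) j| <= `|n * (u - s) * Q (X s w) j| + C * (n * (u - s)) ^+ 2.
    by rewrite -lerBlDl; apply: le_trans hC; exact: lerB_dist.
  case/andP: tau => tau0 tau1.
  apply: (le_trans hC); rewrite normrM (ger0_norm tau0) mulrDl lerD//.
    by rewrite mulrC ler_wpM2r.
  by rewrite ler_wpM2l// expr2 ler_piMl.
rewrite (@eq_Ex _ _ _ P _ (fun w => \sum_i (X s w == i)%:R * (f i - f (X u w)) ^+ 2)) => [|w].
  have gi i : good P (fun w => (X s w == i)%:R * (f i - f (X u w)) ^+ 2).
    by apply: goodM; [exact: (gs (fun k => (k == i)%:R))|exact: (gu (fun k => (f i - f k) ^+ 2))].
  rewrite Ex_sum => [|i]; last exact: good_itg.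
  rewrite -[X in X%:R * _ * _](card_ord d) -mulrA mulr_natl -sumr_const; apply: ler_sum => i _; exact: e.
rewrite (bigD1 (X s w))//= eqxx mul1r big1 ?addr0// => i /negPf iX.
by rewrite eq_sym iX mul0r.
Qed.

Lemma pow4D (R : realType) (u v : R) : (u + v) ^+ 4 <= 8 * (u ^+ 4 + v ^+ 4).
Proof.
rewrite -subr_ge0 (_ : _ - _ = 4 * (u ^+ 2 - v ^+ 2) ^+ 2 +
  (u - v) ^+ 2 * (2 * (u ^+ 2 + v ^+ 2) + (u + v) ^+ 2)); last by ring.
have := sqr_ge0 u; have := sqr_ge0 v; have := sqr_ge0 (u + v) => h1 h2 h3.
by apply: addr_ge0; rewrite mulr_ge0 ?sqr_ge0//; lra.
Qed.

Section brownian_path_independence.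
Context {R : realType} {disp : measure_display} {T : measurableType disp} {d : nat}.
Variables (P : probability T R) (F : R -> set (set T)) (B : R -> T -> R)
  (mu : 'I_d -> R) (Q : 'M[R]_d) (X : R -> T -> 'I_d).
Hypotheses (fF : is_filtration F) (bm : is_brownian_motion P F B) (ctmc : is_ctmc P mu Q X).
Hypothesis indep : independent_classes P (sigma_of_process measurable B) (sigma_of_process setT X).

Let GB := sigma_of_process measurable B.

Lemma brownian_sigma : sigma_algebra setT GB.
Proof. exact: smallest_sigma_algebra. Qed.

Lemma brownian_sigma_measurable : GB `<=` measurable.
Proof.
apply: smallest_sub; first exact: sigma_algebra_measurable.
move=> _ [t t0 [A mA <-]]; have {}t0 : 0 <= t by move: t0; rewrite /= in_itv/= andbT.
rewrite setTI; apply: (filtration_measurable fF t0).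
by apply: (brownian_fmeas bm).
Qed.

Lemma fmeas_brownian t : 0 <= t -> fmeas GB (B t).
Proof.
move=> t0 A mA; apply: sub_sigma_algebra; exists t; first by rewrite /= in_itv/= t0.
by exists A => //; rewrite setTI.
Qed.

(** Conditioning on the chain: its path is held fixed while the Brownian motion is integrated out,
    so Gaussian computations take place with deterministic coefficients. *)
Lemma Ex_quench m k (Phi : (nat -> 'I_d) -> T -> R) : prefix k Phi -> (forall c, good P (Phi c)) ->
  (forall c, fmeas GB (Phi c)) ->
  let x w l := X (dy m l) w in
  Ex P (fun w => Phi (x w) w) = Ex P (fun w => Ex P (Phi (x w))).
Proof.
move=> pPhi gPhi fPhi x.
have i0 : 'I_d := X 0 (point : T).
have mx l i : measurable ((fun w => x w l) @^-1` [set i]).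
  by have [mX _ _] := ctmc; apply: mX; exact: dy_ge0.
apply: (@Ex_path _ _ _ _ P (fun l w => x w l) i0 mx GB k) => //.
  exact: brownian_sigma_measurable.
move=> A c GA; apply: indep => //.
pose GX : set (set T) := sigma_of_process setT X.
have h (j : 'I_k) : GX ((fun w => x w j) @^-1` [set c j]).
  apply: sub_sigma_algebra; exists (dy m j); first by rewrite /= in_itv/= dy_ge0.
  by exists [set c j] => //; rewrite setTI.
have := @bigsetI_measurable _ (g_sigma_algebraType (\bigcup_(t in `[0%R, +oo[%classic) preimage_set_system setT (X t) setT))
  _ (index_enum 'I_k) xpredT (fun j => (fun w => x w j) @^-1` [set c j]).
by apply=> j _; exact: h.
Qed.

End brownian_path_independence.

(** * Moments of the combined drift and noise walk *)

Section modulated_walk.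
Context {R : realType} {d : nat}.
Variables (Q : 'M[R]_d) (p alpha gamma sigma : 'cV[R]_d) (h m0 : R).
Hypotheses (genQ : is_generator Q) (inv_p : invariant_distribution Q p)
  (uniq_p : forall p', invariant_distribution Q p' -> p' = p)
  (gamma_gt0 : forall i, 0 < gamma i 0).

Definition drift_sum (m k n : nat) (c : nat -> 'I_d) : R :=
  \sum_(l < n) 2 ^- m * field p alpha gamma h m0 (dy m (k + l)) (c (k + l)%N).

Lemma drift_sum_prefix m k n : prefix (k + n) (drift_sum m k n).
Proof.
move=> c c' cc'; apply: eq_bigr => l _; rewrite cc'// ltn_add2l//.
Qed.

Lemma drift_sum_cat m k n c : drift_sum m 0 (k + n) c = drift_sum m 0 k c + drift_sum m k n c.
Proof. by rewrite /drift_sum big_split_ord/=; congr (_ + _); apply: eq_bigr => l _. Qed.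

Lemma gsum_cat (disp : measure_display) (T : measurableType disp) (B : R -> T -> R) m sg k n w :
  gsum B m sg 0 (k + n) w = gsum B m sg 0 k w + gsum B m sg k n w.
Proof. by rewrite /gsum big_split_ord/=; congr (_ + _); apply: eq_bigr => l _. Qed.

Lemma gsum_prefix (disp : measure_display) (T : measurableType disp) (B : R -> T -> R) m k n :
  prefix (k + n) (fun (c : nat -> 'I_d) (w : T) => gsum B m (fun l => sigma (c l) 0) k n w).
Proof.
move=> c c' cc'; apply/funext => w; apply: eq_bigr => l _; rewrite cc'// ltn_add2l//.
Qed.

Lemma prefix_le k k' (U : Type) (H : (nat -> 'I_d) -> U) : (k <= k')%N -> prefix k H -> prefix k' H.
Proof. by move=> kk' pH c c' cc'; apply: pH => j jk; apply: cc'; exact: leq_trans jk _. Qed.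

Lemma ctmc_moments (G L : R) : 0 <= G -> 0 <= L -> exists2 C, 0 <= C &
  forall (disp : measure_display) (T : measurableType disp) (P : probability T R)
    (mu : 'I_d -> R) (X : R -> T -> 'I_d) (n : R) (m : nat),
  is_ctmc P mu (n *: Q) X -> 1 <= n -> n ^+ 2 * 2 ^- m <= 1 ->
  forall g : nat -> 'I_d -> R, (forall l i, `|g l i| <= G) ->
    (forall l i, `|g l.+1 i - g l i| <= L * 2 ^- m) -> (forall l, pavg p (g l) = 0) ->
  forall k q, q%:R / 2 ^+ m <= 1 :> R ->
  let t := q%:R / 2 ^+ m in
  let x w l := X (dy m l) w in
  let A w := \sum_(l < q) 2 ^- m * g (k + l)%N (x w (k + l)%N) in
  [/\ Ex P (fun w => A w ^+ 2) <= C * t / n,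
      Ex P (fun w => A w ^+ 4) <= C * t ^+ 2 / n ^+ 2
    & forall H, prefix k.+1 H -> (forall c, `|H c| <= 1) ->
      `|Ex P (fun w => H (x w) * A w)| <= C / n /\
      `|n * Ex P (fun w => H (x w) * A w ^+ 2) -
        (\sum_(l < q) 2 ^- m * (2 * pavg p (fun i => g (k + l)%N i * poisson Q p (g (k + l)%N) i))) *
        Ex P (fun w => H (x w))| <= C * t ^+ 2 + C / Num.sqrt n].
Proof.
move=> G0 L0; have [CP CP0 eC] := expmx_bound Q.
have [C C0 mC] := chain_moments genQ inv_p uniq_p CP0 G0 L0 (ler01 : (0 : R) <= 1).
exists C => // disp T P mu X n m ctmc n1 nm g gG gL g0 k q t1 t x A.
have n0 : 0 < n by exact: lt_le_trans n1.
have Dt0 : 0 < 2 ^- m :> R by rewrite invr_gt0 exprn_gt0.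
have i0 : 'I_d := X 0 (point : T).
pose xx l w := X (dy m l) w.
have mx l i : measurable (xx l @^-1` [set i]).
  by have [mX _ _] := ctmc; apply: mX; exact: dy_ge0.
have dyS l : dy m l.+1 - dy m l = 2 ^- m :> R by rewrite dy_succ addrAC subrr add0r.
pose Pm := expmx (2 ^- m *: (n *: Q)).
have mk l (H : (nat -> 'I_d) -> R) (phi : 'I_d -> R) : prefix l.+1 H ->
    Ex P (fun w => H (xx ^~ w) * phi (xx l.+1 w)) =
    Ex P (fun w => H (xx ^~ w) * \sum_j Pm (xx l w) j * phi j).
  move=> pH; have := @ctmc_markov _ _ _ _ _ _ _ _ ctmc (dy m) _ _ i0 l H phi pH.
  rewrite dyS; apply; first by rewrite /dy mul0r.
  by move=> l'; rewrite dy_succ lerDl ltW.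
have nDt : 0 <= n * 2 ^- m <= 1.
  have nD0 : 0 <= n * 2 ^- m by rewrite mulr_ge0// ltW.
  by rewrite nD0/= (le_trans _ nm)// expr2 -mulrA ler_peMl.
have PmQ i j : `|Pm i j - (i == j)%:R - n * 2 ^- m * Q i j| <= CP * (n * 2 ^- m) ^+ 2.
  by rewrite /Pm scalerA (mulrC (2 ^- m) n); exact: eC.
exact: (mC _ _ P xx Pm n (2 ^- m) i0 mx mk n1 Dt0 nm PmQ g gG gL g0 k q t1).
Qed.

(** The conditions on [a] and [b] match the sizes of the two parts: the chain functional has
    variance O(t/n), the Gaussian sum O(t). [Psi] is measurable for the Brownian sigma-algebra,
    which allows freezing the chain, and for F at the starting time, which makes later increments
    orthogonal to it. *)
Lemma walk_moments : exists2 C, 0 <= C &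
  forall (disp : measure_display) (T : measurableType disp) (P : probability T R)
    (F : R -> set (set T)) (B : R -> T -> R) (mu : 'I_d -> R) (X : R -> T -> 'I_d) (n a b : R),
  is_filtration F -> is_brownian_motion P F B -> is_ctmc P mu (n *: Q) X ->
  independent_classes P (sigma_of_process measurable B) (sigma_of_process setT X) ->
  1 <= n -> a ^+ 2 <= n -> b ^+ 2 <= 1 ->
  forall m, n ^+ 2 * 2 ^- m <= 1 -> forall k q, q%:R / 2 ^+ m <= 1 :> R ->
  let t := q%:R / 2 ^+ m in
  let x w l := X (dy m l) w in
  let D w := a * drift_sum m k q (x w) + b * gsum B m (fun l => sigma (x w l) 0) k q w in
  [/\ good P D, Ex P (fun w => D w ^+ 4) <= C * t ^+ 2
    & forall Psi : (nat -> 'I_d) -> T -> R, prefix k.+1 Psi ->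
      (forall c, fmeas (sigma_of_process measurable B) (Psi c)) ->
      (forall c, fmeas (F (dy m k)) (Psi c)) -> (forall c w, `|Psi c w| <= 1) ->
      `|Ex P (fun w => Psi (x w) w * D w)| <= C / Num.sqrt n /\
      `|Ex P (fun w => Psi (x w) w * (D w ^+ 2 - t * limit_variance Q p alpha gamma sigma h m0 (dy m k)))| <=
        C * t ^+ 2 + C / Num.sqrt n + C * `|a ^+ 2 / n - (1 <= h)%R%:R| + C * `|b ^+ 2 - (h <= 1)%R%:R|].
Proof.
have consts (c1 c2 lv cv s4 s2 : R) (c := 8 * (c1 + 35 * s4) + c1 + c2 + lv + cv + s2) :
    0 <= c1 -> 0 <= c2 -> 0 <= lv -> 0 <= cv -> 0 <= s4 -> 0 <= s2 ->
    [/\ 0 <= c, 8 * (c1 + 35 * s4) <= c, cv <= c & s2 <= c] /\ [/\ c1 <= c, lv + c1 <= c & c1 + c2 <= c].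
  by rewrite /c => *; split; split; lra.
have tri (y1 y2 y3 y4 c1 c2 c3 c4 : R) : `|y1| <= c1 -> `|y2| <= c2 -> `|y3| <= c3 -> `|y4| <= c4 ->
    `|y1 + y2 + y3 + y4| <= c3 + c4 + c1 + c2.
  move=> h1 h2 h3 h4; rewrite -addrA addrC; rewrite (_ : c3 + c4 + c1 + c2 = (c3 + c4) + (c1 + c2)); last by ring.
  by do 3 (apply: (le_trans (ler_normD _ _)); apply: lerD => //); apply: (le_trans (ler_normD _ _)); apply: lerD.
have [G G0 gG] := field_bounded alpha h m0 inv_p gamma_gt0.
have [L L0 gL] := field_lipschitz alpha h m0 inv_p gamma_gt0.
have [CV CV0 VC] := V_integrand_bounded alpha h m0 genQ inv_p uniq_p gamma_gt0.
have [LV LV0 VL] := V_integrand_lipschitz alpha h m0 genQ inv_p uniq_p gamma_gt0.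
(* The squared volatility minus its average is a centered field of the chain, constant in time, so
   the fluctuation of the conditional variance is controlled like the drift. *)
pose s2 i := sigma i 0 ^+ 2 - sigma2_inf p sigma.
pose S := \sum_j `|sigma j 0|.
have S0 : 0 <= S by exact: sumr_ge0.
pose S2 := \sum_j `|s2 j|.
have S20 : 0 <= S2 by exact: sumr_ge0.
have sg0 := sigma2_inf_ge0 sigma inv_p.
have [C1 C10 mA] := ctmc_moments G0 L0.
have [C2 C20 mS] := ctmc_moments S20 (lexx (0 : R)).
pose C := 8 * (C1 + 35 * S ^+ 4) + C1 + C2 + LV + CV + sigma2_inf p sigma.
have S40 : 0 <= S ^+ 4 by exact: exprn_ge0.
have [[C0 cC1 cC3 cC4] [cC2 cC5 cC6]] := consts _ _ _ _ _ _ C10 C20 LV0 CV0 S40 sg0.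
rewrite -/C in C0 cC1 cC2 cC3 cC4 cC5 cC6.
exists C => // disp T P F B mu X n a b fF bm ctmc indep n1 an b1 m nm k q t1 t x D.
have n0 : 0 < n by exact: lt_le_trans n1.
have sn0 : 0 < Num.sqrt n by rewrite sqrtr_gt0.
have Dt0 : 0 < 2 ^- m :> R by rewrite invr_gt0 exprn_gt0.
have t0 : 0 <= t by rewrite /t divr_ge0// exprn_ge0.
have d0 l : 0 <= dy m l :> R by exact: dy_ge0.
have ninv : n^-1 <= (Num.sqrt n)^-1.
  by rewrite lef_pV2 ?posrE// -{2}[n]sqr_sqrtr ?(ltW n0)// expr2 ler_peMl ?(ltW sn0)// -sqrtr1 ler_wsqrtr.
have i0 : 'I_d := X 0 (point : T).
pose xx l w := X (dy m l) w.
have mx l i : measurable (xx l @^-1` [set i]) by have [mX _ _] := ctmc; exact: mX.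
have dyS l : dy m l.+1 - dy m l = 2 ^- m :> R by rewrite dy_succ addrAC subrr add0r.
have dlip l : `|dy m l.+1 - dy m l| = 2 ^- m :> R by rewrite dyS gtr0_norm.
pose g l i := field p alpha gamma h m0 (dy m l) i.
have gG' l i : `|g l i| <= G by exact: gG.
have gL' l i : `|g l.+1 i - g l i| <= L * 2 ^- m by rewrite -(dlip l); exact: gL.
have [_ A4 A3] := mA _ _ P mu X n m ctmc n1 nm g gG' gL'
  (fun l => pavg_field alpha gamma h m0 inv_p _) k q t1.
have s2G (l : nat) i : `|s2 i| <= S2 by exact: state_bounded.
have s2L (l : nat) i : `|s2 i - s2 i| <= 0 * 2 ^- m by rewrite subrr normr0 mul0r.
have s2p (l : nat) : pavg p s2 = 0.
  rewrite /s2 /pavg; under eq_bigr do rewrite mulrBr.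
  rewrite sumrB -mulr_suml; have [_ _ ->] := inv_p; rewrite mul1r /sigma2_inf dotv_pavg /pavg.
  by under [X in _ - X]eq_bigr do rewrite mxE; rewrite subrr.
have [_ _ B3] := mS _ _ P mu X n m ctmc n1 nm (fun=> s2) s2G s2L s2p k q t1.
pose pos c := drift_sum m k q c.
pose vol (c : nat -> 'I_d) w := gsum B m (fun l => sigma (c l) 0) k q w.
have sS (c : nat -> 'I_d) l : `|sigma (c l) 0| <= S by exact: (state_bounded (fun i => sigma i 0)).
have gvol c : good P (vol c) by exact: (gsum_good fF bm).
have fvol c : fmeas (sigma_of_process measurable B) (vol c).
  by apply: gsum_fmeas_wrt => [|s s0]; [exact: brownian_sigma|exact: fmeas_brownian].
have pvol : prefix (k + q) vol by exact: gsum_prefix.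
have ppos : prefix (k + q) pos by exact: drift_sum_prefix.
have quench := Ex_quench fF bm ctmc indep.
have sB := brownian_sigma B.
have gpos : good P (fun w => pos (x w)) by exact: (good_prefix P i0 mx ppos).
have gvolx : good P (fun w => vol (x w) w) by exact: (good_path i0 mx pvol gvol).
have posM w : pos (x w) = \sum_(l < q) 2 ^- m * g (k + l)%N (xx (k + l)%N w) by [].
split.
- by rewrite /D -/pos; apply: goodD; apply: goodZ.
- have vol4 : Ex P (fun w => vol (x w) w ^+ 4) <= 35 * S ^+ 4 * t ^+ 2.
    have pv4 : prefix (k + q) (fun c w => vol c w ^+ 4).
      by move=> c c' cc'; rewrite (pvol c c' cc').
    have pv4' : prefix (k + q) (fun c => Ex P (fun w => vol c w ^+ 4)).
      by move=> c c' cc'; rewrite (pvol c c' cc').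
    rewrite (quench m _ _ pv4); [|by move=> c; gd|by move=> c; apply: fmeasX].
    rewrite -[leRHS](Ex_cst P); apply: Ex_le; [exact: good_itg (good_prefix P i0 mx pv4')|exact: itg_cst|].
    by move=> w; exact: (gsum_fourth fF bm m (sS (x w)) k q).
  have pos4 : Ex P (fun w => pos (x w) ^+ 4) <= C1 * t ^+ 2 / n ^+ 2 by exact: A4.
  apply: (@le_trans _ _ (8 * (a ^+ 4 * Ex P (fun w => pos (x w) ^+ 4) + b ^+ 4 * Ex P (fun w => vol (x w) w ^+ 4)))).
    rewrite -[X in 8 * (X + _)]ExZ; last by apply: good_itg; gd.
    rewrite -[X in 8 * (_ + X)]ExZ; last by apply: good_itg; gd.
    rewrite -ExD; [|by apply: good_itg; gd|by apply: good_itg; gd].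
    rewrite -ExZ; last by apply: good_itg; gd.
    apply: Ex_le; [by apply: good_itg; rewrite /D -/pos; gd|by apply: good_itg; gd|move=> w].
    by rewrite (le_trans (pow4D _ _))// !exprMn.
  have a4 : a ^+ 4 <= n ^+ 2.
    by rewrite -[4%N]/(2 * 2)%N exprM lerXn2r// nnegrE ?sqr_ge0// ltW.
  have b4 : b ^+ 4 <= 1.
    by rewrite -[4%N]/(2 * 2)%N exprM exprn_ile1// sqr_ge0.
  have a40 : 0 <= a ^+ 4 by rewrite -[4%N]/(2 * 2)%N exprM sqr_ge0.
  have b40 : 0 <= b ^+ 4 by rewrite -[4%N]/(2 * 2)%N exprM sqr_ge0.
  have h1 : a ^+ 4 * Ex P (fun w => pos (x w) ^+ 4) <= C1 * t ^+ 2.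
    rewrite (le_trans (ler_wpM2l a40 pos4))// mulrCA ler_piMr ?mulr_ge0// ?sqr_ge0// ler_pdivrMr ?mul1r// exprn_gt0//.
  have h2 : b ^+ 4 * Ex P (fun w => vol (x w) w ^+ 4) <= 35 * S ^+ 4 * t ^+ 2.
    rewrite (le_trans (ler_wpM2l b40 vol4))// ler_piMl// !mulr_ge0// sqr_ge0.
  have t20 : 0 <= t ^+ 2 by exact: sqr_ge0.
  have h3 : 8 * (C1 * t ^+ 2 + 35 * S ^+ 4 * t ^+ 2) <= C * t ^+ 2.
    rewrite -mulrDl mulrA.
    by rewrite ler_wpM2r.
  by apply: le_trans h3; rewrite ler_pM2l// lerD.
move=> Psi pPsi fPsi fPsi' Psi1.
have gPsi c : good P (Psi c).
  by apply: (@good_bounded _ _ _ _ _ 1) => //; apply: fmeas_measurable (fPsi c); exact: (brownian_sigma_measurable fF bm).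
(* Integrating [Psi] over the Brownian motion leaves a bounded function of the chain prefix, an
   admissible test function for the chain estimates. *)
pose e c := Ex P (Psi c).
have pe : prefix k.+1 e by move=> c c' cc'; rewrite /e (pPsi c c').
have e1 c : `|e c| <= 1.
  by rewrite -[leRHS](Ex_cst P); apply: Ex_norm_le => //; [exact: good_itg|exact: itg_cst].
have [A31 A32] := A3 e pe e1; have [B31 _] := B3 e pe e1.
have gvx c : good P (fun w => Psi c w * vol c w) by gd.
have orth c : Ex P (fun w => Psi c w * vol c w) = 0.
  exact: (gsum_orth fF bm).
have sq c : Ex P (fun w => Psi c w * vol c w ^+ 2) =
    (\sum_(l < q) 2 ^- m * s2 (c (k + l)%N) + t * sigma2_inf p sigma) * e c.
  rewrite (gsum_square fF bm)//.
  congr (_ * _); rewrite mulr_suml /s2.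
  rewrite (_ : t * _ = \sum_(l < q) 2 ^- m * sigma2_inf p sigma).
    by rewrite -big_split; apply: eq_bigr => l _ /=; ring.
  by rewrite sumr_const card_ord -[RHS]mulr_natl mulrA.
have pq : prefix (k + q).+1 Psi by apply: prefix_le pPsi; rewrite ltnS leq_addr.
have vq : prefix (k + q).+1 vol by exact: prefix_le pvol.
have oq : prefix (k + q).+1 pos by exact: prefix_le ppos.
have eq_ : prefix (k + q).+1 e by apply: prefix_le pe; rewrite ltnS leq_addr.
have gpx := good_prefix P i0 mx.
have gex : good P (fun w => e (x w)) by exact: gpx pe.
have a_le : `|a| <= Num.sqrt n by rewrite -sqrtr_sqr ler_wsqrtr.
have nsn : n = Num.sqrt n ^+ 2 by rewrite sqr_sqrtr// ltW.
split.
  rewrite (quench m (k + q).+1 (fun c w => Psi c w * (a * pos c + b * vol c w))) => [|c c' cc'|c|c]; last 3 first.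
  - by rewrite (pq c c' cc') (vq c c' cc') (oq c c' cc').
  - by gd.
  - by apply: fmeasM => //; apply: fmeasD => //; [exact: fmeas_cst|apply: fmeasM => //; exact: fmeas_cst].
  rewrite (@eq_Ex _ _ _ P _ (fun w => a * (e (x w) * pos (x w)))) => [|w]; last first.
    rewrite (@eq_Ex _ _ _ P _ (fun w' => a * pos (x w) * Psi (x w) w' + b * (Psi (x w) w' * vol (x w) w'))) => [|w'].
      by rewrite ExD ?ExZ ?orth; [rewrite -/(e (x w)); ring|apply: good_itg; gd..].
    by ring.
  rewrite ExZ; last by apply: good_itg; gd.
  rewrite normrM; have hA : `|Ex P (fun w => e (x w) * pos (x w))| <= C1 / n by exact: A31.
  apply: (@le_trans _ _ (Num.sqrt n * (C1 / n))); first by rewrite ler_pM.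
  have -> : Num.sqrt n * (C1 / n) = C1 / Num.sqrt n.
    by rewrite [X in C1 / X]nsn; field; exact: lt0r_neq0.
  by rewrite ler_wpM2r ?invr_ge0 ?(ltW sn0).
set v := limit_variance _ _ _ _ _ _ _ _.
have gDc c : good P (fun w => a * pos c + b * vol c w) by gd.
rewrite (quench m (k + q).+1 (fun c w => Psi c w * ((a * pos c + b * vol c w) ^+ 2 - t * v))) => [|c c' cc'|c|c]; last 3 first.
- by rewrite (pq c c' cc') (vq c c' cc') (oq c c' cc').
- by gd.
- apply: fmeasM => //; apply: fmeasB => //; last exact: fmeas_cst.
  apply: fmeasX => //; apply: fmeasD => //; [exact: fmeas_cst|apply: fmeasM => //; exact: fmeas_cst].
pose Bs c := \sum_(l < q) 2 ^- m * s2 (c (k + l)%N).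
have pBs : prefix (k + q) Bs.
  by move=> c c' cc'; apply: eq_bigr => l _; rewrite cc'// ltn_add2l.
have gBs : good P (fun w => Bs (x w)) by exact: gpx pBs.
rewrite (@eq_Ex _ _ _ P _ (fun w => a ^+ 2 * (e (x w) * pos (x w) ^+ 2) + b ^+ 2 * (e (x w) * Bs (x w)) +
    (b ^+ 2 * (t * sigma2_inf p sigma) - t * v) * e (x w))) => [|w]; last first.
  have g1 := gPsi (x w); have g2 := gvol (x w).
  rewrite (@eq_Ex _ _ _ P _ (fun w' => (a ^+ 2 * pos (x w) ^+ 2 - t * v) * Psi (x w) w' +
     (2 * a * b * pos (x w) * (Psi (x w) w' * vol (x w) w') + b ^+ 2 * (Psi (x w) w' * vol (x w) w' ^+ 2)))) => [|w'].
    rewrite ExD; [|by apply: good_itg; gd|by apply: good_itg; gd].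
    rewrite [X in _ + X]ExD; [|by apply: good_itg; gd|by apply: good_itg; gd].
    rewrite !ExZ; [|by apply: good_itg; gd|by apply: good_itg; gd|by apply: good_itg; gd].
    rewrite orth sq -/(e (x w)) -/(Bs (x w)); ring.
  by ring.
rewrite ExD; [|by apply: good_itg; gd|by apply: good_itg; gd].
rewrite ExD; [|by apply: good_itg; gd|by apply: good_itg; gd].
rewrite !ExZ; [|by apply: good_itg; gd|by apply: good_itg; gd|by apply: good_itg; gd].
have hX2 : `|n * Ex P (fun w => e (x w) * pos (x w) ^+ 2) -
  (\sum_(l < q) 2 ^- m * (2 * pavg p (fun i => g (k + l)%N i * poisson Q p (g (k + l)%N) i))) *
   Ex P (fun w => e (x w))| <= C1 * t ^+ 2 + C1 / Num.sqrt n by exact: A32.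
have hX3 : `|Ex P (fun w => e (x w) * Bs (x w))| <= C2 / n by exact: B31.
have hE0 : `|Ex P (fun w => e (x w))| <= 1.
  by rewrite -[leRHS](Ex_cst P); apply: Ex_norm_le => //; [exact: good_itg|exact: itg_cst].
move: hX2 hX3 hE0; move: (Ex P _) (Ex P _) (Ex P _) => X3 E0 X2.
pose Vk := V_integrand Q p alpha gamma h m0 (dy m k).
have hV : `|\sum_(l < q) 2 ^- m * (2 * pavg p (fun i => g (k + l)%N i * poisson Q p (g (k + l)%N) i)) - t * Vk| <= LV * t ^+ 2.
  rewrite (_ : t * Vk = \sum_(l < q) 2 ^- m * Vk); last first.
    by rewrite sumr_const card_ord -[RHS]mulr_natl mulrA.
  rewrite -sumrB (le_trans (ler_norm_sum _ _ _))//.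
  have -> : LV * t ^+ 2 = \sum_(l < q) 2 ^- m * (LV * t).
    by rewrite sumr_const card_ord -[RHS]mulr_natl /t; ring.
  apply: ler_sum => l _; rewrite -mulrBr normrM gtr0_norm// ler_pM2l//.
  rewrite -(V_integrandE alpha gamma h m0 genQ inv_p uniq_p) (le_trans (VL _ _ (d0 _) (d0 _)))// ler_wpM2l//.
  rewrite /dy natrD mulrDl addrAC subrr add0r ger0_norm ?mulr_ge0 ?invr_ge0 ?exprn_ge0//.
  by rewrite ler_pM2r// ler_nat ltnW.
move: hV; move: (\sum_(l < q) _) => Vs hV hX2 hX3 hE0.
(* The four summands isolate the four errors: the limit of a^2/n, the limit of b^2, the variance of
   the chain functional including the variation of V' in time, and the fluctuation of the squared
   volatility. *)
have -> : a ^+ 2 * X2 + b ^+ 2 * X3 + (b ^+ 2 * (t * sigma2_inf p sigma) - t * v) * E0 =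
   (a ^+ 2 / n - (1 <= h)%R%:R) * (t * Vk * E0) + (b ^+ 2 - (h <= 1)%R%:R) * (t * sigma2_inf p sigma * E0) +
   (a ^+ 2 / n) * ((Vs - t * Vk) * E0 + (n * X2 - Vs * E0)) + b ^+ 2 * X3.
  rewrite /v /limit_variance -/Vk; field; exact: lt0r_neq0.
have Vk0 : `|Vk| <= CV by rewrite ger0_norm ?VC// V_integrand_ge0.
have an1 : a ^+ 2 / n <= 1 by rewrite ler_pdivrMr// mul1r.
have an0 : 0 <= a ^+ 2 / n by rewrite divr_ge0 ?sqr_ge0// ltW.
have hb0 : 0 <= b ^+ 2 by exact: sqr_ge0.
have k1 : `|(a ^+ 2 / n - (1 <= h)%R%:R) * (t * Vk * E0)| <= C * `|a ^+ 2 / n - (1 <= h)%R%:R|.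
  rewrite normrM mulrC ler_wpM2r// (normrM (t * Vk)) (normrM t) (ger0_norm t0).
  apply: (@le_trans _ _ (1 * CV * 1)); last by rewrite mul1r mulr1.
  by rewrite ler_pM ?mulr_ge0// ler_pM.
have k2 : `|(b ^+ 2 - (h <= 1)%R%:R) * (t * sigma2_inf p sigma * E0)| <= C * `|b ^+ 2 - (h <= 1)%R%:R|.
  rewrite normrM mulrC ler_wpM2r// (normrM (t * _)) (normrM t) (ger0_norm t0) (ger0_norm sg0).
  apply: (@le_trans _ _ (1 * sigma2_inf p sigma * 1)); last by rewrite mul1r mulr1.
  by rewrite ler_pM ?mulr_ge0// ler_pM.
have k3 : `|(a ^+ 2 / n) * ((Vs - t * Vk) * E0 + (n * X2 - Vs * E0))| <= LV * t ^+ 2 + (C1 * t ^+ 2 + C1 / Num.sqrt n).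
  rewrite normrM (ger0_norm an0) -[leRHS]mul1r ler_pM//.
  rewrite (le_trans (ler_normD _ _))// lerD// normrM -[leRHS]mulr1 ler_pM//.
have k4 : `|b ^+ 2 * X3| <= C2 / Num.sqrt n.
  rewrite normrM (ger0_norm hb0) -[leRHS]mul1r ler_pM// (le_trans hX3)// ler_wpM2l//.
have k5 : LV * t ^+ 2 + (C1 * t ^+ 2 + C1 / Num.sqrt n) + C2 / Num.sqrt n <= C * t ^+ 2 + C / Num.sqrt n.
  rewrite !addrA -mulrDl -addrA -mulrDl.
  by rewrite lerD// ler_wpM2r ?sqr_ge0 ?invr_ge0 ?(ltW sn0).
apply: (le_trans (tri _ _ _ _ _ _ _ _ k1 k2 k3 k4)).
by rewrite !lerD2r.
Qed.

End modulated_walk.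

(** * The centered process *)

Lemma itg_of_square (R : realType) (disp : measure_display) (T : measurableType disp)
    (P : probability T R) (X : T -> R) :
  measurable_fun setT X -> itg P (fun w => X w ^+ 2) -> itg P X.
Proof.
move=> mX iX; apply: (@itg_le _ _ _ P _ (fun w => 1 + X w ^+ 2)) => // [|w].
  by apply: itgD => //; exact: itg_cst.
rewrite [leRHS]ger0_norm; last by rewrite addr_ge0// sqr_ge0.
rewrite -(real_normK (num_real (X w))); have := sqr_ge0 (`|X w| - 1); rewrite sqrrB1.
by have := normr_ge0 (X w); lra.
Qed.

Lemma itg_ae (R : realType) (disp : measure_display) (T : measurableType disp)
    (P : probability T R) (X Y : T -> R) :
  {ae P, forall w, X w = Y w} -> measurable_fun setT X -> itg P Y -> itg P X.
Proof.
move=> XY mX iY; have mY := itg_mfun iY.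
apply/integrableP; split; first exact/measurable_EFinP.
have /integrableP[_] := iY; apply: le_lt_trans; rewrite le_eqVlt; apply/orP; left; apply/eqP.
apply: ae_eq_integral => //.
- by apply/measurable_EFinP; exact: measurableT_comp.
- by apply/measurable_EFinP; exact: measurableT_comp.
by move: XY; apply: filterS => w /= ->.
Qed.

Lemma half_expn_cvg (R : realType) (c : R) : (fun n => c * (2^-1 : R) ^+ n) @ \oo --> (0 : R).
Proof.
rewrite -[X in _ --> X](mulr0 c); apply: cvgM; first exact: cvg_cst.
by apply: cvg_expr; rewrite ger0_norm; lra.
Qed.

Lemma dy_shift (R : realType) j i m : dy (j + m) (i * 2 ^ m) = dy j i :> R.
Proof.
by rewrite /dy natrM natrX exprD invfM mulrACA mulfV ?mulr1// expf_neq0.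
Qed.

Lemma half_expn_le (R : realType) (j : nat) (c e : R) : 0 < e ->
  \forall m \near \oo, c * 2 ^- (j + m) <= e.
Proof.
move=> e0; have := half_expn_cvg (c * 2 ^- j) => /cvgrPdist_le/(_ e e0).
apply: filterS => m; rewrite sub0r normrN; apply: le_trans; rewrite (le_trans _ (ler_norm _))//.
by rewrite exprVn -mulrA -invfM -exprD.
Qed.

Section centered_process.
Context {R : realType} {disp : measure_display} {T : measurableType disp} {d : nat}.
Variables (P : probability T R) (F : R -> set (set T)) (B : R -> T -> R)
  (X : R -> T -> 'I_d) (mu : 'I_d -> R) (M : R -> T -> R).
Variables (Q : 'M[R]_d) (p alpha gamma sigma : 'cV[R]_d) (h m0 : R) (N : nat).
Hypotheses (inv_p : invariant_distribution Q p) (gamma_gt0 : forall i, 0 < gamma i 0).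
Hypothesis N0 : (0 < N)%N.
Local Notation n := (N%:R : R).
Hypothesis mm : is_mmou P F B X mu (n *: Q) (n `^ h *: alpha) gamma (n `^ (h / 2) *: sigma) m0 M.
Local Notation rho := (rho p alpha gamma h m0).
Local Notation ginf := (gamma_inf p gamma).
Local Notation ainf := (alpha_inf p alpha).
Local Notation Y := (centered_scaled p alpha gamma h m0 N M).
Local Notation fld := (field p alpha gamma h m0).

Definition drift_scale : R := n `^ (h - scaling_exponent h).
Definition noise_scale : R := n `^ (h / 2 - scaling_exponent h).
(** Vanishes for h = 0, where rho(0) = m0; for h > 0, rho(0) = 0 and it equals N^(-beta) m0. *)
Definition centered_start : R := n `^ (- scaling_exponent h) * (m0 - n `^ h * rho 0).
Definition feedback (t : R) (w : T) : R := integral0 (fun s => gamma (X s w) 0 * Y s w) t.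
Definition rate (t : R) (w : T) : R := integral0 (fun s => gamma (X s w) 0) t.
Definition drift_noise (t : R) (w : T) : R := integral0 (fun s => fld s (X s w)) t.
(** Observed on the grid of level [j], computed on the finer grid of level j + m; the extra depth
    [m] is chosen later in terms of [N]. *)
Definition grid_walk (j m i : nat) (w : T) : R :=
  centered_start + drift_scale * drift_sum p alpha gamma h m0 (j + m) 0 (i * 2 ^ m) (fun l => X (dy (j + m) l) w) +
  noise_scale * gsum B (j + m) (fun l => sigma (X (dy (j + m) l) w) 0) 0 (i * 2 ^ m) w.

Let c : R := n `^ (- scaling_exponent h).
Let n0 : 0 < n. Proof. by rewrite ltr0n. Qed.
Let c0 : 0 < c. Proof. exact: powR_gt0. Qed.

Let nz (r : R) : (r == 0) ==> (n != 0). Proof. by rewrite (gt_eqF n0) implybT. Qed.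

Let aE : drift_scale = c * n `^ h.
Proof. by rewrite /drift_scale addrC powRD. Qed.

Let bE : noise_scale = c * n `^ (h / 2).
Proof. by rewrite /noise_scale addrC powRD. Qed.

Let fF : is_filtration F. Proof. by have [] := mm. Qed.
Let bm : is_brownian_motion P F B. Proof. by have [] := mm. Qed.
Let ctmc : is_ctmc P mu (n *: Q) X. Proof. by have [_ _ [] ] := mm. Qed.

Let state_rcont (f : 'I_d -> R) w : rcont (fun s => f (X s w)).
Proof. exact: (@ctmc_rcont _ _ _ _ _ _ _ _ ctmc f w). Qed.

Let M_path w : cpath (M ^~ w). Proof. by have [_ _ _ _ [_ cM _]] := mm; exact: cM. Qed.

Let rho_cont := @rho_continuous R d p alpha gamma h m0.

Lemma centered_cpath w : cpath (Y ^~ w).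
Proof.
apply/subspace_continuousP => t t0; rewrite /centered_scaled.
have := (@subspace_continuousP R `[0, +oo[%classic R (M ^~ w)).1 (@M_path w) t t0 => hM.
have hr : rho x @[x --> within `[0, +oo[ (nbhs t)] --> rho t.
  by apply: cvg_within_filter; exact: rho_cont.
have hnr : n `^ h * rho x @[x --> within `[0, +oo[ (nbhs t)] --> n `^ h * rho t.
  by apply: cvgM => //; exact: cvg_cst.
by apply: cvgM; [exact: cvg_cst|exact: (cvgB hM hnr)].
Qed.

Lemma centered_measurable t : 0 <= t -> measurable_fun setT (Y t).
Proof.
move=> t0; have [_ _ _ _ [aM _ _]] := mm.
apply: measurable_funM => //; apply: measurable_funB => //.
by apply: fmeas_measurable (adapted_fmeas aM t0); exact: (filtration_measurable fF).
Qed.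

Let cpath_loc (y : R -> R) : cpath y -> loc_bounded y.
Proof. by move=> cy K; exact: cpath_bounded. Qed.

Lemma feedback_measurable t : 0 <= t -> measurable_fun setT (feedback t).
Proof.
move=> t0; apply: integral0_measurable => // [s s0|w|w].
- by apply: measurable_funM; [exact: (ctmc_measurable ctmc (fun i => gamma i 0))|exact: centered_measurable].
- by apply: rcontM; [exact: (@state_rcont (fun i => gamma i 0) _)|exact: cpath_rcont (@centered_cpath w)].
- by apply: loc_boundedM; [exact: (@ctmc_loc_bounded _ _ _ _ X (fun i => gamma i 0) w)|exact: cpath_loc (@centered_cpath w)].
Qed.

Lemma feedback_drift w : drift (\sum_i `|gamma i 0|) (Y ^~ w) (feedback ^~ w) (rate ^~ w).
Proof.
apply: (drift_integral (@centered_cpath w)); first exact: (@state_rcont (fun i => gamma i 0) _).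
by move=> t t0; exact: (state_bounded (fun i => gamma i 0)).
Qed.

Let rho_loc : loc_bounded rho.
Proof.
have [C C0 rC] := rho_bounded alpha h m0 inv_p gamma_gt0.
by apply: (@loc_bounded_bounded _ _ C).
Qed.

Let field_rcont w : rcont (fun s => fld s (X s w)).
Proof.
have cr := continuous_rcont rho_cont.
apply: rcontB; [apply: rcontB|apply: rcontB].
- exact: (@state_rcont (fun i => alpha i 0) _).
- by apply: rcontM => //; exact: (@state_rcont (fun i => gamma i 0) _).
- exact: rcont_cst.
- by apply: rcontM => //; exact: rcont_cst.
Qed.

Let field_loc w : loc_bounded (fun s => fld s (X s w)).
Proof.
have [C C0 fC] := field_bounded alpha h m0 inv_p gamma_gt0.
by apply: (@loc_bounded_bounded _ _ C) => t t0; exact: fC.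
Qed.

Lemma rho_integral t : 0 <= t -> integral0 (fun s => ainf - ginf * rho s) t = rho t - rho 0.
Proof.
move=> t0; pose f s := ainf - ginf * rho s.
have cf : continuous f by move=> s; apply: cvgB; [exact: cvg_cst|apply: cvgM; [exact: cvg_cst|exact: rho_cont]].
have e := @mvt_le R (fun s => prim f s - rho s) (fun=> 0) 0 t 0.
have : `|(prim f t - rho t) - (prim f 0 - rho 0)| <= 0 * `|t - 0|.
  apply: e => [s|s _]; last by rewrite normr0.
  have := is_deriveB (prim_is_derive s cf) (is_derive_rho alpha h m0 inv_p gamma_gt0 s).
  by rewrite subrr.
rewrite mul0r normr_le0 subr_eq0 => /eqP.
have -> : prim f 0 = 0 by rewrite /prim lexx; exact: integral00.
rewrite /prim t0 => hp; rewrite /integral0 -/f; move: hp; move: (Rintegral _ _ _) => v; lra.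
Qed.

(** Since rho' = ainf - ginf rho, adding the feedback to the scaled drift cancels the term in Y and
    leaves N^(h - beta) (alpha - rho gamma), that is, the centered field plus rho'. *)
Let ito : exists2 I, is_ito_integral P F B
    (fun s w => dotv (n `^ (h / 2) *: sigma) (indicator_vector X s w)) I &
  forall t, 0 <= t -> {ae P, forall w, Y t w + feedback t w =
    centered_start + drift_scale * drift_noise t w + c * I t w}.
Proof.
have [_ _ _ _ [_ _ [I itoI MI]]] := mm; exists I => // t t0.
apply: filterS (MI t t0) => w Mw.
pose f s := n `^ h * alpha (X s w) 0 - M s w * gamma (X s w) 0.
have {}Mw : M t w = m0 + integral0 f t + I t w.
  rewrite Mw; congr (_ + _ + _); apply: eq_Rintegral => s _.
  by rewrite dotv_indicator !mxE.
have ra := @state_rcont (fun i => alpha i 0) w; have la := @ctmc_loc_bounded _ _ _ _ X (fun i => alpha i 0) w.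
have rg := @state_rcont (fun i => gamma i 0) w; have lg := @ctmc_loc_bounded _ _ _ _ X (fun i => gamma i 0) w.
have rM := cpath_rcont (@M_path w); have lM := cpath_loc (@M_path w).
have rY := cpath_rcont (@centered_cpath w); have lY := cpath_loc (@centered_cpath w).
have rf : rcont f by apply: rcontB; apply: rcontM => //; exact: rcont_cst.
have lf : loc_bounded f by apply: loc_boundedB; apply: loc_boundedM => //; exact: loc_bounded_cst.
have rr := continuous_rcont rho_cont.
pose g s := ainf - ginf * rho s.
have rG : rcont g by apply: rcontB; [exact: rcont_cst|apply: rcontM => //; exact: rcont_cst].
have lG : loc_bounded g by apply: loc_boundedB; [exact: loc_bounded_cst|apply: loc_boundedM => //; exact: loc_bounded_cst].
have e : c * integral0 f t + feedback t w = drift_scale * drift_noise t w + drift_scale * (rho t - rho 0).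
  have rF := @field_rcont w; have lF := @field_loc w.
  rewrite -mulrDr -rho_integral// -/g /drift_noise -(integral0D rF lF rG lG t0).
  rewrite -(@integral0Z _ _ drift_scale t (rcontD rF rG) (loc_boundedD lF lG) t0).
  rewrite /feedback -integral0Z// -integral0D//.
  - congr integral0; apply/funext => s; rewrite /f /g /field /centered_scaled -/c aE; ring.
  - by apply: rcontM => //; exact: rcont_cst.
  - by apply: loc_boundedM => //; exact: loc_bounded_cst.
  - exact: rcontM.
  - exact: loc_boundedM.
rewrite {1}/centered_scaled -/c Mw /centered_start -/c.
rewrite (_ : _ + feedback t w = c * m0 + c * I t w - c * n `^ h * rho t + (c * integral0 f t + feedback t w)); last by ring.
by rewrite e aE; ring.
Qed.

(** For fixed [N], as [m] grows, the drift part converges as a Riemann sum and the noise part as a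
    left sum of the Ito integral, whose mean-square error is governed by how often the chain moves
    within a fine cell. *)
Lemma centered_approximation j i (e : R) : 0 < e -> \forall m \near \oo,
  itg P (fun w => Y (dy j i) w + feedback (dy j i) w - grid_walk j m i w) /\
  Ex P (fun w => `|Y (dy j i) w + feedback (dy j i) w - grid_walk j m i w|) <= e.
Proof.
move=> e0; have [I itoI YI] := ito; pose t : R := dy j i.
have t0 : 0 <= t by exact: dy_ge0.
have [G G0 fG] := field_bounded alpha h m0 inv_p gamma_gt0.
pose f i := (n `^ (h / 2) *: sigma) i 0.
pose H s w := dotv (n `^ (h / 2) *: sigma) (indicator_vector X s w).
have HE s w : H s w = f (X s w) by exact: dotv_indicator.
have gH s : 0 <= s -> good P (H s).
  move=> s0; rewrite (_ : H s = fun w => f (X s w)); last by apply/funext => w; exact: HE.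
  exact: (ctmc_good ctmc).
have [C C0 oC] := ctmc_oscillation Q f.
pose As m w := drift_sum p alpha gamma h m0 (j + m) 0 (i * 2 ^ m) (fun l => X (dy (j + m) l) w).
have mAs m : measurable_fun setT (As m).
  apply: measurable_sum => l; apply: measurable_funM => //.
  by apply: (ctmc_measurable ctmc (fld _)); exact: dy_ge0.
have AsG m w : `|As m w| <= G * t.
  rewrite (le_trans (ler_norm_sum _ _ _))//.
  have -> : t = dy (j + m) (i * 2 ^ m) by rewrite dy_shift.
  rewrite /dy.
  have -> : G * ((i * 2 ^ m)%:R / 2 ^+ (j + m)) = \sum_(l < i * 2 ^ m) 2 ^- (j + m) * G.
    by rewrite sumr_const card_ord -[RHS]mulr_natl; ring.
  apply: ler_sum => l _; rewrite normrM ger0_norm ?invr_ge0 ?exprn_ge0// ler_wpM2l ?invr_ge0 ?exprn_ge0//.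
  by apply: fG; exact: dy_ge0.
have mA : measurable_fun setT (drift_noise t).
  apply: integral0_measurable => // s s0; exact: (ctmc_measurable ctmc (fld s)).
have cA w : As ^~ w @ \oo --> drift_noise t w.
  rewrite (_ : As ^~ w = fun m => \sum_(l < i * 2 ^ m) fld (dy (j + m) l) (X (dy (j + m) l) w) / 2 ^+ (j + m)).
    exact: riemann_left.
  by apply/funext => m; apply: eq_bigr => l _; rewrite mulrC.
have AG w : `|drift_noise t w| <= G * t.
  have := @integral0_diff R (fun s => fld s (X s w)) 0 t G (@field_rcont w) (@field_loc w) (lexx 0) t0.
  rewrite integral00 !subr0; apply=> s /andP[s0 _]; exact: fG.
have [_ cE] : itg P (fun=> 0 : R) /\ (fun m => Ex P (fun w => `|drift_noise t w - As m w|)) @ \oo --> Ex P (fun=> 0).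
  apply: (@Ex_dct _ _ _ _ _ _ (fun=> G * t + G * t)).
  - by move=> m; apply: measurableT_comp => //; apply: measurable_funB.
  - move=> w; rewrite -(normr0 R) -(subrr (drift_noise t w)); apply: cvg_norm; apply: cvgB => //; exact: cvg_cst.
  - exact: itg_cst.
  - by move=> m w; rewrite normr_id (le_trans (ler_normB _ _))// lerD.
rewrite Ex_cst in cE.
pose es := e / (2 * (drift_scale + c)).
have a0 : 0 < drift_scale by exact: powR_gt0.
have es0 : 0 < es by rewrite divr_gt0 ?mulr_gt0 ?addr_gt0.
near=> m.
have EA : Ex P (fun w => `|drift_noise t w - As m w|) <= es.
  near: m; have /cvgrPdist_le/(_ es es0) := cE; apply: filterS => m; rewrite sub0r normrN; apply: le_trans.
  exact: ler_norm.
pose r := C * (n * 2 ^- (j + m)).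
have nm : n * 2 ^- (j + m) <= 1 by near: m; exact: half_expn_le.
have rs : (4 * C * n * t) * 2 ^- (j + m) <= es ^+ 2 by near: m; apply: half_expn_le; rewrite exprn_gt0.
have r0 : 0 <= r by rewrite /r !mulr_ge0 ?invr_ge0 ?exprn_ge0 ?(ltW n0).
have [iL EL] : itg P (fun w => (left_sum B H (j + m) (i * 2 ^ m) w - I t w) ^+ 2) /\
    Ex P (fun w => (left_sum B H (j + m) (i * 2 ^ m) w - I t w) ^+ 2) <= 4 * r * t.
  have -> : t = dy (j + m) (i * 2 ^ m) by rewrite dy_shift.
  apply: (ito_approximation fF bm itoI gH) => // l s _ /andP[ls sl].
  rewrite (@eq_Ex _ _ _ P _ (fun w => (f (X (dy (j + m) l) w) - f (X s w)) ^+ 2)) => [|w]; last by rewrite -!HE.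
  have sl' : s - dy (j + m) l <= 2 ^- (j + m) by move: sl; rewrite dy_succ -lerBlDl.
  have h1 : n * (s - dy (j + m) l) <= n * 2 ^- (j + m) by rewrite ler_pM2l.
  apply: (le_trans (oC _ _ _ _ _ _ _ _ ctmc (ltW n0) (dy_ge0 _ _) (ltW ls) (le_trans h1 nm))).
  by rewrite ler_wpM2l.
have mI : measurable_fun setT (I t) by exact: (ito_measurable fF itoI).
have gL : good P (left_sum B H (j + m) (i * 2 ^ m)).
  apply: good_sum => l; apply: goodM; first by apply: gH; exact: dy_ge0.
  by apply: (incr_good fF bm); rewrite ?dy_ge0// dy_succ lerDl invr_ge0 exprn_ge0.
have mL : measurable_fun setT (fun w => left_sum B H (j + m) (i * 2 ^ m) w - I t w).
  by apply: measurable_funB => //; exact: good_mfun gL.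
have iL1 : itg P (fun w => left_sum B H (j + m) (i * 2 ^ m) w - I t w) by exact: itg_of_square.
have EL1 : Ex P (fun w => `|left_sum B H (j + m) (i * 2 ^ m) w - I t w|) <= es.
  apply: (le_trans (Ex_sqr_le iL1 iL es0)).
  set E2 := Ex P _ in EL *.
  suff : es^-1 * E2 <= es by lra.
  rewrite mulrC ler_pdivrMr// (le_trans EL)//.
  by rewrite -expr2; apply: le_trans rs; rewrite /r le_eqVlt; apply/orP; left; apply/eqP; ring.
pose D w := drift_scale * (drift_noise t w - As m w) + c * (- (left_sum B H (j + m) (i * 2 ^ m) w - I t w)).
have iA : itg P (fun w => drift_noise t w - As m w).
  apply: (@itg_bounded _ _ _ _ _ (G * t + G * t)); first exact: measurable_funB.
  by move=> w; rewrite (le_trans (ler_normB _ _))// lerD.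
have iD : itg P D by apply: itgD; apply: itgZ => //; exact: itgN.
have ED : Ex P (fun w => `|D w|) <= e.
  apply: (@le_trans _ _ (drift_scale * Ex P (fun w => `|drift_noise t w - As m w|) +
     c * Ex P (fun w => `|left_sum B H (j + m) (i * 2 ^ m) w - I t w|))).
    rewrite -!ExZ; [|exact: itg_norm..].
    rewrite -ExD; [|by apply: itgZ; exact: itg_norm..].
    apply: Ex_le; [exact: itg_norm|by apply: itgD; apply: itgZ; exact: itg_norm|move=> w].
    by rewrite (le_trans (ler_normD _ _))// !normrM normrN (gtr0_norm a0) (gtr0_norm c0).
  rewrite (le_trans (_ : _ <= drift_scale * es + c * es))//; first by rewrite lerD// ler_pM2l.
  have -> : drift_scale * es + c * es = e / 2.
    rewrite /es; field; rewrite gt_eqF// addr_gt0//.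
  by move: e0; lra.
have Lg w : left_sum B H (j + m) (i * 2 ^ m) w =
    n `^ (h / 2) * gsum B (j + m) (fun l => sigma (X (dy (j + m) l) w) 0) 0 (i * 2 ^ m) w.
  by rewrite mulr_sumr; apply: eq_bigr => l _; rewrite HE /f mxE mulrA.
have mW : measurable_fun setT (fun w => Y t w + feedback t w - grid_walk j m i w).
  apply: measurable_funB.
    by apply: measurable_funD; [exact: centered_measurable|exact: feedback_measurable].
  rewrite (_ : grid_walk j m i = fun w => centered_start + drift_scale * As m w + c * left_sum B H (j + m) (i * 2 ^ m) w).
    apply: measurable_funD; last by apply: measurable_funM => //; exact: good_mfun gL.
    by apply: measurable_funD => //; apply: measurable_funM.
  by apply/funext => w; rewrite Lg /grid_walk bE -/(As m w); ring.
have ae : {ae P, forall w, Y t w + feedback t w - grid_walk j m i w = D w}.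
  apply: filterS (YI t t0) => w ->; rewrite /D Lg /grid_walk bE -/(As m w); ring.
split; first exact: itg_ae ae mW iD.
rewrite (@Ex_ae _ _ _ P _ (fun w => `|D w|)) //.
- by apply: filterS ae => w ->.
- exact: measurableT_comp.
- by apply: measurableT_comp => //; exact: itg_mfun iD.
Unshelve. all: by end_near. Qed.

End centered_process.

(** * Powers of N *)

Section scales.
Context {R : realType}.
Implicit Types (h r e : R) (N : nat).

Lemma powR_neg_small r e : r < 0 -> 0 < e -> \forall N \near \oo, N%:R `^ r <= e.
Proof.
move=> r0 e0; have s0 : 0 < - r by rewrite oppr_gt0.
near=> N; have N0 : 0 < N%:R :> R by rewrite ltr0n; near: N; exact: nbhs_infty_gt.
rewrite -[r]opprK powRN -[e]invrK lef_pV2 ?posrE ?powR_gt0 ?invr_gt0//.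
have hN : e^-1 `^ (- r)^-1 <= N%:R by near: N; exact: nbhs_infty_ger.
rewrite (le_trans _ (ge0_ler_powR (ltW s0) _ _ hN)) ?nnegrE ?powR_ge0//.
by rewrite -powRrM mulVf ?gt_eqF// powRr1// invr_ge0 ltW.
Unshelve. all: by end_near. Qed.

Lemma inv_sqrt_small (C e : R) : 0 <= C -> 0 < e -> \forall N \near \oo, C / Num.sqrt N%:R <= e.
Proof.
move=> C0 e0; near=> N; have N0 : 0 < N%:R :> R by rewrite ltr0n; near: N; exact: nbhs_infty_gt.
have sN : 0 < Num.sqrt (N%:R : R) by rewrite sqrtr_gt0.
rewrite ler_pdivrMr// mulrC -ler_pdivrMr//.
have -> : C / e = Num.sqrt ((C / e) ^+ 2) by rewrite sqrtr_sqr ger0_norm// divr_ge0// ltW.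
by rewrite ler_wsqrtr//; near: N; exact: nbhs_infty_ger.
Unshelve. all: by end_near. Qed.

Let expE h : (h <= 1 -> scaling_exponent h = h / 2) /\ (1 <= h -> scaling_exponent h = h - 1 / 2).
Proof.
rewrite /scaling_exponent; split=> h1; first by apply/max_idPl; lra.
by apply/max_idPr; lra.
Qed.

Let exp_ge h : h / 2 <= scaling_exponent h /\ h - 1 / 2 <= scaling_exponent h.
Proof. by rewrite /scaling_exponent !le_max !lexx/= orbT. Qed.

Let sqr_powR (x r : R) : 0 <= x -> (x `^ r) ^+ 2 = x `^ (r * 2).
Proof. by move=> x0; rewrite powRrM -powR_mulrn ?powR_ge0. Qed.

Lemma drift_scale_sqr_le h N : (0 < N)%N -> drift_scale h N ^+ 2 <= N%:R.
Proof.
move=> N0; have [_ hb] := exp_ge h.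
rewrite /drift_scale sqr_powR// -[leRHS]powRr1// ler_powR ?ler1n//; lra.
Qed.

Lemma noise_scale_sqr_le h N : (0 < N)%N -> noise_scale h N ^+ 2 <= 1.
Proof.
move=> N0; have [hb _] := exp_ge h.
rewrite /noise_scale sqr_powR// -[leRHS](powRr0 (N%:R : R)) ler_powR ?ler1n//; lra.
Qed.

(** The quotient is 1 for h >= 1 and N^(h - 1) for h < 1. *)
Lemma drift_scale_limit h e : 0 < e ->
  \forall N \near \oo, `|drift_scale h N ^+ 2 / N%:R - (1 <= h)%R%:R| <= e.
Proof.
move=> e0; have [E1 E2] := expE h; have [h1|h1] := leP 1 h.
  near=> N; have N0 : 0 < N%:R :> R by rewrite ltr0n; near: N; exact: nbhs_infty_gt.
  rewrite /drift_scale sqr_powR// (E2 h1) (_ : (h - (h - 1 / 2)) * 2 = 1); last by field.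
  by rewrite powRr1// divff ?gt_eqF// subrr normr0 ltW.
near=> N; have N0 : 0 < N%:R :> R by rewrite ltr0n; near: N; exact: nbhs_infty_gt.
rewrite subr0 ger0_norm; last by rewrite divr_ge0 ?sqr_ge0.
rewrite /drift_scale sqr_powR// (E1 (ltW h1)).
have -> : (N%:R : R) `^ ((h - h / 2) * 2) / N%:R = N%:R `^ (h - 1).
  rewrite powRD; last by rewrite (gt_eqF N0) implybT.
  by rewrite powRN powRr1//; congr (_ `^ _ / _); field.
by near: N; apply: powR_neg_small => //; rewrite subr_lt0.
Unshelve. all: by end_near. Qed.

(** The square is 1 for h <= 1 and N^(1 - h) for h > 1. *)
Lemma noise_scale_limit h e : 0 < e ->
  \forall N \near \oo, `|noise_scale h N ^+ 2 - (h <= 1)%R%:R| <= e.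
Proof.
move=> e0; have [E1 E2] := expE h; have [h1|h1] := leP h 1.
  near=> N; have N0 : 0 < N%:R :> R by rewrite ltr0n; near: N; exact: nbhs_infty_gt.
  by rewrite /noise_scale (E1 h1) subrr powRr0 expr1n subrr normr0 ltW.
near=> N; have N0 : 0 < N%:R :> R by rewrite ltr0n; near: N; exact: nbhs_infty_gt.
rewrite subr0 ger0_norm; last by rewrite sqr_ge0.
rewrite /noise_scale sqr_powR// (E2 (ltW h1)) (_ : (h / 2 - (h - 1 / 2)) * 2 = 1 - h); last by field.
by near: N; apply: powR_neg_small => //; rewrite subr_lt0.
Unshelve. all: by end_near. Qed.

Lemma centered_start_limit d (p alpha gamma : 'cV[R]_d) h m0 e : 0 <= h -> 0 < e ->
  \forall N \near \oo, `|centered_start p alpha gamma h m0 N| <= e.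
Proof.
move=> h0 e0; have rho0 : rho p alpha gamma h m0 0 = (h == 0)%R%:R * m0.
  by rewrite /rho mulr0 expR0 mul1r subrr mulr0 addr0.
have [h00|hN0] := eqVneq h 0.
  near=> N; rewrite /centered_start rho0 h00 eqxx powRr0 !mul1r subrr mulr0 normr0 ltW//.
have hp : 0 < h by rewrite lt0r hN0.
have [hb _] := exp_ge h.
have r0 : - scaling_exponent h < 0 by rewrite oppr_lt0 (lt_le_trans _ hb)// divr_gt0.
have c0 : 0 < `|m0| + 1 by rewrite ltr_wpDl.
near=> N; rewrite /centered_start rho0 (negPf hN0) mul0r mulr0 subr0 normrM ger0_norm ?powR_ge0//.
rewrite (le_trans (_ : _ <= N%:R `^ (- scaling_exponent h) * (`|m0| + 1)))//.
  by rewrite ler_wpM2l ?powR_ge0// lerDl.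
rewrite -ler_pdivlMr//; near: N; apply: powR_neg_small => //; exact: divr_gt0.
Unshelve. all: by end_near. Qed.

End scales.

(** The centered rate is an additive functional with second moment O(1/n), hence first moment
    O(1/sqrt n). The estimate is proved for Riemann sums, with a constant free of the mesh, and
    passed to the integral. *)
Lemma rate_bound (R : realType) (d : nat) (Q : 'M[R]_d) (p gamma : 'cV[R]_d) :
  is_generator Q -> invariant_distribution Q p ->
  (forall p', invariant_distribution Q p' -> p' = p) ->
  exists2 C, 0 <= C & forall (disp : measure_display) (T : measurableType disp)
    (P : probability T R) (mu : 'I_d -> R) (X : R -> T -> 'I_d) (n : R),
  is_ctmc P mu (n *: Q) X -> 1 <= n -> forall j i,
  let kap w := rate X gamma (dy j i.+1) w - rate X gamma (dy j i) w - gamma_inf p gamma / 2 ^+ j in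
  itg P kap /\ Ex P (fun w => `|kap w|) <= C / Num.sqrt n.
Proof.
move=> genQ inv_p uniq_p.
pose g i := gamma i 0 - gamma_inf p gamma.
pose G := \sum_i `|g i|.
have G0 : 0 <= G by exact: sumr_ge0.
have [C C0 mC] := ctmc_moments genQ inv_p uniq_p G0 (lexx (0 : R)).
exists (1 + C) => [|disp T P mu X n ctmc n1 j i kap]; first by rewrite addr_ge0.
have n0 : 0 < n by exact: lt_le_trans n1.
have sn0 : 0 < Num.sqrt n by rewrite sqrtr_gt0.
have snn : Num.sqrt n ^+ 2 = n by rewrite sqr_sqrtr// ltW.
pose S m w := \sum_(l < 2 ^ m) 2 ^- (j + m) * g (X (dy (j + m) (i * 2 ^ m + l)%N) w).
have gS m : good P (S m).
  by apply: good_sum => l; apply: goodZ; apply: (ctmc_good ctmc g); exact: dy_ge0.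
have meshE m : (2 ^ m)%:R / 2 ^+ (j + m) = 2 ^- j :> R.
  by rewrite natrX exprD; field; rewrite !expf_neq0.
have j1 : 2 ^- j <= 1 :> R by rewrite invf_le1 ?exprn_gt0// exprn_ege1// ler1n.
have SG m w : `|S m w| <= G.
  rewrite (le_trans (ler_norm_sum _ _ _))// (le_trans (_ : _ <= \sum_(l < 2 ^ m) 2 ^- (j + m) * G))//.
    apply: ler_sum => l _; rewrite normrM ger0_norm ?invr_ge0 ?exprn_ge0//.
    by rewrite ler_wpM2l ?invr_ge0 ?exprn_ge0//; exact: (state_bounded g).
  by rewrite sumr_const card_ord -[leLHS]mulr_natl mulrA meshE ler_piMl.
have cS w : S ^~ w @ \oo --> kap w.
  have rf := @ctmc_rcont _ _ _ _ _ _ _ _ ctmc (fun i => gamma i 0) w.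
  have lf := @ctmc_loc_bounded _ _ _ _ X (fun i => gamma i 0) w.
  rewrite (_ : S ^~ w = fun m => \sum_(l < i.+1 * 2 ^ m) gamma (X (dy (j + m) l) w) 0 / 2 ^+ (j + m) -
     \sum_(l < i * 2 ^ m) gamma (X (dy (j + m) l) w) 0 / 2 ^+ (j + m) - gamma_inf p gamma / 2 ^+ j).
    by apply: cvgB; [apply: cvgB; exact: riemann_left|exact: cvg_cst].
  apply/funext => m; rewrite mulSnr big_split_ord/= (addrAC (\sum_(l < i * 2 ^ m) _)) subrr add0r.
  have -> : gamma_inf p gamma / 2 ^+ j = \sum_(l < 2 ^ m) gamma_inf p gamma / 2 ^+ (j + m).
    by rewrite sumr_const card_ord -[RHS]mulr_natl mulrCA meshE.
  rewrite -sumrB.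
  by apply: eq_bigr => l _; rewrite /g; ring.
have [ikap _] := Ex_dct (fun m => good_mfun (gS m)) cS (itg_cst P G) SG.
split=> //; have mS m := measurableT_comp (@normr_measurable R setT) (good_mfun (gS m)).
have [_ cE] : itg P (fun w => `|kap w|) /\ (fun m => Ex P (fun w => `|S m w|)) @ \oo --> Ex P (fun w => `|kap w|).
  apply: (@Ex_dct _ _ _ _ _ _ (fun=> G)) => [m|w||m w].
  - by apply: measurableT_comp => //; exact: good_mfun (gS m).
  - by apply: cvg_norm; exact: cS.
  - exact: itg_cst.
  - by rewrite normr_id.
apply/ler_addgt0Pr => e e0; near \oo => m.
have nm : n ^+ 2 * 2 ^- (j + m) <= 1 by near: m; exact: half_expn_le.
have close : `|Ex P (fun w => `|kap w|) - Ex P (fun w => `|S m w|)| <= e.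
  by near: m; move/cvgrPdist_le: cE; exact.
have gp (l : nat) : pavg p g = 0.
  rewrite /g /pavg; under eq_bigr do rewrite mulrBr.
  by rewrite sumrB -mulr_suml; have [_ _ ->] := inv_p; rewrite mul1r /gamma_inf dotv_pavg /pavg subrr.
have gL (l : nat) i' : `|g i' - g i'| <= 0 * 2 ^- (j + m) by rewrite subrr normr0 mul0r.
have t1 : (2 ^ m)%:R / 2 ^+ (j + m) <= 1 :> R by rewrite meshE.
have [S2 _ _] := mC _ _ P mu X n (j + m)%N ctmc n1 nm (fun=> g) (fun _ => state_bounded g) gL gp (i * 2 ^ m)%N (2 ^ m)%N t1.
have {}S2 : Ex P (fun w => S m w ^+ 2) <= C / n.
  by apply: (le_trans S2); rewrite ler_wpM2r ?invr_ge0 ?(ltW n0)// ler_piMr.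
have := Ex_sqr_le (good_itg (gS m)) (good_itg (goodX 2 (gS m))) (_ : 0 < (Num.sqrt n)^-1).
rewrite invr_gt0 invrK => /(_ sn0) hS.
have h1 : Num.sqrt n * Ex P (fun w => S m w ^+ 2) <= C / Num.sqrt n.
  apply: (le_trans (ler_wpM2l (ltW sn0) S2)).
  by rewrite -[X in C / X]snn le_eqVlt; apply/orP; left; apply/eqP; field; exact: lt0r_neq0.
have h2 : 0 <= (Num.sqrt n)^-1 by rewrite invr_ge0 ltW.
have h3 : 0 <= C / Num.sqrt n by rewrite mulr_ge0.
rewrite mulrDl mul1r; move: close; rewrite ler_norml => /andP[_ close].
move: hS h1 h2 h3 close; move: (Ex P _) (Ex P _) (Ex P _) => x y z; clear gp gL; lra.
Unshelve. all: by end_near. Qed.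

(** * The centered processes form a driven family *)

Section centered_family.
Context {R : realType} {d : nat}.
Variables (Q : 'M[R]_d) (p alpha gamma sigma : 'cV[R]_d) (h m0 : R).
Hypotheses (genQ : is_generator Q) (inv_p : invariant_distribution Q p)
  (uniq_p : forall p', invariant_distribution Q p' -> p' = p)
  (gamma_gt0 : forall i, 0 < gamma i 0).
Local Notation v := (limit_variance Q p alpha gamma sigma h m0).
Local Notation mmou P F B X mu N M := (is_mmou P F B X mu (N%:R *: Q)
  (N%:R `^ h *: alpha) gamma (N%:R `^ (h / 2) *: sigma) m0 M).

Lemma grid_walk_moments : exists2 C, 0 <= C &
  forall (disp : measure_display) (T : measurableType disp) (P : probability T R)
    (F : R -> set (set T)) (B : R -> T -> R) (X : R -> T -> 'I_d) (mu : 'I_d -> R)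
    (M : R -> T -> R) (N : nat),
  (0 < N)%N -> mmou P F B X mu N M ->
  forall j m, N%:R ^+ 2 * 2 ^- (j + m) <= 1 :> R ->
  let U := grid_walk B X p alpha gamma sigma h m0 N j m in
  (forall i, good P (U i)) /\ forall i,
  let D w := U i.+1 w - U i w in
  Ex P (fun w => D w ^+ 4) <= C / 2 ^+ j / 2 ^+ j /\
  forall (f : (nat -> R) -> R) L, 0 <= L -> lip i.+1 L f -> (forall u, `|f u| <= 1) ->
    `|Ex P (fun w => f (U ^~ w) * D w)| <= C / Num.sqrt N%:R /\
    `|Ex P (fun w => f (U ^~ w) * (D w ^+ 2 - v (dy j i) / 2 ^+ j))| <=
      C / 2 ^+ j / 2 ^+ j + C / Num.sqrt N%:R +
      C * `|drift_scale h N ^+ 2 / N%:R - (1 <= h)%R%:R| + C * `|noise_scale h N ^+ 2 - (h <= 1)%R%:R|.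
Proof.
have [C C0 mC] := walk_moments alpha sigma h m0 genQ inv_p uniq_p gamma_gt0.
exists C => // disp T P F B X mu M N N0 mm j m nm U.
have [fF bm [ctmc _] indep _] := mm.
have n1 : 1 <= N%:R :> R by rewrite ler1n.
have i0 : 'I_d := X 0 (point : T).
have mx l i : measurable ((fun w => X (dy (j + m) l) w) @^-1` [set i]).
  by have [mX _ _] := ctmc; apply: mX; exact: dy_ge0.
pose V (c : nat -> 'I_d) i w := centered_start p alpha gamma h m0 N +
  drift_scale h N * drift_sum p alpha gamma h m0 (j + m) 0 (i * 2 ^ m) c +
  noise_scale h N * gsum B (j + m) (fun l => sigma (c l) 0) 0 (i * 2 ^ m) w.
have pV i : prefix (i * 2 ^ m) (V ^~ i).
  move=> c c' cc'; apply/funext => w; rewrite /V (@drift_sum_prefix _ _ _ _ _ _ _ _ 0 _ _ c')//.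
  have /(congr1 (fun f => f w))/= e := @gsum_prefix _ _ sigma _ _ B (j + m) 0 _ c c' cc'.
  by rewrite e.
have gV c i : good P (V c i).
  have := gsum_good fF bm (j + m) (fun l => sigma (c l) 0) 0 (i * 2 ^ m) => g1.
  by rewrite /V; gd.
have UE i w : U i w = V (fun l => X (dy (j + m) l) w) i w by [].
have gU i : good P (U i) by exact: (good_path i0 mx (@pV i) (gV ^~ i)).
split=> // i D; pose t : R := (2 ^ m)%:R / 2 ^+ (j + m).
have tE : t = 2 ^- j by rewrite /t natrX exprD; field; rewrite !expf_neq0.
have t1 : t <= 1 by rewrite tE invf_le1 ?exprn_gt0// exprn_ege1// ler1n.
have [gD D4 D2] := mC _ _ P F B mu X N%:R (drift_scale h N) (noise_scale h N) fF bm ctmc indep n1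
  (drift_scale_sqr_le h N0) (noise_scale_sqr_le h N0) (j + m)%N nm (i * 2 ^ m)%N (2 ^ m)%N t1.
have DE w : D w = drift_scale h N * drift_sum p alpha gamma h m0 (j + m) (i * 2 ^ m) (2 ^ m) (fun l => X (dy (j + m) l) w) +
   noise_scale h N * gsum B (j + m) (fun l => sigma (X (dy (j + m) l) w) 0) (i * 2 ^ m) (2 ^ m) w.
  by rewrite /D !UE /V mulSnr drift_sum_cat gsum_cat; ring.
have e2 : C / 2 ^+ j / 2 ^+ j = C * t ^+ 2 by rewrite tE; ring.
split; first by rewrite e2 (@eq_Ex _ _ _ P _ _ (fun w => congr1 (fun x => x ^+ 4) (DE w))).
move=> f L L0 lf f1.
(* A function of the walk up to index [i] is a function of the chain prefix and of earlier Brownian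
   increments, the shape required by [walk_moments]. *)
pose Psi (c : nat -> 'I_d) w := f (fun l => V c l w).
have sB := brownian_sigma B.
have pPsi : prefix (i * 2 ^ m).+1 Psi.
  move=> c c' cc'; apply/funext => w; apply/eqP; rewrite -subr_eq0 -normr_le0 (le_trans (lf _ _))//.
  rewrite big1 ?mulr0// => l _; rewrite (@pV l c c') ?subrr ?normr0// => l' ll'.
  by apply: cc'; rewrite (leq_trans ll')// (leq_trans _ (leqnSn _))// leq_mul2r -ltnS ltn_ord orbT.
have fPsi c : fmeas (sigma_of_process measurable B) (Psi c).
  apply: (fmeas_lip sB L0 lf) => l _.
  apply: fmeasD => //; first exact: fmeas_cst.
  apply: fmeasM => //; first exact: fmeas_cst.
  by apply: gsum_fmeas_wrt => // s s0; exact: fmeas_brownian.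
have sF := filtration_sigma fF (dy_ge0 (j + m) (i * 2 ^ m)).
have fPsi' c : fmeas (F (dy (j + m) (i * 2 ^ m))) (Psi c).
  apply: (fmeas_lip sF L0 lf) => l li.
  apply: fmeasD => //; first exact: fmeas_cst.
  apply: fmeasM => //; first exact: fmeas_cst.
  apply: (fmeas_filtration fF (dy_ge0 _ _)) (gsum_fmeas fF bm (j + m) _ 0 _).
  by rewrite !dy_shift /dy ler_pM2r ?invr_gt0 ?exprn_gt0// ler_nat -ltnS.
have [h1 h2] := D2 Psi pPsi fPsi fPsi' (fun c w => f1 _).
rewrite dy_shift in h2; split.
  by rewrite (@eq_Ex _ _ _ P _ _ (fun w => congr1 (fun x => f (U ^~ w) * x) (DE w))).
rewrite e2 (@eq_Ex _ _ _ P _ _ (fun w => congr1 (fun x => f (U ^~ w) * (x ^+ 2 - v (dy j i) / 2 ^+ j)) (DE w))).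
by rewrite [v _ / _]mulrC -tE.
Qed.

Lemma driven_centered (disp : nat -> measure_display) (T : forall N, measurableType (disp N))
    (P : forall N, probability (T N) R) (F : forall N, R -> set (set (T N)))
    (B : forall N, R -> T N -> R) (X : forall N, R -> T N -> 'I_d) (mu : 'I_d -> R)
    (M : forall N, R -> T N -> R) (C : R) :
  0 <= h -> (\sum_i `|gamma i 0|) <= C ->
  (forall N, (0 < N)%N -> mmou (P N) (F N) (B N) (X N) mu N (M N)) ->
  driven_family P (fun N => centered_scaled p alpha gamma h m0 N (M N))
    (fun N => feedback (X N) (M N) p alpha gamma h m0 N) (fun N => rate (X N) gamma)
    C (gamma_inf p gamma) v.
Proof.
move=> h0 gC mm.
have [C1 C10 hw] := grid_walk_moments.
have [C2 C20 hr] := rate_bound gamma genQ inv_p uniq_p.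
have near0 : \forall N \near \oo, (0 < N)%N by exact: nbhs_infty_gt.
split.
- near=> N; have N0 : (0 < N)%N by near: N.
  have mN := mm N N0; have dr := feedback_drift p mN.
  have C0' : 0 <= \sum_i `|gamma i 0| by exact: sumr_ge0.
  split; [by move=> t t0; exact: (centered_measurable p mN t0)|by move=> t t0; exact: (feedback_measurable p mN t0)| |].
    split=> w; first exact: (@centered_cpath _ _ _ _ _ _ _ _ _ _ _ p _ _ _ _ _ _ mN w).
    exact: (drift_cpath C0' (@centered_cpath _ _ _ _ _ _ _ _ _ _ _ p _ _ _ _ _ _ mN w) (dr w)).
  move=> w; have [q0 k0 dw] := dr w; split=> // s t a e s0 st ya.
  apply: (le_trans (dw s t a e s0 st ya)).
  have e0 : 0 <= e by apply: le_trans (ya s _) => //; rewrite lexx st.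
  by rewrite ler_wpM2r ?subr_ge0// ler_wpM2r.
(* The initial value is recovered from the approximation at grid index 0, where the walk reduces to
   [centered_start]. *)
- have start N (N0 : (0 < N)%N) e : 0 < e ->
      let y0 := centered_start p alpha gamma h m0 N in
      let Y0 := centered_scaled p alpha gamma h m0 N (M N) 0 in
      itg (P N) Y0 /\ Ex (P N) (fun w => `|Y0 w|) <= e + `|y0|.
    move=> e0 y0 Y0.
    have [m [iD ED]] := filter_ex (centered_approximation inv_p gamma_gt0 N0 (mm N N0) 0 0 e0).
    have DE w : centered_scaled p alpha gamma h m0 N (M N) (dy 0 0) w +
        feedback (X N) (M N) p alpha gamma h m0 N (dy 0 0) w -
        grid_walk (B N) (X N) p alpha gamma sigma h m0 N 0 m 0 w = Y0 w - y0.
      rewrite /grid_walk /drift_sum /gsum mul0n !big_ord0 !mulr0 !addr0.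
      by rewrite {1 2}/dy mul0r /feedback integral00 addr0.
    have iD' : itg (P N) (fun w => Y0 w - y0).
      by move: iD; congr itg; apply/funext => w; exact: DE.
    have ED' : Ex (P N) (fun w => `|Y0 w - y0|) <= e.
      by rewrite -(@eq_Ex _ _ _ _ _ _ (fun w => congr1 Num.norm (DE w))).
    have iY : itg (P N) Y0.
      rewrite (_ : Y0 = fun w => (Y0 w - y0) + y0); last by apply/funext => w; rewrite subrK.
      by apply: itgD => //; exact: itg_cst.
    split=> //; apply: (@le_trans _ _ (Ex (P N) (fun w => `|Y0 w - y0| + `|y0|))).
      apply: Ex_le; [exact: itg_norm|by apply: itgD; [exact: itg_norm|exact: itg_cst]|move=> w].
      by rewrite -{1}[Y0 w](subrK y0) ler_normD.
    rewrite ExD; [|exact: itg_norm|exact: itg_cst].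
    by rewrite Ex_cst lerD2r.
  split; first by apply: filterS near0 => N N0; have [] := start N N0 1 ltr01.
  move=> e e0; have e20 : 0 < e / 2 by exact: divr_gt0.
  near=> N; have N0 : (0 < N)%N by near: N.
  have [_ hE] := start N N0 (e / 2) e20.
  apply: (le_trans hE); rewrite [leRHS](splitr e) lerD2l.
  by near: N; exact: centered_start_limit.
- move=> K; exists C1 => //; near=> N => j i _; have N0 : (0 < N)%N by near: N.
  have mN := mm N N0.
  have mW t : 0 <= t -> measurable_fun setT (fun w => centered_scaled p alpha gamma h m0 N (M N) t w +
      feedback (X N) (M N) p alpha gamma h m0 N t w).
    move=> t0; apply: measurable_funD; first exact: (centered_measurable p mN t0).
    exact: (feedback_measurable p mN t0).
  apply: fourth_moment_limit; first by apply: measurable_funB; apply: mW; exact: dy_ge0.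
  move=> e e0; have e20 : 0 < e / 2 by exact: divr_gt0.
  near \oo => m.
  have nm : N%:R ^+ 2 * 2 ^- (j + m) <= 1 :> R by near: m; exact: half_expn_le.
  have [gU /(_ i)[U4 _]] := hw _ _ _ _ _ _ _ _ _ N0 mN j m nm.
  have [i1 E1] : itg (P N) (fun w => centered_scaled p alpha gamma h m0 N (M N) (dy j i.+1) w +
      feedback (X N) (M N) p alpha gamma h m0 N (dy j i.+1) w -
      grid_walk (B N) (X N) p alpha gamma sigma h m0 N j m i.+1 w) /\
    Ex (P N) (fun w => `|centered_scaled p alpha gamma h m0 N (M N) (dy j i.+1) w +
      feedback (X N) (M N) p alpha gamma h m0 N (dy j i.+1) w -
      grid_walk (B N) (X N) p alpha gamma sigma h m0 N j m i.+1 w|) <= e / 2.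
    by near: m; exact: (centered_approximation inv_p gamma_gt0 N0 mN j i.+1 e20).
  have [i2 E2] : itg (P N) (fun w => centered_scaled p alpha gamma h m0 N (M N) (dy j i) w +
      feedback (X N) (M N) p alpha gamma h m0 N (dy j i) w -
      grid_walk (B N) (X N) p alpha gamma sigma h m0 N j m i w) /\
    Ex (P N) (fun w => `|centered_scaled p alpha gamma h m0 N (M N) (dy j i) w +
      feedback (X N) (M N) p alpha gamma h m0 N (dy j i) w -
      grid_walk (B N) (X N) p alpha gamma sigma h m0 N j m i w|) <= e / 2.
    by near: m; exact: (centered_approximation inv_p gamma_gt0 N0 mN j i e20).
  exists (fun w => grid_walk (B N) (X N) p alpha gamma sigma h m0 N j m i.+1 w -
    grid_walk (B N) (X N) p alpha gamma sigma h m0 N j m i w).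
  split=> //; first by apply: goodB; exact: gU.
    move: (itgB i1 i2); congr itg; apply/funext => w; ring.
  apply: (le_trans _ (_ : e / 2 + e / 2 <= e)); last by rewrite -splitr.
  apply: (le_trans _ (lerD E1 E2)); rewrite -ExD; [|exact: itg_norm..].
  apply: Ex_le; [|by apply: itgD; exact: itg_norm|].
    apply: itg_norm; move: (itgB i1 i2); congr itg; apply/funext => w; ring.
  move=> w; rewrite (le_trans _ (ler_normB _ _))// le_eqVlt; apply/orP; left; apply/eqP; congr `|_|.
  by ring.
- move=> j i e e0; near=> N; have N0 : (0 < N)%N by near: N.
  have [_ _ [ctmc _] _ _] := mm N N0.
  have n1 : 1 <= N%:R :> R by rewrite ler1n.
  have [ik Ek] := hr _ _ _ _ _ _ ctmc n1 j i.
  split=> //; apply: (le_trans Ek); near: N; exact: inv_sqrt_small.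
move=> K; pose C4 := C1 + C1 + C1 + C1; exists C4 => [|n]; first by rewrite !addr_ge0.
(* For each [N] the depth is taken so large that N^2 times the mesh is at most 1 and all grid values
   are approximated within 1/N in mean. *)
have choose N : exists m, (0 < N)%N -> N%:R ^+ 2 * 2 ^- (n + m) <= 1 :> R /\
    forall i : 'I_(K * 2 ^ n).+1,
      itg (P N) (fun w => centered_scaled p alpha gamma h m0 N (M N) (dy n i) w +
        feedback (X N) (M N) p alpha gamma h m0 N (dy n i) w -
        grid_walk (B N) (X N) p alpha gamma sigma h m0 N n m i w) /\
      Ex (P N) (fun w => `|centered_scaled p alpha gamma h m0 N (M N) (dy n i) w +
        feedback (X N) (M N) p alpha gamma h m0 N (dy n i) w -
        grid_walk (B N) (X N) p alpha gamma sigma h m0 N n m i w|) <= N%:R^-1.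
  have [->|N0] := posnP N; first by exists 0%N.
  have Ni : 0 < N%:R^-1 :> R by rewrite invr_gt0 ltr0n.
  near \oo => m; exists m => _; split; first by near: m; exact: half_expn_le.
  near: m; apply: filter_forall => i.
  exact: (centered_approximation inv_p gamma_gt0 N0 (mm N N0) n i Ni).
have [lv hlv] := boolp.choice choose.
pose U N := grid_walk (B N) (X N) p alpha gamma sigma h m0 N n (lv N).
exists U; set s := Num.sqrt _.
have t0 : 0 <= 2 ^- n :> R by rewrite invr_ge0 exprn_ge0.
have t1 : 2 ^- n <= 1 :> R by rewrite invf_le1 ?exprn_gt0// exprn_ege1// ler1n.
have s0 : 0 <= s by exact: sqrtr_ge0.
have s1 : s <= 1 by rewrite -[leRHS]sqrtr1 ler_wsqrtr.
have s2 : s ^+ 2 = 2 ^- n by rewrite sqr_sqrtr.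
have s4 : s ^+ 4 = 2 ^- n / 2 ^+ n by rewrite -[4%N]/(2 * 2)%N exprM s2 expr2.
have s43 : s ^+ 4 <= s ^+ 3 by rewrite exprS ler_piMl// exprn_ge0.
have s30 : 0 <= s ^+ 3 by exact: exprn_ge0.
have cs4 : C1 / 2 ^+ n / 2 ^+ n = C1 * s ^+ 4 by rewrite s4 mulrA.
have C14 : C1 <= C4 by rewrite /C4; lra.
have cs3 : C1 * s ^+ 4 <= C4 * s ^+ 3.
  by apply: (le_trans (ler_wpM2l C10 s43)); rewrite ler_wpM2r.
have hU N (N0 : (0 < N)%N) := hw _ _ _ _ _ _ _ _ _ N0 (mm N N0) n (lv N) (hlv N N0).1.
split.
- split.
  + by apply: filterS near0 => N N0 i; have [gU _] := hU N N0; exact: good_mfun (gU i).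
  + near=> N => i _; have N0 : (0 < N)%N by near: N.
    have [gU /(_ i)[U4 _]] := hU N N0; split.
      by apply: good_itg; apply: goodX; apply: goodB; exact: gU.
    by apply: (le_trans U4); rewrite cs4 ler_wpM2r// exprn_ge0.
  + move=> i f L _ L0 lf f1 e e0; near=> N; have N0 : (0 < N)%N by near: N.
    have [gU /(_ i)[_ /(_ f L L0 lf f1)[h1 _]]] := hU N N0.
    apply: (le_trans h1); rewrite ler_wpDl//; first by rewrite mulr_ge0// addr_ge0// !addr_ge0.
    by near: N; exact: inv_sqrt_small.
  + move=> i f L _ L0 lf f1 e e0.
    have e30 : 0 < e / 3 by exact: divr_gt0.
    have c10 : 0 < C1 + 1 by rewrite ltr_wpDl.
    near=> N; have N0 : (0 < N)%N by near: N.
    have [gU /(_ i)[_ /(_ f L L0 lf f1)[_ h1]]] := hU N N0.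
    apply: (le_trans h1); rewrite cs4.
    have a1 : C1 / Num.sqrt N%:R <= e / 3 by near: N; exact: inv_sqrt_small.
    have small (x : R) : 0 <= x -> x <= e / 3 / (C1 + 1) -> C1 * x <= e / 3.
      move=> x0; rewrite ler_pdivlMr// => hx; apply: le_trans hx; rewrite mulrC ler_wpM2l// lerDl//.
    have a2 : C1 * `|drift_scale h N ^+ 2 / N%:R - (1 <= h)%R%:R| <= e / 3.
      by apply: small => //; near: N; apply: drift_scale_limit; exact: divr_gt0.
    have a3 : C1 * `|noise_scale h N ^+ 2 - (h <= 1)%R%:R| <= e / 3.
      by apply: small => //; near: N; apply: noise_scale_limit; exact: divr_gt0.
    rewrite -!addrA lerD// (_ : e = e / 3 + (e / 3 + e / 3)); last by field.
    by rewrite !lerD.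
- near=> N => i; have N0 : (0 < N)%N by near: N.
  by have [gU _] := hU N N0; exact: good_itg (gU i).
move=> i e iK e0; near=> N; have N0 : (0 < N)%N by near: N.
have [_ /(_ (Ordinal (iK : (i < (K * 2 ^ n).+1)%N)))[iD ED]] := hlv N N0.
split=> //; apply: (le_trans ED).
rewrite -[leRHS]invrK lef_pV2 ?posrE ?invr_gt0 ?ltr0n//.
by near: N; exact: nbhs_infty_ger.
Unshelve. all: by end_near. Qed.

End centered_family.

(** * The limit process *)

Section gaussian_limit.
Context {R : realType} {disp : measure_display} {T : measurableType disp}.
Variables (P : probability T R) (F : R -> set (set T)) (B Y : R -> T -> R)
  (g C Cv L : R) (v : R -> R).
Hypotheses (fF : is_filtration F) (bm : is_brownian_motion P F B)
  (sol : is_sde_solution P F B (fun _ _ x => - g * x) (fun s _ => Num.sqrt (v s)) 0 Y)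
  (g0 : 0 <= g) (gC : g <= C) (L0 : 0 <= L)
  (v0 : forall t, 0 <= t -> 0 <= v t) (vC : forall t, 0 <= t -> v t <= Cv)
  (vL : forall s t, 0 <= s -> 0 <= t -> `|v t - v s| <= L * `|t - s|).

Definition linear_feedback (t : R) (w : T) : R := integral0 (fun s => g * Y s w) t.

Let U j m i := gsum B (j + m) (fun l => Num.sqrt (v (dy (j + m) l))) 0 (i * 2 ^ m).

(** The square root is 1/2-Hölder also at 0, so a Lipschitz variance is enough for the left sums of
    the limit to converge in mean square, even where the variance vanishes. *)
Let sqrt_dist x y : 0 <= x -> 0 <= y -> (Num.sqrt x - Num.sqrt y) ^+ 2 <= `|x - y| :> R.
Proof.
move=> x0 y0; rewrite -{2}(sqr_sqrtr x0) -{2}(sqr_sqrtr y0) subr_sqr normrM -real_normK ?num_real// expr2.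
rewrite ler_wpM2l// [leRHS]ger0_norm ?addr_ge0// (le_trans (ler_normB _ _))//.
by rewrite !ger0_norm.
Qed.

Let Y_path w : cpath (Y ^~ w). Proof. by have [_ cY _] := sol; exact: cY. Qed.

Let mY t : 0 <= t -> measurable_fun setT (Y t).
Proof.
move=> t0; have [aY _ _] := sol.
by apply: fmeas_measurable (adapted_fmeas aY t0); exact: (filtration_measurable fF).
Qed.

Let rY w : rcont (Y ^~ w). Proof. exact: cpath_rcont (@Y_path w). Qed.

Let lY w : loc_bounded (Y ^~ w).
Proof. by move=> K; exact: cpath_bounded (@Y_path w). Qed.

Let mq t : 0 <= t -> measurable_fun setT (linear_feedback t).
Proof.
move=> t0; apply: integral0_measurable => // [s s0|w|w].
- by apply: measurable_funM => //; exact: mY.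
- by apply: rcontM; [exact: rcont_cst|exact: rY].
- by apply: loc_boundedM; [exact: loc_bounded_cst|exact: lY].
Qed.

Let driftY w : drift C (Y ^~ w) (linear_feedback ^~ w) (integral0 (fun=> g)).
Proof.
apply: (drift_integral (@Y_path w)); first exact: rcont_cst.
by move=> t _; rewrite ger0_norm.
Qed.

Let approximation j i (e : R) : 0 < e -> \forall m \near \oo,
  itg P (fun w => Y (dy j i) w + linear_feedback (dy j i) w - U j m i w) /\
  Ex P (fun w => `|Y (dy j i) w + linear_feedback (dy j i) w - U j m i w|) <= e.
Proof.
move=> e0; have [_ _ [I itoI YI]] := sol; pose t : R := dy j i.
have t0 : 0 <= t by exact: dy_ge0.
pose H s (_ : T) := Num.sqrt (v s).
have gH s : 0 <= s -> good P (H s) by move=> _; exact: good_cst.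
near=> m; pose r := L * 2 ^- (j + m).
have r0 : 0 <= r by rewrite mulr_ge0// invr_ge0 exprn_ge0.
have rs : (4 * L * t) * 2 ^- (j + m) <= e ^+ 2 by near: m; apply: half_expn_le; rewrite exprn_gt0.
have [iL EL] : itg P (fun w => (left_sum B H (j + m) (i * 2 ^ m) w - I t w) ^+ 2) /\
    Ex P (fun w => (left_sum B H (j + m) (i * 2 ^ m) w - I t w) ^+ 2) <= 4 * r * t.
  have -> : t = dy (j + m) (i * 2 ^ m) by rewrite dy_shift.
  apply: (ito_approximation fF bm itoI gH) => // l s _ /andP[ls sl].
  have d0 := @dy_ge0 R (j + m) l; have s0 : 0 <= s by exact: le_trans (ltW ls).
  rewrite Ex_cst (le_trans (sqrt_dist (v0 d0) (v0 s0)))// (le_trans (vL s0 d0))// ler_wpM2l//.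
  by rewrite distrC ger0_norm ?subr_ge0 ?(ltW ls)// lerBlDl -dy_succ.
have mI : measurable_fun setT (I t) by exact: (ito_measurable fF itoI).
have gL : good P (left_sum B H (j + m) (i * 2 ^ m)).
  apply: good_sum => l; apply: goodM; first by apply: gH; exact: dy_ge0.
  by apply: (incr_good fF bm); rewrite ?dy_ge0// dy_succ lerDl invr_ge0 exprn_ge0.
have mL : measurable_fun setT (fun w => left_sum B H (j + m) (i * 2 ^ m) w - I t w).
  by apply: measurable_funB => //; exact: good_mfun gL.
have iL1 : itg P (fun w => left_sum B H (j + m) (i * 2 ^ m) w - I t w) by exact: itg_of_square.
have EL1 : Ex P (fun w => `|left_sum B H (j + m) (i * 2 ^ m) w - I t w|) <= e.
  apply: (le_trans (Ex_sqr_le iL1 iL e0)).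
  set E2 := Ex P _ in EL *.
  suff : e^-1 * E2 <= e by lra.
  rewrite mulrC ler_pdivrMr// (le_trans EL)//.
  by rewrite -expr2; apply: le_trans rs; rewrite /r le_eqVlt; apply/orP; left; apply/eqP; ring.
have ae : {ae P, forall w, Y t w + linear_feedback t w - U j m i w = - (left_sum B H (j + m) (i * 2 ^ m) w - I t w)}.
  apply: filterS (YI t t0) => w Yw.
  have e1 : \int[lebesgue_measure]_(s in `[0, t]) (- g * Y s w) = - linear_feedback t w.
    rewrite /linear_feedback -[RHS]mulN1r -integral0Z//.
    - by apply: eq_Rintegral => s _; ring.
    - by apply: rcontM; [exact: rcont_cst|exact: rY].
    - by apply: loc_boundedM; [exact: loc_bounded_cst|exact: lY].
  by rewrite Yw e1 -/(U j m i w) (_ : left_sum _ _ _ _ _ = U j m i w)//; ring.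
have mW : measurable_fun setT (fun w => Y t w + linear_feedback t w - U j m i w).
  apply: measurable_funB; last exact: good_mfun (gsum_good fF bm _ _ _ _).
  by apply: measurable_funD; [exact: mY|exact: mq].
have iD := itgN iL1.
split; first exact: itg_ae ae mW iD.
rewrite (@Ex_ae _ _ _ P _ (fun w => `|left_sum B H (j + m) (i * 2 ^ m) w - I t w|)) //.
- by apply: filterS ae => w ->; rewrite normrN.
- exact: measurableT_comp.
- exact: measurableT_comp.
Unshelve. all: by end_near. Qed.

Let moments j m : let K := 35 * Num.sqrt Cv ^+ 4 + L in
  (forall i, good P (U j m i)) /\ forall i,
  let D w := U j m i.+1 w - U j m i w in
  Ex P (fun w => D w ^+ 4) <= K / 2 ^+ j / 2 ^+ j /\
  forall (f : (nat -> R) -> R) M, 0 <= M -> lip i.+1 M f -> (forall u, `|f u| <= 1) ->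
    Ex P (fun w => f (U j m ^~ w) * D w) = 0 /\
    `|Ex P (fun w => f (U j m ^~ w) * (D w ^+ 2 - v (dy j i) / 2 ^+ j))| <= K / 2 ^+ j / 2 ^+ j.
Proof.
move=> K; have gU i : good P (U j m i) by exact: (gsum_good fF bm).
split=> // i D; pose k := (i * 2 ^ m)%N; pose t : R := (2 ^ m)%:R / 2 ^+ (j + m).
pose sg l := Num.sqrt (v (dy (j + m) l)).
have d0 l : 0 <= dy (j + m) l :> R by exact: dy_ge0.
have tE : t = 2 ^- j by rewrite /t natrX exprD; field; rewrite !expf_neq0.
have DE w : D w = gsum B (j + m) sg k (2 ^ m) w by rewrite /D /U mulSnr gsum_cat addrAC subrr add0r.
have e2 : K / 2 ^+ j / 2 ^+ j = K * t ^+ 2 by rewrite tE; ring.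
have sgC l : `|sg l| <= Num.sqrt Cv by rewrite ger0_norm ?sqrtr_ge0// ler_wsqrtr// vC.
have t20 : 0 <= t ^+ 2 by exact: sqr_ge0.
split.
  rewrite e2 (@eq_Ex _ _ _ P _ _ (fun w => congr1 (fun x => x ^+ 4) (DE w))).
  by rewrite (le_trans (gsum_fourth fF bm _ sgC _ _))// ler_wpM2r// lerDl.
move=> f M M0 lf f1; pose Psi w := f (U j m ^~ w).
have sF := filtration_sigma fF (d0 k).
have fPsi : fmeas (F (dy (j + m) k)) Psi.
  apply: (fmeas_lip sF M0 lf) => l li.
  apply: (fmeas_filtration fF (dy_ge0 _ _)) (gsum_fmeas fF bm (j + m) _ 0 _).
  by rewrite !dy_shift /dy ler_pM2r ?invr_gt0 ?exprn_gt0// ler_nat -ltnS.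
have gPsi : good P Psi.
  apply: (@good_bounded _ _ _ _ _ 1) => [|w]; last exact: f1.
  exact: (@fmeas_measurable _ _ _ (F (dy (j + m) k)) Psi (filtration_measurable fF (d0 k)) fPsi).
have gD : good P (gsum B (j + m) sg k (2 ^ m)) by exact: (gsum_good fF bm).
split.
  rewrite (@eq_Ex _ _ _ P _ _ (fun w => congr1 (fun x => f (U j m ^~ w) * x) (DE w))).
  exact: (gsum_orth fF bm).
rewrite (@eq_Ex _ _ _ P _ (fun w => Psi w * gsum B (j + m) sg k (2 ^ m) w ^+ 2 - v (dy j i) / 2 ^+ j * Psi w)); last first.
  by move=> w; rewrite DE -/(Psi w); ring.
rewrite ExB; [|by apply: good_itg; gd|by apply: good_itg; gd].
rewrite ExZ; last by apply: good_itg; gd.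
rewrite (gsum_square fF bm)// -mulrBl normrM.
have E1 : `|Ex P Psi| <= 1.
  by rewrite -[leRHS](Ex_cst P); apply: Ex_norm_le => //; [exact: good_itg|exact: itg_cst|move=> w; exact: f1].
rewrite -[leRHS]mulr1 ler_pM//.
have -> : v (dy j i) / 2 ^+ j = \sum_(l < 2 ^ m) v (dy (j + m) k) / 2 ^+ (j + m).
  by rewrite /k dy_shift sumr_const card_ord -[RHS]mulr_natl mulrCA -/t tE.
rewrite mulr_suml -sumrB (le_trans (ler_norm_sum _ _ _))//.
apply: (@le_trans _ _ (\sum_(l < 2 ^ m) L * t / 2 ^+ (j + m))).
  apply: ler_sum => l _; rewrite /sg sqr_sqrtr ?v0// -mulrBl normrM [X in _ * X]ger0_norm ?invr_ge0 ?exprn_ge0//.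
  rewrite ler_wpM2r ?invr_ge0 ?exprn_ge0// (le_trans (vL _ _))// ler_wpM2l//.
  rewrite /dy natrD mulrDl addrAC subrr add0r ger0_norm ?mulr_ge0 ?invr_ge0 ?exprn_ge0//.
  by rewrite /t ler_pM2r ?invr_gt0 ?exprn_gt0// ler_nat ltnW.
rewrite sumr_const card_ord -[leLHS]mulr_natl mulrCA -/t e2 -mulrA -expr2 ler_wpM2r// lerDr mulr_ge0// exprn_ge0// sqrtr_ge0.
Qed.

(** With deterministic dispersion the increments are exactly orthogonal to the past, and the rate is
    exactly linear, so the only error of the walk is the variation of [v] within a cell. *)
Lemma driven_gaussian : driven_family (fun _ : nat => P) (fun=> Y) (fun=> linear_feedback)
  (fun _ t _ => integral0 (fun=> g) t) C g v.
Proof.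
pose K0 := 35 * Num.sqrt Cv ^+ 4 + L.
have K00 : 0 <= K0 by rewrite addr_ge0// mulr_ge0// exprn_ge0// sqrtr_ge0.
have C0 : 0 <= C by exact: le_trans gC.
split.
- near=> N; split; [exact: mY|exact: mq| |exact: driftY].
  split=> w; first exact: (@Y_path w).
  exact: (drift_cpath C0 (@Y_path w) (driftY w)).
- have start e : 0 < e -> itg P (Y 0) /\ Ex P (fun w => `|Y 0 w|) <= e.
    move=> e0; have [m [iD ED]] := filter_ex (approximation 0 0 e0).
    have DE w : Y (dy 0 0) w + linear_feedback (dy 0 0) w - U 0 m 0 w = Y 0 w.
      by rewrite /U /gsum mul0n big_ord0 /dy mul0r /linear_feedback integral00 addr0 subr0.
    split; first by move: iD; congr itg; apply/funext => w; exact: DE.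
    by rewrite -(@eq_Ex _ _ _ _ _ _ (fun w => congr1 Num.norm (DE w))).
  split; first by apply: nearW => _; have [] := start 1 ltr01.
  by move=> e e0; apply: nearW => _; have [] := start e e0.
- move=> K; exists K0 => //; apply: nearW => _ j i _.
  have mW t : 0 <= t -> measurable_fun setT (fun w => Y t w + linear_feedback t w).
    by move=> t0; apply: measurable_funD; [exact: mY|exact: mq].
  apply: fourth_moment_limit; first by apply: measurable_funB; apply: mW; exact: dy_ge0.
  move=> e e0; have e20 : 0 < e / 2 by exact: divr_gt0.
  near \oo => m.
  have [gU /(_ i)[U4 _]] := moments j m.
  have [i1 E1] : itg P (fun w => Y (dy j i.+1) w + linear_feedback (dy j i.+1) w - U j m i.+1 w) /\
      Ex P (fun w => `|Y (dy j i.+1) w + linear_feedback (dy j i.+1) w - U j m i.+1 w|) <= e / 2.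
    by near: m; exact: (approximation j i.+1 e20).
  have [i2 E2] : itg P (fun w => Y (dy j i) w + linear_feedback (dy j i) w - U j m i w) /\
      Ex P (fun w => `|Y (dy j i) w + linear_feedback (dy j i) w - U j m i w|) <= e / 2.
    by near: m; exact: (approximation j i e20).
  exists (fun w => U j m i.+1 w - U j m i w).
  split=> //; first by apply: goodB; exact: gU.
    move: (itgB i1 i2); congr itg; apply/funext => w; ring.
  apply: (le_trans _ (_ : e / 2 + e / 2 <= e)); last by rewrite -splitr.
  apply: (le_trans _ (lerD E1 E2)); rewrite -ExD; [|exact: itg_norm..].
  apply: Ex_le; [|by apply: itgD; exact: itg_norm|].
    apply: itg_norm; move: (itgB i1 i2); congr itg; apply/funext => w; ring.
  move=> w; rewrite (le_trans _ (ler_normB _ _))// le_eqVlt; apply/orP; left; apply/eqP; congr `|_|.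
  by ring.
- move=> j i e e0; apply: nearW => _.
  have -> : integral0 (fun=> g) (dy j i.+1) - integral0 (fun=> g) (dy j i) - g / 2 ^+ j = 0.
    by rewrite !integral0_cst ?dy_ge0// dy_succ; ring.
  by rewrite normr0 Ex_cst; split; [exact: itg_cst|exact: ltW].
move=> K; exists K0 => // n.
have choose (N : nat) : exists m, forall i : 'I_(K * 2 ^ n).+1,
    itg P (fun w => Y (dy n i) w + linear_feedback (dy n i) w - U n m i w) /\
    Ex P (fun w => `|Y (dy n i) w + linear_feedback (dy n i) w - U n m i w|) <= N.+1%:R^-1.
  have Ni : 0 < N.+1%:R^-1 :> R by rewrite invr_gt0 ltr0n.
  near \oo => m; exists m; near: m; apply: filter_forall => i; exact: (approximation n i Ni).
have [lv hlv] := boolp.choice choose.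
exists (fun N => U n (lv N)); set s := Num.sqrt _.
have t0 : 0 <= 2 ^- n :> R by rewrite invr_ge0 exprn_ge0.
have t1 : 2 ^- n <= 1 :> R by rewrite invf_le1 ?exprn_gt0// exprn_ege1// ler1n.
have s0 : 0 <= s by exact: sqrtr_ge0.
have s1 : s <= 1 by rewrite -[leRHS]sqrtr1 ler_wsqrtr.
have s4 : s ^+ 4 = 2 ^- n / 2 ^+ n by rewrite -[4%N]/(2 * 2)%N exprM sqr_sqrtr// expr2.
have s43 : s ^+ 4 <= s ^+ 3 by rewrite exprS ler_piMl// exprn_ge0.
have cs4 : K0 / 2 ^+ n / 2 ^+ n = K0 * s ^+ 4 by rewrite s4 mulrA.
split.
- split.
  + by apply: nearW => N i; have [gU _] := moments n (lv N); exact: good_mfun (gU i).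
  + apply: nearW => N i _; have [gU /(_ i)[U4 _]] := moments n (lv N); split.
      by apply: good_itg; apply: goodX; apply: goodB; exact: gU.
    by rewrite -cs4.
  + move=> i f M _ M0 lf f1 e e0; apply: nearW => N.
    have [gU /(_ i)[_ /(_ f M M0 lf f1)[-> _]]] := moments n (lv N).
    by rewrite normr0 addr_ge0 ?(ltW e0)// mulr_ge0// exprn_ge0.
  + move=> i f M _ M0 lf f1 e e0; apply: nearW => N.
    have [gU /(_ i)[_ /(_ f M M0 lf f1)[_ h1]]] := moments n (lv N).
    rewrite (le_trans h1)// -/K0 cs4 (le_trans (ler_wpM2l K00 s43))// lerDl ltW//.
- by apply: nearW => N i; have [gU _] := moments n (lv N); exact: good_itg (gU i).
move=> i e iK e0; near=> N.
have [iD ED] := hlv N (Ordinal (iK : (i < (K * 2 ^ n).+1)%N)).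
split=> //; apply: (le_trans ED).
rewrite -[leRHS]invrK lef_pV2 ?posrE ?invr_gt0 ?ltr0n// (le_trans (_ : _ <= N%:R)) ?ler_nat//.
by near: N; exact: nbhs_infty_ger.
Unshelve. all: by end_near. Qed.

End gaussian_limit.

Theorem theorem5p1 (R : realType) (d : nat)
  (Q : 'M[R]_d) (pi_ alpha gamma sigma : 'cV[R]_d) (mu : 'I_d -> R) (h m0 : R)
  (Q_generator : is_generator Q)
  (pi_invariant : invariant_distribution Q pi_)
  (pi_unique : forall p, invariant_distribution Q p -> p = pi_)
  (gamma_gt0 : forall i, 0 < gamma i 0)
  (h_ge0 : 0 <= h)
  (* for each N >= 1, the process M^[N,h] on its own filtered space *)
  (disp : nat -> measure_display) (T : forall N, measurableType (disp N))
  (P : forall N, probability (T N) R) (F : forall N, R -> set (set (T N)))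
  (B : forall N, R -> T N -> R) (X : forall N, R -> T N -> 'I_d)
  (M : forall N, R -> T N -> R)
  (M_mmou : forall N, (0 < N)%N ->
    is_mmou (P N) (F N) (B N) (X N) mu (N%:R *: Q)
      (N%:R `^ h *: alpha) gamma (N%:R `^ (h / 2) *: sigma) m0 (M N))
  (* the limit process *)
  (displ : measure_display) (Tl : measurableType displ)
  (Pl : probability Tl R) (Fl : R -> set (set Tl)) (Bl Ml : R -> Tl -> R)
  (Fl_filtration : is_filtration Fl)
  (Bl_brownian : is_brownian_motion Pl Fl Bl)
  (Ml_solution : is_sde_solution Pl Fl Bl
    (fun _ _ x => - gamma_inf pi_ gamma * x)
    (fun s _ => limit_dispersion Q pi_ alpha gamma sigma h m0 s) 0 Ml) :
  cvg_weakly P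
    (fun N => centered_scaled pi_ alpha gamma h m0 N (M N)) Pl Ml.
Proof.
have g0 := gamma_inf_gt0 pi_invariant gamma_gt0.
have [Cv _ vC] := limit_variance_bounded alpha sigma h m0 Q_generator pi_invariant pi_unique gamma_gt0.
have [L L0 vL] := limit_variance_lipschitz alpha sigma h m0 Q_generator pi_invariant pi_unique gamma_gt0.
have v0 := limit_variance_ge0 alpha gamma sigma h m0 Q_generator pi_invariant pi_unique.
(* One constant must bound the feedback coefficient of both sides: the gamma_i before the limit and
   their average in it. *)
pose C := \sum_i `|gamma i 0| + gamma_inf pi_ gamma.
have S0 : 0 <= \sum_i `|gamma i 0| by exact: sumr_ge0.
have C0 : 0 <= C by rewrite addr_ge0// ltW.
have dE : (fun s (_ : Tl) => limit_dispersion Q pi_ alpha gamma sigma h m0 s) =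
    (fun s _ => Num.sqrt (limit_variance Q pi_ alpha gamma sigma h m0 s)).
  by apply/funext => s; apply/funext => _; rewrite limit_dispersionE.
rewrite dE in Ml_solution.
apply: (driven_cvg_weakly C0 (ltW g0) (Cv := Cv) (v := limit_variance Q pi_ alpha gamma sigma h m0)).
- by move=> t t0; rewrite v0 vC.
- apply: driven_centered M_mmou => //; by rewrite lerDl ltW.
- apply: (driven_gaussian Fl_filtration Bl_brownian Ml_solution (ltW g0) _ L0 _ vC vL) => //.
  by rewrite lerDr.
Qed.
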